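(* Let $\phi=\tilde p/p$ be a degree $(n,1)$ rational inner function as in the context and let $\alpha\in\mathbb{T}$. Then: (i) for every $f\in K_\phi$, $(J_\alpha f)(\zeta)=f^*(\zeta)$ for $\sigma_\alpha$-almost every $\zeta\in\mathbb{T}^2$, where $f^*$ denotes the non-tangential boundary value of $f$; (ii) $J_\alpha:K_\phi\to L^2(\sigma_\alpha)$ is unitary if and only if $\alpha$ is a generic value for $\phi$.
   Context: $\mathbb{D}$ is the open unit disk, $\mathbb{T}$ the unit circle. Fix $n\ge1$. Let $p\in\mathbb{C}[z_1,z_2]$ have no zeros on $\mathbb{D}^2$, degree at most $n$ in $z_1$ and at most $1$ in $z_2$, and let $\tilde p(z)=z_1^nz_2\overline{p(1/\bar z_1,1/\bar z_2)}$; assume $\tilde p$ has degree exactly $(n,1)$ and $p,\tilde p$ have no common factor, so $\phi=\tilde p/p$ is a rational inner function of degree $(n,1)$. The zeros of $p$ on $\mathbb{T}^2$ are finitely many points $(\tau_1,\lambda_1),\dots,(\tau_m,\lambda_m)$; the non-tangential limit $\phi^*(\zeta)$ exists and is unimodular at every $\zeta\in\mathbb{T}^2$. A value $\alpha\in\mathbb{T}$ is exceptional if $\phi^*(\tau_k,\lambda_k)=\alpha$ for some $k$, and generic otherwise. The Clark measure $\sigma_\alpha$ is the unique positive Borel measure on $\mathbb{T}^2$ with $\frac{1-|\phi(z)|^2}{|\alpha-\phi(z)|^2}=\int_{\mathbb{T}^2}\frac{(1-|z_1|^2)(1-|z_2|^2)}{|\zeta_1-z_1|^2|\zeta_2-z_2|^2}\,d\sigma_\alpha(\zeta)$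 for $z\in\mathbb{D}^2$. $H^2(\mathbb{D}^2)$ is the Hardy space of the bidisk with reproducing kernel $C_w(z)=\frac{1}{(1-z_1\bar w_1)(1-z_2\bar w_2)}$; $K_\phi=H^2(\mathbb{D}^2)\ominus\phi H^2(\mathbb{D}^2)$ is the model space, with reproducing kernel $k_w(z)=(1-\overline{\phi(w)}\phi(z))C_w(z)$. $J_\alpha:K_\phi\to L^2(\sigma_\alpha)$ is the isometry determined by $J_\alpha[k_w](\zeta)=(1-\alpha\overline{\phi(w)})C_w(\zeta)$ for $w\in\mathbb{D}^2$, $\zeta\in\mathbb{T}^2$, extended by linearity and continuity. *)

(* Defs.v *)
From HB Require Import structures.
From mathcomp Require Import all_boot all_order all_algebra.
From mathcomp Require Import all_classical all_reals all_analysis.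
From mathcomp Require Import complex.
Set Implicit Arguments. Unset Strict Implicit. Unset Printing Implicit Defensive.
Import Order.TTheory GRing.Theory Num.Theory.
Local Open Scope classical_set_scope.
Local Open Scope ring_scope.

Section RIF.
Context {R : realType}.
Local Notation C := R[i].

Definition cabs (z : C) : R := Num.sqrt (complex.Re z ^+ 2 + complex.Im z ^+ 2).
Definition cconj (z : C) : C := conjc z.

Definition in_D2 (z : C * C) : Prop := cabs z.1 < 1 /\ cabs z.2 < 1.
Definition in_T2 (z : C * C) : Prop := cabs z.1 = 1 /\ cabs z.2 = 1.

Definition expi (t : R) : C := (cos t +i* sin t)%C.
Definition zeta (t : R * R) : C * C := (expi t.1, expi t.2).
Definition angle_box : set (R * R) :=
  [set t | 0 <= t.1 < 2 * pi /\ 0 <= t.2 < 2 * pi].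

(* bivariate polynomials: p = \sum_k (p`_k)(z1) z2^k, i.e. the coefficient
   of z1^j z2^k is (p`_k)`_j *)
Definition eval2 (p : {poly {poly C}}) (z : C * C) : C := (p.[z.2%:P]).[z.1].

Definition deg_le_n1 (n : nat) (p : {poly {poly C}}) : Prop :=
  leq (size p) 2 /\ forall k : nat, leq (size p`_k) n.+1.
Definition deg_eq_n1 (n : nat) (p : {poly {poly C}}) : Prop :=
  deg_le_n1 n p /\ size p = 2%N /\ exists k, size p`_k = n.+1.

Definition coef2 (p : {poly {poly C}}) (j k : nat) : C := (p`_k)`_j.

(* ptilde(z) = z1^n z2 conj(p(1/conj z1, 1/conj z2)): coefficient of
   z1^j z2^k is conj of the coefficient of z1^(n-j) z2^(1-k) of p *)
Definition ptilde (n : nat) (p : {poly {poly C}}) : {poly {poly C}} :=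
  \poly_(k < 2) \poly_(j < n.+1) cconj (coef2 p (n - j) (1 - k)).

Definition no_common_factor (p q : {poly {poly C}}) : Prop :=
  forall d r s : {poly {poly C}}, p = d * r -> q = d * s ->
    leq (size d) 1 /\ leq (size d`_0) 1.

Definition phi (n : nat) (p : {poly {poly C}}) (z : C * C) : C :=
  eval2 (ptilde n p) z / eval2 p z.

Definition nt_lim (F : C * C -> C) (zt : C * C) (L : C) : Prop :=
  forall c : R, 1 < c -> forall e : R, 0 < e -> exists2 d : R, 0 < d &
    forall z, in_D2 z ->
      cabs (zt.1 - z.1) < c * (1 - cabs z.1) ->
      cabs (zt.2 - z.2) < c * (1 - cabs z.2) ->
      cabs (zt.1 - z.1) < d -> cabs (zt.2 - z.2) < d ->
      cabs (F z - L) < e.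

Definition exceptional (n : nat) (p : {poly {poly C}}) (alpha : C) : Prop :=
  exists z : C * C, in_T2 z /\ eval2 p z = 0 /\ nt_lim (phi n p) z alpha.

(* ---- Hardy space H^2(D^2), via coefficient arrays ---- *)
Definition ccvg (u : nat -> C) (l : C) : Prop :=
  forall e : R, 0 < e -> exists N : nat, forall m, (N <= m)%N -> cabs (u m - l) < e.

Definition sq_summable (a : nat -> nat -> C) : Prop :=
  exists M : R, forall N : nat,
    \sum_(j < N) \sum_(k < N) cabs (a j k) ^+ 2 <= M.

Definition represents (a : nat -> nat -> C) (F : C * C -> C) : Prop :=
  sq_summable a /\ forall z, in_D2 z ->
    ccvg (fun N => \sum_(j < N) \sum_(k < N) a j k * z.1 ^+ j * z.2 ^+ k) (F z).

Definition inner_is (a b : nat -> nat -> C) (v : C) : Prop :=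
  ccvg (fun N => \sum_(j < N) \sum_(k < N) a j k * cconj (b j k)) v.

Definition H2norm2 (a : nat -> nat -> C) : \bar R :=
  esum [set: nat * nat] (fun jk => ((cabs (a jk.1 jk.2)) ^+ 2)%:E).

(* model space K_phi = H^2 minus phi H^2 *)
Definition in_K (n : nat) (p : {poly {poly C}}) (a : nat -> nat -> C) : Prop :=
  sq_summable a /\
  forall (b c : nat -> nat -> C) (G : C * C -> C),
    represents b G -> represents c (fun z => phi n p z * G z) -> inner_is a c 0.

Definition Cker (w z : C * C) : C :=
  ((1 - z.1 * cconj w.1) * (1 - z.2 * cconj w.2))^-1.
Definition kker (n : nat) (p : {poly {poly C}}) (w z : C * C) : C :=
  (1 - cconj (phi n p w) * phi n p z) * Cker w z.

Definition poisson2 (z zt : C * C) : R :=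
  (1 - cabs z.1 ^+ 2) * (1 - cabs z.2 ^+ 2) /
  (cabs (zt.1 - z.1) ^+ 2 * cabs (zt.2 - z.2) ^+ 2).

Definition is_clark_measure (n : nat) (p : {poly {poly C}}) (alpha : C)
    (sigma : {measure set (R * R)%type -> \bar R}) : Prop :=
  sigma (~` angle_box) = 0%E /\
  forall z, in_D2 z ->
    (((1 - cabs (phi n p z) ^+ 2) / cabs (alpha - phi n p z) ^+ 2)%:E =
     \int[sigma]_t (poisson2 z (zeta t))%:E)%E.

Definition in_L2 (sigma : {measure set (R * R)%type -> \bar R}) (g : R * R -> C) : Prop :=
  measurable_fun setT (fun t => complex.Re (g t)) /\
  measurable_fun setT (fun t => complex.Im (g t)) /\
  (\int[sigma]_t ((cabs (g t)) ^+ 2)%:E < +oo)%E.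

Definition is_J (n : nat) (p : {poly {poly C}}) (alpha : C)
    (sigma : {measure set (R * R)%type -> \bar R})
    (J : (nat -> nat -> C) -> R * R -> C) : Prop :=
  (forall a, in_K n p a -> in_L2 sigma (J a)) /\
  (forall a b (c : C), in_K n p a -> in_K n p b ->
     {ae sigma, forall t, J (fun j k => c * a j k + b j k) t = c * J a t + J b t}) /\
  (forall a b, in_K n p a -> in_K n p b ->
     (\int[sigma]_t ((cabs (J a t - J b t)) ^+ 2)%:E
      = H2norm2 (fun j k => (a j k - b j k)%R))%E) /\
  (forall w a, in_D2 w -> represents a (kker n p w) ->
     {ae sigma, forall t,
        J a t = (1 - alpha * cconj (phi n p w)) * Cker w (zeta t)}).

End RIF.

(* Main.v *)
(* Write [Q = alpha p - ptilde = Q0(z1) + Q1(z1) z2]; the Clark measure is carried by [Q = 0].  A square-summable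
   power series [f] lies in the model space iff [p f] has no coefficient of index [(j, k)] with [j >= n] and
   [k >= 1]; hence [p f = g(z1) + z2 sum_(j < n) z1^j h_j(z2)] with one-variable Hardy functions [g] and [h_j].

   (i) The claim is explicit for combinations of reproducing kernels.  If such [f_m] converge geometrically to [f],
   the Hardy-Littlewood maximal function controls [p (f - f_m)] non-tangentially as long as [z1] and [z2] avoid a
   Lebesgue-null set, and [sigma] charges such a null set of values of [z1] (of [z2]) only where [Q(z1, 0) = 0]
   (where [Q(0, z2) = 0]).  There one uses instead
   [|p f|^2 <= ||f||^2 (|p|^2 - |ptilde|^2) C_z(z) <= 2 ||f||^2 |p| |Q| C_z(z)].

   (ii) [alpha] is exceptional iff [Q0] has a zero [tau] on the circle.  In that case all Poisson integrals of
   [sigma] over the line [z1 = tau] equal one positive constant, so on the line [sigma] is a multiple of Lebesgue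
   measure, where [conj z2] is at positive distance from the Szego kernels [1 / (1 - z2 conj w)].  Otherwise
   [conj z2 = - Q1 / Q0] holds [sigma]-almost everywhere, so that [conj z1] and [conj z2] multiply the closed span
   of the Szego kernels into itself, which is therefore all of [L^2]. *)
Require Import Defs.
From HB Require Import structures.
From mathcomp Require Import all_boot all_order all_algebra.
From mathcomp Require Import all_classical all_reals all_analysis.
From mathcomp Require Import complex measurable_realfun.
From mathcomp Require Import ring lra zify.
Set Implicit Arguments. Unset Strict Implicit. Unset Printing Implicit Defensive.
Import Order.TTheory GRing.Theory Num.Theory.
Import numFieldNormedType.Exports.
Local Open Scope classical_set_scope.
Local Open Scope ring_scope.

(** * Complex moduli, coefficient arrays and power series *)

(** The obstacle in (i) is that [p] may vanish on the torus, so that neither [1 / p] nor [phi]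
    extends continuously. Estimates are therefore made for [p f]: for a kernel combination it is
    Lipschitz on the closed bidisc, and in general the degree one in [z2] lets the one-variable
    maximal theorem do what would otherwise call for a two-parameter one. Products with [phi] are
    weak limits of [ptilde b / p(r .)] as [r -> 1]; these stay bounded because a polynomial [q] of
    degree at most [d] without zeros in the disc satisfies [|q(1)| <= 2^d |q(r)|]. Norms are bounds
    on finite corners of coefficient arrays, and pointwise bounds on the torus act on them through
    discrete Parseval at roots of unity, so integration enters only with the maximal function and
    the Clark measure. Masses of [sigma] are estimated by its Poisson integral at points at depth
    [h] inside the bidisc, with Schwarz-Pick inequalities obtained from positivity of the kernel. At
    generic values, once the conjugate coordinates are multipliers, indicators of arcs are
    multipliers as limits of trigonometric polynomials, and those of all Borel sets follow since the
    sets concerned form a sigma-algebra. *)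

Section ComplexModulus.
Context {R : realType}.
Local Notation C := R[i].
Implicit Types z w : C.

Lemma cabsE z : cabs z = ComplexField.Normc.normc z.
Proof. by case: z. Qed.

Lemma cabs_ge0 z : 0 <= cabs z. Proof. exact: sqrtr_ge0. Qed.

Lemma cabs_sqr z : cabs z ^+ 2 = complex.Re z ^+ 2 + complex.Im z ^+ 2.
Proof. by rewrite /cabs sqr_sqrtr // addr_ge0 // sqr_ge0. Qed.

Lemma cabsM z w : cabs (z * w) = cabs z * cabs w.
Proof. by rewrite !cabsE ComplexField.Normc.normcM. Qed.

Lemma cabsV z : cabs z^-1 = (cabs z)^-1.
Proof. by rewrite !cabsE ComplexField.Normc.normcV. Qed.

Lemma cabs0 : cabs (0 : C) = 0.
Proof. by rewrite cabsE ComplexField.Normc.normc0. Qed.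

Lemma cabs1 : cabs (1 : C) = 1.
Proof. by rewrite cabsE ComplexField.Normc.normc1. Qed.

Lemma cabs0_eq0 z : cabs z = 0 -> z = 0.
Proof. rewrite cabsE; exact: ComplexField.Normc.eq0_normc. Qed.

Lemma cabs_eq0 z : (cabs z == 0) = (z == 0).
Proof. by apply/eqP/eqP => [/cabs0_eq0 //|->]; rewrite cabs0. Qed.

Lemma cabs_gt0 z : (0 < cabs z) = (z != 0).
Proof. by rewrite lt_neqAle cabs_ge0 andbT eq_sym cabs_eq0. Qed.

Lemma cabsX z k : cabs (z ^+ k) = cabs z ^+ k.
Proof. by elim: k => [|k IH]; rewrite ?expr0 ?cabs1 // !exprS cabsM IH. Qed.

Lemma cabsD z w : cabs (z + w) <= cabs z + cabs w.
Proof. by rewrite !cabsE le_normcD. Qed.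

Lemma cabsN z : cabs (- z) = cabs z.
Proof. by rewrite !cabsE normcN. Qed.

Lemma cabsBC z w : cabs (z - w) = cabs (w - z).
Proof. by rewrite -cabsN opprB. Qed.

Lemma cabsB z w : cabs (z - w) <= cabs z + cabs w.
Proof. by rewrite -(cabsN w) cabsD. Qed.

Lemma cabs_subr z w : cabs z - cabs w <= cabs (z - w).
Proof. by have := cabsD (z - w) w; rewrite subrK; lra. Qed.

Lemma cabs_dist z w v : cabs (z - w) <= cabs (z - v) + cabs (v - w).
Proof. by have := cabsD (z - v) (v - w); rewrite addrA subrK. Qed.

Lemma cabs_sum (I : Type) (r : seq I) (P : pred I) (F : I -> C) :
  cabs (\sum_(i <- r | P i) F i) <= \sum_(i <- r | P i) cabs (F i).
Proof.
elim/big_ind2: _ => [|x1 x2 y1 y2 h1 h2|//]; first by rewrite cabs0.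
by apply: (le_trans (cabsD _ _)); exact: lerD.
Qed.

Lemma cabs_prod (I : Type) (r : seq I) (P : pred I) (F : I -> C) :
  cabs (\prod_(i <- r | P i) F i) = \prod_(i <- r | P i) cabs (F i).
Proof. by elim/big_ind2: _ => [|x1 x2 y1 y2 <- <-|//]; rewrite ?cabs1 ?cabsM. Qed.

Lemma cabs_real (x : R) : cabs (x%:C)%C = `|x|.
Proof. by rewrite /cabs /= expr0n addr0 sqrtr_sqr. Qed.

Lemma cabs_Re z : `|complex.Re z| <= cabs z.
Proof.
rewrite -(@ler_pXn2r _ 2%N) // ?nnegrE ?cabs_ge0 //.
by rewrite cabs_sqr real_normK ?num_real // lerDl sqr_ge0.
Qed.

Lemma cabs_Im z : `|complex.Im z| <= cabs z.
Proof.
rewrite -(@ler_pXn2r _ 2%N) // ?nnegrE ?cabs_ge0 //.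
by rewrite cabs_sqr real_normK ?num_real // lerDr sqr_ge0.
Qed.

Lemma Re_le_cabs z : complex.Re z <= cabs z.
Proof. exact: le_trans (ler_norm _) (cabs_Re z). Qed.

Lemma cabs_le_ReIm z : cabs z <= `|complex.Re z| + `|complex.Im z|.
Proof.
rewrite -(@ler_pXn2r _ 2%N) // ?nnegrE ?cabs_ge0 ?addr_ge0 //.
rewrite cabs_sqr sqrrD !real_normK ?num_real //.
have := normr_ge0 (complex.Re z); have := normr_ge0 (complex.Im z); nra.
Qed.

Lemma cReD z w : complex.Re (z + w) = complex.Re z + complex.Re w.
Proof. by case: z; case: w. Qed.
Lemma cReN z : complex.Re (- z) = - complex.Re z.
Proof. by case: z. Qed.
Lemma cReB z w : complex.Re (z - w) = complex.Re z - complex.Re w.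
Proof. by case: z; case: w. Qed.
Lemma cImD z w : complex.Im (z + w) = complex.Im z + complex.Im w.
Proof. by case: z; case: w. Qed.
Lemma cImB z w : complex.Im (z - w) = complex.Im z - complex.Im w.
Proof. by case: z; case: w. Qed.
Lemma cReM z w : complex.Re (z * w) =
  complex.Re z * complex.Re w - complex.Im z * complex.Im w.
Proof. by case: z; case: w. Qed.
Lemma cImM z w : complex.Im (z * w) =
  complex.Re z * complex.Im w + complex.Im z * complex.Re w.
Proof. by case: z => a b; case: w => c d. Qed.
Lemma Re_sum (I : Type) (r : seq I) (P : pred I) (F : I -> C) :
  complex.Re (\sum_(i <- r | P i) F i) = \sum_(i <- r | P i) complex.Re (F i).
Proof. by elim/big_ind2: _ => [//|x1 x2 y1 y2 <- <-|//]; rewrite cReD. Qed.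
Lemma Re_conj z : complex.Re (cconj z) = complex.Re z.
Proof. by case: z. Qed.
Lemma Im_conj z : complex.Im (cconj z) = - complex.Im z.
Proof. by case: z. Qed.

Lemma complex_ext z w : complex.Re z = complex.Re w ->
  complex.Im z = complex.Im w -> z = w.
Proof. by case: z => a b; case: w => c d /= -> ->. Qed.

Lemma cconjD z w : cconj (z + w) = cconj z + cconj w.
Proof. exact: rmorphD. Qed.
Lemma cconjN z : cconj (- z) = - cconj z.
Proof. exact: rmorphN. Qed.
Lemma cconjB z w : cconj (z - w) = cconj z - cconj w.
Proof. exact: rmorphB. Qed.
Lemma cconjM z w : cconj (z * w) = cconj z * cconj w.
Proof. exact: rmorphM. Qed.
Lemma cconjX z k : cconj (z ^+ k) = cconj z ^+ k.
Proof. exact: rmorphXn. Qed.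
Lemma cconjV z : cconj z^-1 = (cconj z)^-1.
Proof. exact: conjc_inv. Qed.
Lemma cconjK z : cconj (cconj z) = z.
Proof. exact: conjcK. Qed.
Lemma cconj0 : cconj (0 : C) = 0.
Proof. exact: conjc0. Qed.
Lemma cconj1 : cconj (1 : C) = 1.
Proof. exact: conjc1. Qed.
Lemma cconj_sum (I : Type) (r : seq I) (P : pred I) (F : I -> C) :
  cconj (\sum_(i <- r | P i) F i) = \sum_(i <- r | P i) cconj (F i).
Proof. exact: rmorph_sum. Qed.
Lemma cconj_prod (I : Type) (r : seq I) (P : pred I) (F : I -> C) :
  cconj (\prod_(i <- r | P i) F i) = \prod_(i <- r | P i) cconj (F i).
Proof. exact: rmorph_prod. Qed.
Lemma cconj_eq0 z : (cconj z == 0) = (z == 0).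
Proof. exact: conjc_eq0. Qed.

Lemma cabs_conj z : cabs (cconj z) = cabs z.
Proof. by rewrite /cabs Re_conj Im_conj sqrrN. Qed.

Lemma mul_conj z : z * cconj z = ((cabs z ^+ 2)%:C)%C.
Proof.
rewrite cabs_sqr; case: z => a b; apply: complex_ext; rewrite /= ?cReM ?cImM /=; ring.
Qed.

Lemma Re_mul_conj z : complex.Re (z * cconj z) = cabs z ^+ 2.
Proof. by rewrite mul_conj. Qed.

Lemma conj_unim z : cabs z = 1 -> cconj z = z^-1.
Proof.
move=> h; have z0 : z != 0 by rewrite -cabs_gt0 h.
by apply: (mulfI z0); rewrite mul_conj h expr1n divff.
Qed.

Lemma unim_neq0 z : cabs z = 1 -> z != 0.
Proof. by move=> h; rewrite -cabs_gt0 h. Qed.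

Lemma cabs_sqrB z w : cabs (z - w) ^+ 2 =
  cabs z ^+ 2 - 2 * complex.Re (z * cconj w) + cabs w ^+ 2.
Proof. by rewrite !cabs_sqr cReM Re_conj Im_conj cReB cImB; ring. Qed.

Lemma cabs_sqrD z w : cabs (z + w) ^+ 2 =
  cabs z ^+ 2 + 2 * complex.Re (z * cconj w) + cabs w ^+ 2.
Proof. by rewrite !cabs_sqr cReM Re_conj Im_conj cReD cImD; ring. Qed.

Lemma cabs_sqrD_le z w : cabs (z + w) ^+ 2 <= 2 * cabs z ^+ 2 + 2 * cabs w ^+ 2.
Proof.
rewrite !cabs_sqr cReD cImD.
have := sqr_ge0 (complex.Re z - complex.Re w).
have := sqr_ge0 (complex.Im z - complex.Im w); nra.
Qed.

(** Multiplication by the conjugate phase of [z]; it reduces bounds on moduli to bounds on real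
    parts. *)
Lemma polar z : exists2 g : C, cabs g = 1 & g * z = ((cabs z)%:C)%C.
Proof.
have [->|z0] := eqVneq z 0; first by exists 1; rewrite ?cabs1 ?mulr0 ?cabs0.
have c0 : cabs z != 0 by rewrite cabs_eq0.
exists (cconj z / ((cabs z)%:C)%C).
  by rewrite cabsM cabsV cabs_conj cabs_real ger0_norm ?cabs_ge0 // divff.
rewrite mulrAC [cconj z * z]mulrC mul_conj expr2 rmorphM /= mulfK //.
by rewrite -cabs_eq0 cabs_real ger0_norm ?cabs_ge0.
Qed.

(** Weighted arithmetic-geometric mean inequality. If the [x^2] sum to at most [M1^2] and the [y^2]
    to at most [M2^2], the right-hand side sums to at most [2 M1 M2], so Cauchy-Schwarz and
    Minkowski are reached without square roots. *)
Lemma conv_sqr (x y M1 M2 : R) : 0 < M1 -> 0 < M2 ->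
  2 * (x * y) <= (M2 / M1) * x ^+ 2 + (M1 / M2) * y ^+ 2.
Proof.
move=> h1 h2.
have -> : M2 / M1 * x ^+ 2 + M1 / M2 * y ^+ 2 =
  (M2 * x - M1 * y) ^+ 2 / (M1 * M2) + 2 * (x * y).
  by field; rewrite !gt_eqF.
by rewrite lerDr divr_ge0 ?sqr_ge0 // mulr_ge0 // ltW.
Qed.

Lemma sqr_le_cancel (x y : R) : 0 <= y -> x ^+ 2 <= y ^+ 2 -> x <= y.
Proof. by move=> y0 h; rewrite leNgt; apply/negP => hx; nra. Qed.

Lemma sqr_le (x y : R) : 0 <= x -> x <= y -> x ^+ 2 <= y ^+ 2.
Proof. nra. Qed.

Lemma cabs_one_sub z : cabs z < 1 -> 0 < cabs (1 - z).
Proof. by move=> h; have := cabs_subr 1 z; rewrite cabs1; lra. Qed.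

Lemma one_sub_neq0 z : cabs z < 1 -> 1 - z != 0.
Proof. by rewrite -cabs_gt0; exact: cabs_one_sub. Qed.

Lemma cabs_expi (t : R) : cabs (expi t) = 1.
Proof. by rewrite /cabs /= cos2Dsin2 sqrtr1. Qed.

Lemma expiD (s t : R) : expi (s + t) = expi s * expi t.
Proof. by apply: complex_ext; rewrite ?cReM ?cImM /= ?cosD ?sinD; ring. Qed.

Lemma expi0 : expi (0 : R) = 1.
Proof. by apply: complex_ext; rewrite /= ?cos0 ?sin0. Qed.

Lemma expiN (t : R) : expi (- t) = cconj (expi t).
Proof. by apply: complex_ext; rewrite ?Re_conj ?Im_conj /= ?cosN ?sinN. Qed.

Lemma expiMn (t : R) k : expi (k%:R * t) = expi t ^+ k.
Proof.
elim: k => [|k IH]; first by rewrite mul0r expi0 expr0.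
by rewrite -natr1 mulrDl mul1r expiD IH exprSr.
Qed.

Lemma expi2pi : expi (2 * pi : R) = 1.
Proof. by apply: complex_ext; rewrite /= mulr_natl ?cos2pi ?sin2pi. Qed.

Lemma expi_surj z : cabs z = 1 -> exists2 t : R, 0 <= t < 2 * pi & z = expi t.
Proof.
move=> h; have e := cabs_sqr z; rewrite h expr1n in e.
have hr : -1 <= complex.Re z <= 1.
  by have := cabs_Re z; rewrite h ler_norml.
have hc : cos (acos (complex.Re z)) = complex.Re z by rewrite acosK.
have a0 := acos_ge0 hr; have a1 := acos_lepi hr.
have hs : sin (acos (complex.Re z)) = `|complex.Im z|.
  rewrite sin_acos // -sqrtr_sqr; congr Num.sqrt; lra.
have p0 := pi_gt0 R.
have [i0|i0] := leP 0 (complex.Im z).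
  exists (acos (complex.Re z)); first by apply/andP; split=> //; lra.
  by apply: complex_ext; rewrite /= ?hc // hs ger0_norm.
exists (2 * pi - acos (complex.Re z)).
  have: 0 < acos (complex.Re z).
    rewrite lt_neqAle a0 andbT; apply/eqP => e0.
    move: hs; rewrite -e0 sin0 => /esym/eqP; rewrite normr_eq0 => /eqP; lra.
  by move=> ?; apply/andP; split; lra.
apply: complex_ext; rewrite /= mulr_natl.
  by rewrite cosB cos2pi sin2pi hc; ring.
by rewrite sinB cos2pi sin2pi hs ltr0_norm //; ring.
Qed.

End ComplexModulus.

(** * Square-summable coefficient arrays, measured on finite corners *)

Section Arrays.
Context {R : realType}.
Local Notation C := R[i].
Local Notation array := (nat -> nat -> C).
Implicit Types a b : array.

Lemma rect_widen (V : nmodType) (f : nat -> nat -> V) J K J' K' :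
  (J <= J')%N -> (K <= K')%N ->
  \sum_(j < J) \sum_(k < K) f j k =
  \sum_(j < J') \sum_(k < K') if (j < J)%N && (k < K)%N then f j k else 0.
Proof.
move=> hJ hK.
rewrite (big_ord_widen_cond _ predT (fun j => \sum_(k < K) f j k) hJ) big_mkcond /=.
apply: eq_bigr => j _; case: ifP => hj /=; last by rewrite big1.
by rewrite (big_ord_widen_cond _ predT (f j) hK) big_mkcond.
Qed.

(** Squared norm of the corner of indices below [N]. It is nondecreasing in [N], so a bound for all
    [N] replaces an infinite sum. *)
Definition nN (N : nat) a : R := \sum_(j < N) \sum_(k < N) cabs (a j k) ^+ 2.

Definition ipN (N : nat) a b : C := \sum_(j < N) \sum_(k < N) a j k * cconj (b j k).

(** Norm at most [M]. Positivity of [M] makes the quotient of two bounds available as a weight in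
    [conv_sqr]. *)
Definition bnd (M : R) a := 0 < M /\ forall N, nN N a <= M ^+ 2.

Definition acut (N : nat) a : array :=
  fun j k => if (j < N)%N && (k < N)%N then a j k else 0.

Definition aout (N : nat) a : array :=
  fun j k => if (j < N)%N && (k < N)%N then 0 else a j k.

Lemma nN_ge0 N a : 0 <= nN N a.
Proof. by apply: sumr_ge0 => j _; apply: sumr_ge0 => k _; exact: sqr_ge0. Qed.

Lemma nN_le a b N : (forall j k, cabs (a j k) <= cabs (b j k)) -> nN N a <= nN N b.
Proof.
move=> h; apply: ler_sum => j _; apply: ler_sum => k _.
by rewrite ler_pXn2r // nnegrE cabs_ge0.
Qed.

Lemma nN_acut N N' a : (N <= N')%N -> nN N' (acut N a) = nN N a.
Proof.
move=> h; rewrite /nN (rect_widen (fun j k => cabs (a j k) ^+ 2) h h).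
apply: eq_bigr => j _; apply: eq_bigr => k _; rewrite /acut.
by case: ifP => //; rewrite cabs0 expr0n.
Qed.

Lemma nN_split N N' a : nN N' a = nN N' (acut N a) + nN N' (aout N a).
Proof.
rewrite /nN -big_split; apply: eq_bigr => j _; rewrite -big_split.
apply: eq_bigr => k _; rewrite /acut /aout.
by case: ifP => _ /=; rewrite cabs0 expr0n /= ?addr0 ?add0r.
Qed.

Lemma nN_mono N N' a : (N <= N')%N -> nN N a <= nN N' a.
Proof. by move=> h; rewrite (nN_split N N' a) nN_acut // lerDl nN_ge0. Qed.

Lemma nN_coef a j k N : (j < N)%N -> (k < N)%N -> cabs (a j k) ^+ 2 <= nN N a.
Proof.
move=> hj hk; rewrite /nN (bigD1 (Ordinal hj)) //= (bigD1 (Ordinal hk)) //= -addrA.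
rewrite lerDl addr_ge0 //; first by apply: sumr_ge0 => i _; exact: sqr_ge0.
by apply: sumr_ge0 => i _; apply: sumr_ge0 => l _; exact: sqr_ge0.
Qed.

Lemma bnd_gt0 M a : bnd M a -> 0 < M. Proof. by case. Qed.

Lemma bnd_coef M a j k : bnd M a -> cabs (a j k) <= M.
Proof.
move=> [h0 h]; apply: sqr_le_cancel; first exact: ltW.
apply: (le_trans _ (h (maxn j k).+1)).
by apply: nN_coef; lia.
Qed.

Lemma bnd_sq M a : bnd M a -> sq_summable a.
Proof. by move=> [_ h]; exists (M ^+ 2). Qed.

Lemma sq_bnd a : sq_summable a -> exists M, bnd M a.
Proof.
move=> [M h]; exists (`|M| + 1); split; first by rewrite ltr_wpDl.
move=> N; rewrite /nN; apply: (le_trans (h N)).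
have := ler_norm M; have := normr_ge0 M; nra.
Qed.

Lemma bndD M M' a b : bnd M a -> bnd M' b -> bnd (M + M') (fun j k => a j k + b j k).
Proof.
move=> [h0 h] [h0' h']; split; first exact: addr_gt0.
move=> N.
have e : nN N (fun j k => a j k + b j k) <=
   nN N a + nN N b + ((M' / M) * nN N a + (M / M') * nN N b).
  rewrite /nN !mulr_sumr -!big_split; apply: ler_sum => j _.
  rewrite !mulr_sumr -!big_split; apply: ler_sum => k _.
  apply: (@le_trans _ _ ((cabs (a j k) + cabs (b j k)) ^+ 2)).
    by rewrite ler_pXn2r ?nnegrE ?addr_ge0 ?cabs_ge0 // cabsD.
  have := conv_sqr (cabs (a j k)) (cabs (b j k)) h0 h0'; rewrite /=; lra.
apply: (le_trans e).
have e1 : M' / M * nN N a <= M' * M.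
  have -> : M' * M = M' / M * M ^+ 2 by field; rewrite gt_eqF.
  by apply: ler_wpM2l => //; rewrite divr_ge0 ?ltW.
have e2 : M / M' * nN N b <= M' * M.
  have -> : M' * M = M / M' * M' ^+ 2 by field; rewrite gt_eqF.
  by apply: ler_wpM2l => //; rewrite divr_ge0 ?ltW.
have := h N; have := h' N; nra.
Qed.

Lemma bnd_ext M a b : (forall j k, a j k = b j k) -> bnd M a -> bnd M b.
Proof.
by move=> e; have -> : b = a by apply/funext => j; apply/funext => k; rewrite e.
Qed.

Lemma bndZ M a c K : bnd M a -> 0 < K -> cabs c <= K -> bnd (K * M) (fun j k => c * a j k).
Proof.
move=> [h0 h] K0 hK; split; first exact: mulr_gt0.
move=> N; have -> : nN N (fun j k => c * a j k) = cabs c ^+ 2 * nN N a.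
  rewrite /nN mulr_sumr; apply: eq_bigr => j _; rewrite mulr_sumr.
  by apply: eq_bigr => k _; rewrite cabsM exprMn.
rewrite exprMn; apply: ler_pM; rewrite ?sqr_ge0 ?nN_ge0 //.
by rewrite ler_pXn2r ?nnegrE ?cabs_ge0 // ltW.
Qed.

Lemma bndN M a : bnd M a -> bnd M (fun j k => - a j k).
Proof.
move=> h; have := @bndZ M a (-1) 1 h ltr01; rewrite cabsN cabs1 lexx mul1r => /(_ isT).
by apply: bnd_ext => j k; rewrite mulN1r.
Qed.

Lemma bndB M M' a b : bnd M a -> bnd M' b -> bnd (M + M') (fun j k => a j k - b j k).
Proof. by move=> h h'; exact: (bndD h (bndN h')). Qed.

Lemma bnd_dom M a b : (forall j k, cabs (b j k) <= cabs (a j k)) -> bnd M a -> bnd M b.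
Proof. by move=> e [h0 h]; split=> // N; exact: le_trans (nN_le N e) (h N). Qed.

Lemma bnd_acut M a N : bnd M a -> bnd M (acut N a).
Proof.
by apply: bnd_dom => j k; rewrite /acut; case: ifP => // _; rewrite cabs0 cabs_ge0.
Qed.

(** Lower semicontinuity of the norm under coefficientwise convergence: a corner has finitely many
    entries, so one index [m0] serves all of them at once. *)
Lemma nN_limit (f : nat -> array) a N c :
  (forall j k e, 0 < e -> exists m0, forall m, (m0 <= m)%N -> cabs (f m j k - a j k) < e) ->
  (forall m, nN N (f m) <= c) -> nN N a <= c.
Proof.
move=> hl hc; apply/ler_addgt0Pr => e e0.
pose n2 : R := (N%:R * N%:R) + 1.
have n2p : 0 < n2 by rewrite /n2 ltr_wpDl // mulr_ge0.
have key : forall j k, exists m0, forall m, (m0 <= m)%N ->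
    cabs (a j k) ^+ 2 <= cabs (f m j k) ^+ 2 + e / n2.
  move=> j k; pose A := cabs (a j k).
  have A0 : 0 <= A := cabs_ge0 _.
  (* If an entry of modulus [A] is approximated within [d], its square drops by at most [2 A d],
     which this [d] keeps below [e / n2]. *)
  pose d := Num.min 1 (e / n2 / (2 * A + 1)).
  have d0 : 0 < d.
    by rewrite lt_min ltr01 /= !divr_gt0 // ltr_wpDl // mulr_ge0.
  have [m0 hm] := hl j k d d0; exists m0 => m /hm h.
  have h1 : d <= 1 by rewrite ge_min lexx.
  have h2 : d * (2 * A + 1) <= e / n2.
    rewrite -ler_pdivlMr; first by rewrite ge_min lexx orbT.
    by rewrite ltr_wpDl // mulr_ge0.
  have := cabs_subr (a j k) (f m j k); rewrite cabsBC -/A => h3.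
  have h4 : A - d <= cabs (f m j k) by lra.
  have := cabs_ge0 (f m j k) => h5.
  have [h6|h6] := leP 0 (A - d); first by nra.
  nra.
have [m0 hm0] : exists m0, forall j k : 'I_N,
    cabs (a j k) ^+ 2 <= cabs (f m0 j k) ^+ 2 + e / n2.
  have [g hg] := choice (fun jk : nat * nat => key jk.1 jk.2).
  exists (\max_(j < N) \max_(k < N) g (nat_of_ord j, nat_of_ord k)) => j k.
  apply: (hg (nat_of_ord j, nat_of_ord k)) => /=.
  apply: leq_trans (leq_bigmax j).
  exact: (@leq_bigmax _ (fun k : 'I_N => g (nat_of_ord j, nat_of_ord k))).
apply: (@le_trans _ _ (\sum_(j < N) \sum_(k < N) (cabs (f m0 j k) ^+ 2 + e / n2))).
  by apply: ler_sum => j _; apply: ler_sum => k _; exact: hm0.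
under eq_bigr do rewrite big_split /=.
rewrite big_split /= -/(nN N (f m0)) lerD //.
rewrite !sumr_const !card_ord -mulrnA -mulr_natr natrM mulrAC ler_pdivrMr //.
by rewrite ler_pM2l // /n2 lerDl.
Qed.

Lemma bnd_limit (f : nat -> array) a M :
  (forall j k e, 0 < e -> exists m0, forall m, (m0 <= m)%N -> cabs (f m j k - a j k) < e) ->
  (forall m, bnd M (f m)) -> bnd M a.
Proof.
move=> hl hc; split; first by case: (hc 0).
by move=> N; apply: (nN_limit hl) => m; case: (hc m).
Qed.

(** A corner whose squared norm is within [e^2] of the supremum leaves at most [e^2] outside, and a
    larger corner leaves no more. *)
Lemma tail_small M a e : bnd M a -> 0 < e -> exists N, forall N', (N <= N')%N -> bnd e (aout N' a).
Proof.
move=> [M0 h] e0; pose E := [set x | exists N, x = nN N a].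
have hE : has_sup E.
  split; first by exists (nN 0 a), 0.
  by exists (M ^+ 2) => x [N ->].
have [x [N ->] hx] := sup_adherent (exprn_gt0 2 e0) hE.
exists N => N' hN; split=> // m; set P := maxn m N'.
apply: (le_trans (nN_mono (aout N' a) (leq_maxl m N'))).
have := nN_split N' P a; rewrite nN_acut ?leq_maxr // -/P => hs.
have h1 : nN P a <= sup E by apply: ub_le_sup; [case: hE | exists P].
have h2 := nN_mono a hN; lra.
Qed.

Lemma ipN_le N a b M M' : bnd M a -> bnd M' b -> cabs (ipN N a b) <= M * M'.
Proof.
move=> [h0 h] [h0' h'].
have: cabs (ipN N a b) <= \sum_(j < N) \sum_(k < N) cabs (a j k) * cabs (b j k).
  apply: (le_trans (cabs_sum _ _ _)); apply: ler_sum => j _.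
  apply: (le_trans (cabs_sum _ _ _)); apply: ler_sum => k _.
  by rewrite cabsM cabs_conj.
move/le_trans; apply.
have: 2 * \sum_(j < N) \sum_(k < N) cabs (a j k) * cabs (b j k) <=
   (M' / M) * nN N a + (M / M') * nN N b.
  rewrite /nN !mulr_sumr -!big_split; apply: ler_sum => j _.
  rewrite !mulr_sumr -!big_split; apply: ler_sum => k _; exact: conv_sqr.
have e1 : M' / M * nN N a <= M' * M.
  have -> : M' * M = M' / M * M ^+ 2 by field; rewrite gt_eqF.
  by apply: ler_wpM2l => //; rewrite divr_ge0 ?ltW.
have e2 : M / M' * nN N b <= M' * M.
  have -> : M' * M = M / M' * M' ^+ 2 by field; rewrite gt_eqF.
  by apply: ler_wpM2l => //; rewrite divr_ge0 ?ltW.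
lra.
Qed.

Lemma ipN_acut N N' a b : (N <= N')%N -> ipN N' (acut N a) b = ipN N a b.
Proof.
move=> h; rewrite /ipN (rect_widen (fun j k => a j k * cconj (b j k)) h h).
apply: eq_bigr => j _; apply: eq_bigr => k _; rewrite /acut.
by case: ifP => //; rewrite mul0r.
Qed.

Lemma ipN_split N N' a b : (N <= N')%N -> ipN N' a b = ipN N a b + ipN N' (aout N a) b.
Proof.
move=> h; rewrite -(ipN_acut a b h) /ipN -big_split; apply: eq_bigr => j _.
rewrite -big_split; apply: eq_bigr => k _; rewrite /acut /aout.
by case: ifP => _ /=; rewrite mul0r ?addr0 ?add0r.
Qed.

Lemma ipNDr N a b c : ipN N a (fun j k => b j k + c j k) = ipN N a b + ipN N a c.
Proof.
rewrite /ipN -big_split; apply: eq_bigr => j _; rewrite -big_split.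
by apply: eq_bigr => k _; rewrite cconjD mulrDr.
Qed.

Lemma ipNZr N a b x : ipN N a (fun j k => x * b j k) = cconj x * ipN N a b.
Proof.
rewrite /ipN mulr_sumr; apply: eq_bigr => j _; rewrite mulr_sumr.
by apply: eq_bigr => k _; rewrite cconjM mulrCA.
Qed.

Lemma ipN_conj N a b : cconj (ipN N a b) = ipN N b a.
Proof.
rewrite /ipN cconj_sum; apply: eq_bigr => j _; rewrite cconj_sum.
by apply: eq_bigr => k _; rewrite cconjM cconjK mulrC.
Qed.

Lemma ipN_self N a : ipN N a a = ((nN N a)%:C)%C.
Proof.
rewrite /ipN /nN rmorph_sum; apply: eq_bigr => j _; rewrite rmorph_sum.
by apply: eq_bigr => k _; rewrite mul_conj.
Qed.

Lemma nN_add N a b : nN N (fun j k => a j k + b j k) =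
  nN N a + 2 * complex.Re (ipN N a b) + nN N b.
Proof.
rewrite /nN /ipN Re_sum mulr_sumr -!big_split; apply: eq_bigr => j _.
rewrite Re_sum mulr_sumr -!big_split; apply: eq_bigr => k _ /=.
exact: cabs_sqrD.
Qed.

(** Bounded coefficientwise limits are weak limits: outside a large corner the pairing with [a] is
    small uniformly in [m], and inside it there are finitely many terms. *)
Lemma weak_limit0 (f : nat -> array) a b M K :
  bnd M a -> (forall m, bnd K (f m)) ->
  (forall j k e, 0 < e -> exists m0, forall m, (m0 <= m)%N -> cabs (f m j k - b j k) < e) ->
  (forall m, inner_is a (f m) 0) -> inner_is a b 0.
Proof.
move=> ha hf hl h0 e e0.
have hb := bnd_limit hl hf; have K0 := bnd_gt0 (hf 0%N).
pose e1 := e / (4 * K).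
have e10 : 0 < e1 by rewrite divr_gt0 // mulr_gt0.
have [N hN] := tail_small ha e10.
have hN0 := hN N (leqnn N).
have key : cabs (ipN N a b) <= 2 * (e1 * K).
  apply/ler_addgt0Pr => d d0.
  pose S := \sum_(j < N) \sum_(k < N) (cabs (a j k) + 1).
  have S0 : 0 <= S.
    apply: sumr_ge0 => j _; apply: sumr_ge0 => k _; rewrite addr_ge0 ?cabs_ge0 //.
  pose d1 := d / (S + 1).
  have d10 : 0 < d1 by rewrite divr_gt0 // ltr_wpDl.
  have [m hm] : exists m, forall j k : 'I_N, cabs (f m j k - b j k) < d1.
    have [g hg] := choice (fun jk : nat * nat => hl jk.1 jk.2 d1 d10).
    exists (\max_(j < N) \max_(k < N) g (nat_of_ord j, nat_of_ord k)) => j k.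
    apply: (hg (nat_of_ord j, nat_of_ord k)) => /=.
    apply: leq_trans (leq_bigmax j).
    exact: (@leq_bigmax _ (fun k : 'I_N => g (nat_of_ord j, nat_of_ord k))).
  have h1 : cabs (ipN N a (f m)) <= 2 * (e1 * K).
    have [N1 hN1] := h0 m (e1 * K) (mulr_gt0 e10 K0).
    have := hN1 (maxn N N1) (leq_maxr _ _); rewrite subr0 -/(ipN _ _ _).
    rewrite (ipN_split a (f m) (leq_maxl N N1)).
    have := ipN_le (maxn N N1) hN0 (hf m).
    set x := ipN N a (f m); set y := ipN _ _ _ => h2 h3.
    have := cabsB (x + y) y; rewrite addrK; lra.
  have h2 : cabs (ipN N a b - ipN N a (f m)) <= d1 * S.
    rewrite /ipN -sumrB mulr_sumr; apply: (le_trans (cabs_sum _ _ _)).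
    apply: ler_sum => j _; rewrite -sumrB mulr_sumr; apply: (le_trans (cabs_sum _ _ _)).
    apply: ler_sum => k _; rewrite -mulrBr -cconjB cabsM cabs_conj cabsBC mulrC.
    apply: ler_pM; rewrite ?cabs_ge0 ?(ltW (hm j k)) //.
    by rewrite lerDl.
  have h3 : d1 * S <= d.
    by rewrite /d1 mulrAC ler_pdivrMr ?ltr_wpDl // ler_pM2l // lerDl.
  have := cabsD (ipN N a b - ipN N a (f m)) (ipN N a (f m)); rewrite subrK; lra.
exists N => m hm; rewrite subr0 -/(ipN _ _ _) (ipN_split a b hm).
apply: (le_lt_trans (cabsD _ _)).
have h4 := ipN_le m hN0 hb.
have h5 : e1 * K = e / 4 by rewrite /e1; field; rewrite gt_eqF.
rewrite h5 in h4 key; lra.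
Qed.

End Arrays.

(** * Power series on the bidisc and uniqueness of their coefficients *)

Section PowerSeries.
Context {R : realType}.
Local Notation C := R[i].
Local Notation array := (nat -> nat -> C).
Implicit Types (a b : array) (z w : C * C).

Lemma real_cauchy (u : nat -> R) :
  (forall e, 0 < e -> exists N, forall m, (N <= m)%N -> `|u m - u N| < e) ->
  exists l, forall e, 0 < e -> exists N, forall m, (N <= m)%N -> `|u m - l| < e.
Proof.
move=> h.
have cu : cvg (u @ \oo).
  apply: cauchy_cvg; apply: cauchy_exP => e e0.
  have [N hN] := h e e0; exists (u N).
  exists N => // m /= hm; have := hN m hm.
  by rewrite /ball /= distrC.
exists (lim (u @ \oo)) => e e0.
have /cvgrPdist_lt/(_ e e0)[N _ hN] := cu.
by exists N => m hm; rewrite distrC; apply: hN.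
Qed.

Lemma complex_cauchy (u : nat -> C) :
  (forall e, 0 < e -> exists N, forall m, (N <= m)%N -> cabs (u m - u N) < e) ->
  exists l, ccvg u l.
Proof.
move=> h.
have [x hx] : exists l, forall e, 0 < e ->
    exists N, forall m, (N <= m)%N -> `|complex.Re (u m) - l| < e.
  apply: real_cauchy => e e0; have [N hN] := h e e0; exists N => m hm.
  by rewrite -cReB; apply: le_lt_trans (cabs_Re _) (hN m hm).
have [y hy] : exists l, forall e, 0 < e ->
    exists N, forall m, (N <= m)%N -> `|complex.Im (u m) - l| < e.
  apply: real_cauchy => e e0; have [N hN] := h e e0; exists N => m hm.
  by rewrite -cImB; apply: le_lt_trans (cabs_Im _) (hN m hm).
exists (x +i* y)%C => e e0.
have e2 : 0 < e / 2 by rewrite divr_gt0.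
have [N1 h1] := hx _ e2; have [N2 h2] := hy _ e2.
exists (maxn N1 N2) => m; rewrite geq_max => /andP[m1 m2].
apply: (le_lt_trans (cabs_le_ReIm _)); rewrite cReB cImB /=.
by have := h1 _ m1; have := h2 _ m2; lra.
Qed.

Lemma ccvg_unique (u : nat -> C) l l' : ccvg u l -> ccvg u l' -> l = l'.
Proof.
move=> h h'; apply/eqP; rewrite -subr_eq0 -cabs_eq0; apply/eqP.
apply/le_anti; rewrite cabs_ge0 andbT; apply/ler_addgt0Pr => e e0.
have e2 : 0 < e / 2 by rewrite divr_gt0.
have [N1 h1] := h _ e2; have [N2 h2] := h' _ e2.
have := h1 _ (leq_maxl N1 N2); have := h2 _ (leq_maxr N1 N2).
have := cabs_dist l l' (u (maxn N1 N2)); rewrite (cabsBC l (u _)); lra.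
Qed.

Definition geo (J : nat) (x : R) : R := \sum_(j < J) x ^+ j.

Lemma geo_mul J (x : R) : (1 - x) * geo J x = 1 - x ^+ J.
Proof.
rewrite /geo; elim: J => [|J IH]; first by rewrite big_ord0 mulr0 expr0 subrr.
by rewrite big_ord_recr /= mulrDr IH exprS; ring.
Qed.

Lemma geo_ge0 J (x : R) : 0 <= x -> 0 <= geo J x.
Proof. by move=> x0; apply: sumr_ge0 => j _; exact: exprn_ge0. Qed.

Lemma geo_le J (x : R) : 0 <= x < 1 -> geo J x <= (1 - x)^-1.
Proof.
move=> /andP[x0 x1]; rewrite -[leRHS]mul1r ler_pdivlMr ?subr_gt0 //.
by rewrite mulrC geo_mul gerBl exprn_ge0.
Qed.

Lemma geo_cvg (x e : R) : 0 <= x < 1 -> 0 < e ->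
  exists N, forall J, (N <= J)%N -> (1 - x)^-1 - e < geo J x.
Proof.
move=> /andP[x0 x1] e0.
have := @cvg_expr R x; rewrite ger0_norm // => /(_ x1) /cvgrPdist_lt.
have d0 : 0 < e * (1 - x) by rewrite mulr_gt0 // subr_gt0.
move=> /(_ _ d0)[N _ hN]; exists N => J hJ.
have := hN J hJ; rewrite /= sub0r normrN ger0_norm ?exprn_ge0 // => h.
have x1' : 0 < 1 - x by rewrite subr_gt0.
rewrite -(ltr_pM2l x1') geo_mul mulrBr divff ?gt_eqF //; lra.
Qed.

Definition PS b (J K : nat) z : C := \sum_(j < J) \sum_(k < K) b j k * z.1 ^+ j * z.2 ^+ k.

(** Convergence over all large rectangles and not only squares, so that shifting one index keeps a
    convergent series convergent. *)
Definition sums b z L := forall e : R, 0 < e -> exists N, forall J K,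
  (N <= J)%N -> (N <= K)%N -> cabs (PS b J K z - L) < e.

Definition bdd b := exists M : R, forall j k, cabs (b j k) <= M.

Lemma bnd_bdd M a : bnd M a -> bdd a.
Proof. by move=> h; exists M => j k; exact: bnd_coef h. Qed.

Lemma in_D2P z : in_D2 z -> (0 <= cabs z.1 < 1) /\ (0 <= cabs z.2 < 1).
Proof. by move=> [h1 h2]; rewrite !cabs_ge0. Qed.

Lemma PS_diff b (M : R) J K J' K' z : (forall j k, cabs (b j k) <= M) ->
  (J <= J')%N -> (K <= K')%N ->
  cabs (PS b J' K' z - PS b J K z) <=
    M * (geo J' (cabs z.1) * geo K' (cabs z.2) - geo J (cabs z.1) * geo K (cabs z.2)).
Proof.
move=> hM hJ hK.
have e J1 K1 : geo J1 (cabs z.1) * geo K1 (cabs z.2) =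
    \sum_(j < J1) \sum_(k < K1) cabs z.1 ^+ j * cabs z.2 ^+ k.
  by rewrite /geo mulr_suml; apply: eq_bigr => j _; rewrite mulr_sumr.
rewrite !e /PS (rect_widen (fun j k => cabs z.1 ^+ j * cabs z.2 ^+ k) hJ hK).
rewrite (rect_widen (fun j k => b j k * z.1 ^+ j * z.2 ^+ k) hJ hK).
rewrite -!sumrB mulr_sumr; apply: (le_trans (cabs_sum _ _ _)); apply: ler_sum => j _.
rewrite -!sumrB mulr_sumr; apply: (le_trans (cabs_sum _ _ _)); apply: ler_sum => k _.
case: ifP => _; first by rewrite !subrr cabs0 mulr0.
rewrite !subr0 !cabsM !cabsX -mulrA; apply: ler_wpM2r => //.
by rewrite mulr_ge0 // exprn_ge0 // cabs_ge0.
Qed.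

Lemma PS_le b (M : R) J K z : (forall j k, cabs (b j k) <= M) ->
  cabs (PS b J K z) <= M * (geo J (cabs z.1) * geo K (cabs z.2)).
Proof.
move=> hM; have := @PS_diff b M 0 0 J K z hM (leq0n _) (leq0n _).
by rewrite {2}/PS big_ord0 subr0 /geo !big_ord0 mul0r subr0.
Qed.

Lemma sums_ex b z : bdd b -> in_D2 z -> exists L, sums b z L.
Proof.
move=> [M hM] /in_D2P [h1 h2].
have M0 : 0 <= M by apply: le_trans (cabs_ge0 _) (hM 0%N 0%N).
set g1 := (1 - cabs z.1)^-1; set g2 := (1 - cabs z.2)^-1.
have g10 : 0 < g1 by rewrite invr_gt0 subr_gt0; case/andP: h1.
have g20 : 0 < g2 by rewrite invr_gt0 subr_gt0; case/andP: h2.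
have key : forall e : R, 0 < e -> exists N, forall J K J' K', (N <= J)%N -> (N <= K)%N ->
   (J <= J')%N -> (K <= K')%N -> cabs (PS b J' K' z - PS b J K z) < e.
  (* If each geometric partial sum is within [d] of its limit [g1] or [g2], two products of such
     partial sums differ by at most [d (g1 + g2)]. *)
  move=> e e0; pose d := e / ((M + 1) * (g1 + g2)).
  have M1 : 0 < M + 1 by lra.
  have g3 : 0 < g1 + g2 by lra.
  have d0 : 0 < d by rewrite divr_gt0 // mulr_gt0.
  have [N1 hN1] := geo_cvg h1 d0; have [N2 hN2] := geo_cvg h2 d0.
  exists (maxn N1 N2) => J K J' K'; rewrite !geq_max => /andP[j1 j2] /andP[k1 k2] hJ hK.
  apply: (le_lt_trans (PS_diff z hM hJ hK)).
  have a1 := hN1 J j1; have a2 := hN2 K k2.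
  have b1 := geo_le J' h1; have b2 := geo_le K' h2.
  have c1 := geo_ge0 J' (proj1 (andP h1)); have c2 := geo_ge0 K' (proj1 (andP h2)).
  have c3 := geo_le K h2; have c4 := geo_ge0 K (proj1 (andP h2)).
  rewrite -/g1 in a1 b1; rewrite -/g2 in a2 b2 c3.
  set x' := geo J' _ in b1 c1 *; set y' := geo K' _ in b2 c2 *.
  set x := geo J _ in a1 *; set y := geo K _ in a2 c3 c4 *.
  have h3 : x' * y' - x * y <= d * (g1 + g2).
    have i1 : x' * y' <= g1 * g2 by apply: ler_pM.
    have i2 : (g1 - d) * y <= x * y by rewrite ler_wpM2r // ltW.
    have i3 : g1 * (g2 - y) <= g1 * d by rewrite ler_wpM2l ?ltW //; lra.
    have i4 : d * y <= d * g2 by rewrite ler_wpM2l // ltW.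
    nra.
  have h4 : d * (g1 + g2) = e / (M + 1).
    by rewrite /d; field; rewrite !gt_eqF.
  rewrite h4 in h3.
  apply: (@le_lt_trans _ _ (M * (e / (M + 1)))); first by rewrite ler_wpM2l.
  by rewrite mulrA ltr_pdivrMr // mulrC ltr_pM2l // ltrDl.
have [L hL] : exists l, ccvg (fun N => PS b N N z) l.
  apply: complex_cauchy => e e0; have [N hN] := key e e0.
  by exists N => m hm; apply: hN.
exists L => e e0; have e2 : 0 < e / 2 by rewrite divr_gt0.
have [N hN] := key _ e2; have [N1 hN1] := hL _ e2.
exists N => J K hJ hK.
pose m := maxn N1 (maxn J K).
have := hN J K m m hJ hK; rewrite /m !leq_max !leqnn !orbT => /(_ isT isT).
have := hN1 m (leq_maxl _ _).
have := cabs_dist (PS b J K z) L (PS b m m z).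
rewrite (cabsBC (PS b J K z) (PS b m m z)) /m; lra.
Qed.

Lemma sums_ccvg b z L : sums b z L -> ccvg (fun N => PS b N N z) L.
Proof. by move=> h e e0; have [N hN] := h e e0; exists N => m hm; exact: hN. Qed.

Lemma sums_unique b z L L' : sums b z L -> sums b z L' -> L = L'.
Proof. by move=> /sums_ccvg h /sums_ccvg h'; exact: ccvg_unique h h'. Qed.

(* The value at [z] of the power series, as a limit of rectangular partial sums (junk value [0] without convergence). *)
Definition ev b z : C := xget 0 [set L | sums b z L].

Lemma evP b z : bdd b -> in_D2 z -> sums b z (ev b z).
Proof. by move=> hb hz; have [L hL] := sums_ex hb hz; exact: (xgetPex 0 (ex_intro _ L hL)). Qed.

Lemma ev_unique b z L : bdd b -> in_D2 z -> sums b z L -> ev b z = L.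
Proof. by move=> hb hz hL; exact: sums_unique (evP hb hz) hL. Qed.

Lemma bddD a b : bdd a -> bdd b -> bdd (fun j k => a j k + b j k).
Proof.
move=> [M h] [M' h']; exists (M + M') => j k.
by apply: (le_trans (cabsD _ _)); exact: lerD.
Qed.

Lemma bddZ c a : bdd a -> bdd (fun j k => c * a j k).
Proof.
by move=> [M h]; exists (cabs c * M) => j k; rewrite cabsM ler_wpM2l ?cabs_ge0.
Qed.

Lemma evD a b z : bdd a -> bdd b -> in_D2 z ->
  ev (fun j k => a j k + b j k) z = ev a z + ev b z.
Proof.
move=> ha hb hz; apply: ev_unique => //; first exact: bddD.
move=> e e0; have e2 : 0 < e / 2 by rewrite divr_gt0.
have [N1 h1] := evP ha hz e2; have [N2 h2] := evP hb hz e2.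
exists (maxn N1 N2) => J K; rewrite !geq_max => /andP[j1 j2] /andP[k1 k2].
have -> : PS (fun j k => a j k + b j k) J K z = PS a J K z + PS b J K z.
  rewrite /PS -big_split; apply: eq_bigr => j _; rewrite -big_split.
  by apply: eq_bigr => k _; rewrite !mulrDl.
have := h1 J K j1 k1; have := h2 J K j2 k2.
have := cabsD (PS a J K z - ev a z) (PS b J K z - ev b z).
rewrite opprD addrACA; lra.
Qed.

Lemma evZ c a z : bdd a -> in_D2 z -> ev (fun j k => c * a j k) z = c * ev a z.
Proof.
move=> ha hz; apply: ev_unique => //; first exact: bddZ.
move=> e e0; have c0 : 0 < cabs c + 1 by have := cabs_ge0 c; lra.
have e2 : 0 < e / (cabs c + 1) by rewrite divr_gt0.
have [N1 h1] := evP ha hz e2.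
exists N1 => J K j1 k1.
have -> : PS (fun j k => c * a j k) J K z = c * PS a J K z.
  rewrite /PS mulr_sumr; apply: eq_bigr => j _; rewrite mulr_sumr.
  by apply: eq_bigr => k _; rewrite !mulrA.
rewrite -mulrBr cabsM.
have := h1 J K j1 k1; rewrite ltr_pdivlMr // => h; apply: le_lt_trans h.
by rewrite mulrC ler_wpM2l ?cabs_ge0 // lerDl.
Qed.

Lemma evB a b z : bdd a -> bdd b -> in_D2 z ->
  ev (fun j k => a j k - b j k) z = ev a z - ev b z.
Proof.
move=> ha hb hz.
have -> : (fun j k => a j k - b j k) = (fun j k => a j k + (-1) * b j k).
  by apply/funext => j; apply/funext => k; rewrite mulN1r.
by rewrite evD // ?evZ ?mulN1r //; exact: bddZ.
Qed.

Lemma ev_le b (M : R) z : (forall j k, cabs (b j k) <= M) -> in_D2 z ->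
  cabs (ev b z) <= M / ((1 - cabs z.1) * (1 - cabs z.2)).
Proof.
move=> hM hz; have [h1 h2] := in_D2P hz.
have M0 : 0 <= M by apply: le_trans (cabs_ge0 _) (hM 0%N 0%N).
have hb : bdd b by exists M.
apply/ler_addgt0Pr => e e0; have [N hN] := evP hb hz e0.
have := hN N N (leqnn _) (leqnn _).
have := PS_le N N z hM.
have : M * (geo N (cabs z.1) * geo N (cabs z.2)) <= M / ((1 - cabs z.1) * (1 - cabs z.2)).
  apply: ler_wpM2l => //; rewrite invfM.
  apply: ler_pM.
  - exact: geo_ge0 (cabs_ge0 _).
  - exact: geo_ge0 (cabs_ge0 _).
  - exact: geo_le.
  - exact: geo_le.
have := cabs_subr (ev b z) (PS b N N z); rewrite cabsBC; lra.
Qed.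

(** [S1] and [S2] are multiplication by [z1] and [z2], [L1] is the backward shift in the first
    index, and [tr] exchanges the variables. *)
Definition S1 a : array := fun j k => if j is j'.+1 then a j' k else 0.
Definition S2 a : array := fun j k => if k is k'.+1 then a j k' else 0.
Definition L1 a : array := fun j k => a j.+1 k.
Definition tr a : array := fun j k => a k j.

Lemma bdd_S1 a : bdd a -> bdd (S1 a).
Proof.
move=> [M h]; exists M => -[|j] k //=; rewrite cabs0.
by apply: le_trans (cabs_ge0 _) (h 0%N 0%N).
Qed.

Lemma bdd_L1 a : bdd a -> bdd (L1 a).
Proof. by move=> [M h]; exists M => j k; exact: h. Qed.

Lemma bdd_tr a : bdd a -> bdd (tr a).
Proof. by move=> [M h]; exists M => j k; exact: h. Qed.

Lemma ev_tr a z : bdd a -> in_D2 z -> ev (tr a) (z.2, z.1) = ev a z.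
Proof.
move=> ha hz; apply: ev_unique; [exact: bdd_tr | by case: hz |].
move=> e e0; have [N hN] := evP ha hz e0; exists N => J K hJ hK.
rewrite (_ : PS _ J K _ = PS a K J z); first exact: hN.
rewrite /PS exchange_big; apply: eq_bigr => j _; apply: eq_bigr => k _ /=.
by rewrite /tr mulrAC.
Qed.

Lemma ev_S1 a z : bdd a -> in_D2 z -> ev (S1 a) z = z.1 * ev a z.
Proof.
move=> ha hz; apply: ev_unique => //; first exact: bdd_S1.
move=> e e0; have [N hN] := evP ha hz e0; exists N.+1 => -[//|J] K hJ hK.
have -> : PS (S1 a) J.+1 K z = z.1 * PS a J K z.
  rewrite /PS big_ord_recl /= big1 ?add0r; last by move=> k _; rewrite !mul0r.
  rewrite mulr_sumr; apply: eq_bigr => j _; rewrite mulr_sumr.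
  by apply: eq_bigr => k _; rewrite /bump /= add1n exprS; ring.
rewrite -mulrBr cabsM; apply: le_lt_trans (hN J K _ _); last 2 first.
- by rewrite -ltnS.
- exact: ltnW.
by rewrite ler_piMl ?cabs_ge0 //; case: hz => /ltW.
Qed.

Lemma ev_S2 a z : bdd a -> in_D2 z -> ev (S2 a) z = z.2 * ev a z.
Proof.
move=> ha hz.
have hz' : in_D2 (z.2, z.1) by case: hz.
have e : S2 a = tr (S1 (tr a)) by apply/funext => j; apply/funext => -[|k].
have := @ev_tr (S1 (tr a)) (z.2, z.1) (bdd_S1 (bdd_tr ha)) hz'.
rewrite -e /= => e1; case: z hz hz' e1 => z1 z2 hz hz' /= ->.
by rewrite (ev_S1 (bdd_tr ha) hz') /= -(ev_tr ha hz).
Qed.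

Lemma ev_L1 a z : bdd a -> in_D2 z -> ev a z = ev a (0, z.2) + z.1 * ev (L1 a) z.
Proof.
move=> ha hz; have hz0 : in_D2 (0, z.2) by case: hz => _ h; split; rewrite //= cabs0.
have hS := bdd_S1 (bdd_L1 ha).
pose a0 : array := fun j k => if j is j'.+1 then 0 else a 0%N k.
have ha0 : bdd a0.
  by case: ha => M h; exists M => -[|j] k //=; rewrite cabs0; apply: le_trans (cabs_ge0 _) (h 0%N 0%N).
have e : a = (fun j k => a0 j k + S1 (L1 a) j k).
  by apply/funext => -[|j]; apply/funext => k; rewrite /= ?addr0 ?add0r.
have h1 : ev a0 z = ev a0 (0, z.2).
  apply: ev_unique => // x x0; have [N hN] := evP ha0 hz0 x0.
  exists N.+1 => -[//|J] K hJ hK.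
  have E w : w.2 = z.2 -> PS a0 J.+1 K w = \sum_(k < K) a 0%N k * z.2 ^+ k.
    move=> hw; rewrite /PS big_ord_recl /= [X in _ + X]big1 ?addr0.
      by apply: eq_bigr => k _; rewrite expr0 mulr1 hw.
    by move=> j _; rewrite big1 // => k _; rewrite !mul0r.
  rewrite E //; have := hN J.+1 K (leq_trans (leqnSn _) hJ) (leq_trans (leqnSn _) hK).
  by rewrite E.
have e1 w : in_D2 w -> ev a w = ev a0 w + w.1 * ev (L1 a) w.
  by move=> hw; rewrite {1}e (evD ha0 hS hw) (ev_S1 (bdd_L1 ha) hw).
have e2 : ev a (0, z.2) = ev a0 z.
  rewrite h1; move: (e1 _ hz0) => /=.
  move: (ev a (0, z.2)) (ev a0 (0, z.2)) (ev (L1 a) (0, z.2)) => x y t ->.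
  by rewrite mul0r addr0.
by rewrite e2; exact: e1.
Qed.

Lemma ev0 a : bdd a -> ev a (0, 0) = a 0%N 0%N.
Proof.
move=> ha; have h0 : in_D2 ((0, 0) : C * C) by split; rewrite /= cabs0.
apply: ev_unique => // e e0; exists 1%N => -[//|J] [//|K] _ _.
rewrite /PS big_ord_recl big_ord_recl /= big1; last first.
  by move=> k _; rewrite /bump /= add1n exprS mul0r mulr0.
rewrite big1 ?addr0; last first.
  by move=> j _; rewrite big1 // => k _; rewrite /bump /= add1n exprS !(mul0r, mulr0).
by rewrite !expr0 !mulr1 subrr cabs0.
Qed.

(** By [ev_L1] the shifted series vanishes where [z1] is nonzero. On [z1 = 0] it vanishes by
    continuity: a second shift bounds its variation by a multiple of [|z1|]. *)
Lemma ev_L1_eq0 a : bdd a -> (forall z, in_D2 z -> ev a z = 0) ->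
  forall z, in_D2 z -> ev (L1 a) z = 0.
Proof.
move=> ha h.
have h1 z : in_D2 z -> z.1 != 0 -> ev (L1 a) z = 0.
  move=> hz z0; have hz0 : in_D2 (0, z.2) by case: hz => _ ?; split; rewrite //= cabs0.
  have := ev_L1 ha hz; rewrite (h _ hz) (h _ hz0) add0r => /esym/eqP.
  by rewrite mulf_eq0 (negbTE z0) => /eqP.
move=> [z1 z2] hz; have [e|] := eqVneq z1 0; last by move=> ?; exact: h1.
subst z1.
have hb := bdd_L1 ha; have [M hM] := bdd_L1 hb.
have M0 : 0 <= M by apply: le_trans (cabs_ge0 _) (hM 0%N 0%N).
have q0 : 0 < 1 - cabs z2 by rewrite subr_gt0; case: hz.
apply: cabs0_eq0; apply/le_anti; rewrite cabs_ge0 andbT; apply/ler_addgt0Pr => e e0.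
pose B := M / (2^-1 * (1 - cabs z2)).
have B0 : 0 <= B by rewrite divr_ge0 // mulr_ge0 // ltW.
pose x := Num.min (1/2) (e / (B + 1)).
have B1 : 0 < B + 1 by lra.
have x0 : 0 < x by rewrite lt_min !divr_gt0.
have x1 : x <= 1/2 by rewrite ge_min lexx.
have x2 : x * (B + 1) <= e by rewrite -ler_pdivlMr // ge_min lexx orbT.
have cx : cabs (x%:C)%C = x by rewrite cabs_real ger0_norm // ltW.
have hzx : in_D2 ((x%:C)%C, z2) by split; [rewrite /= cx; lra | case: hz].
have xn0 : (x%:C)%C != 0 by rewrite -cabs_gt0 cx.
have := ev_L1 hb hzx; rewrite (h1 _ hzx xn0) /= => /esym/eqP; rewrite addr_eq0 => /eqP ->.
rewrite cabsN cabsM cx add0r.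
have := ev_le hM hzx; rewrite /= cx => hh.
have : M / ((1 - x) * (1 - cabs z2)) <= B.
  have i1 : 0 < 2^-1 * (1 - cabs z2) by rewrite mulr_gt0 // invr_gt0.
  have i2 : 2^-1 * (1 - cabs z2) <= (1 - x) * (1 - cabs z2).
    by apply: ler_wpM2r; [exact: ltW | lra].
  rewrite ler_wpM2l // lef_pV2 // posrE //; exact: lt_le_trans i2.
nra.
Qed.

(** Shifting [j] times in the first variable and [k] times in the second brings the coefficient
    [(j, k)] to the origin, where it is the value at [(0, 0)]. *)
Lemma ev_inj0 a : bdd a -> (forall z, in_D2 z -> ev a z = 0) -> forall j k, a j k = 0.
Proof.
move=> + + j; elim: j a => [|j IH] a ha h k; last first.
  by apply: (IH (L1 a)); [exact: bdd_L1 | exact: ev_L1_eq0].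
elim: k a ha h => [|k IH] a ha h.
  by rewrite -ev0 // h //; split; rewrite /= cabs0.
have ht : bdd (tr a) := bdd_tr ha.
have h' z : in_D2 z -> ev (tr a) z = 0.
  move=> hz; have hz' : in_D2 (z.2, z.1) by case: hz.
  by have := ev_tr ha hz'; rewrite /= (h _ hz'); case: z hz {hz'}.
have := IH (tr (L1 (tr a))); apply; first exact: bdd_tr (bdd_L1 ht).
move=> z hz; have hz' : in_D2 (z.2, z.1) by case: hz.
have := @ev_tr (L1 (tr a)) (z.2, z.1) (bdd_L1 ht) hz' => /=.
by rewrite (ev_L1_eq0 ht h' hz'); case: z hz {hz'}.
Qed.

Lemma ev_inj a b : bdd a -> bdd b -> (forall z, in_D2 z -> ev a z = ev b z) -> a = b.
Proof.
move=> ha hb h; apply/funext => j; apply/funext => k; apply/eqP.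
rewrite -subr_eq0; apply/eqP.
have hB : bdd (fun j k => a j k - b j k).
  have -> : (fun j k => a j k - b j k) = (fun j k => a j k + (-1) * b j k).
    by apply/funext => ?; apply/funext => ?; rewrite mulN1r.
  exact: bddD ha (bddZ _ hb).
apply: (@ev_inj0 (fun j k => a j k - b j k) hB) => z hz.
by rewrite evB // h // subrr.
Qed.

Lemma represents_ev a F z : represents a F -> in_D2 z -> F z = ev a z.
Proof.
move=> [hs hF] hz; have [M hM] := sq_bnd hs.
exact: ccvg_unique (hF z hz) (sums_ccvg (evP (bnd_bdd hM) hz)).
Qed.

Lemma ev_represents a F M : bnd M a -> (forall z, in_D2 z -> F z = ev a z) -> represents a F.
Proof.
move=> ha h; split; first exact: bnd_sq ha.
move=> z hz; rewrite h //; exact: sums_ccvg (evP (bnd_bdd ha) hz).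
Qed.

End PowerSeries.

(** * Polynomials acting on power series *)

Section PolyAction.
Context {R : realType}.
Local Notation C := R[i].
Local Notation array := (nat -> nat -> C).
Local Notation poly2 := {poly {poly C}}.
Implicit Types (p q : poly2) (u : array) (z : C * C).

Lemma sum_supp (V : nmodType) (f : nat -> V) m d N :
  (forall j, ~~ ((m <= j)%N && (j < m + d)%N) -> f j = 0) -> (m + d <= N)%N ->
  \sum_(j < N) f j = \sum_(i < d) f (m + i)%N.
Proof.
move=> h hN; rewrite -(big_mkord predT f) (@big_cat_nat _ _ _ m 0%N N) //=; last by lia.
rewrite big_nat big1 ?add0r; last first.
  by move=> j /andP[_ hj]; apply: h; lia.
rewrite (@big_cat_nat _ _ _ (m + d) m N) //=; last by lia.
rewrite [X in _ + X]big_nat [X in _ + X]big1 ?addr0; last first.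
  by move=> j /andP[hj _]; apply: h; lia.
rewrite -{1}[m]add0n big_addn addKn big_mkord.
by apply: eq_bigr => i _; rewrite addnC.
Qed.

Lemma coef2D p q j k : coef2 (p + q) j k = coef2 p j k + coef2 q j k.
Proof. by rewrite /coef2 !coefD. Qed.
Lemma coef2B p q j k : coef2 (p - q) j k = coef2 p j k - coef2 q j k.
Proof. by rewrite /coef2 !coefB. Qed.
Lemma coef2C (c : C) j k : coef2 (c%:P)%:P j k = if (j == 0%N) && (k == 0%N) then c else 0.
Proof. rewrite /coef2 coefC; case: (k == 0%N); first by rewrite coefC andbT.
by rewrite coef0 andbF. Qed.
Lemma coef2CM (c : C) p j k : coef2 ((c%:P)%:P * p) j k = c * coef2 p j k.
Proof. by rewrite /coef2 coefCM coefCM. Qed.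

Lemma coef2M p q j k : coef2 (p * q) j k =
  \sum_(l < k.+1) \sum_(i < j.+1) coef2 p i l * coef2 q (j - i) (k - l).
Proof.
by rewrite /coef2 coefM coef_sum; apply: eq_bigr => l _; rewrite coefM.
Qed.

Lemma coef2_ext p q : (forall j k, coef2 p j k = coef2 q j k) -> p = q.
Proof. by move=> h; apply/polyP => k; apply/polyP => j; exact: h. Qed.

Definition trunc (N : nat) u : poly2 := \poly_(k < N) \poly_(j < N) u j k.

Lemma coef2_trunc N u j k :
  coef2 (trunc N u) j k = if (j < N)%N && (k < N)%N then u j k else 0.
Proof.
rewrite /coef2 /trunc coef_poly; case: ifP => hk; last by rewrite coef0 andbF.
by rewrite coef_poly andbT.
Qed.

Lemma coef2_trunc_acut N u : coef2 (trunc N u) = acut N u.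
Proof. by apply/funext => j; apply/funext => k; rewrite coef2_trunc. Qed.

(* Coefficients of the product of the polynomial [p] and the power series [u]. *)
Definition pconv p u : array := fun j k =>
  \sum_(l < k.+1) \sum_(i < j.+1) coef2 p i l * u (j - i)%N (k - l)%N.

Lemma pconv_coef2 p q : pconv p (coef2 q) = coef2 (p * q).
Proof. by apply/funext => j; apply/funext => k; rewrite coef2M. Qed.

Lemma pconv_trunc p u N j k : (j < N)%N -> (k < N)%N ->
  pconv p u j k = coef2 (p * trunc N u) j k.
Proof.
move=> hj hk; rewrite coef2M; apply: eq_bigr => l _; apply: eq_bigr => i _.
by rewrite coef2_trunc !(leq_ltn_trans (leq_subr _ _)).
Qed.

Lemma pconv_eq p u v N j k : (forall j k, (j < N)%N -> (k < N)%N -> u j k = v j k) ->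
  (j < N)%N -> (k < N)%N -> pconv p u j k = pconv p v j k.
Proof.
move=> h hj hk; apply: eq_bigr => l _; apply: eq_bigr => i _.
by rewrite h // (leq_ltn_trans (leq_subr _ _)).
Qed.

(** A coefficient of the product involves only a finite corner of [u], where [u] may be replaced by
    a polynomial; associativity is then that of the polynomial ring. *)
Lemma pconv_comp p q u : pconv p (pconv q u) = pconv (p * q) u.
Proof.
apply/funext => j; apply/funext => k; pose N := (maxn j k).+1.
have hj : (j < N)%N by rewrite /N; lia.
have hk : (k < N)%N by rewrite /N; lia.
rewrite [RHS](pconv_trunc _ _ hj hk) -mulrA -(pconv_coef2 p).
apply: (@pconv_eq p _ _ N) => // j' k' hj' hk'.
by rewrite (pconv_trunc _ _ hj' hk').
Qed.

Lemma pconvDl p q u : pconv (p + q) u = fun j k => pconv p u j k + pconv q u j k.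
Proof.
apply/funext => j; apply/funext => k; rewrite /pconv -big_split.
apply: eq_bigr => l _; rewrite -big_split; apply: eq_bigr => i _.
by rewrite coef2D mulrDl.
Qed.

Lemma pconvBl p q u : pconv (p - q) u = fun j k => pconv p u j k - pconv q u j k.
Proof.
apply/funext => j; apply/funext => k; rewrite /pconv -sumrB.
apply: eq_bigr => l _; rewrite -sumrB; apply: eq_bigr => i _.
by rewrite coef2B mulrBl.
Qed.

Lemma pconvDr p u v :
  pconv p (fun j k => u j k + v j k) = fun j k => pconv p u j k + pconv p v j k.
Proof.
apply/funext => j; apply/funext => k; rewrite /pconv -big_split.
apply: eq_bigr => l _; rewrite -big_split; apply: eq_bigr => i _.
by rewrite mulrDr.
Qed.

Lemma pconvBr p u v :
  pconv p (fun j k => u j k - v j k) = fun j k => pconv p u j k - pconv p v j k.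
Proof.
apply/funext => j; apply/funext => k; rewrite /pconv -sumrB.
apply: eq_bigr => l _; rewrite -sumrB; apply: eq_bigr => i _.
by rewrite mulrBr.
Qed.

Lemma pconvZr p c u : pconv p (fun j k => c * u j k) = fun j k => c * pconv p u j k.
Proof.
apply/funext => j; apply/funext => k; rewrite /pconv mulr_sumr.
apply: eq_bigr => l _; rewrite mulr_sumr; apply: eq_bigr => i _.
by rewrite mulrCA.
Qed.

Lemma pconvC (c : C) u : pconv (c%:P)%:P u = fun j k => c * u j k.
Proof.
apply/funext => j; apply/funext => k; pose N := (maxn j k).+1.
have hj : (j < N)%N by rewrite /N; lia.
have hk : (k < N)%N by rewrite /N; lia.
by rewrite (pconv_trunc _ _ hj hk) coef2CM coef2_trunc hj hk.
Qed.

Lemma pconv1 u : pconv 1 u = u.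
Proof. by rewrite -[1]/(1%:P%:P) pconvC; apply/funext => j; apply/funext => k; rewrite mul1r. Qed.

Lemma pconvX u : pconv 'X u = S2 u.
Proof.
apply/funext => j; apply/funext => k; pose N := (maxn j k).+1.
have hj : (j < N)%N by rewrite /N; lia.
have hk : (k < N)%N by rewrite /N; lia.
clearbody N; rewrite (pconv_trunc _ _ hj hk) /coef2 coefXM; case: k hk => [|k] hk /=.
  by rewrite coef0.
by rewrite -/(coef2 _ _ _) coef2_trunc hj (ltn_trans _ hk).
Qed.

Lemma pconvX1 u : pconv ('X)%:P u = S1 u.
Proof.
apply/funext => j; apply/funext => k; pose N := (maxn j k).+1.
have hj : (j < N)%N by rewrite /N; lia.
have hk : (k < N)%N by rewrite /N; lia.
clearbody N; rewrite (pconv_trunc _ _ hj hk) /coef2 coefCM coefXM; case: j hj => [//|j] hj /=.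
by rewrite -/(coef2 _ _ _) coef2_trunc hk (ltn_trans _ hj).
Qed.

(** Constants and the two variables generate the ring, so statements about [pconv] and [eval2]
    reduce to scalings, the two shifts, sums and products. *)
Lemma poly2_ind (P : poly2 -> Prop) :
  (forall c : C, P (c%:P)%:P) -> P 'X -> P ('X)%:P ->
  (forall p q, P p -> P q -> P (p + q)) -> (forall p q, P p -> P q -> P (p * q)) ->
  forall p, P p.
Proof.
move=> hC hX hX1 hD hM.
have h1 (r : {poly C}) : P r%:P.
  elim/poly_ind: r => [|r c IH]; first by have := hC 0; rewrite polyC0.
  by rewrite polyCD polyCM; apply: (hD _ _ _ (hC c)); exact: hM.
by elim/poly_ind => [|r c IH]; [rewrite -polyC0; exact: h1 | exact: hD (hM _ _ IH hX) (h1 c)].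
Qed.

Lemma eval2D p q z : eval2 (p + q) z = eval2 p z + eval2 q z.
Proof. by rewrite /eval2 !hornerD. Qed.
Lemma eval2B p q z : eval2 (p - q) z = eval2 p z - eval2 q z.
Proof. by rewrite /eval2 !hornerE. Qed.
Lemma eval2M p q z : eval2 (p * q) z = eval2 p z * eval2 q z.
Proof. by rewrite /eval2 !hornerM. Qed.
Lemma eval2C (c : C) z : eval2 (c%:P)%:P z = c.
Proof. by rewrite /eval2 !hornerC. Qed.
Lemma eval2X z : eval2 'X z = z.2.
Proof. by rewrite /eval2 hornerX hornerC. Qed.
Lemma eval2X1 z : eval2 ('X)%:P z = z.1.
Proof. by rewrite /eval2 hornerC hornerX. Qed.
Lemma eval2P (r : {poly C}) z : eval2 r%:P z = r.[z.1].
Proof. by rewrite /eval2 hornerC. Qed.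

Lemma bnd_S1 M u : bnd M u -> bnd M (S1 u).
Proof.
move=> [h0 h]; split=> // N; apply: le_trans (h N).
case: N => [|N]; first by rewrite /nN !big_ord0.
rewrite {1}/nN big_ord_recl /= big1 ?add0r; last by move=> k _; rewrite cabs0 expr0n.
rewrite /nN big_ord_recr /= ler_wpDr //.
by apply: sumr_ge0 => k _; exact: sqr_ge0.
Qed.

Lemma nN_tr N u : nN N (tr u) = nN N u.
Proof. by rewrite /nN exchange_big. Qed.

Lemma bnd_tr M u : bnd M u -> bnd M (tr u).
Proof. by move=> [h0 h]; split=> // N; rewrite nN_tr. Qed.

Lemma S2_tr u : S2 u = tr (S1 (tr u)).
Proof. by apply/funext => j; apply/funext => -[|k]. Qed.

Lemma bnd_S2 M u : bnd M u -> bnd M (S2 u).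
Proof. by move=> h; rewrite S2_tr; apply: bnd_tr; apply: bnd_S1; exact: bnd_tr. Qed.

Lemma bnd_pconv p : exists2 K : R, 0 < K & forall M u, bnd M u -> bnd (K * M) (pconv p u).
Proof.
elim/poly2_ind: p => [c|||p q [K K0 h] [K' K0' h']|p q [K K0 h] [K' K0' h']].
- have c0 : 0 < cabs c + 1 by have := cabs_ge0 c; lra.
  exists (cabs c + 1) => // M u hu; rewrite pconvC; apply: bndZ => //; lra.
- by exists 1 => // M u hu; rewrite pconvX mul1r; exact: bnd_S2.
- by exists 1 => // M u hu; rewrite pconvX1 mul1r; exact: bnd_S1.
- exists (K + K'); first exact: addr_gt0.
  by move=> M u hu; rewrite pconvDl mulrDl; apply: bndD; auto.
- exists (K * K'); first exact: mulr_gt0.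
  by move=> M u hu; rewrite -pconv_comp -mulrA; auto.
Qed.

Lemma bdd_S2 u : bdd u -> bdd (S2 u).
Proof. by move=> h; rewrite S2_tr; apply: bdd_tr; apply: bdd_S1; exact: bdd_tr. Qed.

Lemma bdd_pconv p u : bdd u -> bdd (pconv p u).
Proof.
elim/poly2_ind: p u => [c|||p q h h'|p q h h'] u hu.
- by rewrite pconvC; exact: bddZ.
- by rewrite pconvX; exact: bdd_S2.
- by rewrite pconvX1; exact: bdd_S1.
- by rewrite pconvDl; apply: bddD; auto.
- by rewrite -pconv_comp; auto.
Qed.

Lemma ev_pconv p u z : bdd u -> in_D2 z -> ev (pconv p u) z = eval2 p z * ev u z.
Proof.
move=> + hz; elim/poly2_ind: p u => [c|||p q h h'|p q h h'] u hu.
- by rewrite pconvC evZ // eval2C.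
- by rewrite pconvX ev_S2 // eval2X.
- by rewrite pconvX1 ev_S1 // eval2X1.
- by rewrite pconvDl evD ?h ?h' // ?eval2D ?mulrDl //; exact: bdd_pconv.
- by rewrite -pconv_comp h ?h' // ?eval2M ?mulrA //; exact: bdd_pconv.
Qed.

Lemma bnd_delta : bnd 1 (coef2 (1 : poly2)).
Proof.
have e j k : coef2 (1 : poly2) j k = if (j == 0%N) && (k == 0%N) then 1 else 0.
  by rewrite -[1]/(1%:P%:P) coef2C.
split=> // -[|N]; first by rewrite /nN big_ord0 expr1n.
rewrite /nN big_ord_recl big_ord_recl e /= cabs1 expr1n big1; last first.
  by move=> k _; rewrite e /= cabs0 expr0n.
rewrite big1 ?addr0 // => j _; rewrite big1 // => k _.
by rewrite e /= cabs0 expr0n.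
Qed.

Lemma bnd_coef2 p : exists M, bnd M (coef2 p).
Proof.
have [K K0 h] := bnd_pconv p; exists (K * 1).
by rewrite -[p]mulr1 -pconv_coef2; apply: h; exact: bnd_delta.
Qed.

Lemma bdd_coef2 p : bdd (coef2 p).
Proof. by have [M h] := bnd_coef2 p; exact: bnd_bdd h. Qed.

Lemma ev_coef2 p z : in_D2 z -> ev (coef2 p) z = eval2 p z.
Proof.
move=> hz; rewrite -[p in LHS]mulr1 -pconv_coef2 ev_pconv //; last exact: bdd_coef2.
suff -> : ev (coef2 1) z = 1 by rewrite mulr1.
have e j k : coef2 (1 : poly2) j k = if (j == 0%N) && (k == 0%N) then 1 else 0.
  by rewrite -[1]/(1%:P%:P) coef2C.
apply: ev_unique => //; first exact: bdd_coef2.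
move=> x x0; exists 1%N => -[//|J] [//|K] _ _.
rewrite /PS big_ord_recl big_ord_recl e /= !expr0 !mulr1 big1; last first.
  by move=> k _; rewrite e /= !mul0r.
rewrite big1; first by rewrite !addr0 subrr cabs0.
by move=> j _; rewrite big1 // => k _; rewrite e /= !mul0r.
Qed.

Lemma coef2_mono p m1 m2 j k : coef2 (p * ('X^m1)%:P * 'X^m2) j k =
  if (m1 <= j)%N && (m2 <= k)%N then coef2 p (j - m1) (k - m2) else 0.
Proof.
rewrite /coef2 coefMXn; case: ltnP => hk; first by rewrite coef0 andbF.
by rewrite coefMC coefMXn andbT; case: ltnP.
Qed.

Lemma coef2_ptilde n p j k : coef2 (ptilde n p) j k =
  if (j < n.+1)%N && (k < 2)%N then cconj (coef2 p (n - j) (1 - k)) else 0.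
Proof.
rewrite /coef2 /ptilde coef_poly; case: ifP => hk; last by rewrite coef0 andbF.
by rewrite coef_poly andbT.
Qed.

Lemma deg_coef2 n p j k : deg_le_n1 n p -> ~~ ((j < n.+1)%N && (k < 2)%N) -> coef2 p j k = 0.
Proof.
move=> [h1 h2]; rewrite negb_and -!leqNgt => /orP[h|h]; rewrite /coef2.
  by rewrite (@nth_default _ _ (p`_k)) // (leq_trans (h2 k)).
by rewrite (@nth_default _ _ p) ?coef0 // (leq_trans h1).
Qed.

Lemma deg_ptilde n p : deg_le_n1 n (ptilde n p).
Proof.
split; first exact: size_poly.
move=> k; rewrite /ptilde coef_poly; case: ifP => _; last by rewrite size_poly0.
exact: size_poly.
Qed.

Lemma ptildeK n p : deg_le_n1 n p -> ptilde n (ptilde n p) = p.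
Proof.
move=> h; apply: coef2_ext => j k; rewrite coef2_ptilde; case: ifP => hjk; last first.
  by rewrite (deg_coef2 h) // hjk.
rewrite coef2_ptilde; have [j1 k1] := andP hjk.
have -> : ((n - j < n.+1)%N && (1 - k < 2)%N) by lia.
by rewrite cconjK; congr (coef2 p _ _); lia.
Qed.

Lemma pconv_deg n p u m1 m2 : deg_le_n1 n p ->
  pconv p u (m1 + n)%N (m2 + 1)%N =
  \sum_(l < 2) \sum_(i < n.+1) coef2 p i l * u (m1 + (n - i))%N (m2 + (1 - l))%N.
Proof.
move=> hp; rewrite /pconv.
have e1 l : \sum_(i < (m1 + n).+1) coef2 p i l * u (m1 + n - i)%N (m2 + 1 - l)%N =
    \sum_(i < n.+1) coef2 p i l * u (m1 + n - i)%N (m2 + 1 - l)%N.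
  rewrite (@sum_supp _ (fun i => coef2 p i l * u (m1 + n - i)%N (m2 + 1 - l)%N) 0 n.+1) //.
    by move=> i hi; rewrite (deg_coef2 hp) ?mul0r //; lia.
  by lia.
under eq_bigr do rewrite e1.
rewrite (@sum_supp _ (fun l => \sum_(i < n.+1) coef2 p i l * u (m1 + n - i)%N (m2 + 1 - l)%N) 0 2).
- apply: eq_bigr => l _; apply: eq_bigr => i _; rewrite !add0n.
  congr (_ * u _ _); first by have := ltn_ord i; lia.
  by have := ltn_ord l; lia.
- by move=> l hl; rewrite big1 // => i _; rewrite (deg_coef2 hp) ?mul0r //; lia.
- by lia.
Qed.

(** Reflection reverses and conjugates the coefficients of [p], and the inner product conjugates
    again: pairing with [ptilde z1^m1 z2^m2] is convolution with [p], read at [(m1 + n, m2 + 1)]. *)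
Lemma ip_ptilde_mono n p a m1 m2 N : deg_le_n1 n p ->
  (m1 + n < N)%N -> (m2 + 1 < N)%N ->
  ipN N a (coef2 (ptilde n p * ('X^m1)%:P * 'X^m2)) = pconv p a (m1 + n)%N (m2 + 1)%N.
Proof.
move=> hp h1 h2; rewrite (pconv_deg _ _ _ hp) /ipN.
pose f j k := a j k * cconj (coef2 (ptilde n p * ('X^m1)%:P * 'X^m2) j k).
have f0 j k : ~~ [&& (m1 <= j)%N, (j < m1 + n.+1)%N, (m2 <= k)%N & (k < m2 + 2)%N] -> f j k = 0.
  move=> h; rewrite /f coef2_mono; case: ifP => h'; last by rewrite cconj0 mulr0.
  rewrite coef2_ptilde; case: ifP => h''; last by rewrite cconj0 mulr0.
  lia.
have e1 j : \sum_(k < N) f j k = \sum_(l < 2) f j (m2 + l)%N.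
  apply: sum_supp; last by lia.
  by move=> k hk; apply: f0; lia.
rewrite -/(f _ _); transitivity (\sum_(j < N) \sum_(k < N) f j k); first by [].
under eq_bigr do rewrite e1.
rewrite (@sum_supp _ (fun j => \sum_(l < 2) f j (m2 + l)%N) m1 n.+1); last by lia.
  rewrite exchange_big (reindex_inj rev_ord_inj) /=; apply: eq_bigr => l _.
  rewrite (reindex_inj rev_ord_inj) /=; apply: eq_bigr => i _.
  rewrite /f coef2_mono !subSS !leq_addr /= !addKn coef2_ptilde.
  have hi := ltn_ord i; have hl := ltn_ord l.
  have -> : ((n - i < n.+1)%N && (1 - l < 2)%N) by lia.
  rewrite cconjK mulrC; congr (coef2 p _ _ * _); lia.
by move=> j hj; rewrite big1 // => l _; apply: f0; lia.
Qed.

End PolyAction.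

(** * Bounded multiplication and formal inverses *)

Section Parseval.
Context {R : realType}.
Local Notation C := R[i].
Local Notation array := (nat -> nat -> C).
Local Notation poly2 := {poly {poly C}}.
Implicit Types (P Q : poly2) (u a : array).

Lemma cos_eq1 (d : R) : 0 <= d < 2 * pi -> cos d = 1 -> d = 0.
Proof.
move=> /andP[d0 d1] h; apply/eqP; rewrite eq_le d0 andbT leNgt; apply/negP => hd.
have hs : 0 < sin (d / 2) by apply: sin_gt0_pi; apply/andP; split; lra.
have : cos d = 1 - 2 * sin (d / 2) ^+ 2.
  rewrite {1}[d](_ : d = d / 2 + d / 2); last by field.
  by rewrite cosD -!expr2 cos2sin2; ring.
by rewrite h; have := exprn_gt0 2 hs; lra.
Qed.

Lemma expi_inj (s t : R) : 0 <= s < 2 * pi -> 0 <= t < 2 * pi -> expi s = expi t -> s = t.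
Proof.
wlog hst : s t / t <= s.
  move=> h hs ht e; have [hle|/ltW hle] := leP t s; first exact: h.
  by apply/esym; apply: h.
move=> /andP[s0 s1] /andP[t0 t1] e.
have e1 : expi (s - t) = 1.
  by rewrite expiD expiN e mul_conj cabs_expi expr1n.
apply/eqP; rewrite -subr_eq0; apply/eqP; apply: cos_eq1; first by apply/andP; split; lra.
by have := congr1 (@complex.Re R) e1.
Qed.

Lemma expi_root N x : (0 < N)%N -> expi (2 * pi / N%:R : R) ^+ (N * x) = 1.
Proof.
move=> N0; rewrite exprM -expiMn.
have -> : N%:R * (2 * pi / N%:R) = 2 * pi :> R by field; rewrite pnatr_eq0 -lt0n.
by rewrite expi2pi expr1n.
Qed.

Lemma root_orth N (j j' : nat) : (j < N)%N -> (j' < N)%N ->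
  \sum_(x < N) expi (2 * pi / N%:R : R) ^+ (x * j) * cconj (expi (2 * pi / N%:R) ^+ (x * j'))
  = if j == j' then N%:R else 0.
Proof.
move=> hj hj'; have N0 : (0 < N)%N by apply: leq_ltn_trans hj.
set w := expi _; have w1 : cabs w = 1 by exact: cabs_expi.
pose r := w ^+ j * cconj (w ^+ j').
have er x : w ^+ (x * j) * cconj (w ^+ (x * j')) = r ^+ x.
  by rewrite /r exprMn -cconjX -!exprM !(mulnC x).
under eq_bigr do rewrite er.
have Np : (0 : R) < N%:R by rewrite ltr0n.
case: eqP => [e|/eqP ne].
  have r1 : r = 1 by rewrite /r e mul_conj cabsX w1 !expr1n.
  by rewrite r1; under eq_bigr do rewrite expr1n; rewrite sumr_const card_ord.
have rN : r ^+ N = 1.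
  by rewrite /r exprMn -cconjX -!exprM ![(_ * N)%N]mulnC !expi_root // cconj1 mulr1.
have r1 : r != 1.
  apply: contra ne => /eqP r1.
  have wj : w ^+ j = w ^+ j'.
    have : r * w ^+ j' = w ^+ j' by rewrite r1 mul1r.
    by rewrite /r -mulrA [cconj _ * _]mulrC mul_conj cabsX w1 !expr1n mulr1.
  move: wj; rewrite /w -!expiMn => /expi_inj e.
  have pp := pi_gt0 R.
  have p2 : 0 < 2 * (pi : R) by rewrite mulr_gt0.
  have hh i : (i < N)%N -> 0 <= (i%:R : R) * (2 * pi / N%:R) < (2 * pi : R).
    move=> hi; apply/andP; split.
      by apply: mulr_ge0; [exact: ler0n | apply: divr_ge0; [exact: (ltW p2) | exact: ler0n]].
    by rewrite mulrA ltr_pdivrMr // mulrC ltr_pM2l ?ltr_nat.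
  have := e (hh _ hj) (hh _ hj'); move/mulIf => hI.
  have : (j%:R : R) = j'%:R by apply: hI; rewrite mulf_neq0 ?invr_eq0 ?gt_eqF.
  by move/eqP; rewrite eqr_nat.
have : (r - 1) * \sum_(x < N) r ^+ x = 0.
  by rewrite -subrX1 rN subrr.
by move/eqP; rewrite mulf_eq0 subr_eq0 (negbTE r1) /= => /eqP.
Qed.

Lemma parseval1 N (c : nat -> C) :
  \sum_(x < N) cabs (\sum_(j < N) c j * (expi (2 * pi / N%:R : R) ^+ x) ^+ j) ^+ 2 =
  N%:R * \sum_(j < N) cabs (c j) ^+ 2.
Proof.
set w := expi _.
suff : \sum_(x < N) (\sum_(j < N) c j * (w ^+ x) ^+ j) * cconj (\sum_(j < N) c j * (w ^+ x) ^+ j) =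
   N%:R * \sum_(j < N) (c j * cconj (c j)).
  move=> h; apply: complexI; rewrite rmorph_sum rmorphM rmorph_sum /= rmorph_nat.
  under eq_bigr do rewrite -mul_conj.
  by rewrite h; congr (_ * _); apply: eq_bigr => j _; rewrite mul_conj.
transitivity (\sum_(x < N) \sum_(j < N) \sum_(j' < N)
    c j * cconj (c j') * (w ^+ (x * j) * cconj (w ^+ (x * j')))).
  apply: eq_bigr => x _; rewrite cconj_sum mulr_suml; apply: eq_bigr => j _.
  rewrite mulr_sumr; apply: eq_bigr => j' _.
  by rewrite cconjM -!exprM; ring.
rewrite exchange_big mulr_sumr; apply: eq_bigr => j _.
rewrite exchange_big (bigD1 j) //= -mulr_sumr root_orth // eqxx big1 ?addr0.
  by rewrite mulrC.
move=> j' hj'; rewrite -mulr_sumr root_orth //.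
case: eqP => [e|_]; last by rewrite mulr0.
by move: hj'; rewrite -val_eqE /= e eqxx.
Qed.

(** Exact on the grid of [N]-th roots of unity for polynomials of degree below [N] in each variable,
    so it takes the place of integration over the torus. *)
Lemma parseval2 N a :
  \sum_(y < N) \sum_(x < N)
    cabs (PS a N N (expi (2 * pi / N%:R) ^+ x, expi (2 * pi / N%:R) ^+ y)) ^+ 2 =
  (N%:R * N%:R) * nN N a.
Proof.
set w := expi _.
have e y x : PS a N N (w ^+ x, w ^+ y) =
    \sum_(j < N) (\sum_(k < N) a j k * (w ^+ y) ^+ k) * (w ^+ x) ^+ j.
  rewrite /PS; apply: eq_bigr => j _; rewrite mulr_suml; apply: eq_bigr => k _ /=.
  by rewrite mulrAC.
under eq_bigr => y _ do under eq_bigr => x _ do rewrite e.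
under eq_bigr => y _ do rewrite (parseval1 N (fun j => \sum_(k < N) a j k * (w ^+ y) ^+ k)).
rewrite -mulr_sumr -mulrA; congr (_ * _); rewrite exchange_big /nN mulr_sumr.
by apply: eq_bigr => j _; rewrite (parseval1 N (a j)).
Qed.

Definition supp_in N P := forall j k, ~~ ((j < N)%N && (k < N)%N) -> coef2 P j k = 0.

Lemma supp_ex P : exists N, supp_in N P.
Proof.
exists (maxn (size P) (\max_(k < size P) size (P`_k)%R)) => j k.
rewrite negb_and -!leqNgt !geq_max => /orP[] /andP[h1 h2]; rewrite /coef2.
  have [hk|hk] := ltnP k (size P); last by rewrite (nth_default 0 hk) coef0.
  apply: nth_default; apply: leq_trans h2.
  exact: (@leq_bigmax _ (fun k : 'I_(size P) => size (P`_k)%R) (Ordinal hk)).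
by rewrite (nth_default 0 h1) coef0.
Qed.

Lemma supp_le N N' P : (N <= N')%N -> supp_in N P -> supp_in N' P.
Proof. by move=> h hP j k hjk; apply: hP; lia. Qed.

Lemma eval2_PS N P z : supp_in N P -> eval2 P z = PS (coef2 P) N N z.
Proof.
move=> hP.
have -> : P = trunc N (coef2 P).
  apply: coef2_ext => j k; rewrite coef2_trunc; case: ifP => // h.
  by rewrite hP // h.
rewrite coef2_trunc_acut /PS exchange_big /eval2 /trunc horner_poly.
rewrite horner_sum; apply: eq_bigr => k _.
rewrite hornerM horner_poly -polyC_exp hornerC mulr_suml; apply: eq_bigr => j _.
by rewrite /acut !ltn_ord /=.
Qed.

Lemma bnd_closed a (M : R) : 0 < M -> (forall e, 0 < e -> bnd (M + e) a) -> bnd M a.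
Proof.
move=> M0 h; split=> // N; apply/ler_addgt0Pr => e e0.
pose d := Num.min M (e / (3 * M)).
have d0 : 0 < d by rewrite lt_min M0 /= divr_gt0 // mulr_gt0.
have [_ /(_ N)] := h d d0; move/le_trans; apply.
have h1 : d <= M by rewrite ge_min lexx.
have h2 : d * (3 * M) <= e by rewrite -ler_pdivlMr ?mulr_gt0 // ge_min lexx orbT.
nra.
Qed.

(** At pairs of [N]-th roots of unity, with [N] beyond the degrees of both products, the pointwise
    bound becomes a bound of norms by Parseval. *)
Lemma multiplier_poly P Q (K : R) : 0 < K ->
  (forall z, in_T2 z -> cabs (eval2 P z) <= K * cabs (eval2 Q z)) ->
  forall U M, bnd M (coef2 (Q * U)) -> bnd (K * M) (coef2 (P * U)).
Proof.
move=> K0 hPQ U M [M0 hM]; split; first exact: mulr_gt0.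
have [N1 h1] := supp_ex (P * U); have [N2 h2] := supp_ex (Q * U).
move=> m; pose N := (maxn m (maxn N1 N2)).+1.
have s1 : supp_in N (P * U) by apply: supp_le h1; rewrite /N; lia.
have s2 : supp_in N (Q * U) by apply: supp_le h2; rewrite /N; lia.
apply: (@le_trans _ _ (nN N (coef2 (P * U)))); first by apply: nN_mono; rewrite /N; lia.
have Np : (0 : R) < N%:R * N%:R by rewrite mulr_gt0 // ltr0n.
rewrite -(ler_pM2l Np) -parseval2.
apply: (@le_trans _ _ (K ^+ 2 * (N%:R * N%:R * nN N (coef2 (Q * U))))).
  rewrite -parseval2 mulr_sumr; apply: ler_sum => y _; rewrite mulr_sumr.
  apply: ler_sum => x _; rewrite -!eval2_PS // !eval2M !cabsM -exprMn.
  apply: sqr_le; first by rewrite mulr_ge0 ?cabs_ge0.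
  rewrite mulrA ler_wpM2r ?cabs_ge0 //; apply: hPQ.
  by split; rewrite /= cabsX cabs_expi expr1n.
rewrite exprMn mulrCA; apply: ler_wpM2l; first exact: ltW.
by apply: ler_wpM2l (hM N); exact: sqr_ge0.
Qed.

(** Truncations of [u] fall under the polynomial case: multiplication by [Q] is bounded, so cutting
    off the tail hardly changes the norm of [Q u], and [P u] is the coefficientwise limit. *)
Lemma multiplier P Q (K : R) : 0 < K ->
  (forall z, in_T2 z -> cabs (eval2 P z) <= K * cabs (eval2 Q z)) ->
  forall u M0 M, bnd M0 u -> bnd M (pconv Q u) -> bnd (K * M) (pconv P u).
Proof.
move=> K0 hPQ u M0 M hu hQ; have Mp := bnd_gt0 hQ.
apply: bnd_closed; first exact: mulr_gt0.
move=> e e0; have [K' K'0 hK'] := bnd_pconv Q.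
(* [K'] bounds multiplication by [Q], so tails of norm [e / K / K'] enlarge the final bound [K M] by
   exactly [e]. *)
have d0 : 0 < e / K / K' by rewrite !divr_gt0.
have [N hN] := tail_small hu d0.
have -> : K * M + e = K * (M + K' * (e / K / K')).
  by field; rewrite !gt_eqF.
apply: (@bnd_limit _ (fun m => pconv P (acut (N + m) u))).
  move=> j k x x0; exists (maxn j k).+1 => m hm.
  have h : pconv P (acut (N + m) u) j k = pconv P u j k.
    apply: (@pconv_eq _ P _ _ (N + m)); [|lia|lia].
    by move=> j' k' hj hk; rewrite /acut hj hk.
  by rewrite h subrr cabs0.
move=> m; rewrite -coef2_trunc_acut pconv_coef2.
apply: (multiplier_poly K0 hPQ); rewrite -pconv_coef2 coef2_trunc_acut.
have : bnd (M + K' * (e / K / K')) (fun j k => pconv Q u j k - pconv Q (aout (N + m) u) j k).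
  by apply: bndB => //; apply: hK'; apply: hN; exact: leq_addr.
apply: bnd_ext => j k; rewrite -[LHS]/((fun j k => _) j k) -pconvBr.
congr (pconv Q _ j k); apply/funext => j'; apply/funext => k'.
by rewrite /aout /acut; case: ifP; rewrite ?subr0 ?subrr.
Qed.

End Parseval.

(** * Polynomials without zeros in the disc or the bidisc *)

Section DiscZeroFree.
Context {R : realType}.
Local Notation C := R[i].
Local Notation array := (nat -> nat -> C).
Local Notation poly2 := {poly {poly C}}.
Implicit Types (P Q p : poly2) (u : array).

(** The entries are the reciprocals of the roots, which have modulus at least one, padded with zeros
    up to the length [d]; the length thus depends on the degree bound only. *)
Lemma disc_factor (q : {poly C}) d : (size q <= d.+1)%N ->
  (forall t : C, cabs t < 1 -> q.[t] != 0) ->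
  exists s : seq C, [/\ size s = d, (forall a, a \in s -> cabs a <= 1) &
    forall t, q.[t] = q.[0] * \prod_(a <- s) (1 - a * t)].
Proof.
move=> hs hq; have [r hr] := closed_field_poly_normal q.
have q0 : q.[0] != 0 by apply: hq; rewrite cabs0.
have l0 : lead_coef q != 0.
  by rewrite lead_coef_eq0; apply: contra q0 => /eqP ->; rewrite horner0.
have rt z : z \in r -> 1 <= cabs z.
  move=> hz; rewrite leNgt; apply/negP => /hq; rewrite hr hornerZ mulf_eq0 negb_or => /andP[_].
  by rewrite -/(root _ _) root_prod_XsubC hz.
have sr : (size r <= d)%N.
  have : size q = (size r).+1 by rewrite hr size_scale // size_prod_XsubC.
  by move=> e; rewrite -ltnS -e.
exists (map (fun z => z^-1) r ++ nseq (d - size r) 0); split.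
- by rewrite size_cat size_map size_nseq subnKC.
- move=> a; rewrite mem_cat => /orP[/mapP[z hz ->]|].
    by rewrite cabsV invf_le1 ?rt // (lt_le_trans ltr01) ?rt.
  by rewrite mem_nseq => /andP[_ /eqP ->]; rewrite cabs0.
have e t : q.[t] = lead_coef q * \prod_(z <- r) (- z) * \prod_(z <- r) (1 - z^-1 * t).
  rewrite [in LHS]hr hornerZ horner_prod -mulrA -big_split /=; congr (_ * _).
  apply: eq_big_seq => z hz; rewrite hornerXsubC.
  have z0 : z != 0 by rewrite -cabs_gt0 (lt_le_trans ltr01) ?rt.
  by field.
have e0 : q.[0] = lead_coef q * \prod_(z <- r) (- z).
  by rewrite e [X in _ * X]big1 ?mulr1 // => z _; rewrite mulr0 subr0.
move=> t; rewrite e e0; congr (_ * _); rewrite big_cat /= big_map [X in _ * X]big1_seq ?mulr1 //.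
by move=> a /andP[_]; rewrite mem_nseq => /andP[_ /eqP ->]; rewrite mul0r subr0.
Qed.

(** [|1 - a|] exceeds [|1 - a r|] by at most [1 - r], and [1 - r <= |1 - a r|] because
    [|a| <= 1]. *)
Lemma one_sub_dilate (a : C) (r : R) : cabs a <= 1 -> 0 <= r <= 1 ->
  cabs (1 - a) <= 2 * cabs (1 - a * (r%:C)%C).
Proof.
move=> ha /andP[r0 r1].
have e : 1 - a = (1 - a * (r%:C)%C) - a * ((1 - r)%:C)%C.
  by rewrite rmorphB /= rmorph1; ring.
have h1 : cabs (a * ((1 - r)%:C)%C) <= 1 - r.
  by rewrite cabsM cabs_real ger0_norm ?subr_ge0 // ler_piMl ?subr_ge0.
have h2 : 1 - r <= cabs (1 - a * (r%:C)%C).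
  have := cabs_subr 1 (a * (r%:C)%C); rewrite cabs1 cabsM cabs_real ger0_norm //.
  have := cabs_ge0 a; nra.
have := cabsB (1 - a * (r%:C)%C) (a * ((1 - r)%:C)%C); rewrite -e; lra.
Qed.

Lemma disc_dilate (q : {poly C}) d (r : R) : (size q <= d.+1)%N ->
  (forall t : C, cabs t < 1 -> q.[t] != 0) -> 0 <= r <= 1 ->
  cabs q.[1] <= 2 ^+ d * cabs q.[(r%:C)%C].
Proof.
move=> hs hq hr; have [s [ss s1 e]] := disc_factor hs hq.
rewrite (e 1) (e (r%:C)%C) !cabsM mulrCA; apply: ler_wpM2l; first exact: cabs_ge0.
rewrite -{}ss {e hs}; elim: s s1 => [|a s IH] s1; first by rewrite !big_nil cabs1 expr0 mul1r.
rewrite !big_cons !cabsM /= exprS mulrACA mulr1; apply: ler_pM; rewrite ?cabs_ge0 //.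
  by apply: one_sub_dilate => //; apply: s1; rewrite mem_head.
by apply: IH => b hb; apply: s1; rewrite in_cons hb orbT.
Qed.

Lemma eval2_lin n p z : deg_le_n1 n p -> eval2 p z = (p`_0).[z.1] + (p`_1).[z.1] * z.2.
Proof.
move=> [h _]; rewrite /eval2 (horner_coef_wide _ h) big_ord_recl big_ord1 /=.
by rewrite expr0 mulr1 hornerD hornerM hornerC.
Qed.

Lemma eval2_sum n p z : deg_le_n1 n p ->
  eval2 p z = \sum_(l < 2) \sum_(i < n.+1) coef2 p i l * z.1 ^+ i * z.2 ^+ l.
Proof.
move=> hp; rewrite (eval2_lin _ hp) big_ord_recl big_ord1 /=.
rewrite (horner_coef_wide _ (hp.2 0%N)) (horner_coef_wide _ (hp.2 1%N)); congr (_ + _).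
  by apply: eq_bigr => i _; rewrite expr0 mulr1.
by rewrite mulr_suml; apply: eq_bigr => i _.
Qed.

Lemma eval2_ptilde n p z : deg_le_n1 n p -> z.1 != 0 -> z.2 != 0 ->
  eval2 (ptilde n p) z =
  z.1 ^+ n * z.2 * cconj (eval2 p ((cconj z.1)^-1, (cconj z.2)^-1)).
Proof.
move=> hp z1 z2; rewrite (eval2_sum _ hp) (eval2_sum _ (deg_ptilde n p)).
rewrite cconj_sum mulr_sumr (reindex_inj rev_ord_inj); apply: eq_bigr => l _.
rewrite cconj_sum mulr_sumr (reindex_inj rev_ord_inj); apply: eq_bigr => i _ /=.
have hi := ltn_ord i; have hl := ltn_ord l.
rewrite coef2_ptilde !subSS.
have -> : ((n - i < n.+1)%N && (1 - l < 2)%N) by lia.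
rewrite !cconjM !cconjX !cconjV !cconjK !exprVn.
have -> : (n - (n - i) = i)%N by lia.
have -> : (1 - (1 - l) = l)%N by lia.
have -> : z.1 ^+ (n - i) = z.1 ^+ n * (z.1 ^+ i)^-1.
  by rewrite -exprB ?unitfE // -ltnS.
have -> : z.2 ^+ (1 - l) = z.2 * (z.2 ^+ l)^-1.
  by rewrite -{2}[z.2]expr1 -exprB ?unitfE // -ltnS.
ring.
Qed.

Lemma cabs_ptilde_T2 n p z : deg_le_n1 n p -> in_T2 z ->
  cabs (eval2 (ptilde n p) z) = cabs (eval2 p z).
Proof.
move=> hp [h1 h2]; have z1 := unim_neq0 h1; have z2 := unim_neq0 h2.
rewrite eval2_ptilde // !cabsM cabsX h1 h2 expr1n !mul1r cabs_conj.
by rewrite !conj_unim // !invrK; congr (cabs (eval2 p _)); case: z {h1 h2 z1 z2}.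
Qed.

(** Restriction of [p] to the disc [t -> (v1 t, v2 t)], a one-variable polynomial of degree at most
    [n + 1]; for [v] on the torus it inherits the absence of zeros. *)
Definition slice p (v : C * C) : {poly C} :=
  \sum_(k < 2) (p`_k \Po (v.1 *: 'X)) * (v.2 *: 'X) ^+ k.

Lemma horner_slice n p v t : deg_le_n1 n p -> (slice p v).[t] = eval2 p (v.1 * t, v.2 * t).
Proof.
move=> hp; rewrite (eval2_lin _ hp) /slice horner_sum big_ord_recl big_ord1 /=.
by rewrite !hornerM !horner_comp !horner_exp !hornerZ !hornerX expr0 mulr1 expr1.
Qed.

Lemma size_slice n p v : deg_le_n1 n p -> (size (slice p v) <= n.+2)%N.
Proof.
move=> hp; apply: (leq_trans (size_sum _ _ _)); apply/bigmax_leqP => k _.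
have hX (c : C) : (size (c *: 'X : {poly C}) <= 2)%N.
  by apply: (leq_trans (size_scale_leq _ _)); rewrite size_polyX.
have h1 : (size (p`_k \Po (v.1 *: 'X))%R <= n.+1)%N.
  apply: (leq_trans (size_comp_poly_leq _ _)).
  have := hp.2 k; have := hX v.1; move: (size _) (size _) => x y; nia.
have h2 : (size ((v.2 *: 'X) ^+ k)%R <= 2)%N.
  case: k h1 => [[|[|//]] hk] _ /=; first by rewrite expr0 size_poly1.
  by rewrite expr1.
apply: (leq_trans (size_polyMleq _ _)).
by rewrite -subn1 leq_subLR; apply: (leq_trans (leq_add h1 h2)); lia.
Qed.

(** One factor 2 for each of the [n + 1] factors of the slice. The constant does not depend on [r],
    so it survives [r -> 1] even at zeros of [p]. *)
Lemma dilate_T2 n p z (r : R) : deg_le_n1 n p ->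
  (forall z : C * C, in_D2 z -> eval2 p z != 0) -> in_T2 z -> 0 <= r <= 1 ->
  cabs (eval2 p z) <= 2 ^+ n.+1 * cabs (eval2 p ((r%:C)%C * z.1, (r%:C)%C * z.2)).
Proof.
move=> hp hz [z1 z2] hr.
have h : forall t : C, cabs t < 1 -> (slice p z).[t] != 0.
  by move=> t ht; rewrite (horner_slice _ _ hp); apply: hz; split; rewrite /= cabsM ?z1 ?z2 mul1r.
have := disc_dilate (size_slice z hp) h hr; rewrite !(horner_slice _ _ hp) !mulr1.
by rewrite ![z.1 * _]mulrC ![z.2 * _]mulrC; case: z z1 z2 h.
Qed.

(** Otherwise [z2 = - p0 / p1] would be a zero of [p] in the bidisc. *)
Lemma p1_le_p0 n p t : deg_le_n1 n p -> (forall z : C * C, in_D2 z -> eval2 p z != 0) ->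
  cabs t < 1 -> cabs (p`_1).[t] <= cabs (p`_0).[t].
Proof.
move=> hp hz ht; rewrite leNgt; apply/negP => h.
have h1 : 0 < cabs (p`_1).[t] := le_lt_trans (cabs_ge0 _) h.
have n1 : (p`_1).[t] != 0 by rewrite -cabs_gt0.
have : in_D2 (t, - ((p`_0).[t] / (p`_1).[t])).
  by split=> //=; rewrite cabsN cabsM cabsV ltr_pdivrMr // mul1r.
move/hz; rewrite (eval2_lin _ hp) /= => /negP; apply.
by rewrite mulrN mulrCA divff // mulr1 subrr.
Qed.

Lemma p0_neq0 n p t : deg_le_n1 n p -> (forall z : C * C, in_D2 z -> eval2 p z != 0) ->
  cabs t < 1 -> (p`_0).[t] != 0.
Proof.
move=> hp hz ht; have : in_D2 (t, 0) by split; rewrite //= cabs0.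
by move/hz; rewrite (eval2_lin _ hp) /= mulr0 addr0.
Qed.

Lemma mink N (a b : array) (A B : R) : 0 <= A -> 0 <= B -> nN N a <= A ^+ 2 -> nN N b <= B ^+ 2 ->
  nN N (fun j k => a j k + b j k) <= (A + B) ^+ 2.
Proof.
move=> A0 B0 ha hb; apply/ler_addgt0Pr => e e0.
have [d d0 hd] : exists2 d : R, 0 < d & ((A + d) + (B + d)) ^+ 2 <= (A + B) ^+ 2 + e.
  exists (Num.min 1 (e / (4 * (A + B) + 4))).
    by rewrite lt_min ltr01 /= divr_gt0 //; lra.
  set d := Num.min _ _.
  have h1 : d <= 1 by rewrite ge_min lexx.
  have h2 : d * (4 * (A + B) + 4) <= e.
    by rewrite -ler_pdivlMr ?ge_min ?lexx ?orbT //; lra.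
  have d0 : 0 <= d by rewrite le_min ler01 /= divr_ge0 ?ltW //; lra.
  nra.
apply: le_trans hd.
have hA : bnd (A + d) (acut N a).
  split; first by lra.
  move=> m; apply: (le_trans (nN_mono _ (leq_maxl m N))); rewrite nN_acut ?leq_maxr //.
  apply: (le_trans ha); apply: sqr_le => //; lra.
have hB : bnd (B + d) (acut N b).
  split; first by lra.
  move=> m; apply: (le_trans (nN_mono _ (leq_maxl m N))); rewrite nN_acut ?leq_maxr //.
  apply: (le_trans hb); apply: sqr_le => //; lra.
have [_ /(_ N)] := bndD hA hB; apply: le_trans.
rewrite le_eqVlt; apply/orP; left; apply/eqP.
apply: eq_bigr => j _; apply: eq_bigr => k _.
by rewrite /acut !ltn_ord.
Qed.

(* Division of the power series [u] by [1 - s z1]. *)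
Fixpoint div1 (s : C) u (j k : nat) : C :=
  if j is j'.+1 then u j k + s * div1 s u j' k else u 0%N k.

Lemma div1E s u : div1 s u = fun j k => u j k + s * S1 (div1 s u) j k.
Proof. by apply/funext => -[|j]; apply/funext => k //=; rewrite mulr0 addr0. Qed.

Lemma pconv_div1 s u : pconv (1 - (s%:P)%:P * ('X)%:P) (div1 s u) = u.
Proof.
rewrite pconvBl pconv1 -pconv_comp pconvC pconvX1.
by apply/funext => j; apply/funext => k; rewrite {1}div1E addrK.
Qed.

(** The quotient [v] satisfies [v = u + s z1 v], hence [|v| <= M + r |v|] on a finite corner, where
    [|v|] is finite and can be absorbed. *)
Lemma bnd_div1 s (r : R) u M : cabs s <= r -> 0 <= r < 1 -> bnd M u ->
  bnd (M / (1 - r)) (div1 s u).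
Proof.
move=> hs /andP[r0 r1] [M0 hM]; have q0 : 0 < 1 - r by rewrite subr_gt0.
split; first by rewrite divr_gt0.
move=> N; set V := nN N (div1 s u).
have V0 : 0 <= V := nN_ge0 _ _.
have hV : V = Num.sqrt V ^+ 2 by rewrite sqr_sqrtr.
have x0 := sqrtr_ge0 V; set x := Num.sqrt V in hV x0.
have h : V <= (M + r * x) ^+ 2.
  rewrite /V div1E; apply: mink; rewrite ?(ltW M0) ?mulr_ge0 //.
  apply: (@le_trans _ _ (cabs s ^+ 2 * nN N (S1 (div1 s u)))).
    rewrite /nN mulr_sumr le_eqVlt; apply/orP; left; apply/eqP.
    apply: eq_bigr => j _; rewrite mulr_sumr; apply: eq_bigr => k _.
    by rewrite cabsM exprMn.
  rewrite exprMn -hV; apply: ler_pM; rewrite ?sqr_ge0 ?nN_ge0 //.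
    by apply: sqr_le => //; exact: cabs_ge0.
  rewrite /V; case: (N) => [|m]; first by rewrite /nN !big_ord0.
  rewrite {1}/nN big_ord_recl /= big1 ?add0r; last by move=> k _; rewrite cabs0 expr0n.
  rewrite /nN [leRHS]big_ord_recr /= ler_wpDr //; last by apply: sumr_ge0 => k _; exact: sqr_ge0.
have h2 : x <= M + r * x.
  apply: sqr_le_cancel; last by rewrite -hV.
  by apply: addr_ge0; [exact: ltW | exact: mulr_ge0].
rewrite hV; apply: sqr_le => //; rewrite ler_pdivlMr //; lra.
Qed.

Definition scale1 (r : R) u : array := fun j k => (r%:C)%C ^+ j * u j k.

Lemma scale1_div1 r s u : scale1 r (div1 s u) = div1 ((r%:C)%C * s) (scale1 r u).
Proof.
apply/funext => j; apply/funext => k; rewrite /scale1; elim: j => [//|j IH] /=.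
by rewrite -IH exprS; ring.
Qed.

Definition divs (c : C) (s : seq C) u : array := fun j k => c^-1 * foldr div1 u s j k.

Lemma pconv_divs c s u : c != 0 ->
  pconv ((c%:P)%:P * \prod_(a <- s) (1 - (a%:P)%:P * ('X)%:P)) (divs c s u) = u.
Proof.
move=> c0; rewrite mulrC /divs pconvZr -pconv_comp pconvC pconvZr.
have -> : pconv (\prod_(a <- s) (1 - (a%:P)%:P * ('X)%:P)) (foldr div1 u s) = u.
  elim: s u => [|a s IH] u; first by rewrite big_nil pconv1.
  by rewrite big_cons mulrC -pconv_comp /= pconv_div1.
by apply/funext => j; apply/funext => k; rewrite mulrA mulVf // mul1r.
Qed.

Lemma scale1_divs r c s u : scale1 r (divs c s u) = divs c (map (fun a => (r%:C)%C * a) s) (scale1 r u).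
Proof.
apply/funext => j; apply/funext => k; rewrite /divs {1}/scale1 mulrCA; congr (_ * _).
rewrite -/(scale1 r (foldr div1 u s) j k); congr (_ j k).
by elim: s => [//|a s IH] /=; rewrite scale1_div1 IH.
Qed.

Lemma bnd_divs c s (r : R) u M : c != 0 -> (forall a, a \in s -> cabs a <= r) -> 0 <= r < 1 ->
  bnd M u -> bnd ((cabs c)^-1 * (M / (1 - r) ^+ size s)) (divs c s u).
Proof.
move=> c0 hs hr hu; rewrite /divs; apply: bndZ; last by rewrite cabsV.
  elim: s hs => [|a s IH] hs /=; first by rewrite expr0 divr1.
  rewrite exprSr invfM mulrA.
  apply: bnd_div1 => //; first by apply: hs; rewrite mem_head.
  by apply: IH => b hb; apply: hs; rewrite in_cons hb orbT.
by rewrite invr_gt0 cabs_gt0.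
Qed.

End DiscZeroFree.

(** * The reciprocal of [p] and multiplication by [phi] *)

Section Inverse.
Context {R : realType}.
Local Notation C := R[i].
Local Notation array := (nat -> nat -> C).
Local Notation poly2 := {poly {poly C}}.
Implicit Types (P Q p : poly2) (u : array).

Lemma poly2_eqD P Q : (forall z, in_D2 z -> eval2 P z = eval2 Q z) -> P = Q.
Proof.
move=> h; apply: coef2_ext; suff -> : coef2 P = coef2 Q by [].
apply: ev_inj; [exact: bdd_coef2 | exact: bdd_coef2 |] => z hz.
by rewrite !ev_coef2 // h.
Qed.

Lemma real_complexX (x : R) t : ((x ^+ t)%:C)%C = (x%:C)%C ^+ t.
Proof. exact: rmorphXn. Qed.

Lemma real_complexB (x y : R) : ((x - y)%:C)%C = (x%:C)%C - (y%:C)%C.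
Proof. exact: rmorphB. Qed.

Lemma coef2_1 j k : coef2 (1 : poly2) j k = if (j == 0%N) && (k == 0%N) then 1 else 0.
Proof. by rewrite -[1 in LHS]/(1%:P%:P) coef2C. Qed.

Lemma eval2_1 z : eval2 (1 : poly2) z = 1.
Proof. by rewrite -[1 in LHS]/(1%:P%:P) eval2C. Qed.

Lemma eval2_lin1 (a : C) z : eval2 (1 - (a%:P)%:P * ('X)%:P) z = 1 - a * z.1.
Proof.
by rewrite eval2B eval2_1 eval2M eval2X1 (eval2C a z).
Qed.

Lemma eval2_prod (I : Type) (r : seq I) (F : I -> poly2) z :
  eval2 (\prod_(i <- r) F i) z = \prod_(i <- r) eval2 (F i) z.
Proof.
elim: r => [|i r IH]; last by rewrite !big_cons eval2M IH.
by rewrite !big_nil eval2_1.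
Qed.

Lemma pconv_col (q : {poly C}) u j k :
  pconv q%:P u j k = \sum_(i < j.+1) q`_i * u (j - i)%N k.
Proof.
rewrite /pconv big_ord_recl /= [X in _ + X]big1 ?addr0; last first.
  by move=> l _; rewrite big1 // => i _; rewrite /coef2 coefC /= coef0 mul0r.
by rewrite subn0; apply: eq_bigr => i _; rewrite /coef2 coefC.
Qed.

Definition scale2 (r : R) u : array := fun j k => (r%:C)%C ^+ (j + k) * u j k.

Lemma scp_ex (r : R) P : exists Q, coef2 Q = scale2 r (coef2 P) /\
  forall z, eval2 Q z = eval2 P ((r%:C)%C * z.1, (r%:C)%C * z.2).
Proof.
have [N hN] := supp_ex P; pose Q := trunc N (scale2 r (coef2 P)).
have e : coef2 Q = scale2 r (coef2 P).
  apply/funext => j; apply/funext => k; rewrite coef2_trunc; case: ifP => // h.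
  by rewrite /scale2 hN ?mulr0 // h.
have sQ : supp_in N Q by move=> j k h; rewrite e /scale2 hN // mulr0.
exists Q; split=> // z; rewrite (eval2_PS _ sQ) (eval2_PS _ hN) e /PS.
apply: eq_bigr => j _; apply: eq_bigr => k _ /=.
by rewrite /scale2 !exprMn exprD; ring.
Qed.

Lemma scale2_pconv (r : R) P Q u : coef2 Q = scale2 r (coef2 P) ->
  pconv Q (scale2 r u) = scale2 r (pconv P u).
Proof.
move=> e; apply/funext => j; apply/funext => k; rewrite /pconv {2}/scale2 mulr_sumr.
apply: eq_bigr => l _; rewrite mulr_sumr; apply: eq_bigr => i _.
rewrite e /scale2.
have -> : (j + k = (i + l) + (j - i + (k - l)))%N.
  by have := ltn_ord i; have := ltn_ord l; lia.
by rewrite (exprD _ (i + l) (j - i + (k - l))); ring.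
Qed.

Definition sclp (r : R) (q : {poly C}) : {poly C} := \poly_(i < size q) ((r%:C)%C ^+ i * q`_i).

Lemma horner_sclp r q t : (sclp r q).[t] = q.[(r%:C)%C * t].
Proof.
rewrite horner_poly horner_coef; apply: eq_bigr => i _.
by rewrite exprMn; ring.
Qed.

Lemma scale1_pconv r (q : {poly C}) u :
  scale1 r (pconv q%:P u) = pconv (sclp r q)%:P (scale1 r u).
Proof.
apply/funext => j; apply/funext => k; rewrite pconv_col {1}/scale1 pconv_col mulr_sumr.
apply: eq_bigr => i _; rewrite coef_poly /scale1.
case: ltnP => h; last by rewrite (nth_default 0 h) !mul0r mulr0.
have -> : (r%:C)%C ^+ j = (r%:C)%C ^+ i * (r%:C)%C ^+ (j - i).
  by rewrite -exprD subnKC // -ltnS.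
ring.
Qed.

Lemma poly_lin n p : deg_le_n1 n p -> p = (p`_0)%:P + (p`_1)%:P * 'X.
Proof.
move=> hp; apply: poly2_eqD => z _.
by rewrite (eval2_lin _ hp) eval2D eval2M !eval2P eval2X.
Qed.

Definition dilr (m : nat) : R := 1 - (m.+2)%:R^-1.

Lemma dilr_itv m : 0 < dilr m < 1.
Proof.
rewrite /dilr; have h : 0 < (m.+2)%:R^-1 :> R by rewrite invr_gt0 ltr0n.
have : (m.+2)%:R^-1 < 1 :> R by rewrite invf_lt1 ?ltr0n // ltr1n.
by move=> h'; move: (m.+2%:R^-1) h h' => x h h'; apply/andP; split; lra.
Qed.

Lemma dilr_cvg (c e : R) : 0 <= c -> 0 < e -> exists m0, forall m, (m0 <= m)%N ->
  c * (1 - dilr m) < e.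
Proof.
move=> c0 e0; exists (Num.bound (c / e)) => m hm.
have h := archi_boundP (divr_ge0 c0 (ltW e0)).
rewrite /dilr opprB addrC subrK ltr_pdivrMr ?ltr0n //.
rewrite ltr_pdivrMr // in h; apply: (lt_le_trans h).
rewrite mulrC ler_pM2l // ler_nat; apply: (leq_trans hm); lia.
Qed.

Lemma one_sub_expr (r : R) t : 0 <= r <= 1 -> 1 - r ^+ t <= t%:R * (1 - r).
Proof.
move=> /andP[r0 r1]; elim: t => [|t IH]; first by rewrite expr0 subrr mul0r.
have := exprn_ile1 t r0 r1; have := exprn_ge0 t r0; rewrite exprS -natr1; nra.
Qed.

Lemma pconv_scale_cvg P u j k (e : R) : 0 < e -> exists m0, forall m, (m0 <= m)%N ->
  cabs (pconv P (scale2 (dilr m) u) j k - pconv P u j k) < e.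
Proof.
move=> e0.
pose S := \sum_(l < k.+1) \sum_(i < j.+1) cabs (coef2 P i l * u (j - i)%N (k - l)%N).
have S0 : 0 <= S by apply: sumr_ge0 => l _; apply: sumr_ge0 => i _; exact: cabs_ge0.
have c0 : 0 <= (j + k)%:R * S by rewrite mulr_ge0.
have [m0 hm0] := dilr_cvg c0 e0; exists m0 => m /hm0; apply: le_lt_trans.
move: (dilr_itv m); move: (dilr m) => r /andP[r0 r1].
rewrite mulrAC mulr_sumr /pconv -sumrB; apply: (le_trans (cabs_sum _ _ _)).
apply: ler_sum => l _; rewrite mulr_sumr -sumrB; apply: (le_trans (cabs_sum _ _ _)).
apply: ler_sum => i _; rewrite /scale2; set x := coef2 P i l; set y := u _ _.
have -> : x * ((r%:C)%C ^+ (j - i + (k - l)) * y) - x * y =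
   - (((1 - r ^+ (j - i + (k - l)))%:C)%C * (x * y)).
  by rewrite real_complexB real_complexX; ring.
rewrite cabsN cabsM; apply: ler_wpM2r; first exact: cabs_ge0.
have hr : 0 <= r <= 1 by rewrite !ltW.
rewrite cabs_real ger0_norm; last by rewrite subr_ge0 exprn_ile1 // ltW.
apply: (le_trans (one_sub_expr _ hr)); apply: ler_wpM2r; first by rewrite subr_ge0 ltW.
rewrite ler_nat; lia.
Qed.

Section WithP.
Context (n : nat) (p : poly2) (hp : deg_le_n1 n p)
  (hz : forall z : C * C, in_D2 z -> eval2 p z != 0).

(* Coefficients of [z2^k] in [1 / p]: with [p = p0 + p1 z2] they satisfy [p0 r_(k+1) = - p1 r_k], and [divs c s]
   divides by [p0 = c prod (1 - a z1)]. *)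
Fixpoint inv_rows (c : C) (s : seq C) (k : nat) : array :=
  if k is k'.+1 then fun i l => - pconv (p`_1)%:P (divs c s (inv_rows c s k')) i l
  else coef2 1.

(** [1 / p] need not be square-summable, since [p] may vanish on the torus; its dilates are. After
    dilation in [z1] each row comes from the previous one without increase of norm, because
    [|p1| <= |p0|] in the disc, and dilation in [z2] makes the sum over rows geometric. *)
Lemma inverse_ex : exists e : array, pconv p e = coef2 1 /\
  forall r : R, 0 <= r < 1 -> exists K, bnd K (scale2 r e).
Proof using hp hz.
have h0 t : cabs t < 1 -> (p`_0).[t] != 0 by move=> ht; exact: p0_neq0 hp hz ht.
have [s [ss s1 es]] := disc_factor (hp.2 0%N) h0.
set c := (p`_0).[0] in es; have c0 : c != 0 by apply: h0; rewrite cabs0.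
have ep0 : (p`_0)%:P = (c%:P)%:P * \prod_(a <- s) (1 - (a%:P)%:P * ('X)%:P).
  apply: poly2_eqD => z _; rewrite eval2P es eval2M eval2C eval2_prod; congr (_ * _).
  by apply: eq_bigr => a _; rewrite eval2_lin1.
have hdiv u : pconv (p`_0)%:P (divs c s u) = u by rewrite ep0 pconv_divs.
pose xs := inv_rows c s.
pose e : array := fun j k => divs c s (xs k) j 0%N.
exists e; split.
  have colE (q : {poly C}) u v k k' j : (forall j, u j k = v j k') ->
      pconv q%:P u j k = pconv q%:P v j k'.
    by move=> h; rewrite !pconv_col; apply: eq_bigr => i _; rewrite h.
  rewrite {1}(poly_lin hp) pconvDl -pconv_comp pconvX.
  apply/funext => j; apply/funext => k; rewrite (@colE _ _ (divs c s (xs k)) k 0%N) // hdiv.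
  case: k => [|k].
    rewrite pconv_col big1 ?addr0 // => i _; by rewrite /S2 mulr0.
  rewrite (@colE (p`_1) _ (divs c s (xs k)) k.+1 0%N) //= addNr.
  by rewrite -[1]/(1%:P%:P) coef2C andbF.
move=> r /andP[r0 r1].
pose K := (cabs c)^-1 * (1 / (1 - r) ^+ size s).
have hW k : bnd 1 (scale1 r (xs k)) /\ bnd K (scale1 r (divs c s (xs k))).
  have hd : bnd 1 (scale1 r (xs k)) -> bnd K (scale1 r (divs c s (xs k))).
    move=> h; rewrite scale1_divs /K -(size_map (fun a => (r%:C)%C * a) s).
    apply: bnd_divs => //; last by rewrite r0.
    move=> a /mapP[b hb ->]; rewrite cabsM cabs_real ger0_norm // ler_piMr //.
    exact: s1.
  suff h : bnd 1 (scale1 r (xs k)) by split=> //; exact: hd.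
  elim: k hd => [|k IH] hd /=.
    apply: bnd_ext bnd_delta => j k; rewrite /scale1 /xs /= !coef2_1.
    case: j => [|j] /=; first by rewrite expr0 mul1r.
    by rewrite mulr0.
  have IHk : bnd 1 (scale1 r (xs k)).
    apply: IH => h; rewrite scale1_divs /K -(size_map (fun a => (r%:C)%C * a) s).
    apply: bnd_divs => //; last by rewrite r0.
    move=> a /mapP[b hb ->]; rewrite cabsM cabs_real ger0_norm // ler_piMr //.
    exact: s1.
  have hw : bnd K (scale1 r (divs c s (xs k))).
    rewrite scale1_divs /K -(size_map (fun a => (r%:C)%C * a) s).
    apply: bnd_divs => //; last by rewrite r0.
    move=> a /mapP[b hb ->]; rewrite cabsM cabs_real ger0_norm // ler_piMr //.
    exact: s1.
  have hPQ z : in_T2 z -> cabs (eval2 (sclp r p`_1)%:P z) <= 1 * cabs (eval2 (sclp r p`_0)%:P z).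
    move=> [h1 _]; rewrite mul1r !eval2P !horner_sclp; apply: (p1_le_p0 hp hz).
    by rewrite cabsM h1 mulr1 cabs_real ger0_norm.
  have := multiplier ltr01 hPQ hw; rewrite -scale1_pconv hdiv => /(_ _ IHk).
  rewrite mul1r -scale1_pconv => /bndN; apply: bnd_ext => j l.
  by rewrite /scale1 mulrN.
have K0 : 0 < K by case: (hW 0%N) => _ [].
exists (K / (1 - r)); split; first by rewrite divr_gt0 // subr_gt0.
move=> N; rewrite /nN exchange_big /=.
apply: (@le_trans _ _ (\sum_(k < N) (r ^+ 2) ^+ k * K ^+ 2)).
  apply: ler_sum => k _.
  have [_ [_ /(_ N.+1)]] := hW k; rewrite /nN => h.
  apply: (@le_trans _ _ ((r ^+ 2) ^+ k *
     \sum_(j < N.+1) \sum_(l < N.+1) cabs (scale1 r (divs c s (xs k)) j l) ^+ 2)).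
    rewrite big_ord_recr mulrDr ler_wpDr //=.
      by rewrite mulr_ge0 ?exprn_ge0 // sumr_ge0 // => l _; exact: sqr_ge0.
    rewrite mulr_sumr; apply: ler_sum => j _; rewrite big_ord_recl mulrDr ler_wpDr //=.
      by rewrite mulr_ge0 ?exprn_ge0 // sumr_ge0 // => l _; exact: sqr_ge0.
    rewrite /scale2 /scale1 /e exprD [_ ^+ j * _]mulrC -mulrA cabsM exprMn cabsX cabs_real.
    by rewrite ger0_norm // -!exprM mulnC.
  by apply: ler_wpM2l => //; rewrite exprn_ge0 // exprn_ge0.
rewrite -mulr_suml -/(geo N (r ^+ 2)) expr_div_n mulrC; apply: ler_wpM2l; first exact: sqr_ge0.
have r2 : 0 <= r ^+ 2 < 1 by rewrite sqr_ge0 /= expr_lt1.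
apply: (le_trans (geo_le N r2)); rewrite lef_pV2 ?posrE ?exprn_gt0 ?subr_gt0 //; first by nra.
by case/andP: r2.
Qed.

(** On the torus [|ptilde| = |p| <= 2^(n+1) |p(r .)|], so [ptilde B / p(r .)] is bounded uniformly
    in the radius [r = dilr m]. The array [u] represents [B / p(r .)]; it is kept because
    orthogonality is proved for [ptilde u] before the limit is taken. *)
Lemma phi_mul_poly (e : array) : pconv p e = coef2 1 ->
  (forall r : R, 0 <= r < 1 -> exists K, bnd K (scale2 r e)) ->
  forall (B : poly2) M, bnd M (coef2 B) ->
    (forall m, exists u, [/\ exists K, bnd K u,
        pconv (ptilde n p) u = pconv (ptilde n p * B) (scale2 (dilr m) e) &
        bnd (2 ^+ n.+1 * M) (pconv (ptilde n p) u)]) /\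
    bnd (2 ^+ n.+1 * M) (pconv (ptilde n p * B) e).
Proof using hp hz.
move=> he hbe B M hB.
have h1 m : exists u, [/\ exists K, bnd K u,
        pconv (ptilde n p) u = pconv (ptilde n p * B) (scale2 (dilr m) e) &
        bnd (2 ^+ n.+1 * M) (pconv (ptilde n p) u)].
  have /andP[r0 r1] := dilr_itv m; set r := dilr m in r0 r1 *.
  have r0' : 0 <= r < 1 by rewrite ltW.
  have [K0 hK0] := hbe r r0'; have [KB KB0 hKB] := bnd_pconv B.
  have [q [cq eq]] := scp_ex r p.
  have hu : bnd (KB * K0) (pconv B (scale2 r e)) by exact: hKB.
  exists (pconv B (scale2 r e)); split; [by exists (KB * K0) | by rewrite pconv_comp |].
  have hq : pconv q (pconv B (scale2 r e)) = coef2 B.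
    rewrite pconv_comp mulrC -pconv_comp (scale2_pconv _ cq) he.
    have -> : scale2 r (coef2 1) = coef2 1.
      apply/funext => j; apply/funext => k; rewrite /scale2 coef2_1.
      by case: j k => [|j] [|k] /=; rewrite ?mulr0 // expr0 mul1r.
    by rewrite pconv_coef2 mulr1.
  apply: (@multiplier _ _ q) hu _; first by rewrite exprn_gt0.
    move=> z hT; rewrite (cabs_ptilde_T2 hp hT) eq; apply: (dilate_T2 hp hz hT).
    by rewrite !ltW.
  by rewrite hq.
split=> //.
apply: (@bnd_limit _ (fun m => pconv (ptilde n p * B) (scale2 (dilr m) e))).
  by move=> j k x x0; exact: pconv_scale_cvg.
by move=> m; have [u [_ <- ]] := h1 m.
Qed.

End WithP.

End Inverse.

(** * The model space and its kernels *)

Section ModelSpace.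
Context {R : realType}.
Local Notation C := R[i].
Local Notation array := (nat -> nat -> C).
Local Notation poly2 := {poly {poly C}}.
Implicit Types (a b u : array) (z w : C * C).
Context (n : nat) (p : poly2) (hp : deg_le_n1 n p)
  (hz : forall z : C * C, in_D2 z -> eval2 p z != 0).
Local Notation pt := (ptilde n p).

Lemma ccvgD (u v : nat -> C) l l' : ccvg u l -> ccvg v l' -> ccvg (fun N => u N + v N) (l + l').
Proof.
move=> h h' e e0; have e2 : 0 < e / 2 by rewrite divr_gt0.
have [N1 h1] := h _ e2; have [N2 h2] := h' _ e2.
exists (maxn N1 N2) => m; rewrite geq_max => /andP[m1 m2].
have := cabsD (u m - l) (v m - l'); rewrite opprD addrACA.
have := h1 m m1; have := h2 m m2; lra.
Qed.

Lemma ccvgZ (u : nat -> C) c l : ccvg u l -> ccvg (fun N => c * u N) (c * l).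
Proof.
move=> h e e0; have c0 : 0 < cabs c + 1 by have := cabs_ge0 c; lra.
have [N hN] := h _ (divr_gt0 e0 c0); exists N => m /hN.
rewrite ltr_pdivlMr // -mulrBr cabsM; have := cabs_ge0 (u m - l); nra.
Qed.

Lemma ccvg_cabs_le (u : nat -> C) l (B : R) : (forall m, cabs (u m) <= B) -> ccvg u l -> cabs l <= B.
Proof.
move=> h hl; apply/ler_addgt0Pr => e e0; have [N hN] := hl e e0.
have := hN N (leqnn N); have := h N; have := cabs_subr l (u N); rewrite cabsBC; lra.
Qed.

Definition szego (w : C * C) : array := fun j k => cconj w.1 ^+ j * cconj w.2 ^+ k.

Lemma nN_szego w N : nN N (szego w) = geo N (cabs w.1 ^+ 2) * geo N (cabs w.2 ^+ 2).
Proof.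
rewrite /nN /geo mulr_suml; apply: eq_bigr => j _; rewrite mulr_sumr; apply: eq_bigr => k _.
by rewrite cabsM !cabsX !cabs_conj exprMn -!exprM !(mulnC 2).
Qed.

Lemma bnd_szego w : in_D2 w -> exists M, bnd M (szego w).
Proof.
move=> [h1 h2]; apply: sq_bnd.
have g0 (x : C) : cabs x < 1 -> 0 <= cabs x ^+ 2 < 1.
  by move=> hx; rewrite sqr_ge0 /= expr_lt1 ?cabs_ge0.
exists ((1 - cabs w.1 ^+ 2)^-1 * (1 - cabs w.2 ^+ 2)^-1) => N.
rewrite -/(nN N (szego w)) nN_szego.
by apply: ler_pM; rewrite ?geo_ge0 ?sqr_ge0 // geo_le // g0.
Qed.

Lemma ip_szego N a w : ipN N a (szego w) = PS a N N w.
Proof.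
apply: eq_bigr => j _; apply: eq_bigr => k _.
by rewrite cconjM !cconjX !cconjK mulrA.
Qed.

Lemma den_neq0 w z : in_D2 w -> cabs z.1 <= 1 -> cabs z.2 <= 1 ->
  (1 - z.1 * cconj w.1 != 0) /\ (1 - z.2 * cconj w.2 != 0).
Proof.
move=> [h1 h2] z1 z2; split; apply: one_sub_neq0; rewrite cabsM cabs_conj.
  by have := cabs_ge0 z.1; have := cabs_ge0 w.1; nra.
by have := cabs_ge0 z.2; have := cabs_ge0 w.2; nra.
Qed.

Lemma ev_szego w z : in_D2 w -> in_D2 z -> ev (szego w) z = Cker w z.
Proof.
move=> hw hzz; have [M hM] := bnd_szego hw.
have [d1 d2] := den_neq0 hw (ltW hzz.1) (ltW hzz.2).
pose P1 : poly2 := 1 - ((cconj w.1)%:P)%:P * ('X)%:P.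
pose P2 : poly2 := 1 - ((cconj w.2)%:P)%:P * 'X.
have e1 : pconv (P2 * P1) (szego w) = coef2 1.
  have a1 : pconv P1 (szego w) = fun j k => if j is j'.+1 then 0 else cconj w.2 ^+ k.
    rewrite /P1 pconvBl pconv1 -pconv_comp pconvC pconvX1.
    apply/funext => j; apply/funext => k; rewrite /szego /S1.
    by case: j => [|j]; rewrite ?exprS ?expr0; ring.
  rewrite -pconv_comp a1 /P2 pconvBl pconv1 -pconv_comp pconvC pconvX.
  apply/funext => j; apply/funext => k; rewrite coef2_1 /S2.
  by case: j k => [|j] [|k] /=; rewrite ?exprS ?expr0; ring.
have : ev (pconv (P2 * P1) (szego w)) z = 1 by rewrite e1 ev_coef2 // eval2_1.
rewrite (ev_pconv _ (bnd_bdd hM) hzz) eval2M.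
have -> : eval2 P1 z = 1 - z.1 * cconj w.1 by rewrite eval2_lin1 mulrC.
have -> : eval2 P2 z = 1 - z.2 * cconj w.2.
  by rewrite /P2 eval2B eval2_1 eval2M eval2X (eval2C (cconj w.2) z) mulrC.
rewrite /Cker [(_ - _) * (_ - _)]mulrC => h.
apply: (mulfI (mulf_neq0 d1 d2)); rewrite h mulfV //; exact: mulf_neq0.
Qed.

(** Beyond the degree of [q] every coefficient of the product involves all of [q], and against a
    geometric array the resulting sum is a conjugated value of the reflection of [q]. *)
Lemma pconv_szego (q : poly2) w m1 m2 : deg_le_n1 n q ->
  pconv q (szego w) (m1 + n)%N (m2 + 1)%N =
  cconj w.1 ^+ m1 * cconj w.2 ^+ m2 * cconj (eval2 (ptilde n q) w).
Proof.
move=> hq; rewrite (pconv_deg _ _ _ hq) (eval2_sum _ (deg_ptilde n q)) cconj_sum mulr_sumr.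
rewrite [RHS](reindex_inj rev_ord_inj); apply: eq_bigr => l _.
rewrite cconj_sum mulr_sumr [RHS](reindex_inj rev_ord_inj); apply: eq_bigr => i _ /=.
have hi := ltn_ord i; have hl := ltn_ord l.
rewrite coef2_ptilde !subSS.
have -> : ((n - i < n.+1)%N && (1 - l < 2)%N) by lia.
have -> : (n - (n - i) = i)%N by lia.
have -> : (1 - (1 - l) = l)%N by lia.
by rewrite !cconjM !cconjX cconjK /szego !exprD; ring.
Qed.

Lemma coef2_sum (I : Type) (r : seq I) (F : I -> poly2) j k :
  coef2 (\sum_(i <- r) F i) j k = \sum_(i <- r) coef2 (F i) j k.
Proof. by rewrite /coef2 !coef_sum. Qed.

Lemma trunc_sum N u : trunc N u =
  \sum_(l < N) \sum_(i < N) ((u i l)%:P)%:P * (('X^i)%:P * 'X^l).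
Proof.
rewrite /trunc poly_def; apply: eq_bigr => l _.
rewrite poly_def -mul_polyC rmorph_sum /= mulr_suml; apply: eq_bigr => i _.
by rewrite -mul_polyC rmorphM /= mulrA.
Qed.

(* This characterises the coefficient arrays of the elements of the model space. *)
Definition deg_defect a := forall m1 m2, pconv p a (m1 + n)%N (m2 + 1)%N = 0.

Lemma ip_ptilde_poly a N u : deg_defect a ->
  exists N0, forall N', (N0 <= N')%N -> ipN N' a (coef2 (pt * trunc N u)) = 0.
Proof using hp.
move=> ha; exists (N + n + 2)%N => N' hN'.
have e j k : coef2 (pt * trunc N u) j k =
    \sum_(l < N) \sum_(i < N) u i l * coef2 (pt * ('X^i)%:P * 'X^l) j k.
  rewrite trunc_sum mulr_sumr coef2_sum; apply: eq_bigr => l _.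
  rewrite mulr_sumr coef2_sum; apply: eq_bigr => i _.
  by rewrite mulrCA coef2CM mulrA.
have ips (I : Type) (r : seq I) (F : I -> array) :
    ipN N' a (fun j k => \sum_(i <- r) F i j k) = \sum_(i <- r) ipN N' a (F i).
  elim: r => [|i r IH].
    rewrite big_nil /ipN big1 // => j _; rewrite big1 // => k _.
    by rewrite big_nil cconj0 mulr0.
  rewrite big_cons -IH -ipNDr; congr ipN; apply/funext => j; apply/funext => k.
  by rewrite big_cons.
have -> : coef2 (pt * trunc N u) = (fun j k =>
    \sum_(l < N) \sum_(i < N) u i l * coef2 (pt * ('X^i)%:P * 'X^l) j k).
  by apply/funext => j; apply/funext => k.
rewrite (ips _ _ (fun l : 'I_N => fun j k => \sum_(i < N) u i l * coef2 (pt * ('X^i)%:P * 'X^l) j k)).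
rewrite big1 // => l _.
rewrite (ips _ _ (fun i : 'I_N => fun j k => u i l * coef2 (pt * ('X^i)%:P * 'X^l) j k)).
rewrite big1 // => i _; rewrite ipNZr ip_ptilde_mono ?ha ?mulr0 //.
  by have := ltn_ord i; lia.
by have := ltn_ord l; lia.
Qed.

(** For truncations of [u] this is a finite combination of the relations in [deg_defect], and
    [ptilde] times the truncations converges weakly. *)
Lemma ip_ptilde a u M K : deg_defect a -> bnd M a -> bnd K u -> inner_is a (pconv pt u) 0.
Proof using hp.
move=> ha hM hu; have [L L0 hL] := bnd_pconv pt.
apply: (@weak_limit0 _ (fun N => pconv pt (acut N u)) _ _ M (L * K)) => //.
- by move=> N; apply: hL; exact: bnd_acut.
- move=> j k e e0; exists (maxn j k).+1 => m hm.
  rewrite (@pconv_eq _ pt _ u m) ?subrr ?cabs0 //; [|lia|lia].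
  by move=> j' k' hj hk; rewrite /acut hj hk.
move=> N; rewrite -coef2_trunc_acut pconv_coef2.
have [N0 hN0] := ip_ptilde_poly N u ha.
by move=> e e0; exists N0 => m /hN0; rewrite /ipN => ->; rewrite subrr cabs0.
Qed.

(* [x] is the coefficient array of [phi] times the function represented by [b]. *)
Lemma phi_mul (b : array) M : bnd M b ->
  exists x, [/\ pconv p x = pconv pt b,
    exists M', bnd M' x &
    forall a Ma, bnd Ma a -> deg_defect a -> inner_is a x 0].
Proof using hp hz.
move=> hb; have [e [he hbe]] := inverse_ex hp hz.
(* Coefficients of [ptilde b_N / p]; those in a fixed corner no longer change once the truncation
   [b_N] covers the corner, which is how [x] is defined below. *)
pose f N := pconv (pt * trunc N b) e.
have ff N N' j k : (j < N)%N -> (k < N)%N -> (N <= N')%N -> f N' j k = f N j k.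
  move=> hj hk hN; rewrite /f /pconv.
  apply: eq_bigr => l _; apply: eq_bigr => i _; congr (_ * _).
  rewrite !(mulrC pt) !coef2M; apply: eq_bigr => l' _; apply: eq_bigr => i' _; congr (_ * _).
  rewrite !coef2_trunc.
  have := ltn_ord i; have := ltn_ord l; have := ltn_ord i'; have := ltn_ord l'.
  move=> a1 a2 a3 a4.
  have -> : (i' < N)%N && (l' < N)%N by lia.
  by have -> : (i' < N')%N && (l' < N')%N by lia.
pose x : array := fun j k => f (maxn j k).+1 j k.
have fx N j k : (j < N)%N -> (k < N)%N -> f N j k = x j k.
  by move=> hj hk; rewrite /x; apply: ff; lia.
have fxl j k d : 0 < d -> exists m0, forall m, (m0 <= m)%N -> cabs (f m j k - x j k) < d.
  move=> d0; exists (maxn j k).+1 => m hm; rewrite fx ?subrr ?cabs0 //; lia.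
have hB N : bnd M (coef2 (trunc N b)) by rewrite coef2_trunc_acut; exact: bnd_acut.
have hf N : bnd (2 ^+ n.+1 * M) (f N) by have [] := phi_mul_poly hp hz he hbe (hB N).
exists x; split.
- apply/funext => j; apply/funext => k; pose N := (maxn j k).+1.
  have hj : (j < N)%N by rewrite /N; lia.
  have hk : (k < N)%N by rewrite /N; lia.
  rewrite (@pconv_eq _ p x (f N) N) //; last by move=> *; rewrite fx.
  rewrite /f pconv_comp mulrC -pconv_comp he pconv_coef2 mulr1.
  by rewrite -pconv_trunc.
- by exists (2 ^+ n.+1 * M); exact: bnd_limit fxl hf.
(* Two weak limits are nested: outside in the truncation order [N], inside in the dilation [dilr m],
   under which [1 / p] becomes square-summable. *)
move=> a Ma hMa ha; apply: (weak_limit0 hMa hf fxl) => N.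
have [h1 _] := phi_mul_poly hp hz he hbe (hB N).
refine (weak_limit0 (f := fun m => pconv (pt * trunc N b) (scale2 (dilr m) e))
  (K := 2 ^+ n.+1 * M) hMa _ _ _).
- by move=> m; have [u [_ <-]] := h1 m.
- by move=> j k d d0; exact: pconv_scale_cvg.
by move=> m; have [u [[K hK] <- _]] := h1 m; exact: ip_ptilde ha hMa hK.
Qed.

Lemma ev_phi_mul b x z : bdd b -> bdd x -> pconv p x = pconv pt b -> in_D2 z ->
  ev x z = phi n p z * ev b z.
Proof using hp hz.
move=> hb hx e hzz; apply: (mulfI (hz hzz)); rewrite -ev_pconv // e ev_pconv //.
by rewrite /phi mulrA mulrCA mulfV ?mulr1 // hz.
Qed.

(** Tested on [p z1^m1 z2^m2], whose product with [phi] is the polynomial [ptilde z1^m1 z2^m2],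
    orthogonality is the vanishing of one coefficient of [p a]. *)
Lemma in_K_defect a : in_K n p a -> deg_defect a.
Proof using hp hz.
move=> [hs h] m1 m2.
have [M1 hM1] := bnd_coef2 (p * ('X^m1)%:P * 'X^m2).
have [M2 hM2] := bnd_coef2 (pt * ('X^m1)%:P * 'X^m2).
have h1 : represents (coef2 (p * ('X^m1)%:P * 'X^m2)) (eval2 (p * ('X^m1)%:P * 'X^m2)).
  by apply: ev_represents hM1 _ => z hzz; rewrite ev_coef2.
have h2 : represents (coef2 (pt * ('X^m1)%:P * 'X^m2))
    (fun z => phi n p z * eval2 (p * ('X^m1)%:P * 'X^m2) z).
  apply: ev_represents hM2 _ => z hzz; rewrite ev_coef2 // !eval2M /phi.
  by rewrite !mulrA divfK ?hz.
have h0 := h _ _ _ h1 h2; apply/eqP; rewrite -cabs_eq0; apply/eqP/le_anti.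
rewrite cabs_ge0 andbT; apply/ler_addgt0Pr => e e0; have [N hN] := h0 e e0.
have := hN (maxn N (m1 + n + m2 + 2)) (leq_maxl _ _).
rewrite -/(ipN _ _ _) ip_ptilde_mono // ?subr0 ?add0r; [exact: ltW | lia | lia].
Qed.

(** Uniqueness of coefficients identifies any array representing [phi G] with the one built by
    [phi_mul], which is orthogonal to [a]. *)
Lemma defect_in_K a M : bnd M a -> deg_defect a -> in_K n p a.
Proof using hp hz.
move=> hM ha; split; first exact: bnd_sq hM.
move=> b c G hb hc; have [Mb hMb] := sq_bnd hb.1; have [Mc hMc] := sq_bnd hc.1.
have [x [ex [Mx hMx] hx]] := phi_mul hMb.
have -> : c = x; last exact: hx hM ha.
apply: ev_inj; [exact: bnd_bdd hMc | exact: bnd_bdd hMx |] => z hzz.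
rewrite -(represents_ev hc hzz) (ev_phi_mul (bnd_bdd hMb) (bnd_bdd hMx) ex hzz).
by rewrite -(represents_ev hb hzz).
Qed.

(** The array is the Szego kernel minus [conj (phi w)] times its product with [phi]. Its defect
    vanishes because by [pconv_szego] both terms contribute [conj (ptilde w)] times the same
    monomial; it reproduces because the model space is orthogonal to the subtracted part. *)
Lemma kernel_ex w : in_D2 w -> exists kap, [/\ exists M, bnd M kap,
  (forall z, in_D2 z -> ev kap z = kker n p w z), in_K n p kap &
  forall a, in_K n p a -> inner_is a kap (ev a w)].
Proof using hp hz.
move=> hw; have [Ms hMs] := bnd_szego hw.
have [x [ex [Mx hMx] hx]] := phi_mul hMs.
pose kap : array := fun j k => szego w j k - cconj (phi n p w) * x j k.
have f0 : 0 < cabs (cconj (phi n p w)) + 1 by have := cabs_ge0 (cconj (phi n p w)); lra.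
have fl : cabs (cconj (phi n p w)) <= cabs (cconj (phi n p w)) + 1 by lra.
have hk := bndB hMs (bndZ hMx f0 fl).
have evx z : in_D2 z -> ev x z = phi n p z * Cker w z.
  by move=> hzz; rewrite (ev_phi_mul (bnd_bdd hMs) (bnd_bdd hMx) ex hzz) ev_szego.
exists kap; split.
- by exists (Ms + (cabs (cconj (phi n p w)) + 1) * Mx).
- move=> z hzz; rewrite /kap (evB (bnd_bdd hMs) (bddZ _ (bnd_bdd hMx)) hzz).
  by rewrite (evZ _ (bnd_bdd hMx) hzz) (ev_szego hw hzz) (evx _ hzz) /kker; ring.
- apply: (defect_in_K hk) => m1 m2; rewrite pconvBr pconvZr ex.
  rewrite !pconv_szego ?ptildeK //; last exact: deg_ptilde.
  have -> : eval2 pt w = phi n p w * eval2 p w by rewrite /phi divfK // hz.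
  by rewrite cconjM; ring.
move=> a ha.
have h1 : inner_is a x 0.
  apply: (ha.2 (szego w) x (Cker w)).
    by apply: ev_represents hMs _ => z hzz; rewrite ev_szego.
  by apply: ev_represents hMx _ => z hzz; rewrite evx.
have [Ma hMa] := sq_bnd ha.1.
have h2 : inner_is a (szego w) (ev a w).
  move=> e e0; have [N hN] := sums_ccvg (evP (bnd_bdd hMa) hw) e0.
  by exists N => m hm; rewrite -/(ipN _ _ _) ip_szego; exact: hN.
have := ccvgD h2 (ccvgZ (- phi n p w) h1); rewrite mulr0 addr0.
move=> hh e e0; have [N hN] := hh e e0; exists N => m hm.
suff -> : \sum_(j < m) \sum_(k < m) a j k * cconj (kap j k) =
  \sum_(j < m) \sum_(k < m) a j k * cconj (szego w j k) +
  - phi n p w * \sum_(j < m) \sum_(k < m) a j k * cconj (x j k) by exact: hN.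
rewrite mulr_sumr -big_split; apply: eq_bigr => j _; rewrite mulr_sumr -big_split.
by apply: eq_bigr => k _ /=; rewrite /kap cconjB cconjM cconjK; ring.
Qed.

End ModelSpace.

(** * Inequalities from the reproducing kernel *)

Section KernelBounds.
Context {R : realType}.
Local Notation C := R[i].
Local Notation array := (nat -> nat -> C).
Local Notation poly2 := {poly {poly C}}.
Implicit Types (a b u : array) (z w v : C * C).

(** [ipN_le] wants positive bounds, so the square roots are enlarged by [e], which then tends to
    0. *)
Lemma cauchy_schwarz N a b (A B : R) : nN N a <= A -> nN N b <= B ->
  cabs (ipN N a b) ^+ 2 <= A * B.
Proof.
move=> hA hB; have A0 := le_trans (nN_ge0 _ _) hA; have B0 := le_trans (nN_ge0 _ _) hB.
have key (e : R) : 0 < e -> cabs (ipN N a b) <= (Num.sqrt A + e) * (Num.sqrt B + e).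
  move=> e0; rewrite -(ipN_acut a b (leqnn N)) -ipN_conj cabs_conj -(ipN_acut b _ (leqnn N)).
  have hh (c : array) (D : R) : 0 <= D -> nN N c <= D -> bnd (Num.sqrt D + e) (acut N c).
    move=> D0 hc; have s0 := sqrtr_ge0 D.
    split; first by lra.
    move=> m; apply: (le_trans (nN_mono _ (leq_maxl m N))); rewrite nN_acut ?leq_maxr //.
    apply: (le_trans hc); rewrite -{1}(sqr_sqrtr D0); apply: sqr_le => //; lra.
  by rewrite mulrC; apply: ipN_le; exact: hh.
have sA := sqrtr_ge0 A; have sB := sqrtr_ge0 B.
rewrite -(sqr_sqrtr A0) -(sqr_sqrtr B0) -exprMn; apply: sqr_le; first exact: cabs_ge0.
apply/ler_addgt0Pr => e e0; pose S := Num.sqrt A + Num.sqrt B + 1.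
have S0 : 0 < S by rewrite /S; lra.
pose d := Num.min 1 (e / S).
have d0 : 0 < d by rewrite lt_min ltr01 /= divr_gt0.
have d1 : d <= 1 by rewrite ge_min lexx.
have d2 : d * S <= e by rewrite -ler_pdivlMr // ge_min lexx orbT.
have := key d d0; rewrite /S in d2; nra.
Qed.

Lemma one_sub_real (x : R) : 1 - (x%:C)%C = ((1 - x)%:C)%C.
Proof. by rewrite real_complexB. Qed.

Lemma real_complexM (x y : R) : ((x * y)%:C)%C = (x%:C)%C * (y%:C)%C.
Proof. exact: rmorphM. Qed.

Lemma real_complexV (x : R) : ((x^-1)%:C)%C = ((x%:C)%C)^-1.
Proof. exact: fmorphV. Qed.

(** A sequence as an array supported on second index 0, so that one-variable series are evaluated by
    [ev]. *)
Definition row (f : nat -> C) : array := fun j k => if k == 0%N then f j else 0.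

Definition ev1 (f : nat -> C) (t : C) : C := ev (row f) (t, 0).

Lemma bnd_row a M k : bnd M a -> bnd M (row (fun j => a j k)).
Proof.
move=> [M0 h]; split=> // N.
apply: (@le_trans _ _ (\sum_(j < N) cabs (a j k) ^+ 2)).
  apply: ler_sum => j _; rewrite /row; case: N j => [|N] j; first by case: j.
  rewrite big_ord_recl /= big1 ?addr0 // => i _; by rewrite cabs0 expr0n.
apply: le_trans (h (maxn N k.+1)); rewrite /nN.
have hN : (N <= maxn N k.+1)%N by rewrite leq_maxl.
rewrite (big_ord_widen _ (fun j => cabs (a j k) ^+ 2) hN) big_mkcond.
apply: ler_sum => j _.
have hk : (k < maxn N k.+1)%N by rewrite leq_maxr.
have hs : 0 <= \sum_(i < maxn N k.+1) cabs (a j i) ^+ 2 by apply: sumr_ge0 => i _; exact: sqr_ge0.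
case: ifP => // _; rewrite (bigD1 (Ordinal hk)) //= lerDl.
by apply: sumr_ge0 => i _; exact: sqr_ge0.
Qed.

Lemma bnd_col a M j : bnd M a -> bnd M (row (fun k => a j k)).
Proof. by move=> h; exact: (@bnd_row (tr a)) (bnd_tr h). Qed.

Lemma in_D2_0 (t : C) : cabs t < 1 -> in_D2 (t, (0 : C)).
Proof. by move=> h; split; rewrite //= cabs0. Qed.

Lemma in_D2_0l (t : C) : cabs t < 1 -> in_D2 ((0 : C), t).
Proof. by move=> h; split; rewrite //= cabs0. Qed.

Lemma in_D2_2 (t t' : C) : cabs t < 1 -> cabs t' < 1 -> in_D2 (t, t').
Proof. by []. Qed.

Lemma ev_row f z : bdd (row f) -> in_D2 z -> ev (row f) z = ev1 f z.1.
Proof.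
move=> hf hz; apply: (ev_unique hf hz) => e e0.
have hz0 := in_D2_0 hz.1; have [N hN] := evP hf hz0 e0.
have E J K w : PS (row f) J K.+1 w = \sum_(j < J) f j * w.1 ^+ j.
  apply: eq_bigr => j _; rewrite big_ord_recl /= big1 ?addr0 ?expr0 ?mulr1 //.
  by move=> k _; rewrite /row /= !mul0r.
exists N.+1 => J [//|K] hJ hK; have := hN J K.+1 (ltnW hJ) (ltnW hK).
by rewrite !E.
Qed.

Lemma ev1_partial f t : bdd (row f) -> cabs t < 1 ->
  ccvg (fun N => \sum_(j < N) f j * t ^+ j) (ev1 f t).
Proof.
move=> hf ht e e0; have [N hN] := evP hf (in_D2_0 ht) e0.
exists N.+1 => -[//|m] hm; have := hN m.+1 m.+1 (ltnW hm) (ltnW hm).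
suff -> : PS (row f) m.+1 m.+1 (t, 0) = \sum_(j < m.+1) f j * t ^+ j by [].
apply: eq_bigr => j _; rewrite big_ord_recl /= big1 ?addr0 ?expr0 ?mulr1 //.
by move=> k _; rewrite /row /= !mul0r.
Qed.

Lemma bdd_row (f : nat -> C) : (exists M, forall j, cabs (f j) <= M) -> bdd (row f).
Proof.
move=> [M h]; exists M => j l; rewrite /row; case: ifP => _ //.
by rewrite cabs0; apply: le_trans (cabs_ge0 _) (h 0%N).
Qed.

Lemma ev_strip n a z : bdd a -> in_D2 z ->
  (forall m1 m2, a (m1 + n)%N (m2 + 1)%N = 0) ->
  ev a z = ev1 (fun j => a j 0%N) z.1 +
    z.2 * \sum_(i < n) z.1 ^+ i * ev1 (fun k => a i k.+1) z.2.
Proof.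
move=> ha hz h0.
(* Row [i] of [a] shifted by one in the second index: it represents [z1^i] times the one-variable
   series in [z2] attached to that row. *)
pose r (i : nat) : array := fun j k => if j == i then a i k.+1 else 0.
have rc i : bdd (row (fun k => a i k.+1)).
  by apply: bdd_row; case: ha => M hM; exists M.
have hr i : r i = iter i (@S1 R) (tr (row (fun k => a i k.+1))).
  suff h m : iter m (@S1 R) (tr (row (fun k => a i k.+1))) = fun j k => if j == m then a i k.+1 else 0.
    by rewrite h.
  elim: m => [|m IH]; first by apply/funext => j; apply/funext => k.
  by rewrite iterS IH; apply/funext => -[|j]; apply/funext => k.
have hit u m : bdd u -> bdd (iter m (@S1 R) u) /\ ev (iter m (@S1 R) u) z = z.1 ^+ m * ev u z.
  move=> hu; elim: m => [|m [IH1 IH2]]; first by rewrite expr0 mul1r.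
  by split; [exact: bdd_S1 | rewrite iterS (ev_S1 IH1 hz) IH2 exprS mulrA].
have hz' : in_D2 (z.2, z.1) by case: hz.
have er i : bdd (r i) /\ ev (r i) z = z.1 ^+ i * ev1 (fun k => a i k.+1) z.2.
  have [h1 h2] := hit _ i (bdd_tr (rc i)).
  rewrite -hr in h1 h2; split; first exact: h1.
  have e3 : ev (tr (row (fun k => a i k.+1))) z = ev1 (fun k => a i k.+1) z.2.
    have := ev_tr (rc i) hz' => /=; rewrite -surjective_pairing => ->.
    by rewrite (ev_row (rc i) hz').
  exact: (etrans h2 (congr1 (fun x => z.1 ^+ i * x) e3)).
have es m : bdd (fun j k => \sum_(i < m) r i j k) /\
    ev (fun j k => \sum_(i < m) r i j k) z = \sum_(i < m) z.1 ^+ i * ev1 (fun k => a i k.+1) z.2.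
  elim: m => [|m [IH1 IH2]].
    have e0 : (fun j k => \sum_(i < 0) r i j k) = fun j k => 0 * a j k.
      by apply/funext => j; apply/funext => k; rewrite big_ord0 mul0r.
    by rewrite e0 big_ord0 (evZ _ ha hz) mul0r; split=> //; exact: bddZ.
  have e0 : (fun j k => \sum_(i < m.+1) r i j k) = fun j k => \sum_(i < m) r i j k + r m j k.
    by apply/funext => j; apply/funext => k; rewrite big_ord_recr.
  have [h1 h2] := er m.
  by rewrite e0 big_ord_recr /= (evD IH1 h1 hz) IH2 h2; split=> //; exact: bddD.
have [s1 s2] := es n.
have rb : bdd (row (fun j => a j 0%N)) by apply: bdd_row; case: ha => M hM; exists M.
have e : a = fun j k => row (fun j => a j 0%N) j k + S2 (fun j k => \sum_(i < n) r i j k) j k.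
  apply/funext => j; apply/funext => -[|k]; rewrite /row /S2 /= ?addr0 // add0r.
  have [hj|hj] := ltnP j n.
    rewrite (bigD1 (Ordinal hj)) //= {1}/r eqxx big1 ?addr0 // => i hi.
    rewrite /r; case: eqP => // ej; move: hi; rewrite -val_eqE /= ej eqxx //.
  rewrite big1; first by have := h0 (j - n)%N k; rewrite subnK // addn1.
  by move=> i _; rewrite /r; case: eqP => // ej; have := ltn_ord i; lia.
rewrite {1}e (evD rb (bdd_S2 s1) hz) (ev_row rb hz) (ev_S2 s1 hz) s2.
by [].
Qed.

Section WithPhi.
Context (n : nat) (p : poly2) (hp : deg_le_n1 n p)
  (hz : forall z : C * C, in_D2 z -> eval2 p z != 0).
Local Notation pt := (ptilde n p).
Local Notation phi := (phi n p).

(* The squared norm of the reproducing kernel at [w]. *)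
Definition kn w : R :=
  (1 - cabs (phi w) ^+ 2) / ((1 - cabs w.1 ^+ 2) * (1 - cabs w.2 ^+ 2)).

Lemma D2_sqr w : in_D2 w -> 0 < 1 - cabs w.1 ^+ 2 /\ 0 < 1 - cabs w.2 ^+ 2.
Proof.
by move=> [h1 h2]; rewrite !subr_gt0 !expr_lt1 ?cabs_ge0.
Qed.

Lemma kker_diag w : kker n p w w = ((kn w)%:C)%C.
Proof.
rewrite /kker /Cker /kn [cconj _ * _]mulrC !mul_conj.
by rewrite !one_sub_real -real_complexM -real_complexV -real_complexM.
Qed.

Lemma kernel_norm_ex w : in_D2 w -> exists kap, [/\ in_K n p kap,
  (forall z, in_D2 z -> ev kap z = kker n p w z), (forall N, nN N kap <= kn w) &
  forall a, in_K n p a -> inner_is a kap (ev a w)].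
Proof using hp hz.
move=> hw; have [kap [[M hM] hev hK hrep]] := kernel_ex hp hz hw.
exists kap; split=> // N; have := hrep _ hK; rewrite (hev _ hw) kker_diag => h.
apply/ler_addgt0Pr => e e0; have [m hm] := h e e0.
have := hm (maxn m N) (leq_maxl _ _); rewrite -/(ipN _ _ _) ipN_self -rmorphB /= cabs_real.
have := nN_mono kap (leq_maxr m N); have := ler_norm (nN (maxn m N) kap - kn w); lra.
Qed.

Lemma point_bound a (A : R) w : in_K n p a -> (forall N, nN N a <= A) -> in_D2 w ->
  cabs (ev a w) ^+ 2 <= A * kn w.
Proof using hp hz.
move=> ha hA hw; have [kap [_ _ hk hrep]] := kernel_norm_ex hw.
have A0 : 0 <= A := le_trans (nN_ge0 0 a) (hA 0%N).
have k0 : 0 <= kn w := le_trans (nN_ge0 0 kap) (hk 0%N).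
rewrite -(sqr_sqrtr (mulr_ge0 A0 k0)); apply: sqr_le; first exact: cabs_ge0.
apply: (ccvg_cabs_le _ (hrep _ ha)) => m; apply: sqr_le_cancel; first exact: sqrtr_ge0.
by rewrite (sqr_sqrtr (mulr_ge0 A0 k0)); exact: (cauchy_schwarz (hA m) (hk m)).
Qed.

Lemma kn_ge0 w : in_D2 w -> 0 <= kn w.
Proof using hp hz.
by move=> hw; have [kap [_ _ hk _]] := kernel_norm_ex hw; exact: le_trans (nN_ge0 0 kap) (hk 0%N).
Qed.

Lemma phi_le1 w : in_D2 w -> cabs (phi w) ^+ 2 <= 1.
Proof using hp hz.
move=> hw; have := kn_ge0 hw; have [h1 h2] := D2_sqr hw.
by rewrite /kn pmulr_lge0 ?invr_gt0 ?mulr_gt0 // subr_ge0.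
Qed.

(** Positivity of the Gram matrix of the kernels at [w] and [v]: the bound on point evaluation at
    [v], applied to the kernel at [w]. *)
Lemma schwarz w v : in_D2 w -> in_D2 v -> cabs (kker n p w v) ^+ 2 <= kn w * kn v.
Proof using hp hz.
move=> hw hv; have [kap [hK hev hk _]] := kernel_norm_ex hw.
by rewrite -(hev _ hv); apply: point_bound.
Qed.

Context (hdeg : deg_eq_n1 n (ptilde n p)) (hno : no_common_factor p (ptilde n p)).

(** Takes the place of the maximum principle. If [|phi(w)| = 1], the kernel at [w] has norm zero, so
    [phi] is constant and [ptilde] a multiple of [p], against coprimality and the degree of
    [ptilde]. *)
Lemma phi_lt1 w : in_D2 w -> cabs (phi w) < 1.
Proof using hp hz hdeg hno.
move=> hw; have h1 := phi_le1 hw; rewrite ltNge; apply/negP => h2.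
have e1 : cabs (phi w) ^+ 2 = 1.
  by apply/le_anti; rewrite h1 /= -[X in X <= _](expr1n R 2); apply: sqr_le.
have k0 : kn w = 0 by rewrite /kn e1 subrr mul0r.
have f0 : phi w != 0 by rewrite -cabs_gt0; lra.
have [kap [hK hev hk _]] := kernel_norm_ex hw; rewrite k0 in hk.
have hphi z : in_D2 z -> phi z = (cconj (phi w))^-1.
  move=> hzz; have := schwarz hw hzz; rewrite k0 mul0r => h.
  have : kker n p w z = 0.
    by apply: cabs0_eq0; have := cabs_ge0 (kker n p w z); nra.
  have [d1 d2] := den_neq0 hw (ltW hzz.1) (ltW hzz.2).
  move/eqP; rewrite /kker /Cker mulf_eq0 invr_eq0 mulf_eq0 (negbTE d1) (negbTE d2) !orbF.
  rewrite subr_eq0 => /eqP e.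
  have c0 : cconj (phi w) != 0 by rewrite cconj_eq0.
  by apply: (mulfI c0); rewrite -e mulfV.
pose g := (cconj (phi w))^-1.
have ept : pt = (g%:P)%:P * p.
  apply: poly2_eqD => z hzz; rewrite eval2M (eval2C g z) /g -(hphi z hzz) /Defs.phi.
  by rewrite divfK // hz.
have e2 : pt = p * (g%:P)%:P by rewrite ept mulrC.
have [s1 _] := hno (esym (mulr1 p)) e2.
have := hdeg.2.1; rewrite ept.
move=> hs; have s3 : (size ((g%:P)%:P * p)%R <= 1)%N.
  apply: (leq_trans (size_polyMleq _ _)); rewrite -subn1 leq_subLR.
  exact: (leq_add (size_polyC_leq1 _) s1).
by rewrite hs in s3.
Qed.

(** For two points with the same [z2], [schwarz] reads [(1 - |t|^2) |1 - conj x y|^2 <= (1 - |x|^2)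
    (1 - |y|^2)] with [x = phi(t, t')] and [y = phi(0, t')]; then [|1 - conj x y| >= 1 - |y|]. *)
Lemma schwarz_pick1 (t t' : C) : cabs t < 1 -> cabs t' < 1 ->
  (1 - cabs t ^+ 2) * (1 - cabs (phi (0, t'))) / 2 <= 1 - cabs (phi (t, t')) ^+ 2.
Proof using hp hz hdeg hno.
move=> ht ht'; have hw := in_D2_2 ht ht'; have hv := in_D2_0l ht'.
have := schwarz hw hv; have f1 := phi_lt1 hv; have f2 := phi_lt1 hw.
have [a1 a2] := D2_sqr hw; rewrite /= in a1 a2.
rewrite /kker /Cker /kn /= cabs0 expr0n subr0 mul1r mul0r subr0 mul1r.
set x := phi (t, t') in f2 *; set y := phi (0, t') in f1 *.
set P := 1 - cabs t ^+ 2 in a1 *; set S := 1 - cabs t' ^+ 2 in a2 *.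
rewrite cabsM cabsV mul_conj one_sub_real cabs_real -/S gtr0_norm //.
rewrite exprMn exprVn.
have h1 : 1 - cabs y <= cabs (1 - cconj x * y).
  have := cabs_subr 1 (cconj x * y); rewrite cabs1 cabsM cabs_conj.
  have := cabs_ge0 y; have := cabs_ge0 x; nra.
have h2 : (1 - cabs y) ^+ 2 <= cabs (1 - cconj x * y) ^+ 2 by apply: sqr_le => //; lra.
have -> : (1 - cabs x ^+ 2) / (P * S) * ((1 - cabs y ^+ 2) / S) =
   ((1 - cabs x ^+ 2) / P * (1 - cabs y ^+ 2)) / S ^+ 2.
  by field; rewrite !gt_eqF.
rewrite ler_pM2r ?invr_gt0 ?exprn_gt0 // => h3.
have y0 := cabs_ge0 y.
have h4 : (1 - cabs y) * (1 - cabs y) <= (1 - cabs x ^+ 2) / P * (1 + cabs y) * (1 - cabs y).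
  by move: (le_trans h2 h3); rewrite expr2; congr (_ <= _); ring.
rewrite ler_pM2r ?subr_gt0 // in h4.
have q0 : 0 <= (1 - cabs x ^+ 2) / P.
  by rewrite divr_ge0 ?(ltW a1) // subr_ge0 expr_le1 ?cabs_ge0 // ltW.
have h5 : (1 - cabs y) <= (1 - cabs x ^+ 2) / P * 2.
  apply: (le_trans h4); apply: ler_wpM2l => //; lra.
have h6 := ler_wpM2r (ltW a1) h5.
have e6 : (1 - cabs x ^+ 2) / P * 2 * P = (1 - cabs x ^+ 2) * 2 by field; rewrite gt_eqF.
rewrite e6 in h6; lra.
Qed.

End WithPhi.
End KernelBounds.

(** * Level sets of the rational inner function *)

Section Lipschitz.
Context {R : realType}.
Local Notation C := R[i].
Implicit Types (F G : C * C -> C) (z w : C * C).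

Definition cD2 z := cabs z.1 <= 1 /\ cabs z.2 <= 1.

(** One constant bounds both the function and its difference quotients on the closed bidisc, which
    makes the class closed under products. *)
Definition lip F := exists K : R, [/\ 0 <= K, (forall z, cD2 z -> cabs (F z) <= K) &
  forall z w, cD2 z -> cD2 w -> cabs (F z - F w) <= K * (cabs (z.1 - w.1) + cabs (z.2 - w.2))].

Lemma lip_cst (c : C) : lip (fun=> c).
Proof.
exists (cabs c); split; rewrite ?cabs_ge0 // => z w _ _.
by rewrite subrr cabs0 !(mulr_ge0, addr_ge0) ?cabs_ge0.
Qed.

Lemma lip_fst : lip (fun z => z.1).
Proof.
exists 1; split=> // [z []//|z w _ _]; rewrite mul1r lerDl; exact: cabs_ge0.
Qed.

Lemma lip_snd : lip (fun z => z.2).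
Proof.
exists 1; split=> // [z []//|z w _ _]; rewrite mul1r lerDr; exact: cabs_ge0.
Qed.

Lemma lipD F G : lip F -> lip G -> lip (fun z => F z + G z).
Proof.
move=> [K [K0 h1 h2]] [L [L0 g1 g2]]; exists (K + L); split; first exact: addr_ge0.
  by move=> z hz; apply: (le_trans (cabsD _ _)); apply: lerD; auto.
move=> z w hz hw; rewrite opprD addrACA mulrDl.
by apply: (le_trans (cabsD _ _)); apply: lerD; auto.
Qed.

Lemma lipM F G : lip F -> lip G -> lip (fun z => F z * G z).
Proof.
move=> [K [K0 h1 h2]] [L [L0 g1 g2]]; exists (K * L + K * L); split.
- by rewrite addr_ge0 ?mulr_ge0.
- move=> z hz; rewrite cabsM; apply: (@le_trans _ _ (K * L)).
    by apply: ler_pM; rewrite ?cabs_ge0; auto.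
  by rewrite lerDl mulr_ge0.
move=> z w hz hw.
have -> : F z * G z - F w * G w = F z * (G z - G w) + (F z - F w) * G w by ring.
rewrite [leRHS]mulrDl; apply: (le_trans (cabsD _ _)); rewrite !cabsM; apply: lerD.
  by rewrite -mulrA; apply: ler_pM; rewrite ?cabs_ge0; auto.
by rewrite mulrAC; apply: ler_pM; rewrite ?cabs_ge0; auto.
Qed.

Lemma lip_ext F G : (forall z, F z = G z) -> lip F -> lip G.
Proof. by move=> h; have -> : F = G by apply/funext. Qed.

Lemma lipB F G : lip F -> lip G -> lip (fun z => F z - G z).
Proof.
move=> hF hG; apply: (@lip_ext (fun z => F z + (-1) * G z)).
  by move=> z; rewrite mulN1r.
exact: lipD hF (lipM (lip_cst _) hG).
Qed.

Lemma lip_inv F : lip F -> (exists2 d : R, 0 < d & forall z, cD2 z -> d <= cabs (F z)) ->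
  lip (fun z => (F z)^-1).
Proof.
move=> [K [K0 h1 h2]] [d d0 hd].
have hi z : cD2 z -> F z != 0 by move=> hz; rewrite -cabs_gt0; exact: lt_le_trans (hd z hz).
have hv z : cD2 z -> cabs (F z)^-1 <= d^-1.
  by move=> hz; rewrite cabsV lef_pV2 ?posrE ?cabs_gt0 ?hi // hd.
have d1 : 0 <= d^-1 by rewrite invr_ge0 ltW.
exists (d^-1 + d^-1 * d^-1 * K); split.
- by rewrite addr_ge0 // mulr_ge0 // mulr_ge0.
- by move=> z hz; apply: (le_trans (hv z hz)); rewrite lerDl mulr_ge0 // mulr_ge0.
move=> z w hz hw.
have -> : (F z)^-1 - (F w)^-1 = (F z)^-1 * (F w)^-1 * (F w - F z).
  by field; rewrite !hi.
rewrite !cabsM cabsBC; set D := cabs (z.1 - w.1) + _.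
have D0 : 0 <= D by rewrite addr_ge0 ?cabs_ge0.
apply: (@le_trans _ _ (d^-1 * d^-1 * (K * D))).
  by apply: ler_pM; rewrite ?mulr_ge0 ?cabs_ge0 ?h2 //; apply: ler_pM; rewrite ?cabs_ge0 ?hv.
by rewrite [leRHS]mulrDl [leLHS]mulrA lerDr mulr_ge0.
Qed.

Lemma lip_eval2 (P : {poly {poly C}}) : lip (eval2 P).
Proof.
move: P; apply: poly2_ind => [c|||P P' h h'|P P' h h'].
- by apply: lip_ext (lip_cst c) => z; rewrite eval2C.
- by apply: lip_ext lip_snd => z; rewrite eval2X.
- by apply: lip_ext lip_fst => z; rewrite eval2X1.
- by apply: lip_ext (lipD h h') => z; rewrite eval2D.
- by apply: lip_ext (lipM h h') => z; rewrite eval2M.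
Qed.

Lemma lip_Cker w : in_D2 w -> lip (Cker w).
Proof.
move=> hw; apply: lip_inv.
  apply: lipM; apply: lipB; try exact: lip_cst.
    by apply: lipM; [exact: lip_fst | exact: lip_cst].
  by apply: lipM; [exact: lip_snd | exact: lip_cst].
case: hw => w1 w2.
exists ((1 - cabs w.1) * (1 - cabs w.2)); first by rewrite mulr_gt0 ?subr_gt0.
move=> z [z1 z2]; rewrite cabsM; apply: ler_pM; rewrite ?subr_ge0 ?(ltW w1) ?(ltW w2) //.
  have := cabs_subr 1 (z.1 * cconj w.1); rewrite cabs1 cabsM cabs_conj.
  have := cabs_ge0 w.1; nra.
have := cabs_subr 1 (z.2 * cconj w.2); rewrite cabs1 cabsM cabs_conj.
have := cabs_ge0 w.2; nra.
Qed.

End Lipschitz.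

(** * The polynomial [Q], its factorisation and the lines in its zero set *)

Section LevelSet.
Context {R : realType}.
Local Notation C := R[i].
Local Notation array := (nat -> nat -> C).
Local Notation poly2 := {poly {poly C}}.
Implicit Types (a : array) (z w : C * C) (t : C).
Context (n : nat) (p : poly2) (hp : deg_le_n1 n p)
  (hz : forall z : C * C, in_D2 z -> eval2 p z != 0)
  (hdeg : deg_eq_n1 n (ptilde n p)) (hno : no_common_factor p (ptilde n p))
  (alpha : C) (ha : cabs alpha = 1).
Local Notation pt := (ptilde n p).
Local Notation phi := (phi n p).

(* Its zero set is the level set [phi = c]. *)
Definition level (m : nat) (q : poly2) (c : C) : poly2 := (c%:P)%:P * q - ptilde m q.
Local Notation Q := (level n p alpha).

Lemma eval2_level z : eval2 Q z = alpha * eval2 p z - eval2 pt z.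
Proof. by rewrite /level eval2B eval2M (eval2C alpha z). Qed.

Lemma deg_level : deg_le_n1 n Q.
Proof using hp.
have hc j k : ~~ ((j < n.+1)%N && (k < 2)%N) -> coef2 Q j k = 0.
  by move=> h; rewrite coef2B coef2CM (deg_coef2 hp h) (deg_coef2 (deg_ptilde n p) h) mulr0 subrr.
split.
  apply/leq_sizeP => k hk; apply/polyP => j; rewrite coef0; apply: hc; lia.
by move=> k; apply/leq_sizeP => j hj; apply: hc; lia.
Qed.

(** As [alpha] is unimodular, reflection exchanges the two terms of [alpha p - ptilde] up to the
    factor [- conj alpha]; hence [Q0] determines [Q1]. *)
Lemma ptilde_level : ptilde n Q = ((- cconj alpha)%:P)%:P * Q.
Proof using hp ha.
apply: coef2_ext => j k; rewrite coef2_ptilde coef2CM.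
case: ifP => h; last by rewrite (deg_coef2 deg_level) ?mulr0 // h.
rewrite !coef2B !coef2CM !coef2_ptilde h.
have [j1 k1] := andP h.
have -> : ((n - j < n.+1)%N && (1 - k < 2)%N) by lia.
have -> : (n - (n - j) = j)%N by lia.
have -> : (1 - (1 - k) = k)%N by lia.
have e : cconj alpha * alpha = 1 by rewrite mulrC mul_conj ha expr1n.
rewrite cconjB cconjM cconjK.
set x := coef2 p j k; set y := cconj (coef2 p _ _).
have -> : - cconj alpha * (alpha * x - y) = cconj alpha * y - (cconj alpha * alpha) * x by ring.
by rewrite e mul1r.
Qed.

Lemma level_neq0 z : in_D2 z -> eval2 Q z != 0.
Proof using hp hz hdeg hno ha.
move=> hzz; rewrite eval2_level subr_eq0; apply/eqP => e.
have : phi z = alpha by rewrite /Defs.phi -e mulfK ?hz.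
by move=> e1; have := phi_lt1 hp hz hdeg hno hzz; rewrite e1 ha ltxx.
Qed.

Lemma clark_lhs z : in_D2 z ->
  (1 - cabs (phi z) ^+ 2) / cabs (alpha - phi z) ^+ 2 =
  (cabs (eval2 p z) ^+ 2 - cabs (eval2 pt z) ^+ 2) / cabs (eval2 Q z) ^+ 2.
Proof using hp hz hdeg hno ha.
move=> hzz; have p0 := hz hzz; have q0 := level_neq0 hzz.
have P0 : cabs (eval2 p z) != 0 by rewrite cabs_eq0.
have Q0 : cabs (eval2 Q z) != 0 by rewrite cabs_eq0.
have -> : alpha - phi z = eval2 Q z / eval2 p z.
  by rewrite eval2_level /Defs.phi mulrBl mulfK.
by rewrite /Defs.phi !cabsM !cabsV; field; rewrite P0 Q0.
Qed.

(** With [ptilde = alpha p - Q] the difference is [2 Re (alpha p conj Q) - |Q|^2]. *)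
Lemma num_le z : cabs (eval2 p z) ^+ 2 - cabs (eval2 pt z) ^+ 2 <=
  2 * (cabs (eval2 p z) * cabs (eval2 Q z)).
Proof using ha.
have e : eval2 pt z = alpha * eval2 p z - eval2 Q z by rewrite eval2_level; ring.
rewrite e cabs_sqrB cabsM ha mul1r.
have := Re_le_cabs (alpha * eval2 p z * cconj (eval2 Q z)).
rewrite !cabsM cabs_conj ha mul1r; have := sqr_ge0 (cabs (eval2 Q z)); lra.
Qed.

Lemma level_bound a (A : R) z : in_K n p a -> (forall N, nN N a <= A) -> in_D2 z ->
  cabs (eval2 p z * ev a z) ^+ 2 <=
  A * (2 * (cabs (eval2 p z) * cabs (eval2 Q z))) /
    ((1 - cabs z.1 ^+ 2) * (1 - cabs z.2 ^+ 2)).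
Proof using hp hz ha.
move=> hK hA hzz; have [d1 d2] := D2_sqr hzz.
have A0 : 0 <= A := le_trans (nN_ge0 0 a) (hA 0%N).
have P0 : cabs (eval2 p z) != 0 by rewrite cabs_eq0 hz.
rewrite cabsM exprMn.
apply: (@le_trans _ _ (cabs (eval2 p z) ^+ 2 * (A * kn n p z))).
  by apply: ler_wpM2l; [exact: sqr_ge0 | exact: point_bound].
have -> : cabs (eval2 p z) ^+ 2 * (A * kn n p z) =
   A * (cabs (eval2 p z) ^+ 2 - cabs (eval2 pt z) ^+ 2) /
    ((1 - cabs z.1 ^+ 2) * (1 - cabs z.2 ^+ 2)).
  by rewrite /kn /Defs.phi cabsM cabsV; field; rewrite P0 !gt_eqF.
apply: ler_wpM2r; first by rewrite invr_ge0 ltW // mulr_gt0.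
by apply: ler_wpM2l => //; exact: num_le.
Qed.

Lemma level_lin z : eval2 Q z = (Q`_0).[z.1] + (Q`_1).[z.1] * z.2.
Proof using hp. exact: eval2_lin deg_level. Qed.

Lemma level0_neq0 t : cabs t < 1 -> (Q`_0).[t] != 0.
Proof using hp hz hdeg hno ha.
by move=> ht; have := level_neq0 (in_D2_0 ht); rewrite level_lin /= mulr0 addr0.
Qed.

Lemma level1_refl t : t != 0 -> (Q`_1).[t] = - alpha * t ^+ n * cconj (Q`_0).[(cconj t)^-1].
Proof using hp ha.
move=> t0.
have e1 : cconj alpha * alpha = 1 by rewrite mulrC mul_conj ha expr1n.
have e (z2 : C) : z2 != 0 -> (Q`_0).[t] + (Q`_1).[t] * z2 =
   - alpha * (t ^+ n * z2) * cconj ((Q`_0).[(cconj t)^-1] + (Q`_1).[(cconj t)^-1] * (cconj z2)^-1).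
  move=> z20; have := @eval2_ptilde _ n Q (t, z2) deg_level t0 z20.
  rewrite ptilde_level eval2M (eval2C _ (t, z2)) !level_lin /= => h.
  by rewrite -[RHS]mulrA -h mulrA mulrNN [alpha * _]mulrC e1 mul1r.
(* Both sides of [e] are affine in [z2]; the values at 1 and -1 separate their coefficients. *)
have a1 := e 1 (oner_neq0 _).
have a2 := e (-1); rewrite oppr_eq0 in a2; have {a2} := a2 (oner_neq0 _).
move: a1; rewrite !cconjD !cconjM !cconjV !cconjK ?invrK.
rewrite ?invrN !invr1 !mulr1 !mulrN1.
set x := (Q`_0).[t]; set y := (Q`_1).[t]; set u := cconj _; set v := cconj _ => a1 a2.
have h2 : 2 * y = 2 * (- alpha * t ^+ n * u).
  have -> : 2 * y = (x + y) - (x - y) by ring.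
  rewrite a1 a2; ring.
by apply: (mulfI _ h2); rewrite pnatr_eq0.
Qed.

(** [Q0] has no zeros in the disc, which provides the numbers [b]; by [level1_refl] each factor
    [1 - b t] of [Q0] becomes a factor [t - conj b] of [Q1]. *)
Lemma level_factor : exists s : seq C, [/\ size s = n, (forall b, b \in s -> cabs b <= 1),
  (forall t, (Q`_0).[t] = (Q`_0).[0] * \prod_(b <- s) (1 - b * t)) &
  forall t, (Q`_1).[t] = - alpha * cconj (Q`_0).[0] * \prod_(b <- s) (t - cconj b)].
Proof using hp hz hdeg hno ha.
have [s [ss s1 es]] := disc_factor (deg_level.2 0%N) level0_neq0.
exists s; split=> //.
set c := (Q`_0).[0] in es *.
pose r : {poly C} := (- alpha * cconj c)%:P * \prod_(b <- s) ('X - (cconj b)%:P).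
have er t : r.[t] = - alpha * cconj c * \prod_(b <- s) (t - cconj b).
  rewrite /r hornerM hornerC horner_prod; congr (_ * _).
  by apply: eq_bigr => b _; rewrite hornerXsubC.
suff -> : Q`_1 = r by exact: er.
clearbody r.
(* The reflection formula excludes [t = 0]; multiplying by [X] makes the identity trivial there. *)
have X0 : 'X != 0 :> {poly C} by rewrite polyX_eq0.
apply: (mulfI X0); apply: (@polyC_inj _); apply: poly2_eqD => z _.
rewrite !eval2P !hornerM hornerX; have [->|t0] := eqVneq z.1 0; first by rewrite !mul0r.
congr (_ * _); rewrite level1_refl // es er cconjM cconj_prod -ss.
rewrite -!mulrA; congr (_ * _); rewrite mulrCA; congr (_ * _).
elim: s {ss s1 es er r} => [|b s IH]; first by rewrite !big_nil expr0 mul1r.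
rewrite !big_cons /= exprS -IH cconjB cconjM cconj1 cconjV cconjK; field.
exact: t0.
Qed.

Lemma level_T t : cabs t = 1 -> cabs (Q`_1).[t] = cabs (Q`_0).[t].
Proof using hp ha.
move=> ht; rewrite (level1_refl (unim_neq0 ht)) !cabsM cabsN ha cabsX ht expr1n !mul1r cabs_conj.
by rewrite conj_unim // invrK.
Qed.

(* If [Q] vanishes at [(0, l)] with [l] unimodular then the level set contains
   the horizontal line [z2 = l]. *)
Lemma level_horizontal (l : C) : cabs l = 1 -> eval2 Q (0, l) = 0 ->
  forall t, eval2 Q (t, l) = 0.
Proof using hp hz hdeg hno ha.
move=> hl; have [s [ss s1 e0 e1]] := level_factor.
set c := (Q`_0).[0] in e0 e1 *.
have c0 : c != 0 by apply: level0_neq0; rewrite cabs0.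
rewrite level_lin /= -/c => h.
(* At the origin [|Q1(0)| = |c| prod |b|] must equal [|Q0(0)| = |c|], so all the [|b| <= 1] are
   equal to one, and [Q1] is then a constant multiple of [Q0]. *)
have hu : forall b, b \in s -> cabs b = 1.
  have : cabs (Q`_1).[0] = cabs c.
    by move/eqP: h; rewrite addr_eq0 => /eqP ->; rewrite cabsN cabsM hl mulr1.
  rewrite e1 !cabsM cabsN ha mul1r cabs_conj cabs_prod => hh.
  have c1 : cabs c != 0 by rewrite cabs_eq0.
  have {hh} : \prod_(b <- s) cabs (0 - cconj b) = 1 by apply: (mulfI c1); rewrite hh mulr1.
  have -> : \prod_(b <- s) cabs (0 - cconj b) = \prod_(b <- s) cabs b.
    by apply: eq_bigr => b _; rewrite sub0r cabsN cabs_conj.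
  clear - s1; elim: s s1 => [//|b s IH] s1; rewrite big_cons => hh.
  have b1 : cabs b <= 1 by apply: s1; rewrite mem_head.
  have s1' c : c \in s -> cabs c <= 1 by move=> hc; apply: s1; rewrite in_cons hc orbT.
  have q1 : \prod_(c <- s) cabs c <= 1.
    elim: s s1' {IH s1 hh} => [|c s IH] s1'; first by rewrite big_nil.
    rewrite big_cons mulr_ile1 ?cabs_ge0 ?prodr_ge0 // => *; rewrite ?cabs_ge0 //.
      by apply: s1'; rewrite mem_head.
    by apply: IH => d hd; apply: s1'; rewrite in_cons hd orbT.
  have q0 : 0 <= \prod_(c <- s) cabs c by apply: prodr_ge0 => *; exact: cabs_ge0.
  have b0 := cabs_ge0 b.
  have eb : cabs b = 1 by nra.
  move=> d; rewrite in_cons => /orP[/eqP ->//|hd]; apply: (IH s1') => //.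
  by move: hh; rewrite eb mul1r.
have ek t : (Q`_1).[t] = (- alpha * cconj c * \prod_(b <- s) (- cconj b) / c) * (Q`_0).[t].
  rewrite e1 e0 mulrA divfK // -!mulrA; congr (_ * (_ * _)); rewrite -big_split /=.
  apply: eq_big_seq => b hb; have hb1 := hu b hb.
  by rewrite (conj_unim hb1) mulrBr mulr1 mulrA mulNr mulVf ?unim_neq0 // mulN1r opprK addrC.
set k := (_ / c) in ek.
move=> t; rewrite level_lin /= ek.
have : c * (1 + k * l) = 0 by rewrite mulrDr mulr1 -[RHS]h (ek 0) -/c; ring.
move/eqP; rewrite mulf_eq0 (negbTE c0) /= => /eqP hk.
have -> : (Q`_0).[t] + k * (Q`_0).[t] * l = (Q`_0).[t] * (1 + k * l) by ring.
by rewrite hk mulr0.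
Qed.

(* On a slice, [|phi (r v)|] is a product of Blaschke factors [|r - b| / |1 - b r|]. *)
Lemma slice_schwarz_pick (v : C * C) : in_T2 v -> exists2 c : R, 0 < c &
  forall r : R, 0 < r < 1 ->
  c * (1 - r) <= 1 - cabs (phi ((r%:C)%C * v.1, (r%:C)%C * v.2)) ^+ 2.
Proof using hp hz hdeg hno.
move=> [v1 v2].
have hq t : cabs t < 1 -> (slice p v).[t] != 0.
  by move=> ht; rewrite (horner_slice _ _ hp); apply: hz; split; rewrite /= cabsM ?v1 ?v2 mul1r.
have [s [ss s1 es]] := disc_factor (size_slice v hp) hq.
set c := (slice p v).[0] in es; have c0 : c != 0 by apply: hq; rewrite cabs0.
pose f (r : R) := \prod_(b <- s) cabs ((r%:C)%C - b).
pose g (r : R) := \prod_(b <- s) cabs (1 - b * (r%:C)%C).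
have hD (r : R) : 0 < r < 1 -> in_D2 ((r%:C)%C * v.1, (r%:C)%C * v.2).
  by move=> /andP[r0 r1]; split; rewrite /= cabsM ?v1 ?v2 mulr1 cabs_real ger0_norm // ltW.
have ef (r : R) : 0 < r < 1 -> cabs (phi ((r%:C)%C * v.1, (r%:C)%C * v.2)) = f r / g r.
  move=> hr; have /andP[r0 r1] := hr.
  have rc : (r%:C)%C != 0 by rewrite -cabs_gt0 cabs_real ger0_norm // ltW.
  have hv1 := unim_neq0 v1; have hv2 := unim_neq0 v2.
  have cr : cabs (r%:C)%C = r by rewrite cabs_real ger0_norm // ltW.
  rewrite /Defs.phi cabsM cabsV.
  have -> : cabs (eval2 p ((r%:C)%C * v.1, (r%:C)%C * v.2)) = cabs c * g r.
    by rewrite ![(r%:C)%C * _]mulrC -(horner_slice _ _ hp) es cabsM cabs_prod.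
  have -> : cabs (eval2 pt ((r%:C)%C * v.1, (r%:C)%C * v.2)) = cabs c * f r.
    rewrite (eval2_ptilde hp) /=; try exact: mulf_neq0.
    have einv (x : C) : cabs x = 1 -> (cconj ((r%:C)%C * x))^-1 = x * ((r%:C)%C)^-1.
      by move=> hx; rewrite cconjM invfM (conj_unim hx) invrK mulrC; congr (_ * _^-1); exact: conjc_real.
    rewrite !einv // -(horner_slice _ _ hp) es !cabsM cabsX cabs_conj cabsM v1 v2 !mulr1 cr.
    rewrite ?cabsM ?cr ?v1 ?v2 ?mulr1 cabs_prod mulrCA; congr (_ * _).
    rewrite -exprSr -ss /f; clear - rc cr; elim: s => [|b s IH]; first by rewrite !big_nil mulr1.
    rewrite !big_cons /= exprS -IH -{1}cr mulrACA; congr (_ * _).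
    by rewrite -cabsM mulrBr mulr1 mulrCA mulfV // mulr1.
  by rewrite -mulf_div divff ?mul1r // cabs_eq0.
have id (b : C) (r : R) : cabs (1 - b * (r%:C)%C) ^+ 2 - cabs ((r%:C)%C - b) ^+ 2 =
    (1 - r ^+ 2) * (1 - cabs b ^+ 2).
  have r1 : complex.Re (1 : C) = 1 by [].
  have i1 : complex.Im (1 : C) = 0 by [].
  by rewrite !cabs_sqr !cReB !cImB !cReM !cImM r1 i1 /=; ring.
have le1 (b : C) (r : R) : cabs b <= 1 -> 0 < r < 1 -> cabs ((r%:C)%C - b) <= cabs (1 - b * (r%:C)%C).
  move=> hb /andP[r0 r1]; apply: sqr_le_cancel; first exact: cabs_ge0.
  rewrite -subr_ge0 id mulr_ge0 // subr_ge0 expr_le1 ?cabs_ge0 // ltW //.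
have gpos (b : C) (r : R) : cabs b <= 1 -> 0 < r < 1 -> 0 < cabs (1 - b * (r%:C)%C).
  move=> hb /andP[r0 r1]; apply: cabs_one_sub; rewrite cabsM cabs_real ger0_norm ?ltW //.
  by have := cabs_ge0 b; nra.
(* If all the [b] were unimodular, [|phi|] would be 1 at radius 1/2 on the slice. *)
have [b hb hb1] : exists2 b, b \in s & cabs b < 1.
  apply: contrapT => hn.
  have hu b : b \in s -> cabs b = 1.
    move=> hb; apply/eqP; rewrite eq_le s1 //= leNgt; apply/negP => h; apply: hn; by exists b.
  have h2 : 0 < (2^-1 : R) < 1 by rewrite invr_gt0 invf_lt1 ?ltr1n // ltr0n.
  have := phi_lt1 hp hz hdeg hno (hD _ h2); rewrite ef // /f /g.
  suff -> : \prod_(b <- s) cabs (((2^-1 : R)%:C)%C - b) = \prod_(b <- s) cabs (1 - b * ((2^-1 : R)%:C)%C).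
    rewrite divff ?ltxx // prodf_seq_neq0; apply/allP => b hb; apply/implyP => _.
    by rewrite gt_eqF // gpos // s1.
  apply: eq_big_seq => b hb; apply/eqP; rewrite -(@eqrXn2 _ 2) ?cabs_ge0 // eq_sym -subr_eq0.
  by rewrite id (hu b hb) expr1n subrr mulr0.
(* One interior factor suffices: [1 - |(r - b) / (1 - b r)|^2 = (1 - r^2) (1 - |b|^2) / |1 - b
   r|^2], with [1 - r^2 >= 1 - r] and [|1 - b r| <= 2]. *)
exists ((1 - cabs b ^+ 2) / 4).
  by rewrite divr_gt0 // subr_gt0 expr_lt1 // cabs_ge0.
move=> r hr; have /andP[r0 r1] := hr; rewrite ef //.
pose x := cabs ((r%:C)%C - b) / cabs (1 - b * (r%:C)%C).
have gb := gpos b r (ltW hb1) hr.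
have hx : f r / g r <= x.
  rewrite /f /g !(big_rem b hb) /= -mulf_div -[leRHS]mulr1; apply: ler_wpM2l.
    by rewrite divr_ge0 ?cabs_ge0.
  have hs b' : b' \in rem b s -> cabs b' <= 1 by move=> /mem_rem; exact: s1.
  rewrite ler_pdivrMr ?mul1r.
    rewrite big_seq_cond [leRHS]big_seq_cond; apply: ler_prod => b' /andP[hb' _].
    by rewrite cabs_ge0 le1 // hs.
  rewrite big_seq_cond; apply: prodr_gt0 => b' /andP[hb' _]; by rewrite gpos // hs.
have f0 : 0 <= f r / g r.
  by rewrite divr_ge0 // prodr_ge0 // => *; exact: cabs_ge0.
have hx2 : (f r / g r) ^+ 2 <= x ^+ 2 by apply: sqr_le.
suff h : (1 - cabs b ^+ 2) / 4 * (1 - r) <= 1 - x ^+ 2 by lra.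
have -> : 1 - x ^+ 2 = (1 - r ^+ 2) * (1 - cabs b ^+ 2) / cabs (1 - b * (r%:C)%C) ^+ 2.
  rewrite -id /x; field; by rewrite gt_eqF.
rewrite ler_pdivlMr ?exprn_gt0 //.
have u1 : cabs (1 - b * (r%:C)%C) <= 2.
  have := cabsB 1 (b * (r%:C)%C); rewrite cabs1 cabsM cabs_real ger0_norm ?(ltW r0) //.
  have := cabs_ge0 b; nra.
have u2 : cabs (1 - b * (r%:C)%C) ^+ 2 <= 4.
  by have := sqr_le (ltW gb) u1; lra.
have k0 : 0 <= 1 - cabs b ^+ 2 by rewrite subr_ge0 expr_le1 ?cabs_ge0 // ltW.
have m0 : 0 <= (1 - cabs b ^+ 2) / 4 * (1 - r).
  by rewrite mulr_ge0 ?divr_ge0 // subr_ge0 ltW.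
apply: (@le_trans _ _ ((1 - cabs b ^+ 2) / 4 * (1 - r) * 4)); first exact: ler_wpM2l.
have -> : (1 - cabs b ^+ 2) / 4 * (1 - r) * 4 = (1 - cabs b ^+ 2) * (1 - r) by field.
rewrite [leRHS]mulrC; apply: ler_wpM2l => //; nra.
Qed.

End LevelSet.

(** * Poisson integrals and non-tangential maximal functions *)

Section CircleIntegrals.
Context {R : realType}.
Local Notation C := R[i].
Local Notation mu := (@lebesgue_measure R).
Implicit Types (f g : R -> C) (u v : R -> R).

Definition ccont f := continuous (fun s => complex.Re (f s)) /\ continuous (fun s => complex.Im (f s)).

Lemma rcontD u v : continuous u -> continuous v -> continuous (fun s => u s + v s).
Proof. by move=> hu hv s; apply: continuousD; [exact: hu | exact: hv]. Qed.
Lemma rcontN u : continuous u -> continuous (fun s => - u s).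
Proof. by move=> hu s; apply: continuousN; exact: hu. Qed.
Lemma rcontM u v : continuous u -> continuous v -> continuous (fun s => u s * v s).
Proof. by move=> hu hv s; apply: continuousM; [exact: hu | exact: hv]. Qed.
Lemma rcont_cst (c : R) : continuous (fun _ : R => c).
Proof. by move=> s; exact: cst_continuous. Qed.
Lemma rcontV u : continuous u -> (forall s, u s != 0) -> continuous (fun s => (u s)^-1).
Proof. by move=> hu h0 s; apply: continuousV; [exact: h0 | exact: hu]. Qed.
Lemma rcont_sum (I : Type) (r : seq I) (F : I -> R -> R) :
  (forall i, continuous (F i)) -> continuous (fun s => \sum_(i <- r) F i s).
Proof.
move=> h; elim: r => [|i r IH].
  have -> : (fun s : R => \sum_(i <- [::]) F i s) = fun=> 0.
    by apply/funext => s; rewrite big_nil.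
  exact: rcont_cst.
have -> : (fun s : R => \sum_(j <- i :: r) F j s) = fun s => F i s + \sum_(j <- r) F j s.
  by apply/funext => s; rewrite big_cons.
exact: rcontD.
Qed.

Lemma ccont_cst (c : C) : ccont (fun=> c).
Proof. by split; exact: rcont_cst. Qed.
Lemma ccontD f g : ccont f -> ccont g -> ccont (fun s => f s + g s).
Proof.
move=> [f1 f2] [g1 g2]; split.
  by under eq_fun do rewrite cReD; exact: rcontD.
by under eq_fun do rewrite cImD; exact: rcontD.
Qed.
Lemma ccontM f g : ccont f -> ccont g -> ccont (fun s => f s * g s).
Proof.
move=> [f1 f2] [g1 g2]; split.
  under eq_fun do rewrite cReM.
  by apply: rcontD; [exact: rcontM | apply: rcontN; exact: rcontM].
under eq_fun do rewrite cImM.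
by apply: rcontD; exact: rcontM.
Qed.
Lemma ccont_expi : ccont (@expi R).
Proof. by split; [exact: continuous_cos | exact: continuous_sin]. Qed.
Lemma ccontX f k : ccont f -> ccont (fun s => f s ^+ k).
Proof.
move=> hf; elim: k => [|k IH].
  by under eq_fun do rewrite expr0; exact: ccont_cst.
by under eq_fun do rewrite exprS; exact: ccontM.
Qed.
Lemma ccont_conj f : ccont f -> ccont (fun s => cconj (f s)).
Proof.
move=> [f1 f2]; split; first by under eq_fun do rewrite Re_conj.
by under eq_fun do rewrite Im_conj; exact: rcontN.
Qed.
Lemma ccont_sum (I : Type) (r : seq I) (F : I -> R -> C) :
  (forall i, ccont (F i)) -> ccont (fun s => \sum_(i <- r) F i s).
Proof.
move=> h; elim: r => [|i r IH].
  have -> : (fun s : R => \sum_(i <- [::]) F i s) = fun=> 0.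
    by apply/funext => s; rewrite big_nil.
  exact: ccont_cst.
have -> : (fun s : R => \sum_(j <- i :: r) F j s) = fun s => F i s + \sum_(j <- r) F j s.
  by apply/funext => s; rewrite big_cons.
exact: ccontD.
Qed.
Lemma rcont_cabs f : ccont f -> continuous (fun s => cabs (f s)).
Proof.
move=> [f1 f2] s; rewrite /cabs.
apply: (@continuous_comp _ _ _ (fun s => complex.Re (f s) ^+ 2 + complex.Im (f s) ^+ 2) Num.sqrt).
  by apply: rcontD => x; under eq_fun do rewrite expr2; exact: rcontM.
exact: sqrt_continuous.
Qed.
Lemma rcont_Re f : ccont f -> continuous (fun s => complex.Re (f s)).
Proof. by case. Qed.

Lemma cint u a b : continuous u -> mu.-integrable `[a, b] (EFin \o u).
Proof.
move=> hu; apply: continuous_compact_integrable; first exact: segment_compact.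
exact: continuous_subspaceT.
Qed.

Lemma mseg (a b : R) : measurable (`[a, b]%classic : set R).
Proof. exact: measurable_itv. Qed.

Local Notation "'I[' a , b ']' u" := (\int[mu]_(s in `[a, b]) u s)
  (at level 10, a, b at level 200, u at level 9).

Lemma cintD u v a b : continuous u -> continuous v ->
  I[a, b] (fun s => u s + v s) = I[a, b] u + I[a, b] v.
Proof. by move=> hu hv; rewrite RintegralD //; exact: cint. Qed.

Lemma cintZ (c : R) u a b : continuous u -> I[a, b] (fun s => c * u s) = c * I[a, b] u.
Proof. by move=> hu; rewrite RintegralZl //; exact: cint. Qed.

Lemma cint_le u v a b : continuous u -> continuous v ->
  (forall s, a <= s <= b -> u s <= v s) -> I[a, b] u <= I[a, b] v.
Proof.
move=> hu hv h; apply: le_Rintegral; [exact: mseg | exact: cint | exact: cint |].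
by move=> s /=; rewrite in_itv; exact: h.
Qed.

Lemma cint_cst (c : R) a b : a <= b -> I[a, b] (fun=> c) = c * (b - a).
Proof.
move=> hab; rewrite Rintegral_cst; last exact: mseg.
suff h : mu [set` `[a, b]] = (b - a)%:E by congr (_ * _); exact: (congr1 fine h).
rewrite (lebesgue_measure_itv `[a, b]) /= lte_fin; case: ltP => [h|h]; first by [].
by have -> : a = b; [apply/le_anti; rewrite hab | rewrite subrr].
Qed.

Lemma cint_sum (T : Type) (r : seq T) (F : T -> R -> R) a b : (forall i, continuous (F i)) ->
  a <= b -> I[a, b] (fun s => \sum_(i <- r) F i s) = \sum_(i <- r) I[a, b] (F i).
Proof.
move=> h hab; elim: r => [|i r IH].
  rewrite big_nil; have -> : (fun s : R => \sum_(i <- [::]) F i s) = fun=> 0.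
    by apply/funext => s; rewrite big_nil.
  by rewrite cint_cst // mul0r.
have -> : (fun s : R => \sum_(j <- i :: r) F j s) = fun s => F i s + \sum_(j <- r) F j s.
  by apply/funext => s; rewrite big_cons.
by rewrite cintD // ?IH ?big_cons //; exact: rcont_sum.
Qed.

Lemma expi_per m (s : R) : expi (s + 2 * pi) ^+ m = expi s ^+ m.
Proof. by rewrite expiD expi2pi mulr1. Qed.

Lemma trig_int (a : R) m (c : C) : (0 < m)%N ->
  I[a, a + 2 * pi] (fun s => complex.Re (c * expi s ^+ m)) = 0.
Proof.
move=> m0; set M : R := m%:R; have M0 : M != 0 by rewrite /M pnatr_eq0 -lt0n.
have ef s : complex.Re (c * expi s ^+ m) =
    complex.Re c * cos (M * s) - complex.Im c * sin (M * s).
  by rewrite -expiMn cReM.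
pose F (s : R) := (complex.Re c / M) * sin (M * s) + (complex.Im c / M) * cos (M * s).
have dF (s : R) : is_derive s (1:R) F (complex.Re (c * expi s ^+ m)).
  rewrite ef; apply: is_derive_eq.
  rewrite /GRing.scale /= ?mulr1 ?mul1r ?addr0 ?add0r; field; exact: M0.
have p0 : a < a + 2 * pi by rewrite ltrDl mulr_gt0 // pi_gt0.
have cF : continuous F.
  move=> s; apply: differentiable_continuous; apply/derivable1_diffP.
  by have := dF s; case.
rewrite /Rintegral (@continuous_FTC2 _ _ F) //.
- suff -> : F (a + 2 * pi) = F a by rewrite subee.
  have e : expi (M * (a + 2 * pi)) = expi (M * a).
    by rewrite !expiMn expi_per.
  rewrite /F; have := congr1 (@complex.Re R) e; have := congr1 (@complex.Im R) e.
  by rewrite /= => -> ->.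
- apply: continuous_subspaceT; apply: rcont_Re; apply: ccontM; first exact: ccont_cst.
  exact: ccontX ccont_expi.
- split.
  + by move=> s _; have := dF s; case.
  + by apply: cvg_at_right_filter; exact: cF.
  + by apply: cvg_at_left_filter; exact: cF.
- by move=> s _; rewrite derive1E; have := dF s; case.
Qed.

Lemma trig_int2 (a : R) j k (c : C) :
  I[a, a + 2 * pi] (fun s => complex.Re (c * expi s ^+ j * cconj (expi s ^+ k))) =
  if j == k then 2 * pi * complex.Re c else 0.
Proof.
have p0 : a <= a + 2 * pi by rewrite lerDl mulr_ge0 // pi_ge0.
have hle j' k' (s : R) : (k' <= j')%N -> expi s ^+ j' * cconj (expi s ^+ k') = expi s ^+ (j' - k').
  move=> h; rewrite -{1}(subnK h) exprD -mulrA mul_conj cabsX cabs_expi !expr1n mulr1 //.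
have [hjk|hjk|<-] := ltngtP j k.
- have -> : (fun s : R => complex.Re (c * expi s ^+ j * cconj (expi s ^+ k))) =
     fun s => complex.Re (cconj c * expi s ^+ (k - j)).
    apply/funext => s; rewrite -Re_conj -mulrA !cconjM cconjK; congr (complex.Re (_ * _)).
    by rewrite mulrC -(hle k j) // ltnW.
  by apply: trig_int; rewrite subn_gt0.
- have -> : (fun s : R => complex.Re (c * expi s ^+ j * cconj (expi s ^+ k))) =
     fun s => complex.Re (c * expi s ^+ (j - k)).
    by apply/funext => s; rewrite -mulrA hle // ltnW.
  by apply: trig_int; rewrite subn_gt0.
have -> : (fun s : R => complex.Re (c * expi s ^+ j * cconj (expi s ^+ j))) = fun=> complex.Re c.
  by apply/funext => s; rewrite -mulrA hle // subnn expr0 mulr1.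
by rewrite cint_cst // addrAC subrr add0r mulrC.
Qed.

Definition tpoly N (q : nat -> C) (x : C) : C := \sum_(j < N) q j * x ^+ j.

Lemma ccont_tpoly N q : ccont (fun s => tpoly N q (expi s)).
Proof.
apply: ccont_sum => j; apply: ccontM; first exact: ccont_cst.
exact: ccontX ccont_expi.
Qed.

Lemma ccont_term (c : C) j k : ccont (fun s => c * expi s ^+ j * cconj (expi s ^+ k)).
Proof.
apply: ccontM; last by apply: ccont_conj; exact: ccontX ccont_expi.
by apply: ccontM; [exact: ccont_cst | exact: ccontX ccont_expi].
Qed.

Lemma parseval_int (a : R) N q :
  I[a, a + 2 * pi] (fun s => cabs (tpoly N q (expi s)) ^+ 2) =
  2 * pi * \sum_(j < N) cabs (q j) ^+ 2.
Proof.
have p0 : a <= a + 2 * pi by rewrite lerDl mulr_ge0 // pi_ge0.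
have -> : (fun s : R => cabs (tpoly N q (expi s)) ^+ 2) = fun s =>
    \sum_(j < N) \sum_(k < N) complex.Re (q j * cconj (q k) * expi s ^+ j * cconj (expi s ^+ k)).
  apply/funext => s; rewrite -Re_mul_conj /tpoly cconj_sum mulr_suml Re_sum.
  apply: eq_bigr => j _; rewrite mulr_sumr Re_sum; apply: eq_bigr => k _.
  by congr complex.Re; rewrite cconjM; ring.
rewrite (cint_sum _ (F := fun (j : 'I_N) s => \sum_(k < N)
   complex.Re (q j * cconj (q k) * expi s ^+ j * cconj (expi s ^+ k)))) //; last first.
  by move=> j; apply: rcont_sum => k; apply: rcont_Re; exact: ccont_term.
rewrite mulr_sumr; apply: eq_bigr => j _.
rewrite (cint_sum _ (F := fun (k : 'I_N) s =>
   complex.Re (q j * cconj (q k) * expi s ^+ j * cconj (expi s ^+ k)))) //; last first.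
  by move=> k; apply: rcont_Re; exact: ccont_term.
rewrite (bigD1 j) //= trig_int2 eqxx Re_mul_conj big1 ?addr0 // => k hk.
rewrite trig_int2; case: eqP => // e; move: hk; rewrite -val_eqE /= e eqxx //.
Qed.

Definition pois (z : C) (s : R) : R := (1 - cabs z ^+ 2) / cabs (expi s - z) ^+ 2.

Lemma expi_sub_neq0 (z : C) s : cabs z < 1 -> expi s - z != 0.
Proof.
move=> hz; rewrite subr_eq0; apply/eqP => e.
by have := cabs_expi s; rewrite e => e1; rewrite e1 ltxx in hz.
Qed.

Lemma rcont_pois z : cabs z < 1 -> continuous (pois z).
Proof.
move=> hz; apply: rcontM; first exact: rcont_cst.
apply: rcontV => [|s]; last by rewrite expf_neq0 // cabs_eq0 expi_sub_neq0.
have h : continuous (fun s : R => cabs (expi s - z)).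
  by apply: rcont_cabs; apply: (ccontD ccont_expi (ccont_cst _)).
by under eq_fun do rewrite expr2; exact: rcontM.
Qed.

Lemma pois_ge0 z s : cabs z < 1 -> 0 <= pois z s.
Proof.
move=> hz; have z0 := cabs_ge0 z; rewrite divr_ge0 ?sqr_ge0 //.
by move: (cabs z) hz z0 => x h h0; nra.
Qed.

(** Partial sum of the Fourier series of the Poisson kernel. *)
Definition pois_part L (z : C) (s : R) : R :=
  1 + \sum_(k < L) 2 * complex.Re (cconj z ^+ k.+1 * expi s ^+ k.+1).

(** With [x = conj z e^(is)] the kernel is [Re ((1 + x) / (1 - x))], and it differs from the partial
    sum by [Re (2 x^(L+1) / (1 - x))]. *)
Lemma pois_part_err L z s : cabs z < 1 ->
  `|pois z s - pois_part L z s| <= 2 * cabs z ^+ L.+1 / (1 - cabs z).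
Proof.
move=> hz; set x := cconj z * expi s.
have cx : cabs x = cabs z by rewrite cabsM cabs_conj cabs_expi mulr1.
have x1 : 1 - x != 0 by apply: one_sub_neq0; rewrite cx.
have ce : cabs (expi s - z) = cabs (1 - x).
  rewrite -(cabs_conj (1 - x)) cconjB cconj1 cconjM cconjK.
  have -> : expi s - z = expi s * (1 - z * cconj (expi s)).
    by rewrite mulrBr mulr1 mulrCA mul_conj cabs_expi expr1n mulr1.
  by rewrite cabsM cabs_expi mul1r.
have hp : pois z s = complex.Re ((1 + x) / (1 - x)).
  rewrite /pois ce -cx.
  have -> : (1 + x) / (1 - x) = ((1 + x) * cconj (1 - x)) * ((cabs (1 - x) ^+ 2)^-1%:C)%C.
    rewrite real_complexV -mul_conj.
    have : cconj (1 - x) != 0 by rewrite cconj_eq0.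
    by move: (cconj (1 - x)) => w w0; field; rewrite x1 w0.
  rewrite cReM /= mulr0 subr0; congr (_ / _).
  rewrite cconjB cconj1 mulrBr mulr1 mulrDl mul1r cReB !cReD Re_conj Re_mul_conj /=; ring.
have hpp : pois_part L z s = complex.Re ((1 + x - 2 * x ^+ L.+1) / (1 - x)).
  rewrite /pois_part.
  have -> : \sum_(k < L) 2 * complex.Re (cconj z ^+ k.+1 * expi s ^+ k.+1) =
      complex.Re (2 * \sum_(k < L) x ^+ k.+1).
    rewrite -mulr_sumr.
    have e2 (w : C) : complex.Re (2 * w) = 2 * complex.Re w.
      by rewrite !mulr_natl !mulr2n cReD.
    rewrite e2 Re_sum; congr (_ * _); apply: eq_bigr => k _.
    by rewrite -exprMn.
  have -> : 1 = complex.Re (1 : C) by [].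
  rewrite -cReD; congr complex.Re.
  have hs : (1 - x) * \sum_(k < L) x ^+ k.+1 = x - x ^+ L.+1.
    elim: L => [|L IH]; first by rewrite big_ord0 mulr0 expr1 subrr.
    by rewrite big_ord_recr /= mulrDr IH !exprS; ring.
  apply: (mulfI x1); rewrite mulrDr mulr1 mulrCA hs [RHS]mulrC divfK //; ring.
have -> : pois z s - pois_part L z s = complex.Re (2 * x ^+ L.+1 / (1 - x)).
  by rewrite hp hpp -cReB; congr complex.Re; field.
apply: (le_trans (cabs_Re _)); rewrite !cabsM cabsV cabsX cx.
have -> : cabs (2 : C) = 2.
  by have := cabs_real (2 : R); rewrite ger0_norm // rmorph_nat.
apply: ler_wpM2l; first by rewrite mulr_ge0 ?exprn_ge0 ?cabs_ge0.
rewrite lef_pV2 ?posrE ?subr_gt0 ?cabs_gt0 //.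
by have := cabs_subr 1 x; rewrite cabs1 cx.
Qed.

(** Orthogonality of the exponentials: for [N <= L + 1] the partial sum contains all frequencies of
    the polynomial, so it reproduces the value at [z] exactly. *)
Lemma tpoly_pois_part (a : R) N L q (z : C) : (N <= L.+1)%N ->
  I[a, a + 2 * pi] (fun s => complex.Re (tpoly N q (expi s)) * pois_part L z s) =
  2 * pi * complex.Re (tpoly N q z).
Proof.
move=> hN; have p0 : a <= a + 2 * pi by rewrite lerDl mulr_ge0 // pi_ge0.
pose F (j : 'I_N) (k : 'I_L.+1) s :=
  complex.Re ((q j * z ^+ k) * expi s ^+ j * cconj (expi s ^+ k)).
pose G (j : 'I_N) (k : 'I_L) s :=
  complex.Re ((q j * cconj z ^+ k.+1) * expi s ^+ (j + k.+1)).
have cF j k : continuous (F j k) by apply: rcont_Re; exact: ccont_term.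
have cG j k : continuous (G j k).
  by apply: rcont_Re; apply: ccontM; [exact: ccont_cst | exact: ccontX ccont_expi].
have e : (fun s => complex.Re (tpoly N q (expi s)) * pois_part L z s) =
  fun s => \sum_(j < N) (\sum_(k < L.+1) F j k s + \sum_(k < L) G j k s).
  apply/funext => s; rewrite /tpoly Re_sum mulr_suml; apply: eq_bigr => j _.
  rewrite /pois_part mulrDr mulr1 big_ord_recl /= {1}/F !expr0 cconj1 !mulr1 -addrA.
  congr (_ + _); rewrite mulr_sumr -big_split; apply: eq_bigr => k _ /=.
  rewrite /F /G /bump /= ?add1n.
  set A := q j * expi s ^+ j; set B := cconj z ^+ k.+1 * expi s ^+ k.+1.
  have -> : q j * z ^+ k.+1 * expi s ^+ j * cconj (expi s ^+ k.+1) = A * cconj B.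
    by rewrite /A /B [cconj (cconj _ ^+ _ * _)]cconjM !cconjX cconjK; ring.
  have -> : q j * cconj z ^+ k.+1 * expi s ^+ (j + k.+1) = A * B.
    by rewrite /A /B exprD; ring.
  by clearbody A B; rewrite !cReM Re_conj Im_conj; ring.
rewrite e (cint_sum _ (F := fun j s => \sum_(k < L.+1) F j k s + \sum_(k < L) G j k s)) //; last first.
  by move=> j; apply: rcontD; apply: rcont_sum.
rewrite /tpoly Re_sum mulr_sumr; apply: eq_bigr => j _.
rewrite cintD; [|exact: rcont_sum|exact: rcont_sum].
rewrite (cint_sum _ (F := fun k s => F j k s)) // (cint_sum _ (F := fun k s => G j k s)) //.
rewrite [X in _ + X]big1 ?addr0; last by move=> k _; apply: trig_int; rewrite addnS.
have hj : (j < L.+1)%N by apply: leq_trans hN.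
rewrite (bigD1 (Ordinal hj)) //= {1}/F trig_int2 eqxx big1 ?addr0 // => k hk.
rewrite /F trig_int2; case: eqP => // ej; move: hk; rewrite -val_eqE /= ej eqxx //.
Qed.

(** After a rotation the value at [z] is a nonnegative real part, reproduced by a partial sum of the
    kernel; that sum is within [eps] of the kernel, which costs [eps W] with [W] the integral of the
    modulus. *)
Lemma poisson_subharmonic (a : R) N q (z : C) : cabs z < 1 ->
  2 * pi * cabs (tpoly N q z) <=
  I[a, a + 2 * pi] (fun s => cabs (tpoly N q (expi s)) * pois z s).
Proof.
move=> hz; have p0 : a <= a + 2 * pi by rewrite lerDl mulr_ge0 // pi_ge0.
have [g g1 eg] := polar (tpoly N q z).
have et x : g * tpoly N q x = tpoly N (fun j => g * q j) x.
  by rewrite /tpoly mulr_sumr; apply: eq_bigr => j _; rewrite mulrA.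
have ch : continuous (fun s : R => cabs (tpoly N q (expi s))) by apply: rcont_cabs; exact: ccont_tpoly.
set W := I[a, a + 2 * pi] (fun s => cabs (tpoly N q (expi s))).
have W0 : 0 <= W by apply: Rintegral_ge0 => s _; exact: cabs_ge0.
apply/ler_addgt0Pr => e e0.
have [L hL] : exists2 L, (N <= L.+1)%N & 2 * cabs z ^+ L.+1 / (1 - cabs z) * W <= e.
  have q0 : 0 < 1 - cabs z by rewrite subr_gt0.
  have := @cvg_expr R (cabs z); rewrite ger0_norm ?cabs_ge0 // => /(_ hz) /cvgrPdist_lt.
  pose d := e * (1 - cabs z) / (2 * (W + 1)).
  have W1 : 0 < W + 1 by lra.
  have d0 : 0 < d by rewrite !divr_gt0 // mulr_gt0.
  move=> /(_ d d0)[m _ hm]; exists (maxn m N); first by lia.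
  have := hm (maxn m N).+1 => /(_ _)/=; rewrite sub0r normrN ger0_norm ?exprn_ge0 ?cabs_ge0 //.
  move=> /(_ _) hh; have {}hh : cabs z ^+ (maxn m N).+1 < d by apply: hh; rewrite /=; lia.
  have x0 : 0 <= cabs z ^+ (maxn m N).+1 by rewrite exprn_ge0 ?cabs_ge0.
  set x := cabs z ^+ _ in hh x0 *.
  rewrite -mulrA [_^-1 * W]mulrC mulrA ler_pdivrMr //.
  have h1 : d * (2 * (W + 1)) = e * (1 - cabs z) by rewrite /d divfK // gt_eqF // mulr_gt0.
  have h2 : x * (2 * (W + 1)) <= d * (2 * (W + 1)) by apply: ler_wpM2r; lra.
  nra.
move=> hL2; set eps := 2 * cabs z ^+ L.+1 / (1 - cabs z) in hL2.
have -> : cabs (tpoly N q z) = complex.Re (tpoly N (fun j => g * q j) z) by rewrite -et eg.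
rewrite -(tpoly_pois_part a _ _ hL).
have cpp : continuous (pois_part L z).
  apply: rcontD; first exact: rcont_cst.
  apply: rcont_sum => k; apply: rcontM; first exact: rcont_cst.
  by apply: rcont_Re; apply: ccontM; [exact: ccont_cst | exact: ccontX ccont_expi].
apply: (@le_trans _ _ (I[a, a + 2 * pi] (fun s => cabs (tpoly N q (expi s)) * pois z s +
    eps * cabs (tpoly N q (expi s))))); last first.
  rewrite cintD ?cintZ //; first by rewrite lerD2l.
    by apply: rcontM => //; exact: rcont_pois.
  by apply: rcontM => //; exact: rcont_cst.
apply: cint_le.
- by apply: rcontM => //; apply: rcont_Re; exact: ccont_tpoly.
- apply: rcontD; apply: rcontM => //; [exact: rcont_pois | exact: rcont_cst].
move=> s _; rewrite -et; set t := tpoly N q (expi s).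
have h1 : `|complex.Re (g * t)| <= cabs t.
  by apply: (le_trans (cabs_Re _)); rewrite cabsM g1 mul1r.
have h2 := pois_part_err L s hz; rewrite -/eps in h2.
apply: (le_trans (ler_norm _)); rewrite normrM.
have h3 : `|pois_part L z s| <= pois z s + eps.
  have hp := pois_ge0 s hz; move: h2; rewrite !ler_norml => /andP[? ?]; apply/andP; split; lra.
rewrite [eps * _]mulrC -mulrDr.
by apply: ler_pM; rewrite ?normr_ge0.
Qed.

End CircleIntegrals.

(** * Maximal functions in approach regions *)

Section Nontangential.
Context {R : realType}.
Local Notation C := R[i].
Local Notation mu := (@lebesgue_measure R).

Local Notation "'I[' a , b ']' u" := (\int[mu]_(s in `[a, b]) u s)
  (at level 10, a, b at level 200, u at level 9).

Lemma cint_split (u : R -> R) a x b : continuous u -> a <= x -> x <= b ->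
  I[a, b] u = I[a, x] u + I[x, b] u.
Proof.
move=> hu h1 h2.
have := @Rintegral_itvB R u (BLeft a) (BRight b) x (cint a b hu).
rewrite !bnd_simp => /(_ h1 h2) e.
have h : I[x, b] u = \int[mu]_(s in `]x, b]) u s.
  rewrite Rintegral_itv_obnd_cbnd //.
  by apply: integrableS (cint x b hu) => //; exact: subset_itv_oc_cc.
by rewrite h -e addrC subrK.
Qed.

Lemma sin_le (x : R) : 0 <= x -> sin x <= x.
Proof.
move=> x0; have [s _] : exists2 s : R, s \in `[0, x] & sin x - sin 0 = cos s * (x - 0).
  apply: (@MVT_segment R sin cos) => //.
  by apply: continuous_subspaceT; exact: continuous_sin.
rewrite sin0 !subr0 => ->; have := cos_le1 s; nra.
Qed.

Lemma sin_lip (x : R) : `|sin x| <= `|x|.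
Proof.
have h (y : R) : 0 <= y -> `|sin y| <= y.
  move=> y0; have [y3|y3] := leP y 1.
    rewrite ger0_norm ?sin_le //; move: y0; rewrite le_eqVlt => /predU1P[<-|y0]; first by rewrite sin0.
    by apply: ltW; apply: sin2_gt0; lra.
  by apply: (le_trans _ (ltW y3)); rewrite ler_norml sin_geN1 sin_le1.
have [x0|x0] := leP 0 x; first by rewrite [X in _ <= X]ger0_norm // h.
rewrite -normrN -sinN -[X in _ <= X]normrN [X in _ <= X]gtr0_norm ?oppr_gt0 //; apply: h; lra.
Qed.

(** [sin y = 2 sin w cos w] with [w = y / 2], and the mean value theorem writes [sin w] as
    [w cos xi]; both cosines are at least [cos (pi / 4)], whose square is 1/2. *)
Lemma jordan (y : R) : 0 <= y <= pi / 2 -> y / 2 <= sin y.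
Proof.
move=> /andP[y0 y1]; set w := y / 2.
have p0 := @pi_gt0 R.
have w0 : 0 <= w by rewrite /w; lra.
have [xi xi1 e] : exists2 xi : R, xi \in `[0, w] & sin w - sin 0 = cos xi * (w - 0).
  apply: (@MVT_segment R sin cos) => //.
  by apply: continuous_subspaceT; exact: continuous_sin.
move: e; rewrite sin0 !subr0 => e.
move: xi1; rewrite in_itv /= => /andP[xi0 xi1].
have m (a b : R) : 0 <= a -> b <= pi -> a <= b -> cos b <= cos a.
  move=> a0 b1; rewrite le_eqVlt => /predU1P[->//|ab]; apply: ltW.
  by rewrite ltr_cos // in_itv /=; apply/andP; split; lra.
have e4 : cos (pi / 4 : R) ^+ 2 = 1 / 2.
  have := cos_mulr2n (pi / 4 : R); have -> : (pi / 4 : R) *+ 2 = pi / 2 by rewrite mulr2n; field.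
  by rewrite cos_pihalf mulr2n => h; lra.
have c4 : 0 <= cos (pi / 4 : R) by apply: cos_ge0_pihalf; apply/andP; split; lra.
have c1 : cos (pi / 4) <= cos xi by apply: m; rewrite /w in xi1; lra.
have c2 : cos (pi / 4) <= cos w by apply: m; rewrite /w; lra.
have -> : y = w *+ 2 by rewrite /w mulr2n; field.
rewrite sin_mulr2n e !mulr2n.
move: (cos (pi / 4)) (cos xi) (cos w) e4 c4 c1 c2 => a b c *.
have h1 : a * a <= c * b by apply: ler_pM.
nra.
Qed.

Lemma chord (s t : R) : cabs (expi s - expi t) = 2 * `|sin ((s - t) / 2)|.
Proof.
apply/eqP; rewrite -(eqrXn2 (n := 2)) ?mulr_ge0 ?cabs_ge0 //; apply/eqP.
rewrite cabs_sqr exprMn real_normK ?num_real // cReB cImB /=.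
have -> : (cos s - cos t) ^+ 2 + (sin s - sin t) ^+ 2 =
  (cos s ^+ 2 + sin s ^+ 2) + (cos t ^+ 2 + sin t ^+ 2) - 2 * (cos s * cos t + sin s * sin t) by ring.
rewrite !cos2Dsin2 -cosB.
have {1}-> : s - t = ((s - t) / 2) *+ 2 by rewrite mulr2n; field.
rewrite cos_mulr2n sin2cos2 mulr2n; ring.
Qed.

Lemma chord_le (s t : R) : cabs (expi s - expi t) <= `|s - t|.
Proof.
rewrite chord; have := sin_lip ((s - t) / 2).
by rewrite normrM [ `|2^-1|]ger0_norm ?invr_ge0 //; lra.
Qed.

Lemma chord_ge (s t : R) : `|s - t| <= pi -> `|s - t| / 2 <= cabs (expi s - expi t).
Proof.
move=> h; rewrite chord.
suff : `|s - t| / 2 / 2 <= `|sin ((s - t) / 2)| by lra.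
have e : `|sin ((s - t) / 2)| = `|sin (`|s - t| / 2)|.
  by have [h0|h0] := leP 0 (s - t); [rewrite [in RHS](ger0_norm h0) | rewrite [in RHS](ltr0_norm h0) mulNr sinN normrN].
rewrite e; apply: (le_trans _ (ler_norm _)); apply: jordan.
by rewrite divr_ge0 //= ler_pM2r.
Qed.

(** In the approach region [|e^(is) - z|] is at least [d = 1 - |z|] and at least of order [|t - s|].
    For the least [k] with [|t - s| < 2^k d] the kernel is therefore at most of order [1 / (4^k d)],
    so a single term of the sum dominates it. *)
Lemma pois_dyadic (c t : R) (z : C) (K : nat) s : 1 < c -> cabs z < 1 ->
  cabs (expi t - z) < c * (1 - cabs z) -> pi < 2 ^+ K * (1 - cabs z) -> `|t - s| <= pi ->
  pois z s <= \sum_(k < K.+1)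
    32 * (1 + c) ^+ 2 / 4 ^+ k / (1 - cabs z) * \1_(ball t (2 ^+ k * (1 - cabs z))) s.
Proof.
move=> c1 hz hc hK hs; set d := 1 - cabs z in hc hK *.
have d0 : 0 < d by rewrite subr_gt0.
have hd : 1 - cabs z ^+ 2 <= 2 * d by rewrite /d; have := cabs_ge0 z; nra.
have hk : exists k, `|t - s| < 2 ^+ k * d by exists K; lra.
have [k kP kmin] := ex_minnP hk.
have kK : (k < K.+1)%N by apply: kmin; lra.
rewrite (bigD1 (Ordinal kK)) //=.
have hb : \1_(ball t (2 ^+ k * d)) s = 1 :> R.
  by rewrite indicE mem_set // /ball /=.
rewrite hb mulr1; apply: ler_wpDr.
  apply: sumr_ge0 => i _; rewrite mulr_ge0 // ?indicE ?ler0n //.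
  apply: divr_ge0; last exact: ltW.
  by apply: divr_ge0; rewrite ?exprn_ge0 // mulr_ge0 // sqr_ge0.
have a0 : 0 < cabs (expi s - z) by rewrite cabs_gt0 expi_sub_neq0.
rewrite /pois ler_pdivrMr ?exprn_gt0 //.
apply: (le_trans hd).
have ad : d <= cabs (expi s - z) by have := cabs_subr (expi s) z; rewrite cabs_expi.
case: k kP kmin {kK hb} => [|k] kP kmin.
  rewrite expr0 divr1; move: (cabs _) ad a0 => a ad a0.
  rewrite mulrAC ler_pdivlMr //.
  have : d * d <= a ^+ 2 by rewrite expr2; apply: ler_pM => //; lra.
  have : 1 <= (1 + c) ^+ 2 by rewrite expr2; nra.
  nra.
have x1 : 2 ^+ k * d <= `|t - s|.
  by rewrite leNgt; apply/negP => h; have := kmin _ h; rewrite ltnn.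
have x2 : `|t - s| / 2 <= (1 + c) * cabs (expi s - z).
  apply: (@le_trans _ _ (cabs (expi s - expi t))); first by rewrite distrC chord_ge // distrC.
  apply: (le_trans (cabs_dist (expi s) (expi t) z)); rewrite mulrDl mul1r lerD2l.
  rewrite (cabsBC z); apply: (le_trans (ltW hc)); apply: ler_wpM2l => //; lra.
move: (`|t - s|) x1 x2 => x x1 x2.
move: (cabs (expi s - z)) x2 => a x2.
have p0 : 0 < 2 ^+ k :> R by rewrite exprn_gt0.
have e4 : 4 ^+ k.+1 = 4 * (2 ^+ k * 2 ^+ k) :> R.
  by rewrite exprS -exprMn; congr (_ * _ ^+ _); ring.
rewrite e4; move: (2 ^+ k) p0 x1 => q q0 x1.
have h : (q * d / 2) ^+ 2 <= ((1 + c) * a) ^+ 2.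
  rewrite !expr2; have : 0 <= q * d by rewrite mulr_ge0 // ltW.
  by move=> h; apply: ler_pM; lra.
have -> : 32 * (1 + c) ^+ 2 / (4 * (q * q)) / d * a ^+ 2 = 8 * ((1 + c) * a) ^+ 2 / (q * q * d).
  by field; rewrite !gt_eqF.
rewrite ler_pdivlMr ?mulr_gt0 //.
apply: (@le_trans _ _ (8 * (q * d / 2) ^+ 2)); last by rewrite ler_pM2l.
by rewrite le_eqVlt; apply/orP; left; apply/eqP; field.
Qed.

Definition qabs N (q : nat -> C) (s : R) : R := cabs (tpoly N q (expi s)).

Lemma rcont_qabs N q : continuous (qabs N q).
Proof. by apply: rcont_cabs; exact: ccont_tpoly. Qed.

(** Three full periods: for [t] in [[0, 2 pi]] the window [[t - pi, t + pi]] stays inside, and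
    [parseval_int] applies to each period. *)
Definition qres N q : R -> R := qabs N q \_ `[- (2 * pi), 4 * pi].

Lemma qres_loc N q : locally_integrable [set: R] (qres N q).
Proof.
apply: integrable_locally_restrict; first exact: measurable_itv.
by apply: cint; exact: rcont_qabs.
Qed.

(** [x <= b / 2 + x^2 / (2 b)] trades the [L^1] norm for the squared [L^2] norm, computed by
    Parseval on the three periods. *)
Lemma qres_norm N (q : nat -> C) (b : R) : 0 < b -> \sum_(j < N) cabs (q (nat_of_ord j)) ^+ 2 <= b ^+ 2 ->
  (\int[mu]_s `|(qres N q s)%:E| <= (6 * pi * b)%:E)%E.
Proof.
move=> b0 hb; have p0 := @pi_gt0 R.
have cq := @rcont_qabs N q.
have q0 s : 0 <= qabs N q s by exact: cabs_ge0.
have -> : (\int[mu]_s `|(qres N q s)%:E| = \int[mu]_(s in `[(- (2 * pi))%R, (4 * pi)%R]) (qabs N q s)%:E)%E.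
  rewrite [RHS]integral_mkcond; apply: eq_integral => s _.
  rewrite /qres /= !patchE; case: ifP => _; rewrite ?normr0 //.
  by rewrite ger0_norm.
rewrite -[leLHS]fineK; last first.
  by apply: integrable_fin_num; [exact: measurable_itv | exact: cint].
rewrite lee_fin.
have cq2 : continuous (fun s => qabs N q s ^+ 2) by under eq_fun do rewrite expr2; exact: rcontM.
apply: (@le_trans _ _ (I[- (2 * pi), 4 * pi] (fun s => b / 2 + (2 * b)^-1 * qabs N q s ^+ 2))).
  apply: cint_le => // [|s _].
    by apply: rcontD; [exact: rcont_cst | apply: rcontM => //; exact: rcont_cst].
  move: (qabs N q s) (q0 s) => x x0.
  have -> : b / 2 + (2 * b)^-1 * x ^+ 2 = (b ^+ 2 + x ^+ 2) / (2 * b) by field; rewrite gt_eqF.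
  rewrite ler_pdivlMr ?mulr_gt0 //; have := sqr_ge0 (b - x); nra.
rewrite cintD; [|exact: rcont_cst|by apply: rcontM => //; exact: rcont_cst].
rewrite cint_cst ?cintZ //; last by lra.
have e0 : - (2 * pi) + 2 * pi = 0 :> R by ring.
have e1 : 0 + 2 * pi = 2 * pi :> R by ring.
have e2 : 2 * pi + 2 * pi = 4 * pi :> R by ring.
rewrite (cint_split cq2 (x := 0)); [|lra|lra].
rewrite (cint_split cq2 (a := 0) (x := 2 * pi)); [|lra|lra].
have := parseval_int (- (2 * pi) : R) N q; rewrite e0 => ->.
have := parseval_int (0 : R) N q; rewrite e1 => ->.
have := parseval_int (2 * pi : R) N q; rewrite e2 => ->.
set S := \sum_(j < N) _ in hb *.
have -> : b / 2 * (4 * pi - - (2 * pi)) + (2 * b)^-1 * (2 * pi * S + (2 * pi * S + 2 * pi * S)) =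
  3 * pi * (b + S / b) by field; rewrite gt_eqF.
have : S / b <= b by rewrite ler_pdivrMr // -expr2.
nra.
Qed.

Lemma HL_ball N q t (h : R) r : 0 < r -> (HL_maximal (qres N q) t <= h%:E)%E ->
  (\int[mu]_(s in ball t r) `|(qres N q s)%:E| <= (2 * r * h)%:E)%E.
Proof.
move=> r0 hh.
have : (iavg (qres N q) (ball t r) <= h%:E)%E.
  apply: (le_trans _ hh); apply: ereal_sup_ubound; exists r => //=.
  by rewrite in_itv /= r0.
rewrite /iavg (lebesgue_measure_ball _ (ltW r0)) inver mulrn_eq0 /= gt_eqF // lee_pdivrMl ?mulrn_wgt0 //.
by rewrite -EFinM -[r *+ 2]mulr_natl.
Qed.

(** Weights [32 (1 + c)^2 / (4^k d)] on balls of radius [2^k d] leave [64 (1 + c)^2 h / 2^k] for the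
    term [k], in all at most [128 (1 + c)^2 h]; division by [2 pi] brings the constant below 64. *)
Lemma HL_bound (c t h : R) N q (z : C) : 1 < c -> 0 <= t <= 2 * pi -> cabs z < 1 ->
  cabs (expi t - z) < c * (1 - cabs z) -> (HL_maximal (qres N q) t <= h%:E)%E ->
  cabs (tpoly N q z) <= 64 * (1 + c) ^+ 2 * h.
Proof.
move=> c1 /andP[t0 t1] hz hc hh.
have p0 := @pi_gt0 R.
set d := 1 - cabs z in hc.
have d0 : 0 < d by rewrite subr_gt0.
have h0 : 0 <= h.
  rewrite -lee_fin; apply: (le_trans _ hh).
  by apply: HL_maximalT_ge0; exact: qres_loc.
have [K hK] : exists K, pi < 2 ^+ K * d.
  have [K hK] : exists K : nat, pi / d < K%:R.
    by exists (Num.truncn (pi / d)).+1; exact: truncnS_gt.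
  exists K; rewrite -ltr_pdivrMr //; apply: (lt_le_trans hK).
  by rewrite -natrX ler_nat ltnW // ltn_expl.
have cq := @rcont_qabs N q.
pose D := `[t - pi, t - pi + 2 * pi]%classic : set R.
have mD : measurable D by exact: measurable_itv.
pose cf k : R := 32 * (1 + c) ^+ 2 / 4 ^+ k / d.
have cf0 k : 0 <= cf k.
  apply: divr_ge0; last exact: ltW.
  by apply: divr_ge0; rewrite ?exprn_ge0 // mulr_ge0 // sqr_ge0.
pose B k := ball t (2 ^+ k * d).
have mB k : measurable (B k) by exact: measurable_ball.
have mq : measurable_fun setT (qabs N q) by exact: continuous_measurable_fun.
have m1 k : measurable_fun setT (fun s => (qabs N q s * \1_(B k) s)%:E).
  by apply/measurable_EFinP; apply: measurable_funM => //; exact: measurable_indic.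
have cp : continuous (fun s => qabs N q s * pois z s) by apply: rcontM => //; exact: rcont_pois.
have step k : (\int[mu]_(s in D) ((cf k)%:E * (qabs N q s * \1_(B k) s)%:E) <=
    (64 * (1 + c) ^+ 2 * h / 2 ^+ k)%:E)%E.
  have nn s : (0 <= (qabs N q s * \1_(B k) s)%:E)%E.
    by rewrite lee_fin mulr_ge0 ?cabs_ge0 // indicE ler0n.
  rewrite ge0_integralZl_EFin //; last exact: (measurable_funTS (m1 k)).
  have -> : 64 * (1 + c) ^+ 2 * h / 2 ^+ k = cf k * (2 * (2 ^+ k * d) * h).
    have e4 : 4 ^+ k = 2 ^+ k * 2 ^+ k :> R by rewrite -exprMn; congr (_ ^+ _); ring.
    rewrite /cf e4; have : 2 ^+ k != 0 :> R by rewrite expf_neq0.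
    by move: (2 ^+ k) => w w0; field; rewrite w0 gt_eqF.
  rewrite (EFinM (cf k)); apply: lee_wpmul2l; first by rewrite lee_fin.
  have rk : 0 < 2 ^+ k * d by rewrite mulr_gt0 ?exprn_gt0.
  apply: (le_trans _ (HL_ball rk hh)); rewrite [leRHS]integral_mkcond.
  have mr : measurable_fun setT ((fun s => `|(qres N q s)%:E|%E) \_ (B k)).
    apply/(measurable_restrictT _ _).1 => //; apply: measurable_funTS.
    by apply: measurableT_comp => //; apply/measurable_EFinP; have [] := qres_loc N q.
  apply: (@le_trans _ _ (\int[mu]_(s in D) (((fun s => `|(qres N q s)%:E|%E) \_ (B k)) s))%E).
    apply: ge0_le_integral => //.
    - exact: (measurable_funTS (m1 k)).
    - exact: (measurable_funTS mr).
    move=> s; rewrite /D /= in_itv /= => /andP[s1 s2].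
    rewrite /patch indicE; case: ifP => _; last by rewrite mulr0.
    rewrite mulr1 /qres patchE ifT ?lee_fin ?ler_norm //.
    by rewrite inE /= in_itv /=; apply/andP; split; lra.
  by apply: ge0_subset_integral => // s _; apply: erestrict_ge0.
have main : ((2 * pi * cabs (tpoly N q z))%:E <=
    \sum_(k < K.+1) (64 * (1 + c) ^+ 2 * h / 2 ^+ k)%:E)%E.
  apply: (@le_trans _ _ (\int[mu]_(s in D) (qabs N q s * pois z s)%:E)%E).
    rewrite -[leRHS]fineK; last by apply: integrable_fin_num => //; exact: cint.
    by rewrite lee_fin; exact: poisson_subharmonic.
  apply: (@le_trans _ _ (\int[mu]_(s in D) (\sum_(k < K.+1) (cf k)%:E * (qabs N q s * \1_(B k) s)%:E))%E).
    apply: ge0_le_integral => //.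
    - by move=> s _; rewrite lee_fin mulr_ge0 ?pois_ge0 ?cabs_ge0.
    - by apply: measurable_funTS; apply/measurable_EFinP; exact: continuous_measurable_fun.
    - apply: measurable_funTS; apply: emeasurable_sum => k.
      by apply: measurable_funeM; exact: m1.
    move=> s; rewrite /D /= in_itv /= => /andP[s1 s2].
    have hs : `|t - s| <= pi by rewrite ler_norml; apply/andP; split; lra.
    have hp := pois_dyadic c1 hz hc hK hs.
    under eq_bigr do rewrite -EFinM.
    rewrite sumEFin lee_fin.
    apply: (le_trans (ler_wpM2l (cabs_ge0 _) hp)); rewrite mulr_sumr.
    by apply: ler_sum => k _; rewrite /cf mulrCA.
  rewrite ge0_integral_sum //.
  - by apply: lee_sum => k _; exact: step.
  - by move=> k; apply: measurable_funTS; apply: measurable_funeM; exact: m1.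
  - by move=> k s _; apply: mule_ge0; rewrite lee_fin // mulr_ge0 ?cabs_ge0 // indicE ler0n.
move: main; rewrite sumEFin lee_fin -mulr_sumr.
have hg : \sum_(k < K.+1) (2 ^+ k)^-1 <= 2 :> R.
  have : \sum_(k < K.+1) (2 ^+ k)^-1 = 2 - (2 ^+ K)^-1 :> R.
    elim: (K) => [|k IH]; first by rewrite big_ord_recr big_ord0 /= expr0; lra.
    rewrite big_ord_recr /= IH exprS; have : 2 ^+ k != 0 :> R by rewrite expf_neq0.
    by move: (2 ^+ k) => w w0; field.
  by move=> ->; rewrite gerBl invr_ge0 exprn_ge0.
set A := 64 * (1 + c) ^+ 2 * h; have A0 : 0 <= A by apply: mulr_ge0 => //; apply: mulr_ge0 => //; exact: sqr_ge0.
move=> hm; have p2 : 2 <= pi :> R by exact: pi_ge2.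
have := cabs_ge0 (tpoly N q z); move: (cabs _) hm => x hm x0.
have hx : 2 * pi * x <= A * 2 by apply: (le_trans hm); exact: ler_wpM2l.
nra.
Qed.

(** The maximal inequality is applied to the Taylor polynomials. [E] collects the points where all
    but finitely many of them have a large maximal function: an increasing union of sets of
    uniformly bounded measure. Off [E], infinitely many polynomials are bounded by [l] in the
    approach region. *)
Lemma nt_maximal (c : R) : 1 < c -> exists2 K : R, 0 < K & forall q b l, 0 < l -> bnd b (row q) ->
  exists E : set R, [/\ measurable E, (mu E <= (K * b / l)%:E)%E &
    forall t, 0 <= t <= 2 * pi -> ~ E t -> forall z, cabs z < 1 ->
      cabs (expi t - z) < c * (1 - cabs z) -> cabs (ev1 q z) <= l].
Proof.
move=> c1; set A := 64 * (1 + c) ^+ 2.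
have A0 : 0 < A by rewrite mulr_gt0 // exprn_gt0 //; lra.
have p0 := @pi_gt0 R.
exists (3 * A * (6 * pi)); first by apply: mulr_gt0; apply: mulr_gt0.
move=> q b l l0 hb; pose h := l / A; have h0 : 0 < h by rewrite divr_gt0.
have b0 := hb.1.
pose U N := [set t | (h%:E < HL_maximal (qres N q) t)%E].
have mU N : measurable (U N).
  rewrite -[X in measurable X]setTI; apply: emeasurable_fun_o_infty => //.
  by apply: measurable_HL_maximal; exact: qres_loc.
have hS N : \sum_(j < N) cabs (q j) ^+ 2 <= b ^+ 2.
  case: N => [|N]; first by rewrite big_ord0 sqr_ge0.
  apply: (le_trans _ (hb.2 N.+1)); apply: ler_sum => j _.
  by rewrite big_ord_recl /row /= big1 ?addr0 // => k _; rewrite cabs0 expr0n.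
have mUb N : (mu (U N) <= (3 * A * (6 * pi) * b / l)%:E)%E.
  apply: (le_trans (maximal_inequality (qres_loc N q) h0)).
  apply: (le_trans (lee_wpmul2l _ (qres_norm b0 (hS N)))); first by rewrite lee_fin divr_ge0 // ltW.
  by rewrite -EFinM lee_fin /h; rewrite le_eqVlt; apply/orP; left; apply/eqP; field; rewrite !gt_eqF.
pose V N := \bigcap_(m in [set m | (N <= m)%N]) U m.
have mV N : measurable (V N) by apply: bigcap_measurable => //; exists N => /=.
exists (\bigcup_N V N); split.
- exact: bigcupT_measurable.
- have hV N : (mu (V N) <= (3 * A * (6 * pi) * b / l)%:E)%E.
    apply: (le_trans _ (mUb N)); apply: le_measure; [exact: (mem_set (mV N)) | exact: (mem_set (mU N)) |].
    by move=> t ht; apply: (ht N); rewrite /=.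
  have hc : mu \o V @ \oo --> mu (\bigcup_N V N).
    apply: nondecreasing_cvg_mu => //; first exact: bigcupT_measurable.
    apply/nondecreasing_seqP => N; apply/subsetPset => t ht m /= hm; apply: ht => /=; lia.
  rewrite -(cvg_lim _ hc) //; apply: lime_le; first by apply/cvg_ex; eexists; exact: hc.
  exact: nearW hV.
move=> t ht hE z hz hzc; rewrite leNgt; apply/negP => hl; apply: hE.
have e0 : 0 < cabs (ev1 q z) - l by lra.
have [N hN] := ev1_partial (bnd_bdd hb) hz e0.
exists N => // m /= hm; rewrite /U /= ltNge; apply/negP => hh.
have h1 := HL_bound c1 ht hz hzc hh; have h2 := hN _ hm.
have h3 := cabs_subr (ev1 q z) (tpoly m q z).
rewrite cabsBC in h3; rewrite /tpoly in h1 h3.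
have : 64 * (1 + c) ^+ 2 * h = l by rewrite /h -/A mulrC divfK // gt_eqF.
move: h1 h2 h3; set x := \sum_(j < m) _; lra.
Qed.

(** Borel-Cantelli: norms [b / 4^m] at level [1 / 2^m] give bad sets of summable measure. Integer
    apertures exhaust all of them, so a countable union yields one null set for every [c]. *)
Lemma nt_null (b : R) (q : nat -> nat -> C) : (forall m, bnd (b / 4 ^+ m) (row (q m))) ->
  exists E : set R, [/\ measurable E, mu E = 0%E &
    forall t, 0 <= t <= 2 * pi -> ~ E t -> forall c, 1 < c -> exists m0 : nat, forall m, (m0 <= m)%N ->
      forall z, cabs z < 1 -> cabs (expi t - z) < c * (1 - cabs z) -> cabs (ev1 (q m) z) <= (2 ^+ m)^-1].
Proof.
move=> hq.
have b0 : 0 < b by have := (hq 0%N).1; rewrite expr0 divr1.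
have st (c : nat) : exists E : set R, [/\ measurable E, mu E = 0%E &
    forall t, 0 <= t <= 2 * pi -> ~ E t -> exists m0 : nat, forall m, (m0 <= m)%N ->
      forall z, cabs z < 1 -> cabs (expi t - z) < c.+2%:R * (1 - cabs z) -> cabs (ev1 (q m) z) <= (2 ^+ m)^-1].
  have c1 : 1 < c.+2%:R :> R by rewrite ltr1n.
  have [K K0 hK] := nt_maximal c1.
  have p2 m : 0 < (2 ^+ m)^-1 :> R by rewrite invr_gt0 exprn_gt0.
  have /choice[E hE] := fun m => hK (q m) _ _ (p2 m) (hq m).
  exists (lim_sup_set E); split.
  - by apply: bigcapT_measurable => k; apply: bigcup_measurable => i _; have [] := hE i.
  - apply: lim_sup_set_cvg0; first by move=> k; have [] := hE k.
    have hle m : (mu (E m) <= ((K * b) * (2^-1) ^+ m)%:E)%E.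
      have [_ h _] := hE m; apply: (le_trans h); rewrite lee_fin; rewrite le_eqVlt; apply/orP; left; apply/eqP.
      have e4 : 4 ^+ m = 2 ^+ m * 2 ^+ m :> R by rewrite -exprMn; congr (_ ^+ _); ring.
      rewrite e4 exprVn; have : 2 ^+ m != 0 :> R by rewrite expf_neq0.
      by move: (2 ^+ m) => w w0; field.
    apply: (@le_lt_trans _ _ (\sum_(0 <= m <oo) ((K * b) * (2^-1) ^+ m)%:E)%E).
      by apply: lee_nneseries => // m _; exact: hle.
    have h12 : `|2^-1 : R| < 1 by rewrite ger0_norm ?invr_ge0 //; lra.
    have hcv := @cvg_geometric_series R (K * b) 2^-1 h12.
    have -> : (\sum_(0 <= m <oo) ((K * b) * (2^-1) ^+ m)%:E)%E = (K * b * (1 - 2^-1)^-1)%:E.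
      apply: cvg_lim => //.
      have -> : (fun n : nat => (\sum_(0 <= m < n) ((K * b) * (2^-1) ^+ m)%:E)%E) =
          EFin \o series (geometric (K * b) 2^-1).
        by apply/funext => m /=; rewrite /series /= sumEFin.
      by apply: cvg_EFin; [exact: nearW | exact: hcv].
    by rewrite ltry.
  move=> t ht; rewrite /lim_sup_set => hE'.
  have [m0 hm0] : exists m0, forall m, (m0 <= m)%N -> ~ E m t.
    apply: contrapT => hne; apply: hE' => k _; apply: contrapT => hk; apply: hne; exists k => m hm hmt.
    by apply: hk; exists m.
  exists m0 => m hm z hz hzc; have [_ _ h] := hE m; exact: h (hm0 m hm) _ hz hzc.
have /choice[E hE] := st.
exists (\bigcup_c E c); split.
- by apply: bigcupT_measurable => c; have [] := hE c.
- have : mu.-negligible (\bigcup_c E c).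
    apply: negligible_bigcup => c; have [m0 n0 _] := hE c; exact/negligibleP.
  by move/negligibleP; apply; apply: bigcupT_measurable => c; have [] := hE c.
move=> t ht hE' c c1.
have [k hk] : exists k : nat, c < k.+2%:R.
  exists (Num.truncn c); apply: (lt_trans (truncnS_gt c)); by rewrite ltr_nat.
have hEk : ~ E k t by move=> h; apply: hE'; exists k.
have [_ _ h] := hE k; have [m0 hm0] := h t ht hEk.
exists m0 => m hm z hz hzc; apply: hm0 => //; apply: (lt_le_trans hzc).
by apply: ler_wpM2r; [rewrite subr_ge0 ltW | exact: ltW].
Qed.

End Nontangential.

(** * The Clark measure *)

Section ComplexMeasurable.
Context {R : realType} {d : measure_display} {T : measurableType d}.
Local Notation C := R[i].
Implicit Types (f g : T -> C).

Definition cmeas f := measurable_fun setT (fun t => complex.Re (f t)) /\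
  measurable_fun setT (fun t => complex.Im (f t)).

Lemma cmeas_cst (c : C) : cmeas (fun=> c).
Proof. by split; exact: measurable_cst. Qed.
Lemma cmeasD f g : cmeas f -> cmeas g -> cmeas (fun t => f t + g t).
Proof.
move=> [f1 f2] [g1 g2]; split.
  by under eq_fun do rewrite cReD; exact: measurable_funD.
by under eq_fun do rewrite cImD; exact: measurable_funD.
Qed.
Lemma cmeasM f g : cmeas f -> cmeas g -> cmeas (fun t => f t * g t).
Proof.
move=> [f1 f2] [g1 g2]; split.
  by under eq_fun do rewrite cReM; apply: measurable_funB; exact: measurable_funM.
by under eq_fun do rewrite cImM; apply: measurable_funD; exact: measurable_funM.
Qed.
Lemma cmeasN f : cmeas f -> cmeas (fun t => - f t).
Proof.
move=> h; have -> : (fun t => - f t) = fun t => (-1) * f t by apply/funext => t; rewrite mulN1r.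
by apply: cmeasM => //; exact: cmeas_cst.
Qed.
Lemma cmeasB f g : cmeas f -> cmeas g -> cmeas (fun t => f t - g t).
Proof. by move=> hf hg; apply: cmeasD => //; exact: cmeasN. Qed.
Lemma cmeas_conj f : cmeas f -> cmeas (fun t => cconj (f t)).
Proof.
move=> [f1 f2]; split; first by under eq_fun do rewrite Re_conj.
under eq_fun do rewrite Im_conj; exact: measurable_funN.
Qed.
Lemma cmeas_real (u : T -> R) : measurable_fun setT u -> cmeas (fun t => ((u t)%:C)%C).
Proof. by move=> h; split=> //=; exact: measurable_cst. Qed.
Lemma cmeas_sqr f : cmeas f -> measurable_fun setT (fun t => cabs (f t) ^+ 2).
Proof.
by move=> [f1 f2]; under eq_fun do rewrite cabs_sqr; apply: measurable_funD; exact: measurable_funX.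
Qed.
Lemma cmeas_cabs f : cmeas f -> measurable_fun setT (fun t => cabs (f t)).
Proof.
move=> [f1 f2]; apply: (@measurableT_comp _ _ _ _ _ _ (@Num.sqrt R)).
  by apply: continuous_measurable_fun; exact: sqrt_continuous.
by apply: measurable_funD; exact: measurable_funX.
Qed.
Lemma measurable_invp (u : T -> R) : measurable_fun setT u -> (forall t, 0 < u t) ->
  measurable_fun setT (fun t => (u t)^-1).
Proof.
move=> hu u0; have -> : (fun t => (u t)^-1) = fun t => expR (- ln (u t)).
  by apply/funext => t; rewrite expRN lnK // posrE.
apply: measurableT_comp; first exact: measurable_expR.
by apply: measurable_funN; apply: measurableT_comp => //; exact: measurable_ln.
Qed.
Lemma cmeasV f : cmeas f -> (forall t, f t != 0) -> cmeas (fun t => (f t)^-1).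
Proof.
move=> hf f0.
have -> : (fun t => (f t)^-1) = fun t => cconj (f t) * (((cabs (f t) ^+ 2)^-1)%:C)%C.
  apply/funext => t; apply: (mulfI (f0 t)); rewrite mulfV // mulrA mul_conj -real_complexM mulfV //.
  by rewrite expf_neq0 // cabs_eq0.
apply: cmeasM; first exact: cmeas_conj.
apply: cmeas_real; apply: measurable_invp; first exact: cmeas_sqr.
by move=> t; rewrite exprn_gt0 // cabs_gt0.
Qed.

Lemma meas_ge (u : T -> R) (c : R) : measurable_fun setT u -> measurable [set t | c <= u t].
Proof.
move=> h; have := h measurableT `[c, +oo[%classic (measurable_itv _); rewrite setTI.
by congr measurable; apply/seteqP; split=> t /=; rewrite in_itv /= andbT.
Qed.
Lemma meas_neq0 f : cmeas f -> measurable [set t | f t != 0].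
Proof.
move=> h; have hm := cmeas_cabs h.
have -> : [set t | f t != 0] = \bigcup_k [set t | k.+1%:R^-1 <= cabs (f t)].
  apply/seteqP; split=> t /=.
    rewrite -cabs_gt0 => h0.
    have [k hk] : exists k : nat, (cabs (f t))^-1 < k%:R.
      by exists (Num.truncn (cabs (f t))^-1).+1; exact: truncnS_gt.
    exists k => //=; rewrite invf_ple ?posrE //; apply: ltW; apply: (lt_trans hk).
    by rewrite ltr_nat.
  by move=> [k _ /= hk]; rewrite -cabs_gt0; apply: lt_le_trans hk; rewrite invr_gt0.
by apply: bigcupT_measurable => k; exact: meas_ge.
Qed.
End ComplexMeasurable.

(** * Measurability on the torus and null sets from estimates on arcs *)

Section TorusMeasurable.
Context {R : realType}.
Local Notation C := R[i].
Local Notation mu := (@lebesgue_measure R).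

Lemma cmeas_expi (u : R * R -> R) : measurable_fun setT u -> cmeas (fun t => expi (u t)).
Proof.
move=> hu; split; apply: (measurableT_comp _ hu); apply: continuous_measurable_fun.
  exact: continuous_cos.
exact: continuous_sin.
Qed.
Lemma cmeas_z1 : cmeas (fun t : R * R => (zeta t).1).
Proof. by apply: cmeas_expi; exact: measurable_fst. Qed.
Lemma cmeas_z2 : cmeas (fun t : R * R => (zeta t).2).
Proof. by apply: cmeas_expi; exact: measurable_snd. Qed.

Lemma cmeas_eval2 (P : {poly {poly C}}) : cmeas (fun t : R * R => eval2 P (zeta t)).
Proof.
move: P; apply: poly2_ind => [c|||P P' h h'|P P' h h'].
- have -> : (fun t : R * R => eval2 (c%:P)%:P (zeta t)) = fun=> c.
    by apply/funext => t; rewrite (eval2C c (zeta t)).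
  exact: cmeas_cst.
- have -> : (fun t : R * R => eval2 'X (zeta t)) = fun t => (zeta t).2.
    by apply/funext => t; rewrite eval2X.
  exact: cmeas_z2.
- have -> : (fun t : R * R => eval2 ('X)%:P (zeta t)) = fun t => (zeta t).1.
    by apply/funext => t; rewrite eval2X1.
  exact: cmeas_z1.
- by under eq_fun do rewrite eval2D; exact: cmeasD.
- by under eq_fun do rewrite eval2M; exact: cmeasM.
Qed.

Lemma zeta1_sub z t : cabs z < 1 -> (zeta t : C * C).1 - z != 0.
Proof. exact: expi_sub_neq0. Qed.
Lemma zeta2_sub z t : cabs z < 1 -> (zeta t : C * C).2 - z != 0.
Proof. exact: expi_sub_neq0. Qed.

Lemma meas_poisson2 z : in_D2 z -> measurable_fun setT (fun t : R * R => poisson2 z (zeta t)).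
Proof.
move=> [h1 h2]; apply: measurable_funM; first exact: measurable_cst.
apply: measurable_invp.
  apply: measurable_funM; apply: cmeas_sqr; apply: cmeasB; try exact: cmeas_cst.
    exact: cmeas_z1.
  exact: cmeas_z2.
by move=> t; rewrite mulr_gt0 // exprn_gt0 // cabs_gt0; [exact: zeta1_sub | exact: zeta2_sub].
Qed.

Lemma poisson2_ge0 z t : in_D2 z -> 0 <= poisson2 z (zeta t) :> R.
Proof.
move=> /D2_sqr[h1 h2]; rewrite /poisson2; apply: divr_ge0; apply: mulr_ge0; rewrite ?sqr_ge0 //; exact: ltW.
Qed.

(** Lebesgue outer measure covers [E] by half-open intervals of small total length, and the estimate
    on arcs is summed over the cover. *)
Lemma null_of_arcs (sg : {measure set (R * R)%type -> \bar R}) (f : R * R -> R) (G : set (R * R)) (K : R) :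
  measurable_fun setT f -> measurable G -> 0 <= K ->
  (forall a b, a <= b -> (sg (G `&` f @^-1` `]a, b]) <= (K * (b - a))%:E)%E) ->
  forall E, measurable E -> mu E = 0%E -> sg (G `&` f @^-1` E) = 0%E.
Proof.
move=> mf mG K0 h E mE E0.
have mpre (S : set R) : measurable S -> measurable (G `&` f @^-1` S).
  by move=> mS; apply: measurableI => //; rewrite -[X in measurable X]setTI; exact: mf.
apply/eqP; rewrite eq_le measure_ge0 andbT; apply/lee_addgt0Pr => e e0; rewrite add0e.
have e1 : 0 < e / (K + 1) by rewrite divr_gt0 // ltr_wpDl.
have : (mu E < (e / (K + 1))%:E)%E by rewrite E0 lte_fin.
move=> /ereal_inf_lt[_ [F [mF EF] <-]] hF.
have hFi i : exists a b, a <= b /\ F i = `]a, b]%classic.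
  have := mF i; rewrite /measurable /= => -[[a b] _ /= <-].
  have [ab|ab] := leP a b; first by exists a, b.
  by exists a, a; split=> //; rewrite !set_itv_ge // bnd_simp -leNgt // ltW.
have mFi i : measurable (F i : set R) by have [a [b [_ ->]]] := hFi i; exact: measurable_itv.
apply: (@le_trans _ _ (\sum_(0 <= i <oo) sg (G `&` f @^-1` F i))%E).
  apply: measure_sigma_subadditive => //; [by move=> i; exact: mpre | exact: mpre |].
  by move=> t [tG /EF[i _ hi]]; exists i.
apply: (@le_trans _ _ (\sum_(0 <= i <oo) (K%:E * wlength idfun (F i)))%E).
  apply: lee_nneseries => // i _; have [a [b [ab ->]]] := hFi i.
  by rewrite wlength_itv_bnd // -EFinM; exact: h.
rewrite nneseriesZl; last by move=> i _; exact: wlength_ge0.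
apply: (le_trans (lee_wpmul2l _ (ltW hF))); first by rewrite lee_fin.
rewrite -EFinM lee_fin mulrCA ger_pMr // ler_pdivrMr ?mul1r; lra.
Qed.

End TorusMeasurable.

Section ClarkNull.
Context {R : realType}.
Local Notation C := R[i].
Local Notation poly2 := {poly {poly C}}.
Local Notation mu := (@lebesgue_measure R).
Context (n : nat) (p : poly2) (hp : deg_le_n1 n p)
  (hz : forall z : C * C, in_D2 z -> eval2 p z != 0)
  (hdeg : deg_eq_n1 n (ptilde n p)) (hno : no_common_factor p (ptilde n p))
  (alpha : C) (ha : cabs alpha = 1)
  (sg : {measure set (R * R)%type -> \bar R}) (hsg : is_clark_measure n p alpha sg).
Local Notation pt := (ptilde n p).
Local Notation phi := (Defs.phi n p).
Local Notation Q := (level n p alpha).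

(* The Poisson integral of the Clark measure, with denominators cleared. *)
Definition clarkH (z : C * C) : R :=
  (cabs (eval2 p z) ^+ 2 - cabs (eval2 pt z) ^+ 2) / cabs (eval2 Q z) ^+ 2.

Lemma clark_int z : in_D2 z -> (\int[sg]_t (poisson2 z (zeta t))%:E = (clarkH z)%:E)%E.
Proof using hp hz hdeg hno ha hsg.
by move=> h; rewrite -hsg.2 // /clarkH -(clark_lhs hp hz hdeg hno ha h).
Qed.

(** Markov inequality with the Poisson kernel at [z] as test function; the upper estimates of masses
    below come from it. *)
Lemma sig_le A z m : measurable A -> in_D2 z -> 0 < m ->
  (forall t, A t -> m <= poisson2 z (zeta t)) -> (sg A <= (clarkH z / m)%:E)%E.
Proof using hp hz hdeg hno ha hsg.
move=> mA hzz m0 h.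
have e : (m%:E * sg A <= (clarkH z)%:E)%E.
  rewrite -clark_int // -(setIT A) -integral_indic // -ge0_integralZl_EFin ?(ltW m0) //; last first.
    by apply/measurable_EFinP; exact: measurable_indic.
  apply: ge0_le_integral => //.
  - by move=> t _; rewrite -EFinM lee_fin mulr_ge0 ?(ltW m0) // indicE ler0n.
  - by apply: measurable_funeM; apply/measurable_EFinP; exact: measurable_indic.
  - by apply/measurable_EFinP; exact: meas_poisson2.
  move=> t _; rewrite -EFinM lee_fin indicE; case: (boolP (t \in A)) => ht.
    by rewrite mulr1; apply: h; exact: set_mem.
  by rewrite mulr0 poisson2_ge0.
by rewrite mulrC EFinM lee_pdivlMl.
Qed.

Lemma in_D2_00 : in_D2 ((0, 0) : C * C).
Proof. by split; rewrite /= cabs0. Qed.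

Lemma poisson2_fst (x : C) t : poisson2 (x, 0) (zeta t) = (1 - cabs x ^+ 2) / cabs (expi t.1 - x) ^+ 2 :> R.
Proof. by rewrite /poisson2 /= cabs0 expr0n /= !subr0 cabs_expi expr1n !mulr1. Qed.
Lemma poisson2_snd (x : C) t : poisson2 (0, x) (zeta t) = (1 - cabs x ^+ 2) / cabs (expi t.2 - x) ^+ 2 :> R.
Proof. by rewrite /poisson2 /= cabs0 expr0n /= !subr0 cabs_expi expr1n !mul1r. Qed.

Lemma sig_finite : (sg setT < +oo)%E.
Proof using hp hz hdeg hno ha hsg.
apply: (@le_lt_trans _ _ (clarkH (0, 0) / 1)%:E); last by rewrite ltry.
apply: sig_le => //; first exact: in_D2_00.
by move=> t _; rewrite poisson2_fst subr0 cabs_expi cabs0 expr0n /= subr0 expr1n divr1.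
Qed.

Definition sig_mass : R := fine (sg setT).
Lemma sig_massE : (sig_mass)%:E = sg setT.
Proof using hp hz hdeg hno ha hsg. by rewrite fineK // ge0_fin_numE ?measure_ge0 ?sig_finite. Qed.
Lemma sig_mass_ge0 : 0 <= sig_mass.
Proof. by rewrite fine_ge0 ?measure_ge0. Qed.
Lemma sig_le_mass A : measurable A -> (sg A <= sig_mass%:E)%E.
Proof using hp hz hdeg hno ha hsg.
by move=> mA; rewrite sig_massE; apply: le_measure => //; exact: mem_set.
Qed.

(** [1 - (1 - h)^2 >= h], and the denominator is at most [(2 h)^2]. *)
Lemma pois_near (x : C) (s h : R) : 0 < h -> h < 1 -> cabs (expi s - x) <= 2 * h ->
  cabs x = 1 - h -> 1 / (4 * h) <= (1 - cabs x ^+ 2) / cabs (expi s - x) ^+ 2.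
Proof.
move=> h0 h1 hd hx.
have x1 : cabs x < 1 by rewrite hx; lra.
have a0 : 0 < cabs (expi s - x) by rewrite cabs_gt0 expi_sub_neq0.
rewrite hx; move: (cabs (expi s - x)) a0 hd => a a0 hd.
rewrite ler_pdivlMr ?exprn_gt0 // mulrAC ler_pdivrMr ?mulr_gt0 // mul1r.
have h2 : a ^+ 2 <= (2 * h) ^+ 2 by apply: sqr_le => //; exact: ltW.
apply: (le_trans h2); nra.
Qed.

Lemma dil_sub (h : R) (s s0 : R) : 0 < h -> h < 1 -> `|s - s0| <= h ->
  cabs (expi s - ((1 - h)%:C)%C * expi s0) <= 2 * h.
Proof.
move=> h0 h1 hs; apply: (le_trans (cabs_dist _ _ (expi s0))).
have h2 := chord_le s s0.
have -> : expi s0 - ((1 - h)%:C)%C * expi s0 = (h%:C)%C * expi s0.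
  rewrite -{1}(mul1r (expi s0)) -mulrBl; congr (_ * _).
  by rewrite -(rmorph1 (real_complex R)) -rmorphB /=; congr (_%:C)%C; ring.
rewrite cabsM cabs_expi mulr1 cabs_real (ger0_norm (ltW h0)); lra.
Qed.

Lemma cabs_dil (h : R) s0 : h < 1 -> cabs (((1 - h)%:C)%C * expi s0) = 1 - h.
Proof. by move=> h1; rewrite cabsM cabs_expi mulr1 cabs_real ger0_norm //; lra. Qed.

Lemma sqr_half_le (x y eta L h : R) : 0 < eta -> 0 <= x -> eta <= y -> y <= x + L * h -> L * h <= eta / 2 ->
  (eta / 2) ^+ 2 <= x ^+ 2.
Proof. by move=> e0 x0 h1 h2 h3; apply: sqr_le; lra. Qed.

Lemma num_bound : exists2 K : R, 0 < K & forall z, cD2 z ->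
  cabs (eval2 p z) ^+ 2 - cabs (eval2 pt z) ^+ 2 <= K.
Proof.
have [K [K0 hK _]] := lip_eval2 p; exists (K ^+ 2 + 1); first by rewrite ltr_wpDl // sqr_ge0.
move=> z hzz; have := sqr_le (cabs_ge0 _) (hK z hzz); have := sqr_ge0 (cabs (eval2 pt z)); lra.
Qed.

(** Common form of the two coordinate statements, [zz] embedding the disc as [z2 = 0] or [z1 = 0].
    Where [|Q|] is at least [eta] at the end of a radius, [clarkH] stays bounded at small depth [h],
    while the Poisson kernel is at least [1 / (4 h)] on an arc of length [h], whose mass is thus
    [O(h)]. *)
Lemma arc_null (zz : C -> C * C) (pr : R * R -> R) : measurable_fun setT pr ->
  (forall x, cabs x <= 1 -> cD2 (zz x)) -> (forall x, cabs x < 1 -> in_D2 (zz x)) ->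
  (forall x y, cabs ((zz x).1 - (zz y).1) + cabs ((zz x).2 - (zz y).2) <= cabs (x - y)) ->
  (forall x t, poisson2 (zz x) (zeta t) = (1 - cabs x ^+ 2) / cabs (expi (pr t) - x) ^+ 2) ->
  cmeas (fun t => eval2 Q (zz (expi (pr t)))) ->
  forall E, measurable E -> mu E = 0%E ->
    sg.-negligible [set t | E (pr t) /\ eval2 Q (zz (expi (pr t))) != 0].
Proof using hp hz hdeg hno ha hsg.
move=> mpr h1 h2 h3 h4 mQ E mE E0.
pose G (k : nat) := [set t : R * R | k.+1%:R^-1 <= cabs (eval2 Q (zz (expi (pr t))))].
have mG k : measurable (G k) by apply: meas_ge; exact: cmeas_cabs.
have key k : sg (G k `&` pr @^-1` E) = 0%E.
  set eta : R := k.+1%:R^-1; have e0 : 0 < eta by rewrite invr_gt0.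
  have [L [L0 _ hL]] := lip_eval2 Q; have [K K0 hK] := num_bound.
  (* Within distance [d] the Lipschitz bound keeps [|Q|] above [eta / 2]; longer arcs are paid for
     by the total mass, whence the term [sig_mass / d] of [KK]. *)
  pose d := Num.min (1 / 2) (eta / (2 * (L + 1))).
  have d0 : 0 < d by rewrite lt_min divr_gt0 //= divr_gt0 // mulr_gt0 // ltr_wpDl.
  have d1 : d <= 1 / 2 by rewrite ge_min lexx.
  have dL : L * d <= eta / 2.
    have : d <= eta / (2 * (L + 1)) by rewrite ge_min lexx orbT.
    rewrite ler_pdivlMr; last by rewrite mulr_gt0 // ltr_wpDl.
    by nra.
  pose K2 := 4 * (K / (eta / 2) ^+ 2).
  have K20 : 0 < K2 by rewrite /K2 mulr_gt0 // divr_gt0 // exprn_gt0 // divr_gt0.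
  pose KK := K2 + sig_mass / d.
  have s0 : 0 <= sig_mass / d by rewrite divr_ge0 ?sig_mass_ge0 // ltW.
  apply: (@null_of_arcs _ _ _ _ KK) => //; first by rewrite /KK; lra.
  move=> a b ab.
  have mI : measurable (G k `&` pr @^-1` `]a, b]).
    apply: measurableI => //; rewrite -[X in measurable X]setTI; exact: (mpr measurableT _ (measurable_itv _)).
  have [ba|ba] := leP (b - a) d; last first.
    apply: (le_trans (sig_le_mass mI)); rewrite lee_fin /KK.
    have : sig_mass <= sig_mass / d * (b - a).
      rewrite -mulrA ler_peMr ?sig_mass_ge0 // mulrC ler_pdivlMr // mul1r; exact: ltW.
    nra.
  have [[t0 [G0 I0]]|hne] := pselect (exists t0, (G k `&` pr @^-1` `]a, b]) t0); last first.
    have -> : G k `&` pr @^-1` `]a, b] = set0 by apply/seteqP; split=> t // ht; apply: hne; exists t.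
    by rewrite measure0 lee_fin mulr_ge0 //; rewrite /KK; lra.
  move: I0; rewrite /= in_itv /= => /andP[t0a t0b].
  have h0 : 0 < b - a by lra.
  set h := b - a in ba h0 *.
  have hl1 : h < 1 by lra.
  pose x := ((1 - h)%:C)%C * expi (pr t0).
  have cx : cabs x = 1 - h by exact: cabs_dil.
  have x1 : cabs x < 1 by rewrite cx; lra.
  have m0 : 0 < 1 / (4 * h) by rewrite divr_gt0 // mulr_gt0.
  apply: (le_trans (sig_le mI (h2 _ x1) m0 _)).
    move=> t [_]; rewrite /= in_itv /= => /andP[ta tb]; rewrite h4.
    apply: pois_near => //; apply: dil_sub => //.
    by rewrite ler_norml; apply/andP; split; rewrite /h; lra.
  rewrite lee_fin.
  have hQ : (eta / 2) ^+ 2 <= cabs (eval2 Q (zz x)) ^+ 2.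
    apply: (@sqr_half_le _ (cabs (eval2 Q (zz (expi (pr t0))))) eta L h) => //; first exact: cabs_ge0.
      have := hL (zz (expi (pr t0))) (zz x) (h1 _ _) (h1 _ (ltW x1)).
      rewrite cabs_expi lexx => /(_ isT) hle.
      have := cabsD (eval2 Q (zz (expi (pr t0))) - eval2 Q (zz x)) (eval2 Q (zz x)); rewrite subrK.
      have h5 : L * (cabs ((zz (expi (pr t0))).1 - (zz x).1) + cabs ((zz (expi (pr t0))).2 - (zz x).2)) <= L * h.
        apply: ler_wpM2l => //; apply: (le_trans (h3 _ _)).
        have -> : expi (pr t0) - x = (h%:C)%C * expi (pr t0).
          rewrite /x -{1}(mul1r (expi (pr t0))) -mulrBl; congr (_ * _).
          by rewrite -(rmorph1 (real_complex R)) -rmorphB /=; congr (_%:C)%C; ring.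
        by rewrite cabsM cabs_expi mulr1 cabs_real ger0_norm // ltW.
      lra.
    by apply: le_trans dL; apply: ler_wpM2l.
  have e2 : 0 < (eta / 2) ^+ 2 by rewrite exprn_gt0 // divr_gt0.
  have hH : clarkH (zz x) <= K / (eta / 2) ^+ 2.
    rewrite /clarkH; have hx := hK _ (h1 _ (ltW x1)).
    have q0 : 0 < cabs (eval2 Q (zz x)) ^+ 2 by lra.
    rewrite ler_pdivrMr // mulrAC ler_pdivlMr //.
    apply: (le_trans (ler_wpM2r (ltW e2) hx)); apply: ler_wpM2l => //; exact: ltW.
  rewrite div1r invrK /KK /K2.
  have : clarkH (zz x) * (4 * h) <= K / (eta / 2) ^+ 2 * (4 * h) by apply: ler_wpM2r => //; lra.
  have : 0 <= sig_mass / d * h by rewrite mulr_ge0 // ltW.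
  move: (clarkH (zz x)) (K / (eta / 2) ^+ 2) => A B; nra.
apply: (@negligibleS _ _ _ _ (\bigcup_k (G k `&` pr @^-1` E))).
  move=> t /= [tE]; rewrite -cabs_gt0; set q := cabs _ => h0.
  have [k hk] : exists k : nat, q^-1 < k%:R by exists (Num.truncn q^-1).+1; exact: truncnS_gt.
  exists k => //; split=> //=; rewrite /G /= -/q invf_ple ?posrE //; apply: ltW; apply: (lt_trans hk).
  by rewrite ltr_nat.
apply: negligible_bigcup => k; apply/negligibleP; last exact: key.
apply: measurableI => //; rewrite -[X in measurable X]setTI; exact: mpr.
Qed.

Lemma null_fst E : measurable E -> mu E = 0%E ->
  sg.-negligible [set t | E t.1 /\ eval2 Q (expi t.1, 0) != 0].
Proof using hp hz hdeg hno ha hsg.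
apply: (@arc_null (fun x => (x, 0)) (fun t => t.1)).
- exact: measurable_fst.
- by move=> x hx; split; rewrite /= ?cabs0.
- by move=> x hx; split; rewrite /= ?cabs0.
- by move=> x y /=; rewrite subrr cabs0 addr0.
- exact: poisson2_fst.
have -> : (fun t : R * R => eval2 Q (expi t.1, 0)) = fun t => eval2 (Q`_0)%:P (zeta t).
  by apply/funext => t; rewrite level_lin //= mulr0 addr0 /eval2 hornerC.
exact: cmeas_eval2.
Qed.

Lemma null_snd E : measurable E -> mu E = 0%E ->
  sg.-negligible [set t | E t.2 /\ eval2 Q (0, expi t.2) != 0].
Proof using hp hz hdeg hno ha hsg.
apply: (@arc_null (fun x => (0, x)) (fun t => t.2)).
- exact: measurable_snd.
- by move=> x hx; split; rewrite /= ?cabs0.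
- by move=> x hx; split; rewrite /= ?cabs0.
- by move=> x y /=; rewrite subrr cabs0 add0r.
- exact: poisson2_snd.
have -> : (fun t : R * R => eval2 Q (0, expi t.2)) =
    fun t => (Q`_0).[0] + (Q`_1).[0] * (zeta t).2.
  by apply/funext => t; rewrite level_lin.
by apply: cmeasD; [exact: cmeas_cst | apply: cmeasM; [exact: cmeas_cst | exact: cmeas_z2]].
Qed.

(** At depth [h] on the radius to the point the Poisson kernel is at least [1 / (16 h^2)], while
    [slice_schwarz_pick] bounds its integral by [4 / (c h)]: the mass is [O(h)]. *)
Lemma no_atom t0 : sg [set t0] = 0%E.
Proof using hp hz hdeg hno ha hsg.
have hT : in_T2 (zeta t0 : C * C) by split; exact: cabs_expi.
have [c c0 hc] := slice_schwarz_pick hp hz hdeg hno hT.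
have mt : measurable [set t0].
  have -> : [set t0] = [set t0.1] `*` [set t0.2].
    by apply/seteqP; split=> [t ->|[u v] [/= -> ->]] //; case: t0 {hT c c0 hc}.
  by apply: measurableX; exact: measurable_set1.
apply/eqP; rewrite eq_le measure_ge0 andbT; apply/lee_addgt0Pr => e e0; rewrite add0e.
pose h := Num.min (1 / 2) (e * c / 64).
have h0 : 0 < h by rewrite lt_min !divr_gt0 // mulr_gt0.
have h1 : h <= 1 / 2 by rewrite ge_min lexx.
have he : h <= e * c / 64 by rewrite ge_min lexx orbT.
have r01 : 0 < 1 - h < 1 by apply/andP; split; lra.
pose z : C * C := (((1 - h)%:C)%C * expi t0.1, ((1 - h)%:C)%C * expi t0.2).
have hl : h < 1 by lra.
have hzz : in_D2 z by split; rewrite /= cabs_dil //; lra.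
have m0 : 0 < 1 / (4 * h) * (1 / (4 * h)) by rewrite mulr_gt0 // divr_gt0 // mulr_gt0.
have m0' : 0 < 1 / (4 * h) by rewrite divr_gt0 // mulr_gt0.
apply: (le_trans (sig_le mt hzz m0 _)).
  move=> t ->; have -> : poisson2 z (zeta t0) =
      (1 - cabs z.1 ^+ 2) / cabs (expi t0.1 - z.1) ^+ 2 * ((1 - cabs z.2 ^+ 2) / cabs (expi t0.2 - z.2) ^+ 2).
    by rewrite /poisson2 invfM mulrACA.
  by apply: ler_pM; rewrite ?(ltW m0') //; apply: pois_near => //; rewrite ?cabs_dil //;
    apply: dil_sub => //; rewrite subrr normr0 ltW.
rewrite lee_fin /clarkH -(clark_lhs hp hz hdeg hno ha hzz).
have := hc _ r01; rewrite -/z; have := phi_lt1 hp hz hdeg hno hzz.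
have := cabs_ge0 (phi z); have := cabs_subr alpha (phi z); rewrite ha.
move: (cabs (phi z)) (cabs (alpha - phi z)) => x y hy x0 x1 hcx.
have e1 : 1 - (1 - h) = h by ring.
rewrite e1 in hcx.
have a0 : 0 < 1 - x by lra.
have b1 : (1 - x ^+ 2) / y ^+ 2 <= (1 - x ^+ 2) / (1 - x) ^+ 2.
  apply: ler_wpM2l; first by nra.
  by rewrite lef_pV2 ?posrE ?exprn_gt0 //; [apply: sqr_le; lra | lra].
have b2 : (1 - x ^+ 2) / (1 - x) ^+ 2 <= 4 / (c * h).
  rewrite ler_pdivlMr ?mulr_gt0 // mulrAC ler_pdivrMr ?exprn_gt0 //.
  have : (1 - x ^+ 2) * (c * h) <= (1 - x ^+ 2) * (1 - x ^+ 2) by apply: ler_wpM2l => //; nra.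
  have -> : (1 - x ^+ 2) * (1 - x ^+ 2) = (1 + x) ^+ 2 * (1 - x) ^+ 2 by ring.
  have : (1 + x) ^+ 2 * (1 - x) ^+ 2 <= 4 * (1 - x) ^+ 2 by apply: ler_wpM2r; [exact: sqr_ge0 | nra].
  lra.
apply: (@le_trans _ _ (4 / (c * h) / (1 / (4 * h) * (1 / (4 * h))))).
  by apply: ler_wpM2r; [rewrite invr_ge0 ltW | lra].
have -> : 4 / (c * h) / (1 / (4 * h) * (1 / (4 * h))) = 64 * h / c by field; rewrite !gt_eqF.
rewrite ler_pdivrMr //; lra.
Qed.

End ClarkNull.

(** * The carrier of the Clark measure and the zeros of [p] on the torus *)

Section ClarkSupport.
Context {R : realType}.
Local Notation C := R[i].
Local Notation poly2 := {poly {poly C}}.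
Local Notation mu := (@lebesgue_measure R).
Context (n : nat) (p : poly2) (hp : deg_le_n1 n p)
  (hz : forall z : C * C, in_D2 z -> eval2 p z != 0)
  (hdeg : deg_eq_n1 n (ptilde n p)) (hno : no_common_factor p (ptilde n p))
  (alpha : C) (ha : cabs alpha = 1)
  (sg : {measure set (R * R)%type -> \bar R}) (hsg : is_clark_measure n p alpha sg).
Local Notation pt := (ptilde n p).
Local Notation phi := (Defs.phi n p).
Local Notation Q := (level n p alpha).

Lemma measurable_pt (t0 : R * R) : measurable [set t0].
Proof.
have -> : [set t0] = [set t0.1] `*` [set t0.2].
  by apply/seteqP; split=> [t ->|[u v] [/= -> ->]] //; case: t0.
by apply: measurableX; exact: measurable_set1.
Qed.

(* The Poisson kernel is at least of order [h^-2] on a cell of size [h], and [1 - |phi|^2] is [O(h)] near the torus. *)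
Lemma cell_bound (eta : R) : 0 < eta -> exists K h0 : R, [/\ 0 < K, 0 < h0 &
  forall h A, 0 < h -> h < h0 -> measurable A ->
    (forall t, A t -> eta <= cabs (eval2 Q (zeta t))) ->
    (forall t s, A t -> A s -> `|t.1 - s.1| <= h /\ `|t.2 - s.2| <= h) ->
    (sg A <= (K * h ^+ 3)%:E)%E].
Proof using hp hz hdeg hno ha hsg.
move=> e0; have [L [L0 _ hL]] := lip_eval2 Q.
have [B [B0 hB1 hB]] := lip_eval2 p; have [B' [B0' hB1' hB']] := lip_eval2 pt.
pose N := B + B' + 1.
have N0 : 0 < N by rewrite /N; lra.
pose d := Num.min (1 / 2) (eta / (4 * (L + 1))).
have d0 : 0 < d by rewrite lt_min divr_gt0 //= divr_gt0 // mulr_gt0 // ltr_wpDl.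
have d1 : d <= 1 / 2 by rewrite ge_min lexx.
have dL : L * (2 * d) <= eta / 2.
  have : d <= eta / (4 * (L + 1)) by rewrite ge_min lexx orbT.
  by rewrite ler_pdivlMr; [nra | rewrite mulr_gt0 // ltr_wpDl].
have K0 : 0 < 8 * N ^+ 2 / (eta / 2) ^+ 2 * 16.
  by rewrite mulr_gt0 // divr_gt0 ?mulr_gt0 ?exprn_gt0 // divr_gt0.
exists (8 * N ^+ 2 / (eta / 2) ^+ 2 * 16), d; split=> //.
move=> h A h0 hd mA hA hdiam.
have [[t0 A0]|hne] := pselect (exists t0, A t0); last first.
  have -> : A = set0 by apply/seteqP; split=> t // ht; apply: hne; exists t.
  rewrite measure0 lee_fin; apply: mulr_ge0; last by rewrite exprn_ge0 // ltW.
  exact: ltW.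
have hl : h < 1 by lra.
pose z : C * C := (((1 - h)%:C)%C * expi t0.1, ((1 - h)%:C)%C * expi t0.2).
have hzz : in_D2 z by split; rewrite /= cabs_dil //; lra.
have hzc : cD2 z by split; apply: ltW; [exact: hzz.1 | exact: hzz.2].
have hT : in_T2 (zeta t0 : C * C) by split; exact: cabs_expi.
have hTc : cD2 (zeta t0 : C * C) by split; rewrite cabs_expi.
have m0 : 0 < 1 / (4 * h) by rewrite divr_gt0 // mulr_gt0.
have dd (s : R) : cabs (expi s - ((1 - h)%:C)%C * expi s) <= h.
  have -> : expi s - ((1 - h)%:C)%C * expi s = (h%:C)%C * expi s.
    rewrite -{1}(mul1r (expi s)) -mulrBl; congr (_ * _).
    by rewrite -(rmorph1 (real_complex R)) -rmorphB /=; congr (_%:C)%C; ring.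
  by rewrite cabsM cabs_expi mulr1 cabs_real (ger0_norm (ltW h0)).
have dz : cabs ((zeta t0).1 - z.1) + cabs ((zeta t0).2 - z.2) <= 2 * h.
  by have := dd t0.1; have := dd t0.2; rewrite /z /=; lra.
apply: (le_trans (sig_le hp hz hdeg hno ha hsg mA hzz (mulr_gt0 m0 m0) _)).
  move=> t At; have [u1 u2] := hdiam _ _ At A0.
  have -> : poisson2 z (zeta t) =
      (1 - cabs z.1 ^+ 2) / cabs (expi t.1 - z.1) ^+ 2 * ((1 - cabs z.2 ^+ 2) / cabs (expi t.2 - z.2) ^+ 2).
    by rewrite /poisson2 invfM mulrACA.
  by apply: ler_pM; rewrite ?(ltW m0) //; apply: pois_near => //; rewrite ?cabs_dil //; exact: dil_sub.
rewrite lee_fin.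
have hQ : (eta / 2) ^+ 2 <= cabs (eval2 Q z) ^+ 2.
  apply: (@sqr_half_le _ _ (cabs (eval2 Q (zeta t0))) eta L (2 * h)) => //.
  - exact: cabs_ge0.
  - exact: hA.
  - have := cabsD (eval2 Q (zeta t0) - eval2 Q z) (eval2 Q z); rewrite subrK.
    have := hL _ _ hTc hzc; have := ler_wpM2l L0 dz; lra.
  - by apply: le_trans dL; apply: ler_wpM2l => //; lra.
have e2 : 0 < (eta / 2) ^+ 2 by rewrite exprn_gt0 // divr_gt0.
have lipsq P K : 0 <= K -> (forall z, cD2 z -> cabs (eval2 P z) <= K) ->
   (forall z w : C * C, cD2 z -> cD2 w -> cabs (eval2 P z - eval2 P w) <= K * (cabs (z.1 - w.1) + cabs (z.2 - w.2))) ->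
   `|cabs (eval2 P (zeta t0)) ^+ 2 - cabs (eval2 P z) ^+ 2| <= 4 * K ^+ 2 * h.
  move=> kk0 k1 k2; rewrite subr_sqr normrM.
  have v1 := k1 _ hTc; have v2 := k1 _ hzc.
  have v3 : `|cabs (eval2 P (zeta t0)) - cabs (eval2 P z)| <= K * (2 * h).
    apply: (@le_trans _ _ (cabs (eval2 P (zeta t0) - eval2 P z))).
      rewrite ler_norml; have := cabs_subr (eval2 P (zeta t0)) (eval2 P z).
      have := cabs_subr (eval2 P z) (eval2 P (zeta t0)); rewrite cabsBC; lra.
    by apply: (le_trans (k2 _ _ hTc hzc)); apply: ler_wpM2l.
  have v4 : `|cabs (eval2 P (zeta t0)) + cabs (eval2 P z)| <= 2 * K.
    by rewrite ger0_norm ?addr_ge0 ?cabs_ge0 //; lra.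
  have -> : 4 * K ^+ 2 * h = K * (2 * h) * (2 * K) by ring.
  by apply: ler_pM.
have hnum : cabs (eval2 p z) ^+ 2 - cabs (eval2 pt z) ^+ 2 <= 8 * N ^+ 2 * h.
  have := lipsq p B B0 hB1 hB; have := lipsq pt B' B0' hB1' hB'.
  rewrite !ler_norml (cabs_ptilde_T2 hp hT) => /andP[_ w1] /andP[w2 _].
  have : B ^+ 2 * h <= N ^+ 2 * h by apply: ler_wpM2r; [exact: ltW | apply: sqr_le => //; rewrite /N; lra].
  have : B' ^+ 2 * h <= N ^+ 2 * h by apply: ler_wpM2r; [exact: ltW | apply: sqr_le => //; rewrite /N; lra].
  lra.
have hH : clarkH n p alpha z <= 8 * N ^+ 2 * h / (eta / 2) ^+ 2.
  rewrite /clarkH.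
  have q0 : 0 < cabs (eval2 Q z) ^+ 2 by lra.
  rewrite ler_pdivrMr // mulrAC ler_pdivlMr //.
  apply: (le_trans (ler_wpM2r (ltW e2) hnum)); apply: ler_wpM2l => //.
  by rewrite mulr_ge0 ?mulr_ge0 ?sqr_ge0 // ltW.
apply: (@le_trans _ _ (8 * N ^+ 2 * h / (eta / 2) ^+ 2 / (1 / (4 * h) * (1 / (4 * h))))).
  by apply: ler_wpM2r => //; rewrite invr_ge0 ltW // mulr_gt0.
rewrite le_eqVlt; apply/orP; left; apply/eqP; field; rewrite !gt_eqF //; lra.
Qed.

Lemma grid_index (N : nat) (x : R) : (0 < N)%N -> 0 <= x < 2 * pi -> exists i : 'I_N,
  i%:R * (2 * pi / N%:R) <= x < i.+1%:R * (2 * pi / N%:R).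
Proof.
move=> N0 /andP[x0 x1]; have p0 : 0 < 2 * pi :> R by rewrite mulr_gt0 // pi_gt0.
have n0 : 0 < N%:R :> R by rewrite ltr0n.
pose y := x / (2 * pi / N%:R); have d0 : 0 < 2 * pi / N%:R :> R by rewrite divr_gt0.
have y0 : 0 <= y by rewrite divr_ge0 // ltW.
have /andP[h1 h2] := truncn_itv y0.
have hN : (Num.truncn y < N)%N.
  rewrite -(ltr_nat R); apply: (le_lt_trans h1); rewrite /y ltr_pdivrMr // mulrCA mulfV ?gt_eqF // mulr1 //.
by exists (Ordinal hN) => /=; rewrite -ler_pdivlMr // -ltr_pdivrMr // h1 h2.
Qed.

(* There are [O(h^-2)] cells of size [h], each of mass [O(h^3)]. *)
Lemma null_level : sg.-negligible [set t | eval2 Q (zeta t) != 0].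
Proof using hp hz hdeg hno ha hsg.
pose U := [set t : R * R | 0 <= t.1 < 2 * pi /\ 0 <= t.2 < 2 * pi].
pose G (k : nat) := [set t : R * R | k.+1%:R^-1 <= cabs (eval2 Q (zeta t))].
have mG k : measurable (G k) by apply: meas_ge; apply: cmeas_cabs; exact: cmeas_eval2.
have mrect (a b c d : R) : measurable [set t : R * R | a <= t.1 < b /\ c <= t.2 < d].
  have -> : [set t : R * R | a <= t.1 < b /\ c <= t.2 < d] = `[a, b[%classic `*` `[c, d[%classic.
    by apply/seteqP; split=> t /=; rewrite !in_itv.
  by apply: measurableX; exact: measurable_itv.
have p0 : 0 < 2 * pi :> R by rewrite mulr_gt0 // pi_gt0.
have key k : sg (U `&` G k) = 0%E.
  have k0 : 0 < k.+1%:R^-1 :> R by rewrite invr_gt0.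
  have [K [h0 [K0 h00 hc]]] := cell_bound k0.
  apply/eqP; rewrite eq_le measure_ge0 andbT; apply/lee_addgt0Pr => e e0; rewrite add0e.
  (* The first term makes the cells smaller than [h0], the second makes the total [K (2 pi)^3 / N]
     smaller than [e]. *)
  pose M : R := 2 * pi / h0 + K * (2 * pi) ^+ 3 / e.
  have [N hN] : exists N : nat, M < N%:R by exists (Num.truncn M).+1; exact: truncnS_gt.
  have m1 : 0 < 2 * pi / h0 by rewrite divr_gt0.
  have m2 : 0 < K * (2 * pi) ^+ 3 / e by rewrite divr_gt0 // mulr_gt0 // exprn_gt0.
  have n0 : 0 < N%:R :> R by rewrite /M in hN; lra.
  have N0 : (0 < N)%N by rewrite -(ltr_nat R).
  pose h : R := 2 * pi / N%:R.
  have hp0 : 0 < h by rewrite divr_gt0.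
  have hh : h < h0.
    by rewrite ltr_pdivrMr // -ltr_pdivrMl // mulrC; rewrite /M in hN; lra.
  pose cell (m : nat) := [set t : R * R | (m %/ N)%N%:R * h <= t.1 < (m %/ N).+1%:R * h /\
                                          (m %% N)%N%:R * h <= t.2 < (m %% N).+1%:R * h].
  have mc m : measurable (U `&` G k `&` cell m).
    by apply: measurableI => //; [apply: measurableI => //; exact: mrect | exact: mrect].
  pose F m := U `&` G k `&` cell m.
  apply: (@le_trans _ _ (\sum_(m < N * N) sg (F m))%E).
    have mUG : measurable (U `&` G k) by apply: measurableI => //; exact: mrect.
    apply: (content_subadditive sg (fun m _ => mc m) mUG).
    move=> t [[u1 u2] Gt]; rewrite -(bigcup_mkord _ F).
    have [i hi] := grid_index N0 u1; have [j hj] := grid_index N0 u2.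
    exists (i * N + j)%N => /=.
      apply: (@leq_trans (i.+1 * N)); last by rewrite leq_mul2r ltn_ord orbT.
      by rewrite mulSn addnC ltn_add2r.
    split=> //; rewrite /cell /= divnMDl // modnMDl modn_small // divn_small // addn0.
    by split.
  apply: (@le_trans _ _ (\sum_(m < N * N) (K * h ^+ 3)%:E)%E).
    apply: lee_sum => m _; apply: (hc h _ hp0 hh (mc m)).
      by move=> t [[_ Gt] _].
    move=> t s [_ [/andP[a1 a2] /andP[a3 a4]]] [_ [/andP[b1 b2] /andP[b3 b4]]].
    rewrite -!natr1 !mulrDl !mul1r in a2 a4 b2 b4.
    by split; rewrite ler_norml; apply/andP; split; lra.
  rewrite sumEFin lee_fin sumr_const card_ord -[_ *+ (N * N)]mulr_natr natrM.
  have -> : K * h ^+ 3 * (N%:R * N%:R) = K * (2 * pi) ^+ 3 / N%:R by rewrite /h; field; rewrite gt_eqF.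
  by rewrite ler_pdivrMr // [e * _]mulrC -ler_pdivrMr //; rewrite /M in hN; lra.
have hU : sg.-negligible (~` U).
  apply/negligibleP; last by have := hsg.1.
  by apply: measurableC; exact: mrect.
apply: (@negligibleS _ _ _ _ (~` U `|` \bigcup_k (U `&` G k))).
  move=> t /=; have [hu|hu] := pselect (U t); last by left.
  rewrite -cabs_gt0; set q := cabs _ => q0; right.
  have [k hk] : exists k : nat, q^-1 < k%:R by exists (Num.truncn q^-1).+1; exact: truncnS_gt.
  exists k => //; split=> //; rewrite /G /= -/q invf_ple ?posrE //; apply: ltW; apply: (lt_trans hk).
  by rewrite ltr_nat.
apply: negligibleU => //; apply: negligible_bigcup => k; apply/negligibleP; last exact: key.
by apply: measurableI => //; exact: mrect.
Qed.

(* If the resultant vanished, [p] and its reflection would share the primitive part of [p]. *)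
Lemma resultant_neq0 : p`_0 * pt`_1 - p`_1 * pt`_0 != 0.
Proof using hp hz hdeg hno.
apply/eqP => /eqP; rewrite subr_eq0 => /eqP e.
have h0 : cabs (0 : C) < 1 by rewrite cabs0.
have p00 : p`_0 != 0.
  by apply/eqP => e0; have := p0_neq0 hp hz h0; rewrite e0 horner0 eqxx.

have t1 : pt`_1 != 0.
  have [_ [ss _]] := hdeg; have := lead_coef_eq0 pt; rewrite lead_coefE ss /= => ->.
  by rewrite -size_poly_eq0 ss.
set g := gcdp (p`_0) (p`_1).
have g0 : g != 0 by rewrite gcdp_eq0 negb_and p00.
have [a ea] : exists a, p`_0 = a * g by exists (p`_0 %/ g); rewrite divpK // dvdp_gcdl.
have [b eb] : exists b, p`_1 = b * g by exists (p`_1 %/ g); rewrite divpK // dvdp_gcdr.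
have cab : coprimep a b.
  have := coprimep_div_gcd (p := p`_0) (q := p`_1); rewrite p00 => /(_ isT).
  have -> : p`_0 %/ g = a by rewrite ea mulpK.
  by have -> : p`_1 %/ g = b by rewrite eb mulpK.
have a0 : a != 0 by apply: contra_neq p00 => e0; rewrite ea e0 mul0r.
have e2 : a * pt`_1 = b * pt`_0.
  by apply: (mulIf g0); rewrite mulrAC -ea e eb; ring.
have da : a %| pt`_0.
  by rewrite -(Gauss_dvdpr _ cab) -e2 dvdp_mulr.
have [f ef] : exists f, pt`_0 = f * a by exists (pt`_0 %/ a); rewrite divpK.
have ef1 : pt`_1 = f * b by apply: (mulfI a0); rewrite e2 ef; ring.
have b0 : b != 0 by apply: contra_neq t1 => e0; rewrite ef1 e0 mulr0.
have := hno (d := a%:P + b%:P * 'X) (r := g%:P) (s := f%:P).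
case.
- by rewrite {1}(poly_lin hp) ea eb !polyCM; ring.
- by rewrite {1}(poly_lin (deg_ptilde n p)) ef ef1 !polyCM; ring.
by rewrite addrC size_MXaddC (negbTE (_ : b%:P != 0)) ?polyC_eq0 //= size_polyC b0.
Qed.

(** A common root makes [p], hence by reflection [ptilde], vanish on the line [z1 = t], so that
    [X - t] would divide both. *)
Lemma no_common_root (t : C) : t != 0 -> cabs t = 1 -> (p`_0).[t] = 0 -> (p`_1).[t] = 0 -> False.
Proof using hp hno.
move=> t0 ht h0 h1.
have hev z2 : eval2 p (t, z2) = 0 by rewrite (eval2_lin _ hp) /= h0 h1 mul0r addr0.

have hpt z2 : z2 != 0 -> (pt`_0).[t] + (pt`_1).[t] * z2 = 0.
  move=> z20; have := @eval2_ptilde R n p (t, z2) hp t0 z20.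
  rewrite (eval2_lin _ (deg_ptilde n p)) /= => ->.
  by rewrite (conj_unim ht) invrK hev cconj0 mulr0.
have k1 := hpt 1 (oner_neq0 _); have k2 := hpt (-1) (_ : -1 != 0).
rewrite mulr1 in k1; rewrite mulrN1 oppr_eq0 in k2; have {}k2 := k2 (oner_neq0 _).
have e1 : (pt`_0).[t] = 0.
  have : (pt`_0).[t] *+ 2 = 0 by rewrite mulr2n -[RHS]addr0 -{1}k1 -k2; ring.
  by move/eqP; rewrite mulrn_eq0 /= => /eqP.
have e2 : (pt`_1).[t] = 0 by rewrite e1 add0r in k1.
have dv q : q.[t] = 0 -> exists r, q = ('X - t%:P) * r.
  by move=> hq; have /factor_theorem[r er] : root q t; [exact/eqP | exists r; rewrite mulrC].
have [r0 f0] := dv _ h0; have [r1 f1] := dv _ h1.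
have [s0 g0] := dv _ e1; have [s1 g1] := dv _ e2.
have := hno (d := ('X - t%:P)%:P) (r := r0%:P + r1%:P * 'X) (s := s0%:P + s1%:P * 'X).
case.
- by rewrite {1}(poly_lin hp) f0 f1 !polyCM; ring.
- by rewrite {1}(poly_lin (deg_ptilde n p)) g0 g1 !polyCM; ring.
by rewrite coefC eqxx size_XsubC.
Qed.

(** A zero of [p] on the torus is a zero of [ptilde], so its first coordinate is a root of the
    resultant; over each root the degree one in [z2] leaves at most one point, and points have no
    mass. *)
Lemma null_zeros : sg.-negligible [set t | eval2 p (zeta t) = 0].
Proof using hp hz hdeg hno ha hsg.
pose U := [set t : R * R | 0 <= t.1 < 2 * pi /\ 0 <= t.2 < 2 * pi].
have hU : sg.-negligible (~` U).
  apply/negligibleP; last by have := hsg.1.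
  apply: measurableC.
  have -> : U = `[0, 2 * pi[%classic `*` `[0, 2 * pi[%classic.
    by apply/seteqP; split=> t /=; rewrite !in_itv.
  by apply: measurableX; exact: measurable_itv.
set N := p`_0 * pt`_1 - p`_1 * pt`_0.
have [rs hrs] : exists rs : seq C, forall t, root N t -> t \in rs.
  have [rs ers] := closed_field_poly_normal N; exists rs => t.
  by rewrite ers rootZ ?lead_coef_eq0 ?resultant_neq0 // root_prod_XsubC.
pose S (c : C) := [set t | U t /\ eval2 p (zeta t) = 0 /\ (zeta t).1 = c].
have nS c : sg.-negligible (S c).
  have [[t0 [[u1 u2] [z0 e0]]]|hne] := pselect (exists t0, S c t0); last first.
    have -> : S c = set0 by apply/seteqP; split=> t // ht; apply: hne; exists t.
    exact: negligible_set0.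
  apply: (@negligibleS _ _ _ _ [set t0]).
    move=> t [[v1 v2] [zt et]].
    have q1 : t.1 = t0.1 by apply: expi_inj => //; rewrite -[RHS]e0 in et.
    suff q2 : t.2 = t0.2 by move: q1 q2; case: (t) (t0) => [x y] [x' y'] /= -> ->.
    apply: expi_inj => //; move: z0 zt; rewrite !(eval2_lin _ hp).
    have -> : (zeta t).1 = c by []. rewrite e0 /= => z0 zt.
    have p1 : (p`_1).[c] != 0.
      apply/eqP => h1; have hc : cabs c = 1 by rewrite -e0 cabs_expi.
      apply: (no_common_root (unim_neq0 hc) hc _ h1).
      by move: z0; rewrite h1 mul0r addr0.
    by apply: (mulfI p1); apply: (addrI (p`_0).[c]); rewrite zt z0.
  by apply/negligibleP; [exact: measurable_pt | exact: (no_atom hp hz hdeg hno ha hsg)].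
apply: (@negligibleS _ _ _ _ (~` U `|` [set t | exists2 c, c \in rs & S c t])).
  move=> t /= h0; have [hu|hu] := pselect (U t); last by left.
  right; exists (zeta t).1 => //; apply: hrs.
  have hT : in_T2 (zeta t : C * C) by split; exact: cabs_expi.
  have ht0 : eval2 pt (zeta t) = 0.
    by apply/eqP; rewrite -cabs_eq0 (cabs_ptilde_T2 hp hT) h0 cabs0.
  move: h0 ht0; rewrite (eval2_lin _ hp) (eval2_lin _ (deg_ptilde n p)) => /eqP + /eqP.
  rewrite !addr_eq0 => /eqP a0 /eqP b0.
  by apply/eqP; rewrite /N hornerD hornerN !hornerM a0 b0; ring.
apply: negligibleU => //; elim: rs {hrs} => [|c rs IH].
  have -> : [set t | exists2 c : C, c \in [::] & S c t] = set0.
    by apply/seteqP; split=> t //= [c].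
  exact: negligible_set0.
apply: (@negligibleS _ _ _ _ (S c `|` [set t | exists2 c, c \in rs & S c t])).
  move=> t /= [c']; rewrite inE => /predU1P[->|h] hS; [by left | by right; exists c'].
exact: negligibleU.
Qed.

End ClarkSupport.

(** * Boundary values *)

Section Completeness.
Context {R : realType}.
Local Notation C := R[i].
Local Notation array := (nat -> nat -> C).
Implicit Types (a b : array).

Lemma H2norm2_ge N a : ((nN N a)%:E <= H2norm2 a)%E.
Proof.
have e : (nN N a)%:E = (\sum_(x \in `I_N `*` `I_N) ((cabs (a x.1 x.2)) ^+ 2)%:E)%E.
  rewrite -(pair_fsbig _ (fun j k => (cabs (a j k) ^+ 2)%:E)) //.
  rewrite -fsbig_ord /nN -sumEFin; apply: eq_bigr => j _.
  by rewrite -fsbig_ord -sumEFin.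
rewrite e; apply: ereal_sup_ubound; exists (`I_N `*` `I_N) => //.
by split=> //; apply: finite_setX; exact: finite_II.
Qed.

Lemma H2norm2_le M a : bnd M a -> (H2norm2 a <= (M ^+ 2)%:E)%E.
Proof.
move=> [M0 h]; apply: ge_ereal_sup => _ [A [fA _] <-].
have [N hN] : exists N, A `<=` `I_N `*` `I_N.
  have /finite_seqP[s es] := fA; rewrite es {es}.
  elim: s => [|[j k] s [N IH]]; first by exists 0%N => x /=; rewrite in_nil.
  exists (maxn N (maxn j k).+1) => x /=; rewrite inE => /predU1P[->|/IH[/= h1 h2]] /=.
    by split => /=; lia.
  by split; lia.
apply: (@le_trans _ _ (nN N a)%:E); last by rewrite lee_fin.
have e : (nN N a)%:E = (\sum_(x \in `I_N `*` `I_N) ((cabs (a x.1 x.2)) ^+ 2)%:E)%E.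
  rewrite -(pair_fsbig _ (fun j k => (cabs (a j k) ^+ 2)%:E)) //.
  rewrite -fsbig_ord /nN -sumEFin; apply: eq_bigr => j _.
  by rewrite -fsbig_ord -sumEFin.
rewrite e; apply: lee_fsum_nneg_subset => //.
- by apply: finite_setX; exact: finite_II.
- by move=> x; rewrite !inE; exact: hN.
- by move=> x _; rewrite lee_fin sqr_ge0.
Qed.

Lemma nN_sub0 N a b : nN N (fun j k => a j k - b j k) = nN N (fun j k => b j k - a j k).
Proof. by apply: eq_bigr => j _; apply: eq_bigr => k _; rewrite cabsBC. Qed.

Lemma l2_complete (f : nat -> array) :
  (forall e : R, 0 < e -> exists N, forall k l, (N <= k)%N -> (N <= l)%N -> bnd e (fun i j => f k i j - f l i j)) ->
  exists a, forall e : R, 0 < e -> exists N, forall k, (N <= k)%N -> bnd e (fun i j => f k i j - a i j).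
Proof.
move=> hC.
have /choice[a ha] : forall i, exists ai : nat -> C, forall j, ccvg (fun k => f k i j) (ai j).
  move=> i; have /choice[ai hai] : forall j, exists l, ccvg (fun k => f k i j) l.
    move=> j; apply: complex_cauchy => e e0.
    have e2 : 0 < e / 2 by rewrite divr_gt0.
    have [N hN] := hC _ e2; exists N => m hm.
    by have := bnd_coef i j (hN m N hm (leqnn _)); lra.
  by exists ai.
exists a => e e0; have [N hN] := hC _ e0; exists N => k hk.
apply: (@bnd_limit _ (fun m i j => f k i j - f (m + N)%N i j)) => [i j d d0|m]; last first.
  by apply: hN => //; lia.
have [m0 hm0] := ha i j d d0; exists m0 => m hm.
have -> : f k i j - f (m + N)%N i j - (f k i j - a i j) = - (f (m + N)%N i j - a i j) by ring.
by rewrite cabsN; apply: hm0; lia.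
Qed.
End Completeness.

(** * Density of kernel combinations in the model space *)

Section KernelDensity.
Context {R : realType}.
Local Notation C := R[i].
Local Notation array := (nat -> nat -> C).
Local Notation poly2 := {poly {poly C}}.
Implicit Types (a b : array) (L : seq (C * (C * C))).
Context (n : nat) (p : poly2) (hp : deg_le_n1 n p)
  (hz : forall z : C * C, in_D2 z -> eval2 p z != 0).

Lemma in_K_bnd a : in_K n p a -> exists M, bnd M a.
Proof. by move=> [h _]; exact: sq_bnd. Qed.

Lemma in_K_lin a b c : in_K n p a -> in_K n p b -> in_K n p (fun j k => c * a j k + b j k).
Proof using hp hz.
move=> ha hb; have [M hM] := in_K_bnd ha; have [M' hM'] := in_K_bnd hb.
have c0 : 0 < cabs c + 1 by have := cabs_ge0 c; lra.
have hc : cabs c <= cabs c + 1 by lra.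
apply: (defect_in_K hp hz (bndD (bndZ hM c0 hc) hM')) => m1 m2.
rewrite pconvDr pconvZr (in_K_defect hp hz ha) (in_K_defect hp hz hb) mulr0 addr0 //.
Qed.

Lemma in_K_sub a b : in_K n p a -> in_K n p b -> in_K n p (fun j k => a j k - b j k).
Proof using hp hz.
move=> ha hb; have -> : (fun j k => a j k - b j k) = fun j k => (-1) * b j k + a j k.
  by apply/funext => j; apply/funext => k; rewrite mulN1r addrC.
exact: in_K_lin.
Qed.

(** Each coefficient of [p a] depends continuously on [a], so the vanishing conditions of
    [deg_defect] pass to the limit. *)
Lemma in_K_closed (f : nat -> array) a : (forall m, in_K n p (f m)) ->
  (forall e : R, 0 < e -> exists N, forall k, (N <= k)%N -> bnd e (fun i j => f k i j - a i j)) ->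
  in_K n p a.
Proof using hp hz.
move=> hf hl.
have [N hN] := hl 1 ltr01; have hN1 := hN N (leqnn _).
have [M hM] := in_K_bnd (hf N).
have hB : bnd (M + 1) a.
  by apply: bnd_ext (bndB hM hN1) => j k; ring.
apply: (defect_in_K hp hz hB) => m1 m2.
have [K K0 hK] := bnd_pconv p.
apply/eqP; rewrite -cabs_eq0 eq_le cabs_ge0 andbT; apply/ler_addgt0Pr => e e0; rewrite add0r.
have eK : 0 < e / K by rewrite divr_gt0.
have [k hk] := hl _ eK; have hk1 := hK _ _ (hk k (leqnn _)).
have := bnd_coef (m1 + n)%N (m2 + 1)%N hk1.
rewrite pconvBr (in_K_defect hp hz (hf k)) sub0r cabsN mulrC divfK // gt_eqF //.
Qed.

Lemma in_K0 : in_K n p (fun _ _ => 0).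
Proof using hp hz.
have hb : bnd 1 (fun _ _ => 0 : C).
  by split=> // N; rewrite /nN big1 ?expr1n // => j _; rewrite big1 // => k _; rewrite cabs0 expr0n.
apply: (defect_in_K hp hz hb) => m1 m2.
by rewrite /pconv big1 // => l _; rewrite big1 // => i _; rewrite mulr0.
Qed.

Definition is_kernel (kap : C * C -> array) := forall w, in_D2 w -> [/\ in_K n p (kap w),
  (forall z, in_D2 z -> ev (kap w) z = kker n p w z), (forall N, nN N (kap w) <= kn n p w) &
  forall a, in_K n p a -> inner_is a (kap w) (ev a w)].

Lemma kernel_family : exists kap, is_kernel kap.
Proof using hp hz.
have /choice[kap h] : forall w, exists k : array, in_D2 w -> [/\ in_K n p k,
  (forall z, in_D2 z -> ev k z = kker n p w z), (forall N, nN N k <= kn n p w) &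
  forall a, in_K n p a -> inner_is a k (ev a w)].
  move=> w; have [hw|hw] := pselect (in_D2 w); last by exists (fun _ _ => 0).
  by have [k hk] := kernel_norm_ex hp hz hw; exists k.
by exists kap.
Qed.

(** A combination is a list of coefficients paired with points, so that sums and multiples of
    combinations are concatenation and [map]. *)
Definition kcomb (kap : C * C -> array) L : array := fun j k => \sum_(x <- L) x.1 * kap x.2 j k.
Definition in_disc L := forall x, x \in L -> in_D2 x.2.

Context (kap : C * C -> array) (hk : is_kernel kap).

Lemma kcomb_cons x L : kcomb kap (x :: L) = fun j k => x.1 * kap x.2 j k + kcomb kap L j k.
Proof. by apply/funext => j; apply/funext => k; rewrite /kcomb big_cons. Qed.
Lemma kcomb_nil : kcomb kap [::] = fun _ _ => 0.
Proof. by apply/funext => j; apply/funext => k; rewrite /kcomb big_nil. Qed.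
Lemma kcomb_cat L L' : kcomb kap (L ++ L') = fun j k => kcomb kap L j k + kcomb kap L' j k.
Proof. by apply/funext => j; apply/funext => k; rewrite /kcomb big_cat. Qed.
Lemma kcomb_scale c L : kcomb kap [seq (c * x.1, x.2) | x <- L] = fun j k => c * kcomb kap L j k.
Proof.
apply/funext => j; apply/funext => k; rewrite /kcomb big_map mulr_sumr.
by apply: eq_bigr => x _; rewrite mulrA.
Qed.
Lemma in_disc_cat L L' : in_disc L -> in_disc L' -> in_disc (L ++ L').
Proof. by move=> h h' x; rewrite mem_cat => /orP[/h|/h']. Qed.
Lemma in_disc_scale c L : in_disc L -> in_disc [seq (c * x.1, x.2) | x <- L].
Proof. by move=> h x /mapP[y /h hy ->]. Qed.

Lemma kcomb_in_K L : in_disc L -> in_K n p (kcomb kap L).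
Proof using hp hz hk.
elim: L => [|x L IH] h; first by rewrite kcomb_nil; exact: in_K0.
rewrite kcomb_cons; apply: in_K_lin; last by apply: IH => y hy; apply: h; rewrite inE hy orbT.
by have [] := hk (h x (mem_head _ _)).
Qed.

Lemma parallelogram N a b : nN N (fun j k => a j k - b j k) + nN N (fun j k => a j k + b j k) =
  2 * nN N a + 2 * nN N b.
Proof.
rewrite /nN !mulr_sumr -!big_split; apply: eq_bigr => j _ /=.
rewrite !mulr_sumr -!big_split; apply: eq_bigr => k _ /=.
rewrite cabs_sqrB cabs_sqrD; ring.
Qed.

(* A minimising sequence of residuals [a - sum c_i k_{w_i}] converges by the parallelogram law, and its
   limit is orthogonal to every kernel, so it vanishes. *)
Lemma kernel_dense a : in_K n p a -> forall e : R, 0 < e ->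
  exists2 L, in_disc L & bnd e (fun i j => a i j - kcomb kap L i j).
Proof using hp hz hk.
move=> ha.
pose r L : array := fun i j => a i j - kcomb kap L i j.
pose S := [set x : R | exists2 L, in_disc L & forall N, nN N (r L) <= x].
have Sb L : in_disc L -> exists2 M, S M & bnd (Num.sqrt (M + 1)) (r L).
  move=> hL; have [M hM] := in_K_bnd (in_K_sub ha (kcomb_in_K hL)).
  exists (M ^+ 2); first by exists L => // N; exact: hM.2.
  have m0 : 0 <= M ^+ 2 + 1 by rewrite addr_ge0 ?sqr_ge0.
  split; first by rewrite sqrtr_gt0; have := sqr_ge0 M; lra.
  by move=> N; rewrite sqr_sqrtr //; have := hM.2 N; rewrite /r; lra.
have hS : has_inf S.
  split; first by have [//|M hM _] := Sb [::]; exists M.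
  by exists 0 => x [L _ hL]; apply: le_trans (nN_ge0 0 _) (hL 0%N).
set d := inf S.
have d0 : 0 <= d by apply: lb_le_inf; [exact: hS.1 | move=> x [L _ hL]; apply: le_trans (nN_ge0 0 _) (hL 0%N)].
have low L e : in_disc L -> 0 < e -> exists N, d - e < nN N (r L).
  move=> hL e0; apply: contrapT => hne.
  have : S (d - e).
    by exists L => // N; rewrite leNgt; apply/negP => h; apply: hne; exists N.
  by move/(ge_inf hS.2); rewrite -/d; lra.
have hseq m : exists L, in_disc L /\ forall N, nN N (r L) <= d + m.+1%:R^-1.
  have m0 : 0 < m.+1%:R^-1 :> R by rewrite invr_gt0.
  have [x [L hL hx] hxd] := inf_adherent m0 hS.
  by exists L; split=> // N; apply: (le_trans (hx N)); rewrite -/d in hxd; exact: ltW.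
have /choice[L hL] := hseq.
have hdiff k l N : nN N (fun i j => r (L k) i j - r (L l) i j) <= 2 * k.+1%:R^-1 + 2 * l.+1%:R^-1.
  apply/ler_addgt0Pr => e e0; have e4 : 0 < e / 4 by rewrite divr_gt0.
  (* The residual of the averaged combination is the mean of the two residuals; its squared norm is
     nearly at least the infimum [d], and the parallelogram law bounds the difference. *)
  pose mid := [seq (2^-1 * x.1, x.2) | x <- L k ++ L l].
  have hmid : in_disc mid by apply: in_disc_scale; apply: in_disc_cat; [have [] := hL k | have [] := hL l].
  have [N1 hN1] := low _ _ hmid e4.
  set N2 := maxn N N1.
  apply: (le_trans (nN_mono _ (leq_maxl N N1))).
  have := parallelogram N2 (r (L k)) (r (L l)).
  have e1 : nN N2 (fun i j => r (L k) i j + r (L l) i j) = 4 * nN N2 (r mid).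
    rewrite /nN mulr_sumr; apply: eq_bigr => i _; rewrite mulr_sumr; apply: eq_bigr => j _.
    have -> : r (L k) i j + r (L l) i j = 2 * r mid i j.
      by rewrite /r /mid kcomb_scale kcomb_cat; field.
    rewrite cabsM exprMn; congr (_ * _).
    have -> : (2 : C) = ((2 : R)%:C)%C by rewrite rmorph_nat.
    by rewrite cabs_real normr_nat; ring.
  rewrite e1; have := nN_mono (r mid) (leq_maxr N N1); rewrite -/N2; move: hN1.
  have := (hL k).2 N2; have := (hL l).2 N2.
  move: (nN N2 (r (L k))) (nN N2 (r (L l))) (nN N2 (r mid)) (k.+1%:R^-1) (l.+1%:R^-1) => *; lra.
have smallq (e : R) : 0 < e -> exists m0 : nat, forall m, (m0 <= m)%N -> m.+1%:R^-1 < e.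
  move=> e0; exists (Num.truncn e^-1) => m hm.
  rewrite invf_plt ?posrE //; apply: (lt_le_trans (truncnS_gt _)); by rewrite ler_nat.
have [x hx] : exists x, forall e : R, 0 < e -> exists N, forall k, (N <= k)%N -> bnd e (fun i j => r (L k) i j - x i j).
  apply: l2_complete => e e0; have e4 : 0 < e ^+ 2 / 4 by rewrite divr_gt0 // exprn_gt0.
  have [N hN] := smallq _ e4; exists N => k l hk' hl'; split=> // N'.
  apply: (le_trans (hdiff k l N')); have := hN k hk'; have := hN l hl'.
  move: (k.+1%:R^-1) (l.+1%:R^-1) => *; lra.
have rK m : in_K n p (r (L m)) by apply: in_K_sub => //; apply: kcomb_in_K; have [] := hL m.
have xK : in_K n p x by exact: in_K_closed hx.
have [Mx hMx] := in_K_bnd xK.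
have x0 w : in_D2 w -> ev x w = 0.
  move=> hw; apply/eqP; rewrite -cabs_eq0 eq_le cabs_ge0 andbT.
  have [kK kev kb krep] := hk hw.
  pose K := kn n p w; have K0 : 0 <= K := le_trans (nN_ge0 0 _) (kb 0%N).
  (* Minimality is tested on the residual plus [c] times the kernel, where [|c| = t] and the phase
     of [c] makes the cross term tend to [- 2 t |ev|]. *)
  have main t m : 0 < t -> 2 * t * cabs (ev (r (L m)) w) <= m.+1%:R^-1 + t ^+ 2 * K.
    move=> t0; have [g g1 eg] := polar (ev (r (L m)) w).
    pose c := - (t%:C)%C * cconj g.
    apply/ler_addgt0Pr => e e0.
    have hL' : in_disc ((- c, w) :: L m).
      by move=> y; rewrite inE => /predU1P[->//|]; have [h _] := hL m; exact: h.
    have e1 : r ((- c, w) :: L m) = fun i j => r (L m) i j + c * kap w i j.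
      by apply/funext => i; apply/funext => j; rewrite /r kcomb_cons /=; ring.
    have e2 : 0 < e / 2 by rewrite divr_gt0.
    have e4 : 0 < e / (4 * t) by rewrite divr_gt0 // mulr_gt0.
    have [N1 hN1] := low _ _ hL' e2.
    have [N2 hN2] := krep _ (rK m) _ e4.
    set N := maxn N1 N2.
    have := nN_mono (r ((- c, w) :: L m)) (leq_maxl N1 N2); rewrite -/N e1 (nN_add N) => h1.
    rewrite e1 in hN1.
    have e5 : nN N (fun i j => c * kap w i j) <= t ^+ 2 * K.
      have -> : nN N (fun i j => c * kap w i j) = t ^+ 2 * nN N (kap w).
        rewrite /nN mulr_sumr; apply: eq_bigr => i _; rewrite mulr_sumr; apply: eq_bigr => j _.
        by rewrite cabsM exprMn /c cabsM cabsN cabs_conj g1 mulr1 cabs_real real_normK ?num_real.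
      by apply: ler_wpM2l; [exact: sqr_ge0 | exact: kb].
    have e6 : ipN N (r (L m)) (fun i j => c * kap w i j) = cconj c * ipN N (r (L m)) (kap w).
      by rewrite ipNZr.
    have h2 := hN2 N (leq_maxr _ _); rewrite -/(ipN _ _ _) in h2.
    rewrite e6 in h1.
    have cc : cconj c = - (t%:C)%C * g.
      by rewrite /c cconjM cconjN cconjK; congr (- _ * _); apply: complex_ext; rewrite /= ?oppr0.
    have e7 : cconj c * ipN N (r (L m)) (kap w) =
       - (t * cabs (ev (r (L m)) w))%:C%C + cconj c * (ipN N (r (L m)) (kap w) - ev (r (L m)) w).
      rewrite mulrBr; have -> : cconj c * ev (r (L m)) w = - (t * cabs (ev (r (L m)) w))%:C%C.
        by rewrite cc -mulrA eg mulNr real_complexM.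
      by rewrite opprK addrCA addNr addr0.
    rewrite e7 cReD in h1.
    have h3 : complex.Re (cconj c * (ipN N (r (L m)) (kap w) - ev (r (L m)) w)) <= e / 4.
      apply: (le_trans (Re_le_cabs _)); rewrite cabsM cabs_conj /c cabsM cabsN cabs_conj g1 mulr1 cabs_real.
      rewrite (ger0_norm (ltW t0)); apply: (@le_trans _ _ (t * (e / (4 * t)))).
        by apply: ler_wpM2l; apply: ltW.
      by rewrite le_eqVlt; apply/orP; left; apply/eqP; field; rewrite gt_eqF.
    have h4 : complex.Re (- (t * cabs (ev (r (L m)) w))%:C%C) = - (t * cabs (ev (r (L m)) w)) by rewrite cReN.
    rewrite h4 in h1.
    have h5 := (hL m).2 N.
    set X := complex.Re (cconj c * _) in h1 h3; clearbody X.
    move: h5; move: (m.+1%:R^-1) => q h5; lra.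
  have main2 t : 0 < t -> 2 * t * cabs (ev x w) <= t ^+ 2 * K.
    move=> t0; apply/ler_addgt0Pr => e e0; have e2 : 0 < e / 2 by rewrite divr_gt0.
    have [h1 h2] : cabs w.1 < 1 /\ cabs w.2 < 1 by [].
    pose D := (1 - cabs w.1) * (1 - cabs w.2).
    have D0 : 0 < D by rewrite mulr_gt0 // subr_gt0.
    have e4 : 0 < e / (4 * t) * D by rewrite mulr_gt0 // divr_gt0 // mulr_gt0.
    have [m1 hm1] := smallq _ e2; have [m2 hm2] := hx _ e4.
    set m := maxn m1 m2; have q1 := hm1 m (leq_maxl _ _); have q2 := hm2 m (leq_maxr _ _).
    have q3 := ev_le (fun j k => bnd_coef j k q2) hw.
    rewrite -/D mulfK ?gt_eqF // evB // in q3; last 2 first.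
    - by have [M hM] := in_K_bnd (rK m); exact: bnd_bdd hM.
    - exact: bnd_bdd hMx.
    have q4 : cabs (ev x w) <= cabs (ev (r (L m)) w) + e / (4 * t).
      have := cabsD (ev (r (L m)) w) (- (ev (r (L m)) w - ev x w)); rewrite cabsN.
      have -> : ev (r (L m)) w + - (ev (r (L m)) w - ev x w) = ev x w by ring.
      lra.
    have q5 := main t m t0.
    have q6 : 2 * t * cabs (ev x w) <= 2 * t * (cabs (ev (r (L m)) w) + e / (4 * t)).
      by apply: ler_wpM2l => //; rewrite mulr_ge0 // ltW.
    have q7 : 2 * t * (cabs (ev (r (L m)) w) + e / (4 * t)) = 2 * t * cabs (ev (r (L m)) w) + e / 2.
      by field; rewrite gt_eqF.
    move: q1 q5 q6; rewrite q7; move: (m.+1%:R^-1) => *; lra.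
  apply/ler_addgt0Pr => e e0; rewrite add0r.
  (* For this [t] the bound [2 t |ev| <= t^2 K] gives [|ev| <= t K / 2 < e]. *)
  have t0 : 0 < 2 * e / (K + 1) by rewrite divr_gt0 ?mulr_gt0 //; lra.
  have := main2 _ t0; set t := 2 * e / (K + 1) in t0 *.
  have et : t * (K + 1) = 2 * e by rewrite /t divfK // gt_eqF //; lra.
  have -> : t ^+ 2 * K = 2 * t * (t * K / 2) by field.
  have e3 : t * (K + 1) = t * K + t by ring.
  have t2 : 0 < 2 * t by lra.
  by rewrite (ler_pM2l t2) => h; lra.
have xe : x = fun _ _ => 0.
  apply: ev_inj; [exact: bnd_bdd hMx | by exists 0 => j k; rewrite cabs0 | move=> z hzz].
  rewrite x0 //; apply/esym/eqP; rewrite -cabs_eq0 eq_le cabs_ge0 andbT.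
  have h : forall j k : nat, cabs ((fun _ _ => 0 : C) j k) <= 0 by move=> j k; rewrite cabs0.
  by have := ev_le h hzz; rewrite mul0r.
move=> e e0; have [m hm] := hx _ e0; exists (L m); first by have [] := hL m.
by apply: bnd_ext (hm m (leqnn _)) => i j; rewrite xe subr0.
Qed.
End KernelDensity.

Section AlmostEverywhere.
Context {R : realType} {d : measure_display} {T : measurableType d}.
Context (mu : {measure set T -> \bar R}).

Lemma bc_geo (E : nat -> set T) (K : R) : (forall m, measurable (E m)) ->
  (forall m, (mu (E m) <= (K * (2^-1) ^+ m)%:E)%E) ->
  mu.-negligible [set t | forall m0, exists2 m, (m0 <= m)%N & E m t].
Proof.
move=> mE hE; apply: (@negligibleS _ _ _ _ (lim_sup_set E)).
  by move=> t /= h m0 _; have [m hm] := h m0; exists m.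
apply/negligibleP.
  by apply: bigcapT_measurable => k; apply: bigcup_measurable.
apply: lim_sup_set_cvg0 => //.
apply: (@le_lt_trans _ _ (\sum_(0 <= m <oo) (K * (2^-1) ^+ m)%:E)%E).
  by apply: lee_nneseries => // m _; exact: hE.
have h12 : `|2^-1 : R| < 1 by rewrite ger0_norm ?invr_ge0 //; lra.
have hcv := @cvg_geometric_series R K 2^-1 h12.
have -> : (\sum_(0 <= m <oo) (K * (2^-1) ^+ m)%:E)%E = (K * (1 - 2^-1)^-1)%:E.
  apply: cvg_lim => //.
  have -> : (fun n : nat => (\sum_(0 <= m < n) (K * (2^-1) ^+ m)%:E)%E) =
      EFin \o series (geometric K 2^-1).
    by apply/funext => m /=; rewrite /series /= sumEFin.
  by apply: cvg_EFin; [exact: nearW | exact: hcv].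
by rewrite ltry.
Qed.

Lemma chebyshev2 (g : T -> R) (c M : R) : measurable_fun setT g -> 0 < c ->
  (\int[mu]_t (g t ^+ 2)%:E <= M%:E)%E -> (mu [set t | (c <= g t)%R] <= (M / c ^+ 2)%:E)%E.
Proof.
move=> mg c0 hM; set A := [set t | c <= g t].
have mA : measurable A by exact: meas_ge.
have c2 : 0 < c ^+ 2 by rewrite exprn_gt0.
rewrite mulrC EFinM lee_pdivlMl //; apply: (le_trans _ hM).
rewrite -(setIT A) -integral_indic // -ge0_integralZl_EFin ?(ltW c2) //; last first.
  by apply/measurable_EFinP; exact: measurable_indic.
apply: ge0_le_integral => //.
- by move=> t _; rewrite -EFinM lee_fin mulr_ge0 ?(ltW c2) // indicE ler0n.
- by apply: measurable_funeM; apply/measurable_EFinP; exact: measurable_indic.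
- by apply/measurable_EFinP; exact: measurable_funX.
move=> t _; rewrite -EFinM lee_fin indicE; case: (boolP (t \in A)) => ht.
  by rewrite mulr1; apply: sqr_le; [exact: ltW | exact: set_mem ht].
by rewrite mulr0 sqr_ge0.
Qed.

(** Chebyshev at height [1 / 2^m] gives sets of measure at most [1 / 4^m], and Borel-Cantelli
    applies. *)
Lemma ae_of_L2 (g : nat -> T -> R) : (forall m, measurable_fun setT (g m)) ->
  (forall m, (\int[mu]_t (g m t ^+ 2)%:E <= ((16 ^+ m)^-1)%:E)%E) ->
  mu.-negligible [set t | ~ exists m0, forall m, (m0 <= m)%N -> g m t < (2 ^+ m)^-1].
Proof.
move=> mg hg; pose E m := [set t | (2 ^+ m)^-1 <= g m t].
have p2 m : 0 < 2 ^+ m :> R by rewrite exprn_gt0.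
apply: (@negligibleS _ _ _ _ [set t | forall m0, exists2 m, (m0 <= m)%N & E m t]).
  move=> t /= h m0; apply: contrapT => h'; apply: h; exists m0 => m hm.
  by rewrite ltNge; apply/negP => hE; apply: h'; exists m.
apply: (@bc_geo E 1); first by move=> m; exact: meas_ge.
move=> m; apply: (le_trans (chebyshev2 (mg m) _ (hg m))); first by rewrite invr_gt0.
rewrite lee_fin mul1r exprVn.
have e16 : 16 ^+ m = (2 ^+ m) ^+ 4 :> R by rewrite exprAC; congr (_ ^+ _); ring.
rewrite e16; have : 1 <= 2 ^+ m :> R by rewrite exprn_ege1 //; lra.
move: (2 ^+ m) (p2 m) => x x0 x1.
have -> : (x ^+ 4)^-1 / (x^-1) ^+ 2 = x^-1 * x^-1 by field; rewrite gt_eqF.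
by rewrite ger_pMr ?invr_gt0 // invf_le1.
Qed.
End AlmostEverywhere.

(** * Estimates over the zeros of [Q(z1, 0)] and of [Q(0, z2)] *)

Section StripBounds.
Context {R : realType}.
Local Notation C := R[i].
Local Notation array := (nat -> nat -> C).
Local Notation poly2 := {poly {poly C}}.
Implicit Types (a b : array) (L : seq (C * (C * C))).
Context (n : nat) (p : poly2) (hp : deg_le_n1 n p)
  (hz : forall z : C * C, in_D2 z -> eval2 p z != 0)
  (hdeg : deg_eq_n1 n (ptilde n p)) (hno : no_common_factor p (ptilde n p))
  (alpha : C) (ha : cabs alpha = 1).
Local Notation pt := (ptilde n p).
Local Notation phi := (Defs.phi n p).
Local Notation Q := (level n p alpha).

Lemma strip_fst g (x : C) : in_K n p g -> cabs x < 1 ->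
  ev1 (fun j => pconv p g j 0%N) x = eval2 p (x, 0) * ev g (x, 0).
Proof using hp hz.
move=> hg hx; have [M hM] := in_K_bnd hg; have hD := in_D2_0 hx.
rewrite -(ev_pconv p (bnd_bdd hM) hD) (ev_strip (bdd_pconv p (bnd_bdd hM)) hD (in_K_defect hp hz hg)).
by rewrite /= mul0r addr0.
Qed.

(** [level_bound] divides [|Q|] by the product of the [1 - |z_i|^2]; where [|Q|] is at most [K]
    times that product, only the norm of [g] remains, and [(2 B K + 1)^2] absorbs the factor
    [2 B K]. *)
Lemma key_bound g (eps : R) z (B K : R) : in_K n p g -> bnd eps g -> in_D2 z -> 0 <= K ->
  cabs (eval2 p z) <= B -> cabs (eval2 Q z) <= K * ((1 - cabs z.1 ^+ 2) * (1 - cabs z.2 ^+ 2)) ->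
  cabs (eval2 p z * ev g z) <= (2 * B * K + 1) * eps.
Proof using hp hz hdeg hno ha.
move=> hg he hD K0 hB hK.
have B0 : 0 <= B := le_trans (cabs_ge0 _) hB.
have e0 := he.1.
have D0 : 0 < (1 - cabs z.1 ^+ 2) * (1 - cabs z.2 ^+ 2).
  by have [h1 h2] := D2_sqr hD; exact: mulr_gt0.
apply: sqr_le_cancel; first by rewrite mulr_ge0 ?addr_ge0 ?mulr_ge0 // ltW.
apply: (le_trans (level_bound hp hz ha hg he.2 hD)).
rewrite ler_pdivrMr //; set D := (1 - _) * (1 - _) in D0 hK *; clearbody D.
have h1 : cabs (eval2 p z) * cabs (eval2 Q z) <= B * (K * D) by apply: ler_pM; rewrite ?cabs_ge0.
apply: (@le_trans _ _ (eps ^+ 2 * (2 * (B * (K * D))))).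
  by apply: ler_wpM2l; [exact: sqr_ge0 | lra].
have -> : eps ^+ 2 * (2 * (B * (K * D))) = (2 * B * K) * (eps ^+ 2 * D) by ring.
rewrite exprMn -[leRHS]mulrA; apply: ler_wpM2r; first by rewrite mulr_ge0 ?sqr_ge0 // ltW.
have : 0 <= 2 * B * K by apply: mulr_ge0 => //; lra.
by move: (2 * B * K) => X; nra.
Qed.

(** In the approach region [|Q(x, 0)| <= L |x - t| <= L c (1 - |x|)], and on [z2 = 0] the function
    [p g] reduces to its first summand. *)
Lemma bound_fst (c : R) (t : C) : 1 < c -> cabs t = 1 -> eval2 Q (t, 0) = 0 ->
  exists2 K : R, 0 < K & forall g eps x, in_K n p g -> bnd eps g -> cabs x < 1 ->
    cabs (t - x) < c * (1 - cabs x) -> cabs (ev1 (fun j => pconv p g j 0%N) x) <= K * eps.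
Proof using hp hz hdeg hno ha.
move=> c1 ht hQ; have [L [L0 _ hL]] := lip_eval2 Q; have [B [B0 hB _]] := lip_eval2 p.
have LC : 0 <= L * c by rewrite mulr_ge0 //; lra.
exists (2 * B * (L * c) + 1); first by rewrite ltr_wpDl //; apply: mulr_ge0 => //; lra.
move=> g eps x hg he hx hc; rewrite strip_fst //.
have hD := in_D2_0 hx.
have hDc : cD2 (x, 0) by split; rewrite /= ?cabs0 // ltW.
have hTc : cD2 (t, 0) by split; rewrite /= ?cabs0 // ht.
apply: key_bound => //; first exact: hB.
rewrite /= cabs0 expr0n /= subr0 mulr1.
have := hL _ _ hDc hTc; rewrite hQ subr0 /= subrr cabs0 addr0 cabsBC => h.
apply: (le_trans h); rewrite -mulrA; apply: ler_wpM2l => //; apply: (le_trans (ltW hc)).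
apply: ler_wpM2l; first lra.
by have := cabs_ge0 x; move: (cabs x) hx => r h1 h2; nra.
Qed.

(** By [level_horizontal], [Q] vanishes on all of [z2 = t], so [p g] is bounded over the circle
    [|z1| = 1/2]. Subtracting the first summand leaves a polynomial in [z1] of degree below [n],
    whose coefficients are extracted by discrete Parseval, the radius 1/2 costing the factor
    [2^n]. *)
Lemma bound_snd (c : R) (t : C) : 1 < c -> cabs t = 1 -> eval2 Q (0, t) = 0 ->
  exists2 K : R, 0 < K & forall g eps x (i : 'I_n), in_K n p g -> bnd eps g -> cabs x < 1 ->
    cabs (t - x) < c * (1 - cabs x) -> cabs (x * ev1 (fun k => pconv p g i k.+1) x) <= K * eps.
Proof using hp hz hdeg hno ha.
move=> c1 ht hQ0; have hQ := level_horizontal hp hz hdeg hno ha ht hQ0.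
have [L [L0 _ hL]] := lip_eval2 Q; have [B [B0 hB _]] := lip_eval2 p.
have [Kp Kp0 hKp] := bnd_pconv p.
have LC : 0 <= L * c by rewrite mulr_ge0 //; lra.
pose K1 := 2 * B * (2 * (L * c)) + 1.
have K10 : 0 < K1 by rewrite /K1 ltr_wpDl //; apply: mulr_ge0; lra.
exists (2 ^+ n * (K1 + 2 * Kp)); first by rewrite mulr_gt0 ?exprn_gt0 // addr_gt0 // mulr_gt0.
move=> g eps x i hg he hx hc; have e0 := he.1.
have hy := hKp _ _ he; set y := pconv p g in hy *.
have half (u : C) : cabs u = 1 -> cabs (u / 2) = 1 / 2.
  move=> hu; rewrite cabsM hu mul1r cabsV.
  have -> : (2 : C) = ((2 : R)%:C)%C by rewrite rmorph_nat.
  by rewrite cabs_real normr_nat div1r.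
have main u : cabs u = 1 ->
    cabs (x * \sum_(j < n) (u / 2) ^+ j * ev1 (fun k => y j k.+1) x) <= (K1 + 2 * Kp) * eps.
  move=> hu; have hh := half u hu.
  have hu1 : cabs (u / 2) < 1 by rewrite hh; lra.
  have hD : in_D2 (u / 2, x) by [].
  have hDc : cD2 (u / 2, x) by split; apply: ltW.
  have hTc : cD2 (u / 2, t) by split; rewrite /= ?ht // ltW.
  have h1 : cabs (ev y (u / 2, x)) <= K1 * eps.
    have [M hM] := in_K_bnd hg; rewrite (ev_pconv p (bnd_bdd hM) hD).
    apply: key_bound => //; [by rewrite mulr_ge0 | exact: hB |].
    rewrite /= hh.
    have := hL _ _ hDc hTc; rewrite hQ subr0 /= subrr cabs0 add0r cabsBC => h.
    apply: (le_trans h); apply: (@le_trans _ _ (L * c * (1 - cabs x))).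
      by rewrite -mulrA; apply: ler_wpM2l => //; exact: ltW.
    have := cabs_ge0 x; move: (L * c) LC (cabs x) hx => A A0 r r1 r0.
    have -> : 2 * A * ((1 - (1 / 2) ^+ 2) * (1 - r ^+ 2)) = A * ((1 - r) * (3 / 2 * (1 + r))) by field.
    by apply: ler_wpM2l => //; nra.
  have h2 : cabs (ev1 (fun j => y j 0%N) (u / 2)) <= 2 * Kp * eps.
    have := ev_le (fun j k => bnd_coef j k (bnd_row 0%N hy)) (in_D2_0 hu1).
    rewrite /= cabs0 subr0 mulr1 hh /ev1 => h; apply: (le_trans h).
    by rewrite le_eqVlt; apply/orP; left; apply/eqP; field.
  have := ev_strip (bnd_bdd hy) hD (in_K_defect hp hz hg); rewrite /= => e.
  have -> : x * \sum_(j < n) (u / 2) ^+ j * ev1 (fun k => y j k.+1) x =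
      ev y (u / 2, x) - ev1 (fun j => y j 0%N) (u / 2) by rewrite e addrC addKr.
  by apply: (le_trans (cabsB _ _)); rewrite mulrDl; exact: lerD.
pose cc (j : nat) := x * (2^-1) ^+ j * ev1 (fun k => y j k.+1) x.
have M0 : 0 <= (K1 + 2 * Kp) * eps by apply: mulr_ge0; lra.
have hps : n%:R * \sum_(j < n) cabs (cc j) ^+ 2 <= n%:R * ((K1 + 2 * Kp) * eps) ^+ 2.
  rewrite -parseval1; apply: (@le_trans _ _ (\sum_(k < n) ((K1 + 2 * Kp) * eps) ^+ 2)).
    apply: ler_sum => k _; apply: sqr_le; first exact: cabs_ge0.
    set u := expi _ ^+ k; have hu : cabs u = 1 by rewrite /u cabsX cabs_expi expr1n.
    have := main u hu; rewrite mulr_sumr.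
    congr (cabs _ <= _); apply: eq_bigr => j _; rewrite /cc exprMn; ring.
  by rewrite sumr_const card_ord -[leLHS]mulr_natl.
have n0 : 0 < n%:R :> R by rewrite ltr0n; case: (n) i => // -[].
rewrite ler_pM2l // in hps.
have hi : cabs (cc i) <= (K1 + 2 * Kp) * eps.
  apply: sqr_le_cancel => //; apply: (le_trans _ hps); rewrite (bigD1 i) //= lerDl.
  by apply: sumr_ge0 => j _; exact: sqr_ge0.
have p2 : 2 ^+ i != 0 :> C by rewrite expf_neq0 // pnatr_eq0.
have -> : x * ev1 (fun k => y i k.+1) x = 2 ^+ i * cc i by rewrite /cc exprVn; field.
rewrite cabsM cabsX.
have -> : cabs (2 : C) = 2.
  have -> : (2 : C) = ((2 : R)%:C)%C by rewrite rmorph_nat.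
  by rewrite cabs_real normr_nat.
rewrite -mulrA; apply: ler_pM; rewrite ?exprn_ge0 ?cabs_ge0 //.
by apply: ler_weXn2l; [lra | exact: ltnW].
Qed.

End StripBounds.

(** * Non-tangential limits at a single point *)

Section Boundary.
Context {R : realType}.
Local Notation C := R[i].
Local Notation array := (nat -> nat -> C).
Local Notation poly2 := {poly {poly C}}.
Local Notation mu := (@lebesgue_measure R).
Implicit Types (a b : array) (L : seq (C * (C * C))).
Context (n : nat) (p : poly2) (hp : deg_le_n1 n p)
  (hz : forall z : C * C, in_D2 z -> eval2 p z != 0)
  (hdeg : deg_eq_n1 n (ptilde n p)) (hno : no_common_factor p (ptilde n p))
  (alpha : C) (ha : cabs alpha = 1).
Local Notation pt := (ptilde n p).
Local Notation phi := (Defs.phi n p).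
Local Notation Q := (level n p alpha).
Context (kap : C * C -> array) (hk : is_kernel n p kap).

(** The boundary function that [is_J] prescribes for [kcomb]. *)
Definition Jcomb L (t : R * R) : C :=
  \sum_(x <- L) x.1 * ((1 - alpha * cconj (phi x.2)) * Cker x.2 (zeta t)).

Lemma ev_kcomb L z : in_disc L -> in_D2 z ->
  ev (kcomb kap L) z = \sum_(x <- L) x.1 * kker n p x.2 z.
Proof using hp hz hk.
move=> + hzz; elim: L => [|x L IH] hL.
  rewrite kcomb_nil big_nil; apply/eqP; rewrite -cabs_eq0 eq_le cabs_ge0 andbT.
  have h : forall j k : nat, cabs ((fun _ _ => 0 : C) j k) <= 0 by move=> j k; rewrite cabs0.
  by have := ev_le h hzz; rewrite mul0r.
have hL' : in_disc L by move=> y hy; apply: hL; rewrite inE hy orbT.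
have [kK kev _ _] := hk (hL x (mem_head _ _)).
have [M hM] := in_K_bnd kK; have [M' hM'] := in_K_bnd (kcomb_in_K hp hz hk hL').
rewrite kcomb_cons big_cons evD // ?evZ ?kev ?IH //; [exact: bnd_bdd hM | | exact: bnd_bdd hM'].
exact: bddZ (bnd_bdd hM).
Qed.

(** [p] times a kernel combination, with the denominator of [phi] cancelled; it is Lipschitz up to
    the torus, zeros of [p] included. *)
Definition pcomb L (z : C * C) : C :=
  \sum_(x <- L) x.1 * ((eval2 p z - cconj (phi x.2) * eval2 pt z) * Cker x.2 z).

Lemma pcombE L z : in_disc L -> in_D2 z -> eval2 p z * ev (kcomb kap L) z = pcomb L z.
Proof using hp hz hk.
move=> hL hzz; rewrite ev_kcomb // mulr_sumr; apply: eq_bigr => x _.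
rewrite /kker mulrCA; congr (_ * _); rewrite mulrA; congr (_ * _).
rewrite mulrBr mulr1; congr (_ - _); rewrite mulrCA; congr (_ * _).
by rewrite /Defs.phi mulrCA mulfV ?mulr1 //; exact: hz.
Qed.

Lemma pcomb_T L t : eval2 Q (zeta t) = 0 -> pcomb L (zeta t) = eval2 p (zeta t) * Jcomb L t.
Proof.
move=> hQ; rewrite /Jcomb mulr_sumr; apply: eq_bigr => x _.
have e : eval2 pt (zeta t) = alpha * eval2 p (zeta t).
  by move/eqP: hQ; rewrite eval2_level subr_eq0 => /eqP.
rewrite e; ring.
Qed.

Lemma lip_pcomb L : in_disc L -> lip (pcomb L).
Proof.
elim: L => [|x L IH] hL.
  by apply: (@lip_ext _ (fun=> 0)) (lip_cst 0) => z; rewrite /pcomb big_nil.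
apply: (@lip_ext _ (fun z => x.1 * ((eval2 p z - cconj (phi x.2) * eval2 pt z) * Cker x.2 z) + pcomb L z)).
  by move=> z; rewrite /pcomb big_cons.
apply: lipD; last by apply: IH => y hy; apply: hL; rewrite inE hy orbT.
apply: lipM; first exact: lip_cst.
apply: lipM; last by apply: lip_Cker; exact: hL (mem_head _ _).
by apply: lipB; [exact: lip_eval2 | apply: lipM; [exact: lip_cst | exact: lip_eval2]].
Qed.

Section Point.
Context (a : array) (haK : in_K n p a) (L : nat -> seq (C * (C * C)))
  (hL : forall m, in_disc (L m)) (hLb : forall m, bnd (4 ^+ m)^-1 (fun i j => a i j - kcomb kap (L m) i j))
  (t : R * R) (lim : C).
Let g m : array := fun i j => a i j - kcomb kap (L m) i j.
Let y m := pconv p (g m).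

Definition small_nt (f : nat -> nat -> C) (u : C) := forall c : R, 1 < c -> exists m0 : nat,
  forall m, (m0 <= m)%N -> forall z, cabs z < 1 -> cabs (u - z) < c * (1 - cabs z) ->
  cabs (ev1 (f m) z) <= (2 ^+ m)^-1.

Let gK m : in_K n p (g m).
Proof. by apply: (in_K_sub hp hz) => //; exact: kcomb_in_K. Qed.

Let p42 m : (4 ^+ m)^-1 <= (2 ^+ m)^-1 :> R.
Proof.
rewrite lef_pV2 ?posrE ?exprn_gt0 //; apply: lerXn2r; rewrite ?nnegrE; lra.
Qed.

(** Each summand of [p g] is small for one of two reasons: the coordinate avoids the null set of the
    maximal theorem, or [Q] vanishes on the corresponding slice. Up to [sigma]-null sets one of them
    always holds. *)
Lemma strip_small : eval2 Q ((zeta t).1, 0) = 0 \/ small_nt (fun m j => y m j 0%N) (zeta t).1 ->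
  eval2 Q (0, (zeta t).2) = 0 \/ (forall i : 'I_n, small_nt (fun m k => y m i k.+1) (zeta t).2) ->
  forall c : R, 1 < c -> exists2 K : R, 0 < K & exists m0 : nat, forall m, (m0 <= m)%N -> forall z, in_D2 z ->
    cabs ((zeta t).1 - z.1) < c * (1 - cabs z.1) -> cabs ((zeta t).2 - z.2) < c * (1 - cabs z.2) ->
    cabs (eval2 p z * ev (g m) z) <= K * (2 ^+ m)^-1.
Proof using hp hz hdeg hno ha hk haK hL hLb.
move=> H1 H2 c c1.
have [K1 K10 [m1 hm1]] : exists2 K : R, 0 < K & exists m0 : nat, forall m, (m0 <= m)%N -> forall z, cabs z < 1 ->
    cabs ((zeta t).1 - z) < c * (1 - cabs z) -> cabs (ev1 (fun j => y m j 0%N) z) <= K * (2 ^+ m)^-1.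
  case: H1 => [hQ|hs].
    have [K K0 hK] := bound_fst hp hz hdeg hno ha c1 (cabs_expi t.1) hQ.
    exists K => //; exists 0%N => m _ z hzz hc; apply: (le_trans (hK _ _ _ (gK m) (hLb m) hzz hc)).
    by apply: ler_wpM2l; [exact: ltW | exact: p42].
  have [m0 hm0] := hs c c1; exists 1 => //; exists m0 => m hm z hzz hc; rewrite mul1r; exact: hm0.
have [K2 K20 [m2 hm2]] : exists2 K : R, 0 < K & exists m0 : nat, forall m, (m0 <= m)%N -> forall z, cabs z < 1 ->
    cabs ((zeta t).2 - z) < c * (1 - cabs z) -> forall i : 'I_n,
    cabs (z * ev1 (fun k => y m i k.+1) z) <= K * (2 ^+ m)^-1.
  case: H2 => [hQ|hs].
    have [K K0 hK] := bound_snd hp hz hdeg hno ha c1 (cabs_expi t.2) hQ.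
    exists K => //; exists 0%N => m _ z hzz hc i; apply: (le_trans (hK _ _ _ i (gK m) (hLb m) hzz hc)).
    by apply: ler_wpM2l; [exact: ltW | exact: p42].
  have /choice[m0 hm0] := fun i => hs i c c1.
  exists 1 => //; exists (\max_i m0 i) => m hm z hzz hc i; rewrite mul1r cabsM.
  have h1 := hm0 i m (leq_trans (leq_bigmax i) hm) z hzz hc.
  by apply: (le_trans _ h1); rewrite ler_piMl ?cabs_ge0 // ltW.
exists (K1 + n%:R * K2); first by rewrite ltr_wpDr // mulr_ge0 // ltW.
exists (maxn m1 m2) => m hm z hzz c1' c2'.
have [M hM] := in_K_bnd (gK m).
rewrite -(ev_pconv p (bnd_bdd hM) hzz) (ev_strip (bdd_pconv p (bnd_bdd hM)) hzz (in_K_defect hp hz (gK m))).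
apply: (le_trans (cabsD _ _)); rewrite mulrDl; apply: lerD.
  by apply: hm1 => //; [exact: leq_trans (leq_maxl _ _) hm | exact: hzz.1].
rewrite mulr_sumr; apply: (le_trans (cabs_sum _ _ _)).
apply: (@le_trans _ _ (\sum_(i < n) K2 * (2 ^+ m)^-1)); last first.
  by rewrite sumr_const card_ord -[leLHS]mulr_natl mulrA.
apply: ler_sum => i _.
have h1 : cabs (z.2 * ev1 (fun k => y m i k.+1) z.2) <= K2 * (2 ^+ m)^-1.
  by apply: hm2 => //; [exact: leq_trans (leq_maxr _ _) hm | exact: hzz.2].
rewrite mulrCA cabsM; apply: (le_trans _ h1).
rewrite ler_piMl ?cabs_ge0 // cabsX exprn_ile1 ?cabs_ge0 //; apply: ltW; exact: hzz.1.
Qed.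

(** As [p] is nonzero at the boundary point, it suffices to follow [p f]: it is uniformly close to
    [pcomb] in the approach region, [pcomb] is Lipschitz, and on [Q = 0] its boundary value is [p]
    times [Jcomb], which tends to [p lim]. *)
Lemma nt_point : eval2 Q (zeta t) = 0 -> eval2 p (zeta t) != 0 ->
  eval2 Q ((zeta t).1, 0) = 0 \/ small_nt (fun m j => y m j 0%N) (zeta t).1 ->
  eval2 Q (0, (zeta t).2) = 0 \/ (forall i : 'I_n, small_nt (fun m k => y m i k.+1) (zeta t).2) ->
  (forall e : R, 0 < e -> exists m0 : nat, forall m, (m0 <= m)%N -> cabs (Jcomb (L m) t - lim) < e) ->
  nt_lim (ev a) (zeta t) lim.
Proof using hp hz hdeg hno ha hk haK hL hLb.
move=> hQ hp0 H1 H2 H3 c c1 e e0.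
have [K K0 [m1 hm1]] := strip_small H1 H2 c1.
set P := eval2 p (zeta t) in hp0 *.
have P0 : 0 < cabs P by rewrite cabs_gt0.
have l0 := cabs_ge0 lim.
(* the target accuracy for [p F - p(zeta) lim] and for [p - p(zeta)] *)
pose d := Num.min (e * cabs P / 8) (Num.min (cabs P / 2) (e * cabs P / (8 * (cabs lim + 1)))).
have d0 : 0 < d.
  rewrite !lt_min; apply/and3P; split; rewrite ?divr_gt0 ?mulr_gt0 //; lra.
have d1 : d <= e * cabs P / 8 by rewrite ge_min lexx.
have d2 : d <= cabs P / 2 by rewrite !ge_min lexx !orbT.
have d3 : d <= e * cabs P / (8 * (cabs lim + 1)) by rewrite !ge_min lexx !orbT.
have [m2 hm2] : exists m2 : nat, forall m, (m2 <= m)%N -> K * (2 ^+ m)^-1 < d.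
  have [k hk'] : exists k : nat, K / d < k%:R by exists (Num.truncn (K / d)).+1; exact: truncnS_gt.
  exists k => m hm; rewrite ltr_pdivrMr ?exprn_gt0 // mulrC -ltr_pdivrMr //.
  apply: (lt_le_trans hk'); rewrite -natrX ler_nat; apply: (leq_trans hm); exact: ltnW (ltn_expl _ _).
have dP : 0 < d / (cabs P + 1) by rewrite divr_gt0 // ltr_wpDr // ltW.
have [m3 hm3] := H3 _ dP.
pose m := maxn m1 (maxn m2 m3).
have q1 := hm1 m (leq_maxl _ _).
have q2 := hm2 m (leq_trans (leq_maxl _ _) (leq_maxr _ _)).
have q3 := hm3 m (leq_trans (leq_maxr _ _) (leq_maxr _ _)).
have [B [B0 _ hB]] := lip_pcomb (@hL m); have [B' [B'0 _ hB']] := lip_eval2 p.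
pose s := d / (2 * (B + B' + 1)).
have s0 : 0 < s by rewrite divr_gt0 // mulr_gt0 //; lra.
exists s => // z hzz hc1 hc2 hs1 hs2.
have hzc : cD2 z by split; apply: ltW; [exact: hzz.1 | exact: hzz.2].
have hTc : cD2 (zeta t : C * C) by split; rewrite cabs_expi.
have hsum : cabs ((zeta t).1 - z.1) + cabs ((zeta t).2 - z.2) <= 2 * s by lra.
have es : 2 * s * (B + B' + 1) = d by rewrite /s; field; rewrite gt_eqF //; lra.
have u0 := cabs_ge0 ((zeta t).1 - z.1); have v0 := cabs_ge0 ((zeta t).2 - z.2).
have r1 : cabs (pcomb (L m) z - P * Jcomb (L m) t) <= d.
  rewrite -pcomb_T // cabsBC; apply: (le_trans (hB _ _ hTc hzc)).
  by apply: (le_trans (ler_wpM2l B0 hsum)); rewrite -es; nra.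
have r2 : cabs (eval2 p z - P) <= d.
  rewrite cabsBC; apply: (le_trans (hB' _ _ hTc hzc)).
  by apply: (le_trans (ler_wpM2l B'0 hsum)); rewrite -es; nra.
have r3 : cabs (P * Jcomb (L m) t - P * lim) <= d.
  rewrite -mulrBr cabsM; apply: (le_trans (ler_wpM2l (ltW P0) (ltW q3))).
  rewrite mulrCA ger_pMr // ler_pdivrMr; lra.
have r4 := q1 z hzz hc1 hc2.
have [M hM] := in_K_bnd haK; have [M' hM'] := in_K_bnd (kcomb_in_K hp hz hk (@hL m)).
have eg : eval2 p z * ev (g m) z = eval2 p z * ev a z - pcomb (L m) z.
  by rewrite -pcombE // /g evB // ?mulrBr //; [exact: bnd_bdd hM | exact: bnd_bdd hM'].
rewrite eg in r4.
have r5 : cabs (eval2 p z * ev a z - P * lim) < 3 * d.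
  have -> : eval2 p z * ev a z - P * lim = (eval2 p z * ev a z - pcomb (L m) z) +
     ((pcomb (L m) z - P * Jcomb (L m) t) + (P * Jcomb (L m) t - P * lim)) by ring.
  apply: (le_lt_trans (cabsD _ _)).
  have := cabsD (pcomb (L m) z - P * Jcomb (L m) t) (P * Jcomb (L m) t - P * lim).
  move: (cabs _) (cabs _) (cabs _) (cabs _) r1 r3 r4 => *; lra.
have r6 : cabs P / 2 <= cabs (eval2 p z).
  by have := cabs_subr P (eval2 p z); rewrite cabsBC; lra.
have r7 : cabs (eval2 p z * (ev a z - lim)) < 3 * d + d * cabs lim.
  have -> : eval2 p z * (ev a z - lim) = (eval2 p z * ev a z - P * lim) + (P - eval2 p z) * lim by ring.
  apply: (le_lt_trans (cabsD _ _)); rewrite cabsM cabsBC.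
  have := ler_wpM2r l0 r2; lra.
have r8 : d * cabs lim <= e * cabs P / 8.
  apply: (le_trans (ler_wpM2r l0 d3)).
  have e8 : e * cabs P / (8 * (cabs lim + 1)) * (cabs lim + 1) = e * cabs P / 8.
    by field; rewrite gt_eqF //; lra.
  by rewrite -e8; move: d3; move: (e * cabs P / (8 * _)) => x d3; nra.
rewrite cabsM in r7.
have w0 := cabs_ge0 (ev a z - lim).
have r9 : cabs P / 2 * cabs (ev a z - lim) <= cabs (eval2 p z) * cabs (ev a z - lim) by apply: ler_wpM2r.
have r10 : cabs P / 2 * cabs (ev a z - lim) < cabs P / 2 * e by lra.
by rewrite ltr_pM2l ?divr_gt0 // in r10.
Qed.
End Point.
End Boundary.

Section BoundaryValues.
Context {R : realType}.
Local Notation C := R[i].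
Local Notation array := (nat -> nat -> C).
Local Notation poly2 := {poly {poly C}}.
Local Notation mu := (@lebesgue_measure R).
Implicit Types (a b : array) (L : seq (C * (C * C))).

Lemma nN_row N (f : nat -> C) : nN N.+1 (row f) = \sum_(j < N.+1) cabs (f j) ^+ 2.
Proof.
apply: eq_bigr => j _; rewrite big_ord_recl /row /= big1 ?addr0 // => k _.
by rewrite cabs0 expr0n.
Qed.

Lemma bnd_row_shift (f : nat -> C) M : bnd M (row f) -> bnd M (row (fun k => f k.+1)).
Proof.
move=> [M0 h]; split=> // -[|N]; first by rewrite /nN big_ord0 sqr_ge0.
rewrite nN_row; apply: (le_trans _ (h N.+2)); rewrite nN_row [leRHS]big_ord_recl /=.
by rewrite lerDr sqr_ge0.
Qed.

Context (n : nat) (p : poly2) (hp : deg_le_n1 n p)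
  (hz : forall z : C * C, in_D2 z -> eval2 p z != 0)
  (hdeg : deg_eq_n1 n (ptilde n p)) (hno : no_common_factor p (ptilde n p))
  (alpha : C) (ha : cabs alpha = 1)
  (sg : {measure set (R * R)%type -> \bar R}) (hsg : is_clark_measure n p alpha sg)
  (J : array -> R * R -> C) (hJ : is_J n p alpha sg J).
Local Notation pt := (ptilde n p).
Local Notation phi := (Defs.phi n p).
Local Notation Q := (level n p alpha).
Context (kap : C * C -> array) (hk : is_kernel n p kap).

Lemma J_meas a : in_K n p a -> cmeas (J a).
Proof using hJ. by move=> /hJ.1[h1 [h2 _]]. Qed.

Lemma J_diff_le a b M : in_K n p a -> in_K n p b -> bnd M (fun j k => a j k - b j k) ->
  (\int[sg]_t ((cabs (J a t - J b t)) ^+ 2)%:E <= (M ^+ 2)%:E)%E.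
Proof using hJ. by move=> ha' hb' h; rewrite hJ.2.2.1 //; exact: H2norm2_le. Qed.

Lemma J_diff_ge a b N : in_K n p a -> in_K n p b ->
  ((nN N (fun j k => a j k - b j k)%R)%:E <= \int[sg]_t ((cabs (J a t - J b t)) ^+ 2)%:E)%E.
Proof using hJ. by move=> ha' hb'; rewrite hJ.2.2.1 //; exact: H2norm2_ge. Qed.

Lemma J_kcomb L : in_disc L -> sg.-negligible [set t | J (kcomb kap L) t <> Jcomb n p alpha L t].
Proof using hp hz hk hJ.
elim: L => [|x L IH] hL.
  have h0 := hJ.2.1 _ _ (-1) (in_K0 hp hz) (in_K0 hp hz).
  apply: negligibleS h0 => t /= h1 h2; apply: h1; rewrite /Jcomb big_nil kcomb_nil.
  move: h2; have -> : (fun _ _ => -1 * 0 + 0) = (fun _ _ => 0) :> array.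
    by apply/funext => j; apply/funext => k; rewrite mulr0 addr0.
  by rewrite mulN1r addNr.
have hL' : in_disc L by move=> y hy; apply: hL; rewrite inE hy orbT.
have hx := hL x (mem_head _ _).
have [kK kev _ _] := hk hx; have [M hM] := in_K_bnd kK.
have h1 := hJ.2.1 _ _ x.1 kK (kcomb_in_K hp hz hk hL').
have h2 := hJ.2.2.2 x.2 (kap x.2) hx (ev_represents hM (fun z hzz => esym (kev z hzz))).
apply: negligibleS (negligibleU h1 (negligibleU h2 (IH hL'))) => t /= h3.
apply: contrapT => h4; apply: h3.
have [g1 [g2 g3]] : J (fun j k => x.1 * kap x.2 j k + kcomb kap L j k) t =
    x.1 * J (kap x.2) t + J (kcomb kap L) t /\
    J (kap x.2) t = (1 - alpha * cconj (phi x.2)) * Cker x.2 (zeta t) /\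
    J (kcomb kap L) t = Jcomb n p alpha L t.
  split; first by apply: contrapT => h; apply: h4; left.
  by split; apply: contrapT => h; apply: h4; right; [left | right].
by rewrite kcomb_cons /Jcomb big_cons g1 g2 g3.
Qed.

(** The rate [1 / 4^m] serves both limits: it is the one [nt_null] asks for the summands of
    [p (a - kcomb)], and by isometry the squared [L^2] errors of [J] are at most [1 / 16^m], as
    [ae_of_L2] asks. *)
Theorem boundary_value a : in_K n p a -> sg.-negligible [set t | ~ nt_lim (ev a) (zeta t) (J a t)].
Proof using hp hz hdeg hno ha hsg hJ hk.
move=> haK.
have q4 m : 0 < (4 ^+ m)^-1 :> R by rewrite invr_gt0 exprn_gt0.
have /choice[L hL] : forall m, exists L, in_disc L /\ bnd (4 ^+ m)^-1 (fun i j => a i j - kcomb kap L i j).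
  by move=> m; have [L h1 h2] := kernel_dense hp hz hk haK (q4 m); exists L.
have hL1 m : in_disc (L m) by have [] := hL m.
have hL2 m : bnd (4 ^+ m)^-1 (fun i j => a i j - kcomb kap (L m) i j) by have [] := hL m.
pose g m : array := fun i j => a i j - kcomb kap (L m) i j.
have aK m : in_K n p (kcomb kap (L m)) by exact: kcomb_in_K.
have [Kp Kp0 hKp] := bnd_pconv p.
pose y m := pconv p (g m).
have hy m : bnd (Kp / 4 ^+ m) (y m) by exact: hKp (hL2 m).
have [E0 [mE0 E00 hE0]] := nt_null (fun m => bnd_row 0%N (hy m)).
(* The shift drops the entries of second index 0, which belong to the first summand. *)
have /choice[E1 hE1] := fun i => nt_null (fun m => bnd_row_shift (bnd_col i (hy m))).
pose E2 := \bigcup_i E1 i.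
have mE2 : measurable E2 by apply: bigcupT_measurable => i; have [] := hE1 i.
have E20 : mu E2 = 0%E.
  have : mu.-negligible E2.
    apply: negligible_bigcup => i; have [m0 n0 _] := hE1 i; exact/negligibleP.
  by move/negligibleP; apply.
have N1 := negligible_bigcup (fun m => J_kcomb (@hL1 m)).
have mg m : measurable_fun setT (fun t => cabs (J (kcomb kap (L m)) t - J a t)).
  by apply: cmeas_cabs; apply: cmeasB; exact: J_meas.
have N2 := ae_of_L2 mg (fun m => _).
have {}N2 := N2 sg.
have hI m : (\int[sg]_t ((cabs (J (kcomb kap (L m)) t - J a t)) ^+ 2)%:E <= ((16 ^+ m)^-1)%:E)%E.
  have -> : (16 ^+ m)^-1 = ((4 ^+ m)^-1) ^+ 2 :> R by rewrite exprVn -exprM mulnC exprM; congr (_ ^+ _)^-1; ring.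
  apply: J_diff_le => //; have [h1 h2] := hL2 m; split=> // N.
  by rewrite nN_sub0; exact: h2.
have {}N2 := N2 hI.
have N3 := null_level hp hz hdeg hno ha hsg.
have N4 := null_zeros hp hz hdeg hno ha hsg.
have N5 := null_fst hp hz hdeg hno ha hsg mE0 E00.
have N6 := null_snd hp hz hdeg hno ha hsg mE2 E20.
have N7 : sg.-negligible (~` [set t : R * R | 0 <= t.1 < 2 * pi /\ 0 <= t.2 < 2 * pi]).
  apply/negligibleP; last by have := hsg.1.
  apply: measurableC.
  have -> : [set t : R * R | 0 <= t.1 < 2 * pi /\ 0 <= t.2 < 2 * pi] = `[0, 2 * pi[%classic `*` `[0, 2 * pi[%classic.
    by apply/seteqP; split=> t /=; rewrite !in_itv.
  by apply: measurableX; exact: measurable_itv.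
apply: negligibleS (negligibleU N1 (negligibleU N2 (negligibleU N3 (negligibleU N4
  (negligibleU N5 (negligibleU N6 N7)))))) => t /= hn.
apply: contrapT => hall; apply: hn.
have a1 m : J (kcomb kap (L m)) t = Jcomb n p alpha (L m) t.
  by apply: contrapT => h; apply: hall; left; exists m.
have a2 : exists m0, forall m, (m0 <= m)%N -> cabs (J (kcomb kap (L m)) t - J a t) < (2 ^+ m)^-1.
  by apply: contrapT => h; apply: hall; right; left.
have a3 : eval2 Q (zeta t) = 0.
  by apply: contrapT => h; apply: hall; do 2 right; left; exact/eqP.
have a4 : eval2 p (zeta t) != 0.
  by apply/eqP => h; apply: hall; do 3 right; left.
have a5 : ~ E0 t.1 \/ eval2 Q (expi t.1, 0) = 0.
  have [h|h] := pselect (E0 t.1); last by left.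
  by right; apply: contrapT => h'; apply: hall; do 4 right; left; split=> //; exact/eqP.
have a6 : ~ E2 t.2 \/ eval2 Q (0, expi t.2) = 0.
  have [h|h] := pselect (E2 t.2); last by left.
  by right; apply: contrapT => h'; apply: hall; do 5 right; left; split=> //; exact/eqP.
have [/andP[t10 t11] /andP[t20 t21]] : 0 <= t.1 < 2 * pi /\ 0 <= t.2 < 2 * pi.
  by apply: contrapT => h; apply: hall; do 6 right.
have b1 : 0 <= t.1 <= 2 * pi by rewrite t10 ltW.
have b2 : 0 <= t.2 <= 2 * pi by rewrite t20 ltW.
apply: (nt_point hp hz hdeg hno ha hk haK hL1 hL2 a3 a4).
- case: a5 => [h|h]; [right | by left] => c c1.
  by have [_ _ hh] := And3 mE0 E00 hE0; exact: hh b1 h c c1.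
- case: a6 => [h|h]; [right | by left] => i c c1.
  have [_ _ hh] := hE1 i; apply: (hh _ b2 _ c c1) => h'; apply: h; by exists (nat_of_ord i).
move=> e e0; have [m0 hm0] := a2.
have [k hk'] : exists k : nat, e^-1 < k%:R by exists (Num.truncn e^-1).+1; exact: truncnS_gt.
exists (maxn m0 k) => m hm; rewrite -a1.
apply: (lt_trans (hm0 m (leq_trans (leq_maxl _ _) hm))).
rewrite invf_plt ?posrE ?exprn_gt0 //; apply: (lt_le_trans hk'); rewrite -natrX ler_nat.
by apply: (leq_trans (leq_trans (leq_maxr _ _) hm)); exact: ltnW (ltn_expl _ _).
Qed.
End BoundaryValues.

(** * Exceptional values *)

Section RadialLimits.
Context {R : realType}.
Local Notation C := R[i].
Implicit Types (F G : C * C -> C).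

Lemma lip_poly (q : {poly C}) : exists2 K : R, 0 <= K & forall x y, cabs x <= 1 -> cabs y <= 1 ->
  cabs (q.[x] - q.[y]) <= K * cabs (x - y).
Proof.
have [K [K0 _ hK]] := lip_eval2 q%:P; exists K => // x y hx hy.
have := hK (x, 0) (y, 0); rewrite /cD2 /= cabs0 /eval2 !hornerC /= subrr cabs0 addr0; apply.
  by split.
by split.
Qed.

Lemma quot_cont F G w1 : lip F -> lip G -> cD2 w1 -> G w1 != 0 -> forall e : R, 0 < e ->
  exists2 d : R, 0 < d & forall z, cD2 z -> cabs (z.1 - w1.1) + cabs (z.2 - w1.2) < d ->
    cabs (F z / G z - F w1 / G w1) < e.
Proof.
move=> [K [K0 hF1 hF]] [L [L0 hG1 hG]] hw g0 e e0.
set g := cabs (G w1); have gp : 0 < g by rewrite cabs_gt0.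
pose B := 2 * (2 * K * L + 1) / g ^+ 2.
have B0 : 0 < B by rewrite divr_gt0 ?exprn_gt0 // mulr_gt0 // ltr_wpDl // !mulr_ge0.
pose d := Num.min (g / (2 * (L + 1))) (e / B).
have d0 : 0 < d.
  rewrite lt_min; apply/andP; split; apply: divr_gt0 => //.
  by rewrite mulr_gt0 // ltr_wpDl.
exists d => // z hz; set s := cabs _ + cabs _ => hs.
have s0 : 0 <= s by rewrite addr_ge0 // cabs_ge0.
have s1 : s < g / (2 * (L + 1)) by apply: lt_le_trans hs _; rewrite ge_min lexx.
have s2 : s < e / B by apply: lt_le_trans hs _; rewrite ge_min lexx orbT.
have h1 := hG _ _ hz hw; rewrite -/s in h1.
have h2 : g / 2 <= cabs (G z).
  have := cabs_subr (G w1) (G z); rewrite cabsBC -/g.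
  have : L * s <= g / 2.
    by rewrite ltr_pdivlMr in s1; [nra | rewrite mulr_gt0 // ltr_wpDl].
  lra.
have z0 : G z != 0 by rewrite -cabs_gt0; lra.
have -> : F z / G z - F w1 / G w1 = ((F z - F w1) * G w1 - F w1 * (G z - G w1)) / (G z * G w1).
  by field; rewrite z0 g0.
rewrite cabsM cabsV ltr_pdivrMr; last by rewrite cabs_gt0 mulf_neq0.
have h3 : cabs ((F z - F w1) * G w1 - F w1 * (G z - G w1)) <= 2 * K * L * s.
  apply: (le_trans (cabsB _ _)); rewrite !cabsM.
  have u1 : cabs (F z - F w1) * cabs (G w1) <= K * s * L by apply: ler_pM; rewrite ?cabs_ge0 ?hF ?hG1.
  have u2 : cabs (F w1) * cabs (G z - G w1) <= K * (L * s) by apply: ler_pM; rewrite ?cabs_ge0 ?hF1.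
  lra.
apply: (le_lt_trans h3); rewrite cabsM -/g.
have h4 : s * B < e by rewrite -ltr_pdivlMr.
have h5 : e * (g / 2 * g) <= e * (cabs (G z) * g) by apply: ler_wpM2l; [exact: ltW | apply: ler_wpM2r => //; exact: ltW].
apply: lt_le_trans h5.
have h6 : s * B * (g / 2 * g) = s * (2 * K * L + 1) by rewrite /B; field; rewrite gt_eqF.
have h7 : s * B * (g / 2 * g) < e * (g / 2 * g) by rewrite ltr_pM2r // mulr_gt0 // divr_gt0.
apply: le_lt_trans h7; rewrite h6; nra.
Qed.

(** Inequalities proved inside the bidisc pass to a boundary point along [w] by Lipschitz
    continuity; they are kept in product form because numerator and denominator may vanish together
    there. *)
Lemma radial_le F G (K L r0 : R) (w : R -> C * C) w1 : lip F -> lip G -> 0 <= K -> 0 <= L -> 0 <= r0 < 1 -> cD2 w1 ->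
  (forall r, 0 < r < 1 -> cD2 (w r) /\ cabs ((w r).1 - w1.1) + cabs ((w r).2 - w1.2) <= 2 * (1 - r)) ->
  (forall r, r0 < r < 1 -> K * cabs (F (w r)) <= L * cabs (G (w r))) ->
  K * cabs (F w1) <= L * cabs (G w1).
Proof.
move=> [A [A0 _ hF]] [B [B0 _ hG]] K0 L0 /andP[r00 r01] hw1 hw h; apply/ler_addgt0Pr => e e0.
pose M := (K * A + L * B) * 2 + 1.
have KA : 0 <= K * A by rewrite mulr_ge0.
have LB : 0 <= L * B by rewrite mulr_ge0.
have M0 : 0 < M by rewrite /M; lra.
pose d := Num.min ((1 - r0) / 2) (e / M).
have d0 : 0 < d by rewrite lt_min !divr_gt0 // subr_gt0.
have d1 : d <= (1 - r0) / 2 by rewrite ge_min lexx.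
have dM : d * M <= e by rewrite -ler_pdivlMr // ge_min lexx orbT.
have r1 : 0 < 1 - d < 1 by apply/andP; split; lra.
have r2 : r0 < 1 - d < 1 by apply/andP; split; lra.
have [v1 v2] := hw _ r1; have v3 := h _ r2.
have e1 : 1 - (1 - d) = d by ring.
rewrite e1 in v2.
have f1 := hF _ _ v1 hw1; have g1 := hG _ _ v1 hw1.
set s := cabs _ + cabs _ in v2 f1 g1.
have f2 : cabs (F w1) <= cabs (F (w (1 - d))) + A * s.
  by have := cabs_subr (F w1) (F (w (1 - d))); rewrite cabsBC; lra.
have g2 : cabs (G (w (1 - d))) <= cabs (G w1) + B * s.
  by have := cabs_subr (G (w (1 - d))) (G w1); lra.
have f3 := ler_wpM2l K0 f2; have g3 := ler_wpM2l L0 g2.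
have s3 : K * A * s <= K * A * (2 * d) by apply: ler_wpM2l.
have s4 : L * B * s <= L * B * (2 * d) by apply: ler_wpM2l.
rewrite /M in dM; lra.
Qed.

Lemma dil_unim (s : R) (u : C) : 0 <= s <= 1 -> cabs u = 1 ->
  cabs ((s%:C)%C * u) = s /\ cabs ((s%:C)%C * u - u) = 1 - s.
Proof.
move=> /andP[s0 s1] hu; split; first by rewrite cabsM hu mulr1 cabs_real ger0_norm.
have -> : (s%:C)%C * u - u = ((s - 1)%:C)%C * u by rewrite real_complexB mulrBl rmorph1 mul1r.
by rewrite cabsM hu mulr1 cabs_real ler0_norm; lra.
Qed.

Lemma radial_fst (u z2 : C) : cabs u = 1 -> cabs z2 <= 1 -> forall r : R, 0 < r < 1 ->
  cD2 ((r%:C)%C * u, z2) /\ cabs ((r%:C)%C * u - u) + cabs (z2 - z2) <= 2 * (1 - r).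
Proof.
move=> hu h2 r /andP[r0 r1]; have rr : 0 <= r <= 1 by apply/andP; split; exact: ltW.
by have [e1 e2] := dil_unim rr hu; rewrite /cD2 /= e1 e2 subrr cabs0; split; [split=> //; exact: ltW | lra].
Qed.

Lemma radial_both (u v : C) : cabs u = 1 -> cabs v = 1 -> forall r : R, 0 < r < 1 ->
  cD2 ((r%:C)%C * u, (r%:C)%C * v) /\ cabs ((r%:C)%C * u - u) + cabs ((r%:C)%C * v - v) <= 2 * (1 - r).
Proof.
move=> hu hv r /andP[r0 r1]; have rr : 0 <= r <= 1 by apply/andP; split; exact: ltW.
have [e1 e2] := dil_unim rr hu; have [e3 e4] := dil_unim rr hv.
by rewrite /cD2 /= e1 e2 e3 e4; split; [split; exact: ltW | lra].
Qed.
End RadialLimits.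

(** * Roots of [Q0] on the circle and the lines over them *)

Section Line.
Context {R : realType}.
Local Notation C := R[i].
Local Notation poly2 := {poly {poly C}}.
Context (n : nat) (p : poly2) (hp : deg_le_n1 n p)
  (hz : forall z : C * C, in_D2 z -> eval2 p z != 0)
  (hdeg : deg_eq_n1 n (ptilde n p)) (hno : no_common_factor p (ptilde n p))
  (alpha : C) (ha : cabs alpha = 1)
  (sg : {measure set (R * R)%type -> \bar R}) (hsg : is_clark_measure n p alpha sg).
Local Notation pt := (ptilde n p).
Local Notation phi := (Defs.phi n p).
Local Notation Q := (level n p alpha).

Lemma level_phi z : in_D2 z -> cabs (eval2 Q z) = cabs (eval2 p z) * cabs (alpha - phi z).
Proof using hz.
move=> hzz; rewrite -cabsM eval2_level; congr cabs.
by have := hz hzz; rewrite /Defs.phi => h; field.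
Qed.

Lemma phi_gap z : in_D2 z -> 1 - cabs (phi z) ^+ 2 <= 2 * cabs (alpha - phi z).
Proof using hp hz hdeg hno ha.
move=> hzz; have h1 := phi_lt1 hp hz hdeg hno hzz; have h0 := cabs_ge0 (phi z).
by have := cabs_subr alpha (phi z); rewrite ha; nra.
Qed.

(* On [z1 = tau] the polynomials [p] and its reflection are proportional, so [phi (tau, .)] is constant. *)
Lemma exceptional_root : exceptional n p alpha -> exists2 tau, cabs tau = 1 & (Q`_0).[tau] = 0.
Proof using hp hz hdeg hno ha.
move=> [[tau lam] [[/= ht hl] [hp0 hnt]]]; exists tau => //.
have t0 := unim_neq0 ht; have l0 := unim_neq0 hl.
have el : (p`_0).[tau] = - ((p`_1).[tau] * lam).
  by move: hp0; rewrite (eval2_lin _ hp) /= => /eqP; rewrite addr_eq0 => /eqP.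
have p1 : (p`_1).[tau] != 0.
  apply/eqP => h1; apply: (no_common_root hp hno t0 ht _ h1).
  by rewrite el h1 mul0r oppr0.
set q := (p`_1).[tau] in el p1.
have ep z2 : eval2 p (tau, z2) = q * (z2 - lam) by rewrite (eval2_lin _ hp) /= el -/q; ring.
pose b := - (tau ^+ n * cconj q * cconj lam).
have ept z2 : z2 != 0 -> eval2 pt (tau, z2) = b * (z2 - lam).
  move=> z20; rewrite (@eval2_ptilde R n p (tau, z2) hp t0 z20) /= (conj_unim ht) invrK ep.
  rewrite cconjM cconjB.
  have -> : cconj ((cconj z2)^-1) = z2^-1 by rewrite cconjV cconjK.
  have e1 : lam * cconj lam = 1 by rewrite mul_conj hl expr1n.
  rewrite /b.
  have -> : - (tau ^+ n * cconj q * cconj lam) * (z2 - lam) =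
     tau ^+ n * cconj q * (lam * cconj lam - z2 * cconj lam) by ring.
  by rewrite e1; field.
have q0 : 0 < cabs q by rewrite cabs_gt0.
(* Then [alpha p - ptilde] vanishes on the line for [z2] nonzero, and the values at 1 and -1
   annihilate both coefficients. *)
suff e : alpha * q = b.
  have hz2 z2 : z2 != 0 -> (Q`_0).[tau] + (Q`_1).[tau] * z2 = 0.
    move=> z20; have := level_lin hp alpha (tau, z2); rewrite /= => <-.
    by rewrite eval2_level ep ept // mulrA e subrr.
  have k1 := hz2 1 (oner_neq0 _).
  have k2 : (Q`_0).[tau] + (Q`_1).[tau] * (-1) = 0 by apply: hz2; rewrite oppr_eq0 oner_neq0.
  have : (Q`_0).[tau] *+ 2 = 0.
    have -> : (Q`_0).[tau] *+ 2 = ((Q`_0).[tau] + (Q`_1).[tau] * 1) + ((Q`_0).[tau] + (Q`_1).[tau] * (-1)) by ring.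
    by rewrite k1 k2 addr0.
  by move/eqP; rewrite mulrn_eq0 /= => /eqP.
apply/eqP; rewrite -subr_eq0 -cabs_eq0 eq_le cabs_ge0 andbT; apply/ler_addgt0Pr => e e0; rewrite add0r.
have e2 : 0 < e / (2 * cabs q) by rewrite divr_gt0 // mulr_gt0.
have [d d0 hd] := hnt 2 (ltr1n _ 2) _ e2.
(* The point [(tau, (1 - h) lam)] is reached along a radius in [z1], inside the approach region of
   aperture 2; there [|alpha - phi|] is below the chosen accuracy, and [radial_le] carries the
   estimate to [z1 = tau]. *)
pose h := Num.min (1 / 2) (d / 2).
have h0 : 0 < h by rewrite lt_min !divr_gt0.
have h1 : h <= 1 / 2 by rewrite ge_min lexx.
have h2 : h < d by have : h <= d / 2 by [rewrite ge_min lexx orbT]; lra.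
have h01 : 0 <= 1 - h <= 1 by apply/andP; split; lra.
pose z2 : C := ((1 - h)%:C)%C * lam.
have [c2 c2'] := dil_unim h01 hl; rewrite -/z2 in c2 c2'.
have z20 : z2 != 0 by rewrite -cabs_gt0 c2; lra.
have hzl : z2 - lam != 0 by rewrite -cabs_gt0 c2'; lra.
have main : cabs (alpha * eval2 p (tau, z2) - eval2 pt (tau, z2)) * 1 <= e / (2 * cabs q) * cabs (eval2 p (tau, z2)) * 1 -> cabs (alpha * q - b) <= e.
  rewrite ep (ept _ z20) mulrA -mulrBl !cabsM !mulr1 mulrA.
  rewrite ler_pM2r ?cabs_gt0 // => hh; apply: (le_trans hh).
  have -> : e / (2 * cabs q) * cabs q = e / 2 by field; rewrite gt_eqF.
  lra.
apply: main; rewrite !mulr1 -eval2_level.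
have hz2 : cabs z2 < 1 by rewrite c2; lra.
pose r0 := Num.max 0 (1 - d).
have r01 : 0 <= r0 < 1 by rewrite le_max lexx /= gt_max; apply/andP; split; lra.
rewrite -[leLHS]mul1r.
apply: (@radial_le _ _ _ _ _ r0 (fun r => ((r%:C)%C * tau, z2)) (tau, z2) (lip_eval2 _) (lip_eval2 _)) => //.
- exact: ltW.
- by split; rewrite /= ?ht //; exact: ltW.
- exact: (radial_fst ht (ltW hz2)).
move=> r /andP[]; rewrite gt_max => /andP[rp rd] r1.
have rr : 0 <= r <= 1 by apply/andP; split; exact: ltW.
have [e3 e4] := dil_unim rr ht.
have hD : in_D2 ((r%:C)%C * tau, z2) by split; rewrite //= e3.
rewrite mul1r (level_phi hD) mulrC; apply: ler_wpM2r; first exact: cabs_ge0.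
rewrite cabsBC; apply: ltW; apply: hd => //=; rewrite cabsBC ?e3 ?e4 ?c2 ?c2'; lra.
Qed.
Context (tau : C) (ht : cabs tau = 1) (hroot : (Q`_0).[tau] = 0).

Lemma root1 : (Q`_1).[tau] = 0.
Proof using hp ha ht hroot.
by apply/eqP; rewrite -cabs_eq0 (level_T hp ha ht) hroot cabs0.
Qed.

Lemma level_div : exists R0 R1 : {poly C}, [/\ Q`_0 = R0 * ('X - tau%:P), Q`_1 = R1 * ('X - tau%:P) &
  forall z, eval2 Q z = (z.1 - tau) * eval2 (R0%:P + R1%:P * 'X) z].
Proof using hp ha ht hroot.
have /factor_theorem[R0 e0] : root (Q`_0) tau by apply/eqP.
have /factor_theorem[R1 e1] : root (Q`_1) tau by apply/eqP; exact: root1.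
exists R0, R1; split=> // z.
rewrite (level_lin hp) e0 e1 !hornerM !hornerXsubC eval2D eval2M !eval2P eval2X; ring.
Qed.

(** On the line [alpha p = ptilde]; comparing coefficients in [z2] gives [|p0| = |p1|] at [tau],
    both nonzero by coprimality, so the zero in [z2] is unimodular. *)
Lemma line_zero : exists2 lam : C, cabs lam = 1 & exists2 q : C, q != 0 &
  forall z2, eval2 p (tau, z2) = q * (z2 - lam).
Proof using hp hno ha ht hroot.
have t0 := unim_neq0 ht.
have hz2 z2 : z2 != 0 -> alpha * ((p`_0).[tau] + (p`_1).[tau] * z2) =
    tau ^+ n * (z2 * cconj (p`_0).[tau] + cconj (p`_1).[tau]).
  move=> z20; have := eval2_level n p alpha (tau, z2); rewrite (level_lin hp) /= hroot root1 mul0r addr0.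
  rewrite (@eval2_ptilde R n p (tau, z2) hp t0 z20) /= (conj_unim ht) invrK !(eval2_lin _ hp) /=.
  move/eqP; rewrite eq_sym subr_eq0 => /eqP ->.
  rewrite cconjD cconjM.
  have -> : cconj ((cconj z2)^-1) = z2^-1 by rewrite cconjV cconjK.
  by field.
have k1 := hz2 1 (oner_neq0 _).
have k2 : alpha * ((p`_0).[tau] + (p`_1).[tau] * (-1)) =
    tau ^+ n * ((-1) * cconj (p`_0).[tau] + cconj (p`_1).[tau]) by apply: hz2; rewrite oppr_eq0 oner_neq0.
have e01 : cabs (p`_0).[tau] = cabs (p`_1).[tau].
  have h : alpha * (p`_0).[tau] = tau ^+ n * cconj (p`_1).[tau].
    apply/eqP; rewrite -subr_eq0; apply/eqP.
    have : (alpha * (p`_0).[tau] - tau ^+ n * cconj (p`_1).[tau]) *+ 2 = 0.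
      have -> : (alpha * (p`_0).[tau] - tau ^+ n * cconj (p`_1).[tau]) *+ 2 =
        alpha * ((p`_0).[tau] + (p`_1).[tau] * 1) + alpha * ((p`_0).[tau] + (p`_1).[tau] * (-1)) - tau ^+ n * cconj (p`_1).[tau] *+ 2 by ring.
      by rewrite k1 k2; ring.
    by move/eqP; rewrite mulrn_eq0 /= => /eqP.
  by have := congr1 cabs h; rewrite !cabsM ha mul1r cabsX ht expr1n mul1r cabs_conj.
have p1 : (p`_1).[tau] != 0.
  apply/eqP => h1; apply: (no_common_root hp hno t0 ht _ h1).
  by apply/eqP; rewrite -cabs_eq0 e01 h1 cabs0.
exists (- ((p`_0).[tau] / (p`_1).[tau])).
  by rewrite cabsN cabsM cabsV e01 divff // cabs_eq0.
by exists (p`_1).[tau] => // z2; rewrite (eval2_lin _ hp) /=; field.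
Qed.

(* [Q / (z1 - tau)] vanishes on the line at the same unimodular point as [p]. *)
Lemma line_quotient : exists q r lam : C, exists P2 : poly2, [/\
  q != 0 /\ r != 0, cabs lam = 1, (forall z, eval2 Q z = (z.1 - tau) * eval2 P2 z),
  (forall z2, eval2 p (tau, z2) = q * (z2 - lam)) &
  forall z2, eval2 P2 (tau, z2) = r * (z2 - lam)].
Proof using hp hz hdeg hno ha ht hroot.
have [lam hl [q q0 ep]] := line_zero.
have [R0 [R1 [e0 e1 eQ]]] := level_div.
set P2 := R0%:P + R1%:P * 'X in eQ.
have eP z : eval2 P2 z = R0.[z.1] + R1.[z.1] * z.2 by rewrite /P2 eval2D eval2M !eval2P eval2X.
(* [schwarz_pick1] bounds [|Q| = |p| |alpha - phi|] below by a multiple of [(1 - |z1|) |p|];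
   dividing by [|z1 - tau| = 1 - |z1|] on the radius and letting [z1] tend to [tau] leaves a lower
   bound for [|P2|]. *)
have low z2 : cabs z2 < 1 -> eval2 P2 (tau, z2) != 0.
  move=> hz2; have k0 : 0 < (1 - cabs (phi (0, z2))) / 2.
    by rewrite divr_gt0 // subr_gt0; apply: phi_lt1 => //; exact: in_D2_0l.
  set k := _ / 2 in k0.
  have h : k * cabs (eval2 p (tau, z2)) <= 2 * cabs (eval2 P2 (tau, z2)).
    apply: (@radial_le _ _ _ _ _ 0 (fun r => ((r%:C)%C * tau, z2)) (tau, z2) (lip_eval2 _) (lip_eval2 _)) => //.
    - exact: ltW.
    - by rewrite lexx ltr01.
    - by split; rewrite /= ?ht //; exact: ltW.
    - exact: (radial_fst ht (ltW hz2)).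
    move=> r /andP[rp r1]; have rr : 0 <= r <= 1 by apply/andP; split; exact: ltW.
    have [e3 e4] := dil_unim rr ht.
    have hr : cabs ((r%:C)%C * tau) < 1 by rewrite e3.
    have hD : in_D2 ((r%:C)%C * tau, z2) by [].
    have h1 := schwarz_pick1 hp hz hdeg hno hr hz2.
    have h2 := phi_gap hD; have h3 := level_phi hD.
    rewrite eQ /= cabsM e4 in h3; rewrite e3 in h1.
    have pp := cabs_ge0 (eval2 p ((r%:C)%C * tau, z2)).
    have h4 : (1 - r ^+ 2) * k <= 2 * cabs (alpha - phi ((r%:C)%C * tau, z2)) by rewrite /k; lra.
    have h5 := ler_wpM2l pp h4.
    have h6 : (1 - r) * ((1 + r) * k * cabs (eval2 p ((r%:C)%C * tau, z2))) <= (1 - r) * (2 * cabs (eval2 P2 ((r%:C)%C * tau, z2))).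
      move: h5 h3; move: (cabs (eval2 p _)) (cabs (alpha - _)) (cabs (eval2 P2 _)) => A B D h5 h3.
      by rewrite [(1 - r) * (2 * D)]mulrCA h3; lra.
    rewrite ler_pM2l ?subr_gt0 // in h6; apply: le_trans h6.
    by apply: ler_wpM2r => //; nra.
  rewrite -cabs_gt0; have : 0 < k * cabs (eval2 p (tau, z2)).
    rewrite mulr_gt0 // cabs_gt0 ep mulf_neq0 // subr_eq0; apply/eqP => e.
    by rewrite e hl ltxx in hz2.
  lra.
(* [|Q0| = |Q1|] on the circle; the common factor [x - tau] cancels at circle points near [tau], and
   continuity reaches [tau] itself. *)
have e01 : cabs R0.[tau] = cabs R1.[tau].
  have [K0 K00 h0] := lip_poly R0; have [K1 K10 h1] := lip_poly R1.
  suff hd (e : R) : 0 < e -> `|cabs R0.[tau] - cabs R1.[tau]| <= e.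
    by apply/eqP; rewrite -subr_eq0 -normr_eq0 eq_le normr_ge0 andbT; apply/ler_addgt0Pr => e e00; rewrite add0r hd.
  move=> e00; pose th := Num.min 1 (e / (K0 + K1 + 1)).
  have M0 : 0 < K0 + K1 + 1 by lra.
  have t0 : 0 < th by rewrite lt_min ltr01 divr_gt0.
  have t1 : th <= 1 by rewrite ge_min lexx.
  have t2 : th * (K0 + K1 + 1) <= e by rewrite -ler_pdivlMr // ge_min lexx orbT.
  pose x := tau * expi th.
  have hx : cabs x = 1 by rewrite cabsM ht mul1r cabs_expi.
  have exd : cabs (x - tau) = cabs (expi th - expi 0).
    by rewrite expi0 /x -{2}(mulr1 tau) -mulrBr cabsM ht mul1r.
  have d1 : cabs (x - tau) <= th.
    by rewrite exd; have := chord_le th 0; rewrite subr0 (ger0_norm (ltW t0)).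
  have d2 : 0 < cabs (x - tau).
    rewrite exd; have := @chord_ge R th 0; rewrite subr0 (ger0_norm (ltW t0)).
    have := pi_ge2 R => p2 h; have := h _; lra.
  have ex : cabs R0.[x] = cabs R1.[x].
    have := level_T hp ha hx; rewrite e0 e1 !hornerM !hornerXsubC !cabsM => /(mulIf _) -> //.
    by rewrite gt_eqF.
  have x1 : cabs x <= 1 by rewrite hx.
  have tt1 : cabs tau <= 1 by rewrite ht.
  have u0 := h0 _ _ x1 tt1; have u1 := h1 _ _ x1 tt1.
  have w0 : K0 * cabs (x - tau) <= K0 * th by apply: ler_wpM2l.
  have w1 : K1 * cabs (x - tau) <= K1 * th by apply: ler_wpM2l.
  have v0 := cabs_subr R0.[x] R0.[tau]; have v1 := cabs_subr R1.[x] R1.[tau].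
  have v2 := cabs_subr R0.[tau] R0.[x]; have v3 := cabs_subr R1.[tau] R1.[x].
  rewrite cabsBC in v2; rewrite cabsBC in v3.
  by rewrite ler_norml; apply/andP; split; lra.
have h00 : cabs (0 : C) < 1 by rewrite cabs0.
have r00 : R0.[tau] != 0 by have := low 0 h00; rewrite eP /= mulr0 addr0.
have r1 : R1.[tau] != 0 by rewrite -cabs_eq0 -e01 cabs_eq0.
pose lam' := - (R0.[tau] / R1.[tau]).
have hl' : cabs lam' = 1 by rewrite cabsN cabsM cabsV e01 divff // cabs_eq0.
have eP2 z2 : eval2 P2 (tau, z2) = R1.[tau] * (z2 - lam') by rewrite eP /lam' /=; field.
suff ell : lam' = lam by exists q, R1.[tau], lam, P2; split=> // z2; rewrite eP2 ell.
have hT : in_T2 (tau, lam') by [].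
(* On the radius to [(tau, lam')], where [P2] tends to zero, the lower bound for [1 - |phi|^2]
   forces [p] to tend to zero as well, and [lam] is the only zero of [p] on the line. *)
have [c c0 hc] := slice_schwarz_pick hp hz hdeg hno hT.
have h : c * cabs (eval2 p (tau, lam')) <= 2 * cabs (eval2 P2 (tau, lam')).
  apply: (@radial_le _ _ _ _ _ 0 (fun r => ((r%:C)%C * tau, (r%:C)%C * lam')) (tau, lam') (lip_eval2 _) (lip_eval2 _)) => //.
  - exact: ltW.
  - by rewrite lexx ltr01.
  - by split; rewrite /= ?ht ?hl'.
  - exact: (radial_both ht hl').
  move=> r /andP[rp r1']; have rr : 0 <= r <= 1 by apply/andP; split; exact: ltW.
  have [e3 e4] := dil_unim rr ht; have [e5 e6] := dil_unim rr hl'.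
  have hD : in_D2 ((r%:C)%C * tau, (r%:C)%C * lam') by split; rewrite /= ?e3 ?e5.
  have h1 : c * (1 - r) <= 1 - cabs (phi ((r%:C)%C * tau, (r%:C)%C * lam')) ^+ 2 by apply: hc; rewrite rp r1'.
  have h2 := phi_gap hD; have h3 := level_phi hD.
  rewrite eQ /= cabsM e4 in h3.
  have pp := cabs_ge0 (eval2 p ((r%:C)%C * tau, (r%:C)%C * lam')).
  have h4 := le_trans h1 h2; have h5 := ler_wpM2l pp h4.
  rewrite -(ler_pM2l (_ : 0 < 1 - r)) ?subr_gt0 //.
  move: h5 h3; move: (cabs (eval2 p _)) (cabs (alpha - _)) (cabs (eval2 P2 _)) => A B D h5 h3.
  by rewrite [(1 - r) * (2 * D)]mulrCA h3; lra.
have : c * cabs (eval2 p (tau, lam')) <= 0 by apply: (le_trans h); rewrite eP2 subrr mulr0 cabs0 mulr0.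
rewrite pmulr_rle0 // => hle.
have /eqP : cabs (eval2 p (tau, lam')) = 0 by apply/le_anti; rewrite hle cabs_ge0.
by rewrite cabs_eq0 ep mulf_eq0 (negbTE q0) /= subr_eq0 => /eqP.
Qed.

End Line.

(** * The Clark measure on the line over a root *)

Section LineMeasure.
Context {R : realType}.
Local Notation C := R[i].
Local Notation poly2 := {poly {poly C}}.
Context (n : nat) (p : poly2) (hp : deg_le_n1 n p)
  (hz : forall z : C * C, in_D2 z -> eval2 p z != 0)
  (hdeg : deg_eq_n1 n (ptilde n p)) (hno : no_common_factor p (ptilde n p))
  (alpha : C) (ha : cabs alpha = 1)
  (sg : {measure set (R * R)%type -> \bar R}) (hsg : is_clark_measure n p alpha sg).
Local Notation pt := (ptilde n p).
Local Notation phi := (Defs.phi n p).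
Local Notation Q := (level n p alpha).
Context (tau : C) (ht : cabs tau = 1) (hroot : (Q`_0).[tau] = 0).

Definition line (u : C) := [set t : R * R | expi t.1 = u].

Lemma meas_line u : measurable (line u).
Proof.
have -> : line u = ~` [set t | (zeta t).1 - u != 0].
  apply/seteqP; split=> t; rewrite /line /=; first by move=> ->; rewrite subrr eqxx.
  by move/negP; rewrite negbK subr_eq0 => /eqP.
apply: measurableC; apply: meas_neq0; apply: cmeasB; [exact: cmeas_z1 | exact: cmeas_cst].
Qed.

(** [clarkH] is the real part of the Herglotz function [(alpha + phi) / (alpha - phi) = 2 alpha p /
    Q - 1]. *)
Lemma clarkH_level z : in_D2 z -> clarkH n p alpha z = 2 * complex.Re (alpha * eval2 p z / eval2 Q z) - 1.
Proof using hp hz hdeg hno ha.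
move=> hzz; have q0 := level_neq0 hp hz hdeg hno ha hzz.
have e : eval2 pt z = alpha * eval2 p z - eval2 Q z by rewrite eval2_level; ring.
rewrite /clarkH e cabs_sqrB cabsM ha mul1r.
have s0 : cabs (eval2 Q z) != 0 by rewrite cabs_eq0.
have -> : alpha * eval2 p z / eval2 Q z =
    alpha * eval2 p z * cconj (eval2 Q z) * (((cabs (eval2 Q z) ^+ 2)^-1)%:C)%C.
  rewrite real_complexV -mul_conj.
  have : cconj (eval2 Q z) != 0 by rewrite cconj_eq0.
  by move: (cconj _) => w w0; field; rewrite q0 w0.
rewrite [in RHS]cReM /= mulr0 subr0; field; exact: s0.
Qed.

Let h (m : nat) : R := m.+2%:R^-1.
Let h01 m : 0 < h m < 1.
Proof. by rewrite /h invr_gt0 ltr0n /= invf_lt1 ?ltr0n // ltr1n. Qed.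
Let zm z2 m : C * C := (((1 - h m)%:C)%C * tau, z2).
Let Y z2 m : R := h m / (2 - h m) * clarkH n p alpha (zm z2 m).

Let zmD z2 m : cabs z2 < 1 -> in_D2 (zm z2 m) /\ cabs ((zm z2 m).1 - tau) = h m.
Proof.
move=> h2; have /andP[m0 m1] := h01 m.
have rr : 0 <= 1 - h m <= 1 by apply/andP; split; lra.
have [e1 e2] := dil_unim rr ht.
by rewrite /in_D2 /zm /= e1 e2; split; [split=> //; lra | lra].
Qed.

Let hsmall (e : R) : 0 < e -> exists m0 : nat, forall m, (m0 <= m)%N -> h m < e.
Proof.
move=> e0; exists (Num.truncn e^-1) => m hm.
rewrite /h invf_plt ?posrE //; apply: (lt_le_trans (truncnS_gt _)); rewrite ler_nat ltnS; exact: leq_trans hm (leqnSn m).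
Qed.

(* [Y z2 m] is the Poisson integral at [(z1, z2)] times [(1 - |z1|) / (1 + |z1|)], with [z1 -> tau] radially; its limit
   does not depend on [z2] because [Q / (z1 - tau)] and [p] have the same unimodular zero on the line. *)
Lemma line_density : exists2 rho : R, 0 < rho & forall z2, cabs z2 < 1 ->
  forall e, 0 < e -> exists m0 : nat, forall m, (m0 <= m)%N -> `|Y z2 m - rho| < e.
Proof using hp hz hdeg hno ha ht hroot.
have [q [r [lam [P2 [[q0 r0] hl eQ ep eP]]]]] := line_quotient hp hz hdeg hno ha ht hroot.
(* At [zm] the factor [z1 - tau] is [- h tau], so [Y] equals [(2 Re (- alpha conj tau p / P2) - h) /
   (2 - h)], and [p / P2] tends to [q / r]. *)
pose rho := complex.Re (- alpha * cconj tau * (q / r)).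
have ett : tau * cconj tau = 1 by rewrite mul_conj ht expr1n.
have t0 := unim_neq0 ht.
have zl z2 : cabs z2 < 1 -> z2 - lam != 0.
  by move=> h2; rewrite subr_eq0; apply/eqP => e; rewrite e hl ltxx in h2.
have eY z2 m : cabs z2 < 1 -> Y z2 m =
    (2 * complex.Re (- alpha * cconj tau * (eval2 p (zm z2 m) / eval2 P2 (zm z2 m))) - h m) / (2 - h m).
  move=> h2; have [hD hd] := zmD m h2; have /andP[m0 m1] := h01 m.
  have Q0 := level_neq0 hp hz hdeg hno ha hD.
  have P0 : eval2 P2 (zm z2 m) != 0 by apply: contra_neq Q0 => e; rewrite eQ e mulr0.
  rewrite /Y clarkH_level // eQ.
  have -> : (zm z2 m).1 - tau = ((- h m)%:C)%C * tau.
    by rewrite /zm /= real_complexB rmorph1 rmorphN /=; ring.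
  have hm0 : ((h m)%:C)%C != 0 :> C by rewrite -cabs_eq0 cabs_real normr_eq0 gt_eqF.
  have -> : alpha * eval2 p (zm z2 m) / (((- h m)%:C)%C * tau * eval2 P2 (zm z2 m)) =
      (- alpha * cconj tau * (eval2 p (zm z2 m) / eval2 P2 (zm z2 m))) * (((h m)^-1)%:C)%C.
    rewrite real_complexV rmorphN /=.
    have -> : cconj tau = tau^-1 by apply: conj_unim.
    by field; rewrite P0 t0 hm0.
  rewrite cReM /= mulr0 subr0; field; rewrite gt_eqF //=; [|lra]; rewrite gt_eqF //; lra.
have qc z2 : cabs z2 < 1 -> forall e, 0 < e -> exists m0 : nat, forall m, (m0 <= m)%N ->
    cabs (eval2 p (zm z2 m) / eval2 P2 (zm z2 m) - q / r) < e.
  move=> h2 e e0.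
  have hc : cD2 (tau, z2) by split; rewrite /= ?ht // ltW.
  have P0 : eval2 P2 (tau, z2) != 0 by rewrite eP mulf_neq0 // zl.
  have [d d0 hd] := quot_cont (lip_eval2 p) (lip_eval2 P2) hc P0 e0.
  have [m0 hm0] := hsmall d0; exists m0 => m hm; have [hD hdist] := zmD m h2.
  have eqr : q / r = eval2 p (tau, z2) / eval2 P2 (tau, z2) by rewrite ep eP; field; rewrite r0 zl.
  rewrite eqr; apply: hd; first by split; apply: ltW; [exact: hD.1 | exact: hD.2].
  by rewrite hdist /= subrr cabs0 addr0; exact: hm0.
have cvY z2 : cabs z2 < 1 -> forall e, 0 < e -> exists m0 : nat, forall m, (m0 <= m)%N -> `|Y z2 m - rho| < e.
  move=> h2 e e0; have e4 : 0 < e / 4 by rewrite divr_gt0.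
  have n0 : 0 < 1 + `|rho| by rewrite ltr_wpDr.
  have e5 : 0 < e / (2 * (1 + `|rho|)) by rewrite divr_gt0 // mulr_gt0.
  have [m1 hm1] := qc z2 h2 _ e4; have [m2 hm2] := hsmall e5.
  exists (maxn m1 m2) => m hm.
  have g1 := hm1 m (leq_trans (leq_maxl _ _) hm); have g2 := hm2 m (leq_trans (leq_maxr _ _) hm).
  rewrite eY //; have /andP[k0 k1] := h01 m.
  set X := complex.Re _.
  have hX : `|X - rho| < e / 4.
    rewrite /X /rho -cReB -mulrBr; apply: (le_lt_trans (cabs_Re _)).
    by rewrite cabsM cabsM cabsN ha cabs_conj ht !mul1r.
  rewrite ltr_pdivlMr ?mulr_gt0 // in g2.
  have -> : (2 * X - h m) / (2 - h m) - rho = (2 * (X - rho) - h m * (1 - rho)) / (2 - h m).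
    by field; rewrite gt_eqF //; lra.
  rewrite normrM normfV (ger0_norm (_ : 0 <= 2 - h m)); last lra.
  rewrite ltr_pdivrMr; last lra.
  apply: (@lt_le_trans _ _ e); last by nra.
  apply: (le_lt_trans (ler_normB _ _)); rewrite !normrM normr_nat (ger0_norm (ltW k0)).
  have : `|1 - rho| <= 1 + `|rho| by apply: (le_trans (ler_normB _ _)); rewrite normr1.
  by move=> hr; have := ler_wpM2l (ltW k0) hr; lra.
exists rho => //.
have h00 : cabs (0 : C) < 1 by rewrite cabs0.
pose k := (1 - cabs (phi (0, 0))) / 2.
have k0 : 0 < k by rewrite divr_gt0 // subr_gt0; apply: phi_lt1 => //; exact: in_D2_0l.
have qr0 : 0 < cabs (q / r) by rewrite cabs_gt0 mulf_neq0 // invr_eq0.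
(* A lower bound for [Y] valid for all large [m], from [schwarz_pick1] at [z2 = 0]; it makes the
   limit [rho] positive. *)
pose eta := k * (cabs (q / r) / 2) ^+ 2.
have eta0 : 0 < eta by rewrite mulr_gt0 // exprn_gt0 // divr_gt0.
have [m1 hm1] := cvY 0 h00 _ eta0.
have qr2 : 0 < cabs (q / r) / 2 by rewrite divr_gt0.
have [m2 hm2] := qc 0 h00 _ qr2.
pose m := maxn m1 m2.
have g1 := hm1 m (leq_maxl _ _); have g2 := hm2 m (leq_maxr _ _).
have [hD hdist] := zmD m h00; have /andP[s0 s1] := h01 m.
have low : eta <= Y 0 m.
  have Q0 := level_neq0 hp hz hdeg hno ha hD.
  have P0 : eval2 P2 (zm 0 m) != 0 by apply: contra_neq Q0 => e; rewrite eQ e mulr0.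
  have hr : 0 <= 1 - h m <= 1 by apply/andP; split; lra.
  have [e1 e2] := dil_unim hr ht.
  have h1 := schwarz_pick1 hp hz hdeg hno hD.1 h00.
  rewrite -/(zm 0 m) -[((1 - cabs _ ^+ 2) * _) / 2]mulrA -/k e1 in h1.
  have h3 := level_phi n hz alpha hD; rewrite eQ cabsM hdist in h3.
  have pp : 0 < cabs (eval2 p (zm 0 m)) by rewrite cabs_gt0 hz.
  have P1 : 0 < cabs (eval2 P2 (zm 0 m)) by rewrite cabs_gt0.
  have eag : cabs (alpha - phi (zm 0 m)) = h m * cabs (eval2 P2 (zm 0 m)) / cabs (eval2 p (zm 0 m)).
    by rewrite h3 mulrC mulrA mulVf ?mul1r // gt_eqF.
  rewrite /Y /clarkH -(clark_lhs hp hz hdeg hno ha hD) eag.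
  have hq : (cabs (q / r) / 2) ^+ 2 <= (cabs (eval2 p (zm 0 m)) / cabs (eval2 P2 (zm 0 m))) ^+ 2.
    apply: sqr_le; first by rewrite ltW.
    rewrite -cabsV -cabsM; have := cabs_subr (q / r) (eval2 p (zm 0 m) / eval2 P2 (zm 0 m)).
    rewrite cabsBC in g2; lra.
  apply: (@le_trans _ _ (k * (cabs (eval2 p (zm 0 m)) / cabs (eval2 P2 (zm 0 m))) ^+ 2)).
    by apply: ler_wpM2l => //; exact: ltW.
  move: h1 pp P1; move: (1 - cabs (phi _) ^+ 2) (cabs (eval2 p _)) (cabs (eval2 P2 _)) => A B D h1 B0 D0.
  have -> : h m / (2 - h m) * (A / (h m * D / B) ^+ 2) = A * (B / D) ^+ 2 / ((2 - h m) * h m).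
    by field; rewrite !gt_eqF //; lra.
  rewrite ler_pdivlMr; last by rewrite mulr_gt0 //; lra.
  have -> : k * (B / D) ^+ 2 * ((2 - h m) * h m) = (1 - (1 - h m) ^+ 2) * k * (B / D) ^+ 2 by ring.
  by apply: ler_wpM2r => //; exact: sqr_ge0.
by move: g1; rewrite ltr_norml => /andP[_]; lra.
Qed.

(** [h / (2 - h)] times the Poisson kernel in [z1] is [h^2 / |e^(i t1) - z1|^2], which is 1 on the
    line, tends to 0 off it and never exceeds 1; dominated convergence turns [line_density] into an
    integral over the line. *)
Lemma line_mass : exists2 rho : R, 0 < rho & forall z2, cabs z2 < 1 ->
  (\int[sg]_(t in line tau) (poisson2 (0, z2) (zeta t))%:E = rho%:E)%E.
Proof using hp hz hdeg hno ha ht hroot hsg.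
have [rho rho0 hY] := line_density; exists rho => // z2 h2.
have hD0 : in_D2 (0, z2) by exact: in_D2_0l.
pose f m (t : R * R) := (h m ^+ 2 / cabs (expi t.1 - (zm z2 m).1) ^+ 2 * poisson2 (0, z2) (zeta t))%:E.
have ef m t : f m t = ((h m / (2 - h m))%:E * (poisson2 (zm z2 m) (zeta t))%:E)%E.
  have /andP[m0 m1] := h01 m; rewrite /f -EFinM; congr EFin.
  have rr : 0 <= 1 - h m <= 1 by apply/andP; split; lra.
  have [e1 _] := dil_unim rr ht.
  have [[D1 D2] _] := zmD m h2.
  have n1 : cabs (expi t.1 - (zm z2 m).1) != 0 by rewrite cabs_eq0 expi_sub_neq0.
  have n2 : cabs (expi t.2 - z2) != 0 by rewrite cabs_eq0 expi_sub_neq0.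
  rewrite poisson2_snd /poisson2 e1 /=.
  by field; rewrite n1 n2 gt_eqF //; lra.
have mp2 := meas_poisson2 hD0.
have mfm m : measurable_fun setT (f m).
  have -> : f m = fun t => ((h m / (2 - h m))%:E * (poisson2 (zm z2 m) (zeta t))%:E)%E.
    by apply/funext => t; exact: ef.
  apply: measurable_funeM; apply/measurable_EFinP; apply: meas_poisson2; by have [] := zmD m h2.
have If m : (\int[sg]_t f m t = (Y z2 m)%:E)%E.
  have [hD _] := zmD m h2; have /andP[m0 m1] := h01 m.
  rewrite (eq_integral (fun t => (h m / (2 - h m))%:E * (poisson2 (zm z2 m) (zeta t))%:E)%E); last by move=> t _; exact: ef.
  rewrite ge0_integralZl_EFin //.
  - by rewrite (clark_int hp hz hdeg hno ha hsg hD) -EFinM.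
  - by move=> t _; rewrite lee_fin poisson2_ge0.
  - by apply/measurable_EFinP; exact: meas_poisson2.
  - by rewrite divr_ge0 //; lra.
pose f0 (t : R * R) := ((fun t => (poisson2 (0, z2) (zeta t))%:E) \_ (line tau)) t.
have mf0 : measurable_fun setT f0.
  apply/(measurable_restrictT _ _).1; first exact: meas_line.
  by apply: measurable_funTS; apply/measurable_EFinP.
have cv1 : (\int[sg]_t f m t)%E @[m --> \oo] --> (\int[sg]_t f0 t)%E.
  apply: (@dominated_cvg _ _ _ sg setT measurableT f f0 (fun t => (poisson2 (0, z2) (zeta t))%:E)) => //.
  - move=> t _; rewrite /f0 patchE; case: ifPn => htl.
      have e : expi t.1 = tau by move/set_mem: htl.
      have -> : f ^~ t = fun=> (poisson2 (0, z2) (zeta t))%:E.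
        apply/funext => m; rewrite /f e cabsBC; have [_ ->] := zmD m h2.
        by have /andP[m0 _] := h01 m; rewrite divff ?mul1r // expf_neq0 // gt_eqF.
      exact: cvg_cst.
    have e : expi t.1 != tau by apply/eqP => e; move/negP: htl; apply; exact: mem_set.
    apply: cvg_EFin; first exact: nearW.
    pose P := poisson2 (0, z2) (zeta t); have P0 : 0 <= P by exact: poisson2_ge0.
    set a := cabs (expi t.1 - tau); have a0 : 0 < a by rewrite cabs_gt0 subr_eq0.
    apply/cvgrPdist_lt => e0 e00.
    have d0 : 0 < Num.min (a / 2) (e0 * a ^+ 2 / (4 * (P + 1))).
      rewrite lt_min; apply/andP; split; apply: divr_gt0 => //.
        by rewrite mulr_gt0 // exprn_gt0.
      by rewrite mulr_gt0 // ltr_wpDl.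
    have [m0 hm0] := hsmall d0; exists m0 => // m /= hm.
    have := hm0 m hm; rewrite lt_min => /andP[u1 u2].
    have [_ hd] := zmD m h2; have /andP[k0 k1] := h01 m.
    have u3 : a / 2 <= cabs (expi t.1 - (zm z2 m).1).
      have := cabs_dist (expi t.1) tau (zm z2 m).1; rewrite hd -/a; lra.
    change (`|0 - (h m ^+ 2 / cabs (expi t.1 - (zm z2 m).1) ^+ 2 * P)| < e0).
    rewrite sub0r normrN ger0_norm; last by rewrite mulr_ge0 // divr_ge0 // sqr_ge0.
    rewrite mulrAC ltr_pdivrMr; last by rewrite exprn_gt0 //; lra.
    rewrite ltr_pdivlMr ?mulr_gt0 ?ltr_wpDl // in u2.
    have u4 : (a / 2) ^+ 2 <= cabs (expi t.1 - (zm z2 m).1) ^+ 2 by apply: sqr_le => //; lra.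
    have u5 := ler_wpM2l (ltW e00) u4.
    apply: lt_le_trans u5.
    have u6 : h m ^+ 2 * P <= h m * P by apply: ler_wpM2r => //; rewrite expr2; nra.
    apply: (le_lt_trans u6); nra.
  - by apply/integrableP; split; [exact/measurable_EFinP |
      under eq_integral do rewrite gee0_abs ?lee_fin ?poisson2_ge0 //;
      rewrite (clark_int hp hz hdeg hno ha hsg hD0) ltry].
  - move=> m t _; rewrite gee0_abs; last first.
      by rewrite lee_fin mulr_ge0 ?poisson2_ge0 // divr_ge0 ?sqr_ge0.
    rewrite lee_fin ler_piMl ?poisson2_ge0 // ler_pdivrMr; last first.
      by rewrite exprn_gt0 // cabs_gt0 expi_sub_neq0 //; have [[]] := zmD m h2.
    rewrite mul1r; apply: sqr_le; first by have /andP[/ltW] := h01 m.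
    have := cabs_subr (expi t.1) (zm z2 m).1; rewrite cabs_expi.
    have /andP[m0 m1] := h01 m; have rr : 0 <= 1 - h m <= 1 by apply/andP; split; lra.
    have [e1 _] := dil_unim rr ht; rewrite /zm /= e1; lra.
have cv2 : (\int[sg]_t f m t)%E @[m --> \oo] --> rho%:E.
  have -> : (fun m => \int[sg]_t f m t)%E = EFin \o Y z2 by apply/funext => m; exact: If.
  apply: cvg_EFin; first exact: nearW.
  apply/cvgrPdist_lt => e e0; have [m0 hm0] := hY z2 h2 e e0.
  by exists m0 => // m /= hm; rewrite distrC; exact: hm0.
rewrite integral_mkcond; apply: (cvg_unique _ cv1 cv2); exact: ereal_hausdorff.
Qed.

(* Only the mass on the line is needed: [Re H >= rho P_{z1}(tau)] forces [phi -> alpha] non-tangentially. *)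
Lemma root_exceptional : exceptional n p alpha.
Proof using hp hz hdeg hno ha ht hroot hsg.
have [rho rho0 hrho] := line_mass.
have [lam hl [q q0 ep]] := line_zero hp hno ha ht hroot.
exists (tau, lam); split; first by [].
split; first by rewrite ep subrr mulr0.
(* The chain [rho / (c |tau - z1|) <= clarkH <= 2 / |alpha - phi|] gives
   [|alpha - phi| <= 2 c |tau - z1| / rho]. *)
move=> c c1 e e0; exists (e * rho / (2 * c)); first by rewrite divr_gt0 ?mulr_gt0 //; lra.
move=> z hD hc1 hc2 hd1 hd2; rewrite /= in hc1 hc2 hd1 hd2.
have hz2 : cabs z.2 < 1 := hD.2. have hz1 : cabs z.1 < 1 := hD.1.
set w := (1 - cabs z.1 ^+ 2) / cabs (tau - z.1) ^+ 2.
have a0 : 0 < cabs (tau - z.1).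
  by rewrite cabs_gt0 subr_eq0; apply/eqP => e1; rewrite -e1 ht ltxx in hz1.
have w0 : 0 <= w by rewrite divr_ge0 ?sqr_ge0 // subr_ge0 expr_le1 ?cabs_ge0 // ltW.
have low : w * rho <= clarkH n p alpha z.
  rewrite -lee_fin -(clark_int hp hz hdeg hno ha hsg hD) EFinM -(hrho _ hz2).
  rewrite -ge0_integralZl_EFin //; last 3 first.
  - exact: meas_line.
  - by move=> t _; rewrite lee_fin poisson2_ge0 //; exact: in_D2_0l.
  - by apply: measurable_funTS; apply/measurable_EFinP; apply: meas_poisson2; exact: in_D2_0l.
  apply: (@le_trans _ _ (\int[sg]_(t in line tau) (poisson2 z (zeta t))%:E)%E).
    rewrite le_eqVlt; apply/orP; left; apply/eqP; apply: eq_integral => t /set_mem htl.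
    rewrite -EFinM poisson2_snd /poisson2 /w; congr EFin; rewrite /= htl.
    have n2 : cabs (expi t.2 - z.2) != 0 by rewrite cabs_eq0 expi_sub_neq0.
    by field; rewrite n2 gt_eqF.
  apply: ge0_subset_integral => //; first exact: meas_line.
  - by apply/measurable_EFinP; exact: meas_poisson2.
  - by move=> t _; rewrite lee_fin poisson2_ge0.
have b0 : 0 < cabs (alpha - phi z).
  rewrite cabs_gt0 subr_eq0; apply/eqP => e1; have := phi_lt1 hp hz hdeg hno hD.
  by rewrite -e1 ha ltxx.
have up : clarkH n p alpha z <= 2 / cabs (alpha - phi z).
  rewrite /clarkH -(clark_lhs hp hz hdeg hno ha hD) ler_pdivrMr ?exprn_gt0 //.
  have -> : 2 / cabs (alpha - phi z) * cabs (alpha - phi z) ^+ 2 = 2 * cabs (alpha - phi z).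
    by field; rewrite gt_eqF.
  exact: phi_gap.
have lw : 1 / (c * cabs (tau - z.1)) <= w.
  rewrite /w ler_pdivlMr ?exprn_gt0 //.
  have -> : 1 / (c * cabs (tau - z.1)) * cabs (tau - z.1) ^+ 2 = cabs (tau - z.1) / c.
    by field; rewrite !gt_eqF //; lra.
  rewrite ler_pdivrMr; last lra.
  have := cabs_ge0 z.1; move: hc1 hz1; move: (cabs z.1) (cabs (tau - _)) => x y hx1 hx2 hx3.
  have : 0 <= c * (x * (1 - x)) by apply: mulr_ge0; [lra | apply: mulr_ge0; lra].
  lra.
rewrite cabsBC.
have h1 : 1 / (c * cabs (tau - z.1)) * rho <= 2 / cabs (alpha - phi z).
  by apply: (le_trans _ up); apply: (le_trans _ low); apply: ler_wpM2r => //; exact: ltW.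
move: h1; rewrite ler_pdivlMr // => h1.
have e3 : 1 / (c * cabs (tau - z.1)) * rho * cabs (alpha - phi z) * (c * cabs (tau - z.1)) = rho * cabs (alpha - phi z).
  by field; rewrite !gt_eqF //; lra.
have ca : 0 < c * cabs (tau - z.1) by rewrite mulr_gt0 //; lra.
have h2 := ler_wpM2r (ltW ca) h1; rewrite e3 in h2.
rewrite -(ltr_pM2l rho0); apply: (le_lt_trans h2).
rewrite ltr_pdivlMr in hd1; last by rewrite mulr_gt0 //; lra.
lra.
Qed.
End LineMeasure.

(** * Generic values *)

Section Multipliers.
Context {R : realType}.
Local Notation C := R[i].
Implicit Types (f g u v : R * R -> C) (L : seq (C * (C * C))).
Context (sg : {measure set (R * R)%type -> \bar R}) (mass : R) (hmass : (sg setT <= mass%:E)%E).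

Definition bfun f := cmeas f /\ exists K : R, forall t, cabs (f t) <= K.
Definition N2 f := (\int[sg]_t (cabs (f t) ^+ 2)%:E)%E.

Lemma bfun_cst (c : C) : bfun (fun=> c).
Proof. by split; [exact: cmeas_cst | exists (cabs c)]. Qed.
Lemma bfunD f g : bfun f -> bfun g -> bfun (fun t => f t + g t).
Proof.
move=> [mf [K hK]] [mg [K' hK']]; split; first exact: cmeasD.
by exists (K + K') => t; apply: (le_trans (cabsD _ _)); exact: lerD.
Qed.
Lemma bfunM f g : bfun f -> bfun g -> bfun (fun t => f t * g t).
Proof.
move=> [mf [K hK]] [mg [K' hK']]; split; first exact: cmeasM.
by exists (K * K') => t; rewrite cabsM; apply: ler_pM; rewrite ?cabs_ge0.
Qed.
Lemma bfunB f g : bfun f -> bfun g -> bfun (fun t => f t - g t).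
Proof.
move=> hf hg; have -> : (fun t => f t - g t) = fun t => f t + (-1) * g t.
  by apply/funext => t; rewrite mulN1r.
by apply: bfunD => //; apply: bfunM => //; exact: bfun_cst.
Qed.

Lemma N2_meas f : cmeas f -> measurable_fun setT (fun t => (cabs (f t) ^+ 2)%:E).
Proof. by move=> h; apply/measurable_EFinP; exact: cmeas_sqr. Qed.
Let nn f t : (0 <= (cabs (f t) ^+ 2)%:E)%E.
Proof. by rewrite lee_fin sqr_ge0. Qed.

Lemma N2_le f (K : R) : cmeas f -> (forall t, cabs (f t) <= K) -> (N2 f <= (K ^+ 2 * mass)%:E)%E.
Proof using hmass.
move=> mf hK; apply: (@le_trans _ _ (\int[sg]_t (K ^+ 2)%:E)%E).
  apply: ge0_le_integral => //; first exact: N2_meas.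
  by move=> t _; rewrite lee_fin; apply: sqr_le; [exact: cabs_ge0 | exact: hK].
by rewrite integral_cst // (EFinM (K ^+ 2)); apply: lee_wpmul2l => //; rewrite lee_fin sqr_ge0.
Qed.

Lemma N2D f g : cmeas f -> cmeas g -> (N2 (fun t => (f t + g t)%R) <= 2%:E * N2 f + 2%:E * N2 g)%E.
Proof.
move=> mf mg; rewrite -!ge0_integralZl_EFin //; try exact: N2_meas; try by move=> t _; exact: nn.
rewrite -ge0_integralD //; last 4 first.
- by move=> t _; rewrite mule_ge0.
- by apply: measurable_funeM; exact: N2_meas.
- by move=> t _; rewrite mule_ge0.
- by apply: measurable_funeM; exact: N2_meas.
apply: ge0_le_integral => //.
- by move=> t _; rewrite lee_fin sqr_ge0.
- by apply: N2_meas; exact: cmeasD.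
- by apply: emeasurable_funD; apply: measurable_funeM; exact: N2_meas.
by move=> t _; rewrite -!EFinM -EFinD lee_fin cabs_sqrD_le.
Qed.

Lemma N2Z (c : C) f : cmeas f -> N2 (fun t => c * f t) = ((cabs c ^+ 2)%:E * N2 f)%E.
Proof.
move=> mf; rewrite -ge0_integralZl_EFin ?sqr_ge0 //; last exact: N2_meas.
by apply: eq_integral => t _; rewrite cabsM exprMn EFinM.
Qed.

Lemma N2M u f (K : R) : cmeas u -> cmeas f -> (forall t, cabs (u t) <= K) ->
  (N2 (fun t => (u t * f t)%R) <= (K ^+ 2)%:E * N2 f)%E.
Proof.
move=> mu mf hK; rewrite -ge0_integralZl_EFin ?sqr_ge0 //; last exact: N2_meas.
apply: ge0_le_integral => //.
- by move=> t _; rewrite lee_fin sqr_ge0.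
- by apply: N2_meas; exact: cmeasM.
- by apply: measurable_funeM; exact: N2_meas.
move=> t _; rewrite -EFinM lee_fin cabsM exprMn; apply: ler_wpM2r; first exact: sqr_ge0.
by apply: sqr_le; [exact: cabs_ge0 | exact: hK].
Qed.

Lemma N2_ae f g : cmeas f -> cmeas g -> sg.-negligible [set t | f t <> g t] -> N2 f = N2 g.
Proof.
move=> mf mg h; apply: ge0_ae_eq_integral => //; try exact: N2_meas; try by move=> t _; exact: nn.
by apply: negligibleS h => t /= h1 h2; apply: h1 => _; rewrite h2.
Qed.

Lemma N2_sub f g h : cmeas f -> cmeas g -> cmeas h ->
  (N2 (fun t => (f t - h t)%R) <= 2%:E * N2 (fun t => (f t - g t)%R) + 2%:E * N2 (fun t => (g t - h t)%R))%E.
Proof.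
move=> mf mg mh; have -> : (fun t => f t - h t) = fun t => (f t - g t) + (g t - h t).
  by apply/funext => t; rewrite addrA subrK.
by apply: N2D; exact: cmeasB.
Qed.

Definition scomb L (t : R * R) : C := \sum_(x <- L) x.1 * Cker x.2 (zeta t).

Lemma bfun_ker w : in_D2 w -> bfun (fun t => Cker w (zeta t)).
Proof.
move=> hw; have [K [K0 hK _]] := lip_Cker hw; split; last first.
  by exists K => t; apply: hK; split; rewrite cabs_expi.
have e (t : R * R) : Cker w (zeta t) = ((1 - (zeta t).1 * cconj w.1) * (1 - (zeta t).2 * cconj w.2))^-1 by [].
apply: cmeasV.
  apply: cmeasM; apply: cmeasB; try exact: cmeas_cst; apply: cmeasM; try exact: cmeas_cst.
    exact: cmeas_z1.
  exact: cmeas_z2.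
move=> t; apply: mulf_neq0; apply: one_sub_neq0; rewrite cabsM cabs_expi mul1r cabs_conj.
  exact: hw.1.
exact: hw.2.
Qed.

Lemma bfun_scomb L : in_disc L -> bfun (scomb L).
Proof.
elim: L => [|x L IH] hL.
  have -> : scomb [::] = fun=> 0 by apply/funext => t; rewrite /scomb big_nil.
  exact: bfun_cst.
have -> : scomb (x :: L) = fun t => x.1 * Cker x.2 (zeta t) + scomb L t.
  by apply/funext => t; rewrite /scomb big_cons.
apply: bfunD; last by apply: IH => y hy; apply: hL; rewrite inE hy orbT.
by apply: bfunM; [exact: bfun_cst | apply: bfun_ker; exact: hL (mem_head _ _)].
Qed.

(* bounded functions in the [L^2(sg)]-closure of the span of the Szego kernels *)
Definition EE g := bfun g /\ forall e : R, 0 < e ->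
  exists2 L, in_disc L & (N2 (fun t => (scomb L t - g t)%R) <= e%:E)%E.

Lemma EE_lim g : bfun g -> (forall e : R, 0 < e -> exists2 g', EE g' & (N2 (fun t => (g' t - g t)%R) <= e%:E)%E) -> EE g.
Proof.
move=> hg h; split=> // e e0; have e4 : 0 < e / 4 by rewrite divr_gt0.
have [g' [hg' h1] h2] := h _ e4; have [L hL h3] := h1 _ e4; exists L => //.
apply: (le_trans (N2_sub (bfun_scomb hL).1 hg'.1 hg.1)).
apply: (@le_trans _ _ (2%:E * (e / 4)%:E + 2%:E * (e / 4)%:E)%E).
  by apply: leeD; apply: lee_wpmul2l; rewrite ?lee_fin.
by rewrite -!EFinM -EFinD lee_fin; lra.
Qed.

Lemma EE_lin (c : C) f g : EE f -> EE g -> EE (fun t => c * f t + g t).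
Proof.
move=> [hf h1] [hg h2]; split.
  by apply: bfunD => //; apply: bfunM => //; exact: bfun_cst.
move=> e e0; have c1 : 0 < cabs c ^+ 2 + 1 by rewrite ltr_wpDl // sqr_ge0.
have e4 : 0 < e / 4 / (cabs c ^+ 2 + 1) by rewrite !divr_gt0.
have e4' : 0 < e / 4 by rewrite divr_gt0.
have [L hL k1] := h1 _ e4; have [L' hL' k2] := h2 _ e4'.
exists ([seq (c * x.1, x.2) | x <- L] ++ L').
  by apply: in_disc_cat => //; exact: in_disc_scale.
have -> : (fun t => scomb ([seq (c * x.1, x.2) | x <- L] ++ L') t - (c * f t + g t)) =
    fun t => c * (scomb L t - f t) + (scomb L' t - g t).
  apply/funext => t; rewrite /scomb big_cat big_map /=.
  have -> : \sum_(x <- L) c * x.1 * Cker x.2 (zeta t) = c * \sum_(x <- L) x.1 * Cker x.2 (zeta t).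
    by rewrite mulr_sumr; apply: eq_bigr => x _; rewrite mulrA.
  ring.
have m1 : cmeas (fun t => scomb L t - f t) by apply: cmeasB; [exact: (bfun_scomb hL).1 | exact: hf.1].
have m2 : cmeas (fun t => scomb L' t - g t) by apply: cmeasB; [exact: (bfun_scomb hL').1 | exact: hg.1].
apply: (le_trans (N2D (cmeasM (cmeas_cst c) m1) m2)); rewrite N2Z //.
apply: (@le_trans _ _ (2%:E * ((cabs c ^+ 2)%:E * (e / 4 / (cabs c ^+ 2 + 1))%:E) + 2%:E * (e / 4)%:E)%E).
  apply: leeD; apply: lee_wpmul2l; rewrite ?lee_fin //.
  by apply: lee_wpmul2l; rewrite ?lee_fin ?sqr_ge0.
rewrite -!EFinM -EFinD lee_fin.
have : cabs c ^+ 2 * (e / 4 / (cabs c ^+ 2 + 1)) <= e / 4.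
  rewrite mulrA ler_pdivrMr // mulrC; apply: ler_wpM2l; lra.
lra.
Qed.

Lemma EE_ker w : in_D2 w -> EE (fun t => Cker w (zeta t)).
Proof.
move=> hw; split; first exact: bfun_ker.
move=> e e0; exists [:: (1, w)]; first by move=> x; rewrite inE => /eqP ->.
have -> : (fun t => scomb [:: (1, w)] t - Cker w (zeta t)) = fun=> 0.
  by apply/funext => t; rewrite /scomb big_seq1 mul1r subrr.
rewrite /N2 (eq_integral (fun=> 0%E)) ?integral0 ?lee_fin ?ltW // => t _.
by rewrite cabs0 expr0n.
Qed.

(** The multipliers of [EE] form an algebra closed under uniform and bounded pointwise limits;
    density is proved by enlarging it until it contains all bounded functions. *)
Definition mult u := bfun u /\ forall g, EE g -> EE (fun t => u t * g t).

(** Kernel combinations approximate every element of [EE], and multiplication by a bounded function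
    is continuous in [L^2]. *)
Lemma multP u : bfun u -> (forall w, in_D2 w -> EE (fun t => u t * Cker w (zeta t))) -> mult u.
Proof.
move=> hu h; split=> // g [hg hE]; apply: EE_lim; first exact: bfunM.
move=> e e0; have [mu [K hK]] := hu.
have K1 : 0 < K ^+ 2 + 1 by rewrite ltr_wpDl // sqr_ge0.
have e1 : 0 < e / (K ^+ 2 + 1) by rewrite divr_gt0.
have [L hL hd] := hE _ e1; exists (fun t => u t * scomb L t).
  elim: L hL {hd} => [|x L IH] hL.
    have -> : (fun t => u t * scomb [::] t) = fun t => (-1) * (u t * Cker (0, 0) (zeta t)) + u t * Cker (0, 0) (zeta t).
      by apply/funext => t; rewrite /scomb big_nil mulr0 mulN1r addNr.
    have h00 : in_D2 ((0, 0) : C * C) by exact: in_D2_00.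
    by apply: EE_lin; exact: h.
  have -> : (fun t => u t * scomb (x :: L) t) = fun t => x.1 * (u t * Cker x.2 (zeta t)) + u t * scomb L t.
    by apply/funext => t; rewrite /scomb big_cons; ring.
  apply: EE_lin; first by apply: h; exact: hL (mem_head _ _).
  by apply: IH => y hy; apply: hL; rewrite inE hy orbT.
have -> : (fun t => u t * scomb L t - u t * g t) = fun t => u t * (scomb L t - g t).
  by apply/funext => t; rewrite mulrBr.
apply: (le_trans (N2M mu (cmeasB (bfun_scomb hL).1 hg.1) hK)).
apply: (@le_trans _ _ ((K ^+ 2)%:E * (e / (K ^+ 2 + 1))%:E)%E).
  by apply: lee_wpmul2l => //; rewrite lee_fin sqr_ge0.
rewrite -EFinM lee_fin mulrA ler_pdivrMr // mulrC; apply: ler_wpM2l; lra.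
Qed.

Lemma mult_cst (c : C) : mult (fun=> c).
Proof.
split; first exact: bfun_cst.
move=> g hg; have -> : (fun t => c * g t) = fun t => (c - 1) * g t + g t by apply/funext => t; ring.
exact: EE_lin.
Qed.
Lemma multD u v : mult u -> mult v -> mult (fun t => u t + v t).
Proof.
move=> [hu h1] [hv h2]; split; first exact: bfunD.
move=> g hg; have -> : (fun t => (u t + v t) * g t) = fun t => 1 * (u t * g t) + v t * g t.
  by apply/funext => t; ring.
by apply: EE_lin; [exact: h1 | exact: h2].
Qed.
Lemma multM u v : mult u -> mult v -> mult (fun t => u t * v t).
Proof.
move=> [hu h1] [hv h2]; split; first exact: bfunM.
move=> g hg; have -> : (fun t => u t * v t * g t) = fun t => u t * (v t * g t).
  by apply/funext => t; rewrite mulrA.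
by apply: h1; exact: h2.
Qed.
Lemma mult_ext u v : (forall t, u t = v t) -> mult u -> mult v.
Proof. by move=> e; have -> : u = v by apply/funext. Qed.
Lemma multB u v : mult u -> mult v -> mult (fun t => u t - v t).
Proof.
move=> hu hv; apply: (@mult_ext (fun t => u t + (-1) * v t)); first by move=> t; rewrite mulN1r.
exact: multD hu (multM (mult_cst _) hv).
Qed.
Lemma multX u k : mult u -> mult (fun t => u t ^+ k).
Proof.
move=> hu; elim: k => [|k IH].
  by apply: (@mult_ext (fun=> 1)) (mult_cst 1) => t; rewrite expr0.
by apply: (@mult_ext (fun t => u t * u t ^+ k)) (multM hu IH) => t; rewrite exprS.
Qed.
Lemma mult_sum (I : Type) (r : seq I) (F : I -> R * R -> C) :
  (forall i, mult (F i)) -> mult (fun t => \sum_(i <- r) F i t).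
Proof.
move=> h; elim: r => [|i r IH].
  by apply: (@mult_ext (fun=> 0)) (mult_cst 0) => t; rewrite big_nil.
by apply: (@mult_ext (fun t => F i t + \sum_(j <- r) F j t)) (multD (h i) IH) => t; rewrite big_cons.
Qed.
Lemma mult_prod (I : eqType) (r : seq I) (F : I -> R * R -> C) :
  (forall i, i \in r -> mult (F i)) -> mult (fun t => \prod_(i <- r) F i t).
Proof.
elim: r => [|i r IH] h.
  by apply: (@mult_ext (fun=> 1)) (mult_cst 1) => t; rewrite big_nil.
apply: (@mult_ext (fun t => F i t * \prod_(j <- r) F j t)); first by move=> t; rewrite big_cons.
apply: multM; first by apply: h; rewrite mem_head.
by apply: IH => j hj; apply: h; rewrite inE hj orbT.
Qed.

Lemma mult_ae u v : mult v -> bfun u -> sg.-negligible [set t | u t <> v t] -> mult u.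
Proof.
move=> [hv h] hu hn; split=> // g hg; apply: EE_lim; first exact: bfunM hu hg.1.
move=> e e0; exists (fun t => v t * g t); first exact: h.
have mg := hg.1.1.
rewrite (@N2_ae _ (fun=> 0)).
- rewrite /N2 (eq_integral (fun=> 0%E)) ?integral0 ?lee_fin ?ltW // => t _.
  by rewrite cabs0 expr0n.
- by apply: cmeasB; apply: cmeasM => //; [exact: hv.1 | exact: hu.1].
- exact: cmeas_cst.
by apply: negligibleS hn => t /= h1 h2; apply: h1; rewrite h2 subrr.
Qed.

Lemma mult_unif u : bfun u -> (forall e : R, 0 < e -> exists2 v, mult v & forall t, cabs (v t - u t) <= e) -> mult u.
Proof using hmass.
move=> hu h; split=> // g hg; apply: EE_lim; first exact: bfunM hu hg.1.
move=> e e0; have [mg [K hK]] := hg.1.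
have K0 : 0 <= K := le_trans (cabs_ge0 _) (hK (0, 0)).
have m0 : 0 <= mass by rewrite -lee_fin; apply: le_trans hmass.
pose B := K ^+ 2 * mass + 1.
have B0 : 0 < B by rewrite /B ltr_wpDl // mulr_ge0 // sqr_ge0.
have d0 : 0 < Num.min 1 (e / B) by rewrite lt_min ltr01 divr_gt0.
have [v [hv hvE] hd] := h _ d0; exists (fun t => v t * g t); first exact: hvE.
have -> : (fun t => v t * g t - u t * g t) = fun t => (v t - u t) * g t.
  by apply/funext => t; rewrite mulrBl.
set d := Num.min _ _ in d0 hd.
apply: (@le_trans _ _ (((d * K) ^+ 2 * mass)%:E)).
  apply: N2_le; first by apply: cmeasM => //; apply: cmeasB; [exact: hv.1 | exact: hu.1].
  by move=> t; rewrite cabsM; apply: ler_pM; rewrite ?cabs_ge0.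
rewrite lee_fin exprMn -mulrA.
have d1 : d <= 1 by rewrite ge_min lexx.
have d2 : d * B <= e by rewrite -ler_pdivlMr // ge_min lexx orbT.
have : 0 <= K ^+ 2 * mass by rewrite mulr_ge0 // sqr_ge0.
rewrite /B in d2; move: (K ^+ 2 * mass) d2 => X d2 X0.
have : d ^+ 2 * X <= d * X by apply: ler_wpM2r => //; rewrite expr2; nra.
nra.
Qed.

Lemma mult_geo u (b : C) : mult u -> (forall t, cabs (u t) <= 1) -> cabs b < 1 ->
  mult (fun t => (1 - b * u t)^-1).
Proof using hmass.
move=> hu u1 hb; have b0 : 0 < 1 - cabs b by rewrite subr_gt0.
have bu t : cabs (b * u t) <= cabs b.
  by rewrite cabsM ler_piMr ?cabs_ge0.
have nz t : 1 - b * u t != 0 by apply: one_sub_neq0; apply: le_lt_trans (bu t) hb.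
have lowb t : 1 - cabs b <= cabs (1 - b * u t).
  by have := cabs_subr 1 (b * u t); rewrite cabs1; have := bu t; lra.
apply: mult_unif.
  split.
    apply: cmeasV => //; apply: cmeasB; first exact: cmeas_cst.
    by apply: cmeasM; [exact: cmeas_cst | exact: hu.1.1].
  exists (1 - cabs b)^-1 => t; rewrite cabsV lef_pV2 ?posrE ?cabs_gt0 //.
move=> e e0; have := @cvg_expr R (cabs b); rewrite ger0_norm ?cabs_ge0 // => /(_ hb) /cvgrPdist_lt.
have d0 : 0 < e * (1 - cabs b) by rewrite mulr_gt0.
move=> /(_ _ d0)[N _ hN]; exists (fun t => \sum_(k < N) b ^+ k * u t ^+ k).
  by apply: mult_sum => k; apply: multM; [exact: mult_cst | exact: multX].
move=> t; have -> : \sum_(k < N) b ^+ k * u t ^+ k - (1 - b * u t)^-1 = - ((b * u t) ^+ N / (1 - b * u t)).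
  have hs : (1 - b * u t) * \sum_(k < N) b ^+ k * u t ^+ k = 1 - (b * u t) ^+ N.
    elim: (N) => [|k IH]; first by rewrite big_ord0 mulr0 expr0 subrr.
    by rewrite big_ord_recr /= mulrDr IH !exprMn !exprS; ring.
  by apply: (mulfI (nz t)); rewrite mulrBr hs; field; exact: nz.
rewrite cabsN cabsM cabsV cabsX ler_pdivrMr ?cabs_gt0 //.
have := hN N (leqnn _) => /=; rewrite sub0r normrN ger0_norm ?exprn_ge0 ?cabs_ge0 // => h1.
apply: (@le_trans _ _ (cabs b ^+ N)); first by apply: lerXn2r; rewrite ?nnegrE ?cabs_ge0.
by apply: (le_trans (ltW h1)); apply: ler_wpM2l => //; exact: ltW.
Qed.

(** Dominated convergence, the constant majorant being integrable because [sigma] is finite. *)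
Lemma mult_pt u (v : nat -> R * R -> C) (K : R) : cmeas u -> (forall k, mult (v k)) ->
  (forall k t, cabs (v k t) <= K) ->
  (forall t (e : R), 0 < e -> exists N : nat, forall k, (N <= k)%N -> cabs (v k t - u t) < e) -> mult u.
Proof using hmass.
move=> mu hv hK hl.
have uK t : cabs (u t) <= K.
  apply/ler_addgt0Pr => e e0; have [N hN] := hl t e e0.
  by have := cabs_subr (u t) (v N t); rewrite cabsBC; have := hN N (leqnn _); have := hK N t; lra.
have hu : bfun u by split=> //; exists K.
split=> // g hg; apply: EE_lim; first exact: bfunM hu hg.1.
have [mg [G hG]] := hg.1.
have G0 : 0 <= G := le_trans (cabs_ge0 _) (hG (0, 0)).
have K0 : 0 <= K := le_trans (cabs_ge0 _) (uK (0, 0)).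
pose F k t := (cabs (v k t * g t - u t * g t) ^+ 2)%:E.
have mF k : cmeas (fun t => v k t * g t - u t * g t).
  by apply: cmeasB; apply: cmeasM => //; exact: (hv k).1.1.
have bF k t : cabs (v k t * g t - u t * g t) <= 2 * K * G.
  apply: (le_trans (cabsB _ _)); rewrite !cabsM.
  have h1 : cabs (v k t) * cabs (g t) <= K * G by apply: ler_pM; rewrite ?cabs_ge0.
  have h2 : cabs (u t) * cabs (g t) <= K * G by apply: ler_pM; rewrite ?cabs_ge0.
  lra.
have cv : (\int[sg]_t F k t)%E @[k --> \oo] --> (\int[sg]_t (cst 0 t))%E.
  apply: (@dominated_cvg _ _ _ sg setT measurableT F _ (fun=> ((2 * K * G) ^+ 2)%:E)) => //.
  - by move=> k; exact: N2_meas.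
  - move=> t _; apply: cvg_EFin; first exact: nearW.
    apply/cvgrPdist_lt => e e0.
    have d0 : 0 < Num.min 1 (e / (G ^+ 2 + 1)).
      by rewrite lt_min ltr01 divr_gt0 // ltr_wpDl // sqr_ge0.
    have [N hN] := hl t _ d0; exists N => // k /= hk.
    change (`|0 - cabs (v k t * g t - u t * g t) ^+ 2| < e).
    rewrite sub0r normrN ger0_norm ?sqr_ge0 // -mulrBl cabsM exprMn.
    have := hN k hk; rewrite lt_min => /andP[h1 h2].
    have x0 := cabs_ge0 (v k t - u t); have y0 := cabs_ge0 (g t).
    have g2 : cabs (g t) ^+ 2 <= G ^+ 2 by apply: sqr_le => //; exact: hG.
    rewrite ltr_pdivlMr in h2; last by rewrite ltr_wpDl // sqr_ge0.
    have h3 : cabs (v k t - u t) ^+ 2 * cabs (g t) ^+ 2 <= cabs (v k t - u t) * G ^+ 2.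
      by apply: ler_pM; rewrite ?sqr_ge0 // expr2; nra.
    apply: (le_lt_trans h3); lra.
  - apply/integrableP; split; first exact: measurable_cst.
    rewrite (eq_integral (fun=> ((2 * K * G) ^+ 2)%:E)); last first.
      by move=> t _; rewrite gee0_abs // lee_fin sqr_ge0.
    rewrite integral_cst //; apply: (@le_lt_trans _ _ (((2 * K * G) ^+ 2)%:E * mass%:E)%E).
      by apply: lee_wpmul2l => //; rewrite lee_fin sqr_ge0.
    by rewrite -EFinM ltry.
  - move=> k t _; rewrite gee0_abs ?lee_fin ?sqr_ge0 //.
    by apply: sqr_le; [exact: cabs_ge0 | exact: bF].
move: cv; rewrite integral0 => /fine_cvgP[[N1 _ h1] /cvgrPdist_lt cv] e e0.
have [N2' _ h2] := cv e e0; pose N := maxn N1 N2'.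
exists (fun t => v N t * g t); first exact: (hv N).2.
have f1 := h1 N (leq_maxl _ _); have := h2 N (leq_maxr _ _) => /=.
rewrite sub0r normrN => h3; rewrite -[leLHS](fineK f1) lee_fin.
exact: ltW (le_lt_trans (ler_norm _) h3).
Qed.
End Multipliers.

(** * From multipliers to density in [L^2] *)

Section Density.
Context {R : realType}.
Local Notation C := R[i].
Local Notation mu := (@lebesgue_measure R).
Implicit Types (f g u v : R * R -> C) (A B : set (R * R)).
Context (sg : {measure set (R * R)%type -> \bar R}) (mass : R) (hmass : (sg setT <= mass%:E)%E).
Local Notation mult := (mult sg).
Local Notation EE := (EE sg).

(** The relation [K_x - K_0 = conj x z K_x] puts [z K_x] in [EE] for nonzero [x], and [z K_0] is the
    [L^2] limit as [x] tends to 0. Both coordinates use this, with the other coordinate of the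
    kernel point fixed. *)
Lemma EE_shift (K : C -> R * R -> C) (z : R * R -> C) (B : R) : bfun z -> (forall t, cabs (z t) <= 1) ->
  (forall x, cabs x < 1 -> EE (K x)) ->
  (forall x t, cabs x < 1 -> K x t - K 0 t = cconj x * (z t * K x t)) ->
  (forall x t, cabs x <= 1 / 2 -> cabs (K x t) <= B) ->
  forall x, cabs x < 1 -> EE (fun t => z t * K x t).
Proof using hmass.
move=> hz z1 hK hrel hB.
have h00 : cabs (0 : C) < 1 by rewrite cabs0.
have nz x : cabs x < 1 -> x != 0 -> EE (fun t => z t * K x t).
  move=> hx x0; have cx : cconj x != 0 by rewrite cconj_eq0.
  have -> : (fun t => z t * K x t) = fun t => (cconj x)^-1 * K x t + (- (cconj x)^-1 * K 0 t + (-1 * K 0 t + K 0 t)).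
    by apply/funext => t; apply: (mulfI cx); rewrite -hrel //; field.
  have hz0 : EE (fun t => -1 * K 0 t + K 0 t) by apply: EE_lin; exact: hK.
  by apply: EE_lin; [exact: hK | apply: EE_lin => //; exact: hK].
move=> x hx; have [->|x0] := eqVneq x 0; last exact: nz.
have hb0 := hK _ h00; apply: EE_lim; first exact: bfunM hz hb0.1.
have m0 : 0 <= mass by rewrite -lee_fin; apply: le_trans hmass.
have half0 : cabs (0 : C) <= 1 / 2 by rewrite cabs0 divr_ge0.
have B0 : 0 <= B := le_trans (cabs_ge0 _) (hB 0 (0, 0) half0).
move=> e e0; pose M := B ^+ 2 * mass + 1.
have M0 : 0 < M by rewrite /M ltr_wpDl // mulr_ge0 // sqr_ge0.
pose d := Num.min (1 / 2) (e / M).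
have d0 : 0 < d by rewrite lt_min !divr_gt0.
have d1 : d <= 1 / 2 by rewrite ge_min lexx.
have dM : d * M <= e by rewrite -ler_pdivlMr // ge_min lexx orbT.
pose y : C := (d%:C)%C.
have cy : cabs y = d by rewrite /y cabs_real ger0_norm // ltW.
have hy : cabs y < 1 by rewrite cy; lra.
have y0 : y != 0 by rewrite -cabs_gt0 cy.
exists (fun t => z t * K y t); first exact: nz.
apply: (@le_trans _ _ ((d * B) ^+ 2 * mass)%:E).
  apply: (N2_le hmass).
    by apply: cmeasB; apply: cmeasM; [exact: hz.1 | exact: (hK _ hy).1.1 | exact: hz.1 | exact: hb0.1.1].
  move=> t; rewrite -mulrBr hrel // cabsM; apply: (@le_trans _ _ (1 * (d * B))); last by rewrite mul1r.
  apply: ler_pM; rewrite ?cabs_ge0 // cabsM cabs_conj cy; apply: ler_wpM2l; first exact: ltW.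
  rewrite cabsM; apply: (@le_trans _ _ (1 * B)); last by rewrite mul1r.
  by apply: ler_pM; rewrite ?cabs_ge0 //; apply: hB; rewrite cy.
rewrite lee_fin exprMn -mulrA.
have X0 : 0 <= B ^+ 2 * mass by rewrite mulr_ge0 // sqr_ge0.
rewrite /M in dM; move: (B ^+ 2 * mass) dM X0 => X dM X0.
have : d ^+ 2 * X <= d * X by apply: ler_wpM2r => //; rewrite expr2; nra.
nra.
Qed.

Lemma CkerE (x y : C) z : Cker (x, y) z = ((1 - z.1 * cconj x) * (1 - z.2 * cconj y))^-1.
Proof. by []. Qed.

Lemma Szego_half (x y : C) (t s : R) : cabs x <= 1 / 2 -> cabs y < 1 ->
  cabs (((1 - expi t * cconj x) * (1 - expi s * cconj y))^-1) <= 2 / (1 - cabs y).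
Proof.
move=> hx hy; have y0 : 0 < 1 - cabs y by rewrite subr_gt0.
have h1 : 1 / 2 <= cabs (1 - expi t * cconj x).
  have := cabs_subr 1 (expi t * cconj x); rewrite cabs1 cabsM cabs_expi mul1r cabs_conj; lra.
have h2 : 1 - cabs y <= cabs (1 - expi s * cconj y).
  by have := cabs_subr 1 (expi s * cconj y); rewrite cabs1 cabsM cabs_expi mul1r cabs_conj.
rewrite cabsV cabsM; have -> : 2 / (1 - cabs y) = (1 / 2 * (1 - cabs y))^-1 by field; rewrite gt_eqF.
have d0 : 0 < 1 / 2 * (1 - cabs y) by rewrite mulr_gt0 // divr_gt0.
have hh : 1 / 2 * (1 - cabs y) <= cabs (1 - expi t * cconj x) * cabs (1 - expi s * cconj y).
  by apply: ler_pM => //; rewrite ?divr_ge0 // ltW.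
by rewrite lef_pV2 ?posrE //; exact: lt_le_trans d0 hh.
Qed.

Lemma mult_z1 : mult (fun t => (zeta t).1).
Proof using hmass.
have hb : bfun (fun t : R * R => (zeta t : C * C).1).
  by split; [exact: cmeas_z1 | exists 1 => t; rewrite cabs_expi].
apply: (multP hb) => -[w1 w2] [/= h1 h2].
apply: (@EE_shift (fun x t => Cker (x, w2) (zeta t)) _ (2 / (1 - cabs w2)) hb _ _ _ _ w1 h1).
- by move=> t; rewrite cabs_expi.
- by move=> x hx; apply: EE_ker.
- move=> x t hx; rewrite !CkerE cconj0 mulr0 subr0 mul1r.
  have n1 : 1 - (zeta t).1 * cconj x != 0 by apply: one_sub_neq0; rewrite cabsM cabs_expi mul1r cabs_conj.
  have n2 : 1 - (zeta t).2 * cconj w2 != 0 by apply: one_sub_neq0; rewrite cabsM cabs_expi mul1r cabs_conj.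
  by field; rewrite n1 n2.
by move=> x t hx; apply: Szego_half.
Qed.

Lemma mult_z2 : mult (fun t => (zeta t).2).
Proof using hmass.
have hb : bfun (fun t : R * R => (zeta t : C * C).2).
  by split; [exact: cmeas_z2 | exists 1 => t; rewrite cabs_expi].
apply: (multP hb) => -[w1 w2] [/= h1 h2].
apply: (@EE_shift (fun x t => Cker (w1, x) (zeta t)) _ (2 / (1 - cabs w1)) hb _ _ _ _ w2 h2).
- by move=> t; rewrite cabs_expi.
- by move=> x hx; apply: EE_ker.
- move=> x t hx; rewrite !CkerE cconj0 mulr0 subr0 mulr1.
  have n1 : 1 - (zeta t).1 * cconj w1 != 0 by apply: one_sub_neq0; rewrite cabsM cabs_expi mul1r cabs_conj.
  have n2 : 1 - (zeta t).2 * cconj x != 0 by apply: one_sub_neq0; rewrite cabsM cabs_expi mul1r cabs_conj.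
  by field; rewrite n1 n2.
by move=> x t hx; rewrite /Cker mulrC; apply: Szego_half.
Qed.

Definition ind A (t : R * R) : C := if t \in A then 1 else 0.

Lemma ind_in A t : A t -> ind A t = 1. Proof. by move=> h; rewrite /ind mem_set. Qed.
Lemma ind_out A t : ~ A t -> ind A t = 0. Proof. by move=> h; rewrite /ind memNset. Qed.
Lemma cabs_ind A t : cabs (ind A t) <= 1.
Proof. by rewrite /ind; case: ifP => _; rewrite ?cabs1 ?cabs0. Qed.
Lemma bfun_ind A : measurable A -> bfun (ind A).
Proof.
move=> mA; split; last by exists 1 => t; exact: cabs_ind.
have -> : ind A = fun t => ((\1_A t : R)%:C)%C.
  by apply/funext => t; rewrite /ind indicE; case: (t \in A).
by apply: cmeas_real; exact: measurable_indic.
Qed.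

(** These sets form a sigma-algebra, stable under modification by [sigma]-null sets. *)
Definition SM A := measurable A /\ mult (ind A).

Lemma SM_C A : SM A -> SM (~` A).
Proof.
move=> [mA h]; split; first exact: measurableC.
apply: (mult_ext _ (multB (mult_cst sg 1) h)) => t.
have [hA|hA] := pselect (A t); first by rewrite (ind_in hA) ind_out ?subrr // => /(_ hA).
by rewrite (ind_out hA) ind_in // subr0.
Qed.
Lemma SM_I A B : SM A -> SM B -> SM (A `&` B).
Proof.
move=> [mA h] [mB h']; split; first exact: measurableI.
apply: (mult_ext _ (multM h h')) => t.
have [hA|hA] := pselect (A t); last by rewrite (ind_out hA) mul0r ind_out // => -[].
rewrite (ind_in hA) mul1r; have [hB|hB] := pselect (B t); first by rewrite !ind_in.
by rewrite !ind_out // => -[].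
Qed.
Lemma SM_T : SM setT.
Proof.
split=> //; apply: (mult_ext _ (mult_cst sg 1)) => t; by rewrite ind_in.
Qed.
Lemma SM_U A B : SM A -> SM B -> SM (A `|` B).
Proof.
move=> hA hB; have -> : A `|` B = ~` (~` A `&` ~` B) by rewrite setCI !setCK.
by apply: SM_C; apply: SM_I; exact: SM_C.
Qed.
Lemma SM_bigcup (A : nat -> set (R * R)) : (forall k, SM (A k)) -> SM (\bigcup_k A k).
Proof using hmass.
move=> h; have mU : measurable (\bigcup_k A k) by apply: bigcupT_measurable => k; have [] := h k.
split=> //; pose B N := \bigcup_(k in `I_N) A k.
have hB N : SM (B N).
  elim: N => [|N IH].
    by rewrite /B II0 bigcup_set0 -[set0]setCK setC0; apply: SM_C; exact: SM_T.
  by rewrite /B IIS bigcup_setU bigcup_set1; exact: SM_U.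
apply: (@mult_pt _ _ _ hmass _ (fun N => ind (B N)) 1).
- exact: (bfun_ind mU).1.
- by move=> N; have [] := hB N.
- by move=> N t; exact: cabs_ind.
move=> t e e0; have [[k _ hk]|hn] := pselect ((\bigcup_k A k) t).
  exists k.+1 => N hN; rewrite !ind_in ?subrr ?cabs0 //; [by exists k | by exists k].
exists 0%N => N _; rewrite !ind_out ?subrr ?cabs0 // => -[k _ hk]; apply: hn; by exists k.
Qed.

Lemma SM_ae A B : SM A -> measurable B -> sg.-negligible ((A `\` B) `|` (B `\` A)) -> SM B.
Proof.
move=> [mA h] mB hn; split; [exact: mB|apply: (mult_ae h); first exact: bfun_ind].
apply: negligibleS hn => t /= hne; have [hA|hA] := pselect (A t); have [hB|hB] := pselect (B t).
- by case: hne; rewrite !ind_in.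
- by left.
- by right.
- by case: hne; rewrite !ind_out.
Qed.

Lemma bernoulli (x : R) k : 0 <= x <= 1 -> 1 - k%:R * x <= (1 - x) ^+ k.
Proof.
move=> /andP[x0 x1]; elim: k => [|k IH]; first by rewrite mul0r subr0 expr0.
rewrite exprS; have h : (1 - x) * (1 - k%:R * x) <= (1 - x) * (1 - x) ^+ k.
  by apply: ler_wpM2l => //; rewrite subr_ge0.
apply: (le_trans _ h); rewrite -natr1; have : 0 <= k%:R * x * x by rewrite !mulr_ge0.
lra.
Qed.
Lemma bernoulli_up (x : R) k : 0 <= x -> 1 + k%:R * x <= (1 + x) ^+ k.
Proof.
move=> x0; elim: k => [|k IH]; first by rewrite mul0r addr0 expr0.
rewrite exprS; have h : (1 + x) * (1 + k%:R * x) <= (1 + x) * (1 + x) ^+ k.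
  by apply: ler_wpM2l => //; rewrite addr_ge0.
apply: (le_trans _ h); rewrite -natr1; have : 0 <= k%:R * x * x by rewrite !mulr_ge0.
lra.
Qed.

(* For [0 <= x <= 1] the first factor tends to the indicator of [x > 1/2] off [x = 1/2] (Bernoulli), and the
   second one kills the exceptional level. *)
Definition bern (k : nat) (x : R) : R := (1 - (1 - x) ^+ k) ^+ (2 ^ k) * (1 - (1 - (2 * x - 1) ^+ 2) ^+ k).

Lemma bern_01 k x : 0 <= x <= 1 -> 0 <= bern k x <= 1.
Proof.
move=> /andP[x0 x1].
have h1 : 0 <= 1 - (1 - x) ^+ k <= 1.
  by rewrite subr_ge0 gerBl exprn_ge0 ?exprn_ile1 //; lra.
have h2 : 0 <= 1 - (1 - (2 * x - 1) ^+ 2) ^+ k <= 1.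
  have w0 : 0 <= 1 - (2 * x - 1) ^+ 2.
    have : 0 <= x * (1 - x) by rewrite mulr_ge0 // subr_ge0.
    lra.
  have w1 : 1 - (2 * x - 1) ^+ 2 <= 1 by rewrite gerBl sqr_ge0.
  by rewrite subr_ge0 gerBl exprn_ge0 // exprn_ile1.
move/andP: h1 => [a1 a2]; move/andP: h2 => [b1 b2].
rewrite /bern; apply/andP; split; first by rewrite mulr_ge0 // exprn_ge0.
have c1 : (1 - (1 - x) ^+ k) ^+ (2 ^ k) <= 1 by rewrite exprn_ile1.
have c0 : 0 <= (1 - (1 - x) ^+ k) ^+ (2 ^ k) by rewrite exprn_ge0.
by rewrite -[leRHS]mulr1; apply: ler_pM.
Qed.

Lemma geo0 (q : R) : 0 <= q < 1 -> forall e, 0 < e -> exists N : nat, forall k, (N <= k)%N -> q ^+ k < e.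
Proof.
move=> /andP[q0 q1] e e0; have := @cvg_expr R q; rewrite ger0_norm // => /(_ q1) /cvgrPdist_lt.
move=> /(_ e e0)[N _ hN]; exists N => k hk.
by have := hN k hk => /=; rewrite sub0r normrN ger0_norm // exprn_ge0.
Qed.

Lemma bern_cvg x (e : R) : 0 <= x <= 1 -> 0 < e -> exists N : nat, forall k, (N <= k)%N ->
  `|bern k x - (if 1 / 2 < x then 1 else 0)| < e.
Proof.
move=> /andP[x0 x1] e0; have e2 : 0 < e / 2 by rewrite divr_gt0.
have b01 k := bern_01 k (_ : 0 <= x <= 1).
have {}b01 k : 0 <= bern k x <= 1 by apply: b01; rewrite x0 x1.
case: ifPn => [hx|]; last rewrite -leNgt le_eqVlt => /predU1P[->|hx].
- have q1 : 0 <= 2 * (1 - x) < 1 by apply/andP; split; lra.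
  have q2 : 0 <= 1 - (2 * x - 1) ^+ 2 < 1 by apply/andP; split; nra.
  have [N1 h1] := geo0 q1 e2; have [N2 h2] := geo0 q2 e2.
  exists (maxn N1 N2) => k hk.
  have g1 := h1 k (leq_trans (leq_maxl _ _) hk); have g2 := h2 k (leq_trans (leq_maxr _ _) hk).
  have /andP[_ bk1] := b01 k.
  have y01 : 0 <= (1 - x) ^+ k <= 1 by rewrite exprn_ge0 ?exprn_ile1 //; lra.
  have := bernoulli (2 ^ k) y01; rewrite natrX -exprMn => hb.
  rewrite exprMn in g1 hb.
  have y0 : 0 <= 1 - (2 * x - 1) ^+ 2 by nra.
  have z0 : 0 <= (1 - (2 * x - 1) ^+ 2) ^+ k by rewrite exprn_ge0.
  have z1 : (1 - (2 * x - 1) ^+ 2) ^+ k <= 1 by rewrite exprn_ile1 //; nra.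
  rewrite ltr_norml; apply/andP; split; last lra.
  rewrite /bern; set a := (1 - (1 - x) ^+ k) ^+ (2 ^ k) in hb *.
  have a1 : a <= 1 by rewrite /a exprn_ile1 //; move/andP: y01 => [? ?]; lra.
  set b := (1 - (2 * x - 1) ^+ 2) ^+ k in g2 z0 z1 *; set c := 2 ^+ k * (1 - x) ^+ k in g1 hb.
  have : (1 - c) * (1 - b) <= a * (1 - b) by apply: ler_wpM2r => //; lra.
  have c0 : 0 <= c by rewrite /c mulr_ge0 ?exprn_ge0 //; lra.
  nra.
- exists 0%N => k _; rewrite /bern.
  have -> : 1 - (2 * (1 / 2) - 1) ^+ 2 = 1 :> R by field.
  by rewrite expr1n subrr mulr0 subrr normr0.
have q1 : 0 <= (2 * (1 - x))^-1 < 1 by rewrite invr_ge0 invf_lt1; [apply/andP; split|]; lra.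
have [N h1] := geo0 q1 e0; exists N => k hk; have g1 := h1 k hk.
have /andP[bk0 _] := b01 k; rewrite subr0 ger0_norm //; apply: le_lt_trans g1.
have y0 : 0 <= (1 - x) ^+ k by rewrite exprn_ge0 //; lra.
have y1 : (1 - x) ^+ k <= 1 by rewrite exprn_ile1 //; lra.
have := bernoulli_up (2 ^ k) y0; rewrite natrX -exprMn => hb.
have p0 : 0 < (2 * (1 - x)) ^+ k by rewrite exprn_gt0 //; lra.
have a0 : 0 <= (1 - (1 - x) ^+ k) ^+ (2 ^ k) by rewrite exprn_ge0 //; lra.
have hb2 : bern k x <= (1 - (1 - x) ^+ k) ^+ (2 ^ k).
  rewrite /bern ler_piMr // gerBl exprn_ge0 //; nra.
apply: (le_trans hb2); rewrite exprVn -[leRHS]div1r ler_pdivlMr //.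
apply: (@le_trans _ _ ((1 - (1 - x) ^+ k) ^+ (2 ^ k) * (1 + (1 - x) ^+ k) ^+ (2 ^ k))).
  by apply: ler_wpM2l => //; lra.
by rewrite -exprMn exprn_ile1 //; nra.
Qed.

Lemma SM_gt (u : R * R -> R) : measurable_fun setT u -> (forall t, 0 <= u t <= 1) ->
  mult (fun t => ((u t)%:C)%C) -> SM [set t | 1 / 2 < u t].
Proof using hmass.
move=> mu hu hm.
have mS : measurable [set t | 1 / 2 < u t].
  have := mu measurableT `]1 / 2, +oo[%classic (measurable_itv _); rewrite setTI.
  by congr measurable; apply/seteqP; split=> t /=; rewrite in_itv /= andbT.
split=> //; apply: (@mult_pt _ _ _ hmass _ (fun k t => ((bern k (u t))%:C)%C) 1).
- exact: (bfun_ind mS).1.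
- move=> k; apply: (@mult_ext _ _ (fun t => (1 - (1 - ((u t)%:C)%C) ^+ k) ^+ (2 ^ k) *
     (1 - (1 - (2 * ((u t)%:C)%C - 1) ^+ 2) ^+ k))).
    move=> t; rewrite /bern.
    by rewrite rmorphM /= !rmorphXn /= !rmorphB /= !rmorphXn /= !rmorphB /= rmorphXn rmorphB rmorphM /= !rmorph1 rmorph_nat.
  have c1 := mult_cst sg 1.
  have c2 := multM (mult_cst sg 2) hm.
  exact: multM (multX _ (multB c1 (multX _ (multB c1 hm)))) (multB c1 (multX _ (multB c1 (multX _ (multB c2 c1))))).
- by move=> k t; rewrite cabs_real ger0_norm; have /andP[] := bern_01 k (hu t).
move=> t e e0; have [N hN] := bern_cvg (hu t) e0; exists N => k hk; have := hN k hk.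
have [h|h] := boolP (1 / 2 < u t); first by rewrite ind_in // -(rmorph1 (real_complex R)) -real_complexB cabs_real.
by rewrite ind_out ?subr0 ?cabs_real //; exact/negP.
Qed.

(* Simple-function approximation from below by level sets. *)
Lemma mult_bounded (u : R * R -> R) (M : nat) : (forall A, measurable A -> SM A) ->
  measurable_fun setT u -> (forall t, 0 <= u t < M%:R) -> mult (fun t => ((u t)%:C)%C).
Proof using hmass.
move=> hS mu hu.
have hbu : bfun (fun t => ((u t)%:C)%C).
  split; first exact: cmeas_real.
  by exists M%:R => t; have /andP[h0 h1] := hu t; rewrite cabs_real ger0_norm // ltW.
apply: (mult_unif hmass hbu) => e e0.
pose N := (Num.truncn e^-1).+1; have hN : e^-1 < N%:R :> R by exact: truncnS_gt.
have N0 : 0 < N%:R :> R by rewrite ltr0n.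
exists (fun t => (((N%:R)^-1)%:C)%C * \sum_(j < M * N) ind [set t | j.+1%:R / N%:R <= u t] t).
  apply: multM; first exact: mult_cst.
  by apply: mult_sum => j; have [] := hS _ (meas_ge (j.+1%:R / N%:R) mu).
move=> t; have /andP[u0 u1] := hu t.
pose T := Num.truncn (N%:R * u t).
have nu0 : 0 <= N%:R * u t by rewrite mulr_ge0 // ltW.
have /andP[t1 t2] := truncn_itv nu0; rewrite -/T in t1 t2.
have hT : (T <= M * N)%N.
  rewrite -(ler_nat R); apply: (le_trans t1); rewrite natrM mulrC; apply: ler_wpM2r; exact: ltW.
have -> : \sum_(j < M * N) ind [set t | j.+1%:R / N%:R <= u t] t = T%:R.
  have ej (j : nat) : ind [set t | j.+1%:R / N%:R <= u t] t = if (j < T)%N then 1 else 0.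
    case: ifPn => h.
      by rewrite ind_in //= ler_pdivrMr // [leRHS]mulrC; apply: le_trans t1; rewrite ler_nat.
    rewrite ind_out //= ler_pdivrMr // [X in _ <= X]mulrC => h'; move/negP: h; apply.
    by rewrite -ltnS -(ltr_nat R); exact: le_lt_trans h' t2.
  have : forall K, (T <= K)%N -> \sum_(j < K) (ind [set t | j.+1%:R / N%:R <= u t] t) = T%:R.
    move=> K hK; under eq_bigr do rewrite ej.
    rewrite -big_mkcond /= -(big_ord_widen _ (fun=> 1) hK) sumr_const card_ord //.
  exact.
have -> : (((N%:R)^-1)%:C)%C * T%:R - ((u t)%:C)%C = ((T%:R / N%:R - u t)%:C)%C.
  by rewrite real_complexB rmorphM /= rmorph_nat mulrC.
rewrite cabs_real ler_norml.
have hle : T%:R / N%:R <= u t by rewrite ler_pdivrMr // mulrC.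
have hge : u t - N%:R^-1 <= T%:R / N%:R.
  rewrite -natr1 in t2; rewrite ler_pdivlMr // mulrBl mulVf ?gt_eqF // mulrC; lra.
have : N%:R^-1 <= e by rewrite invf_ple ?posrE // ltW.
lra.
Qed.

Lemma EE_one : EE (fun=> 1).
Proof.
have -> : (fun=> 1) = (fun t : R * R => Cker ((0, 0) : C * C) (zeta t)).
  by apply/funext => t; rewrite CkerE cconj0 !mulr0 subr0 mulr1 invr1.
by apply: EE_ker; exact: in_D2_00.
Qed.

(** Real and imaginary parts are multipliers, after a shift by [K] that makes them nonnegative;
    applied to the constant 1, which is the kernel at the origin, this puts [g] in [EE]. *)
Lemma EE_bounded g : (forall A, measurable A -> SM A) -> bfun g -> EE g.
Proof using hmass.
move=> hS [[m1 m2] [K hK]].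
have K0 : 0 <= K := le_trans (cabs_ge0 _) (hK (0, 0)).
have [M hM] : exists M : nat, 2 * K < M%:R :> R by exists (Num.truncn (2 * K)).+1; exact: truncnS_gt.
have re t : `|complex.Re (g t)| <= K := le_trans (cabs_Re _) (hK t).
have im t : `|complex.Im (g t)| <= K := le_trans (cabs_Im _) (hK t).
have sh (u : R * R -> R) : measurable_fun setT u -> (forall t, `|u t| <= K) -> mult (fun t => ((u t)%:C)%C).
  move=> mu hu; apply: (@mult_ext _ _ (fun t => ((u t + K)%:C)%C - (K%:C)%C)).
    by move=> t; rewrite -real_complexB addrK.
  apply: multB; last exact: mult_cst.
  apply: (@mult_bounded (fun t => u t + K) M) => //.
    by apply: measurable_funD => //; exact: measurable_cst.
  by move=> t; have := hu t; rewrite ler_norml => /andP[? ?]; apply/andP; split; lra.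
have hm : mult g.
  apply: (@mult_ext _ _ (fun t => ((complex.Re (g t))%:C)%C + 'i%C * ((complex.Im (g t))%:C)%C)).
    by move=> t; apply: complex_ext; rewrite ?cReD ?cImD ?cReM ?cImM /=; ring.
  apply: multD; first exact: sh.
  by apply: multM; [exact: mult_cst | exact: sh].
have := hm.2 _ EE_one.
by have -> : (fun t => g t * 1) = g by apply/funext => t; rewrite mulr1.
Qed.

Lemma L2_dense g : (forall A, measurable A -> SM A) -> cmeas g -> (N2 sg g < +oo)%E ->
  forall e : R, 0 < e -> exists2 L, in_disc L & (N2 sg (fun t => (scomb L t - g t)%R) <= e%:E)%E.
Proof using hmass.
move=> hS mg hg e e0; have e4 : 0 < e / 4 by rewrite divr_gt0.
pose A (k : nat) := [set t | cabs (g t) <= k%:R].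
have mA k : measurable (A k).
  have hm := cmeas_cabs mg.
  have := hm measurableT `]-oo, k%:R]%classic (measurable_itv _); rewrite setTI.
  by congr measurable; apply/seteqP; split=> t /=; rewrite in_itv.
pose gk k t := ind (A k) t * g t.
have bk k : bfun (gk k).
  split; first by apply: cmeasM => //; exact: (bfun_ind (mA k)).1.
  exists k%:R => t; rewrite /gk; have [h|h] := pselect (A k t); first by rewrite ind_in // mul1r.
  by rewrite ind_out // mul0r cabs0.
have mgk k : cmeas (fun t => gk k t - g t) by apply: cmeasB => //; exact: (bk k).1.
have cv : (\int[sg]_t (cabs (gk k t - g t) ^+ 2)%:E)%E @[k --> \oo] --> (\int[sg]_t (cst 0 t))%E.
  apply: (@dominated_cvg _ _ _ sg setT measurableT (fun k t => (cabs (gk k t - g t) ^+ 2)%:E) _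
    (fun t => (cabs (g t) ^+ 2)%:E)) => //.
  - by move=> k; apply/measurable_EFinP; exact: cmeas_sqr.
  - move=> t _; apply: cvg_EFin; first exact: nearW.
    apply/cvgrPdist_lt => d d0; exists (Num.truncn (cabs (g t))).+1 => // k /= hk.
    change (`|0 - cabs (gk k t - g t) ^+ 2| < d).
    rewrite /gk ind_in ?mul1r ?subrr ?cabs0 ?expr0n /= ?subrr ?normr0 //.
    apply: ltW; apply: (lt_le_trans (truncnS_gt _)); by rewrite ler_nat.
  - apply/integrableP; split; first by apply/measurable_EFinP; exact: cmeas_sqr.
    rewrite (eq_integral (fun t => (cabs (g t) ^+ 2)%:E)) // => t _.
    by rewrite gee0_abs // lee_fin sqr_ge0.
  - move=> k t _; rewrite gee0_abs ?lee_fin ?sqr_ge0 //; apply: sqr_le; first exact: cabs_ge0.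
    rewrite /gk; have [h|h] := pselect (A k t); first by rewrite ind_in // mul1r subrr cabs0 cabs_ge0.
    by rewrite ind_out // mul0r sub0r cabsN.
move: cv; rewrite integral0 => /fine_cvgP[[N1 _ h1] /cvgrPdist_lt cv].
have [N2' _ h2] := cv _ e4; pose N := maxn N1 N2'.
have f1 := h1 N (leq_maxl _ _); have h3 := h2 N (leq_maxr _ _).
have hN : (N2 sg (fun t => (gk N t - g t)%R) <= (e / 4)%:E)%E.
  rewrite /= sub0r normrN in h3; rewrite -[leLHS](fineK f1) lee_fin.
  exact: ltW (le_lt_trans (ler_norm _) h3).
have [_ hE] := EE_bounded hS (bk N); have [L hL hd] := hE _ e4; exists L => //.
apply: (le_trans (N2_sub sg (bfun_scomb hL).1 (bk N).1 mg)).
apply: (@le_trans _ _ (2%:E * (e / 4)%:E + 2%:E * (e / 4)%:E)%E).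
  by apply: leeD; apply: lee_wpmul2l; rewrite ?lee_fin.
by rewrite -!EFinM -EFinD lee_fin; lra.
Qed.
End Density.

(** * Arcs and Borel sets in one coordinate *)

Section Coordinates.
Context {R : realType}.
Local Notation C := R[i].
Context (sg : {measure set (R * R)%type -> \bar R}) (mass : R) (hmass : (sg setT <= mass%:E)%E).
Local Notation mult := (mult sg).
Local Notation SM := (SM sg).

(** In [[0, 2 pi[] the points beyond [x] form an arc with midpoint [(x + 2 pi) / 2] and half-length
    [(2 pi - x) / 2], hence a superlevel set of a translated cosine. *)
Lemma cos_arc (x t : R) : 0 <= x < 2 * pi -> 0 <= t < 2 * pi ->
  (cos ((2 * pi - x) / 2) < cos (t - (x + 2 * pi) / 2)) = (x < t).
Proof.
move=> /andP[x0 x1] /andP[t0 t1]; have p0 := @pi_gt0 R.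
set eta := (2 * pi - x) / 2; set y := t - _.
have mono (a b : R) : 0 <= a -> a <= b -> b <= pi -> cos b <= cos a.
  move=> a0; rewrite le_eqVlt => /predU1P[->//|ab] b1; apply: ltW.
  by rewrite ltr_cos // in_itv /=; apply/andP; split; lra.
have [h|h] := ltP x t.
  rewrite -(cos_norm y) ltr_cos ?in_itv /=.
  - by rewrite ltr_norml /y /eta; apply/andP; split; lra.
  - by rewrite normr_ge0 /= ler_norml /y; apply/andP; split; lra.
  - by rewrite /eta; apply/andP; split; lra.
apply/negbTE; rewrite -leNgt -(cosN y).
have [hy|hy] := leP (- y) pi; first by apply: mono => //; rewrite /y /eta; lra.
have -> : cos (- y) = cos (2 * pi + y).
  have -> : 2 * pi + y = - (- y) + pi *+ 2 by rewrite opprK addrC mulr_natl.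
  by rewrite cosD2pi [RHS]cosN.
by apply: mono; rewrite /y /eta; rewrite /y in hy; lra.
Qed.

Context (pr : R * R -> R) (mpr : measurable_fun setT pr)
  (hpr : sg.-negligible (~` [set t | 0 <= pr t < 2 * pi]))
  (h1 : mult (fun t => expi (pr t))) (h2 : mult (fun t => cconj (expi (pr t)))).

Lemma SM_cos (th c : R) : -1 <= c <= 1 -> SM [set t | c < cos (pr t - th)].
Proof using hmass mpr h1 h2.
(* An affine image of the cosine with values in [[0, 1]], normalised so that the threshold [c]
   becomes 1/2. *)
move=> /andP[c0 c1]; pose u (t : R * R) := (cos (pr t - th) - c + 2) / 4.
have -> : [set t | c < cos (pr t - th)] = [set t | 1 / 2 < u t].
  apply/seteqP; split=> t /=; rewrite /u; lra.
have mc : measurable_fun setT (fun t => cos (pr t - th)).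
  apply: measurableT_comp; first by apply: continuous_measurable_fun; exact: continuous_cos.
  by apply: measurable_funB => //; exact: measurable_cst.
apply: (SM_gt hmass).
- apply: measurable_funM; last exact: measurable_cst.
  apply: measurable_funD; last exact: measurable_cst.
  by apply: measurable_funB => //; exact: measurable_cst.
- move=> t; rewrite /u; have := cos_le1 (pr t - th); have := cos_geN1 (pr t - th) => *.
  by apply/andP; split; lra.
apply: (@mult_ext _ _ (fun t => ((8^-1)%:C)%C * (expi (- th) * expi (pr t) + cconj (expi (- th)) * cconj (expi (pr t))) +
   (((2 - c) / 4)%:C)%C)).
  move=> t; rewrite -cconjM -expiD addrC; apply: complex_ext.
    rewrite !(cReD, cReM, cImD, Re_conj, Im_conj) /= /u [- th + _]addrC; by field.
  by rewrite !(cReD, cReM, cImD, cImM, Re_conj, Im_conj) /=; ring.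
apply: multD; last exact: mult_cst.
apply: multM; first exact: mult_cst.
exact: multD (multM (mult_cst _ _) h1) (multM (mult_cst _ _) h2).
Qed.

Lemma SM_ray x : SM [set t | x < pr t].
Proof using hmass mpr hpr h1 h2.
have p0 := @pi_gt0 R.
have mr : measurable [set t | x < pr t].
  have -> : [set t | x < pr t] = ~` [set t | - x <= - pr t].
    by apply/seteqP; split=> t /=; rewrite lerN2 leNgt; [move=> ->; exact | move/negP; rewrite negbK].
  by apply: measurableC; apply: meas_ge; exact: measurable_funN.
have [x0|x0] := ltP x 0.
  apply: (SM_ae (SM_T sg) mr); apply: negligibleS hpr => t /= hx /andP[u0 u1].
  by case: hx => -[// _ ]; apply; lra.
have [x1|x1] := ltP x (2 * pi); last first.
  apply: (SM_ae (SM_C (SM_T sg)) mr); apply: negligibleS hpr => t /= hx /andP[u0 u1].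
  by case: hx => -[h3 h4]; [exact: h3 | lra].
have c01 : -1 <= cos ((2 * pi - x) / 2) <= 1 by rewrite cos_geN1 cos_le1.
apply: (SM_ae (SM_cos ((x + 2 * pi) / 2) c01) mr); apply: negligibleS hpr => t /= hx ht.
have hx0 : 0 <= x < 2 * pi by rewrite x0 x1.
by move: hx; rewrite (cos_arc hx0 ht) => -[[? ?]|[? ?]].
Qed.

Lemma SM_pre (A : set R) : measurable A -> SM (pr @^-1` A).
Proof using hmass mpr hpr h1 h2.
suff h : <<s (@ocitv R) >> `<=` [set A | SM (pr @^-1` A)] by exact: h.
apply: smallest_sub.
  split.
  - rewrite /= preimage_set0 -[set0]setCK setC0; apply: SM_C; exact: SM_T.
  - by move=> B hB; rewrite /= setTD preimage_setC; exact: SM_C.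
  - by move=> F hF; rewrite /= preimage_bigcup; exact: (SM_bigcup hmass).
move=> _ [[a b] /= _ <-] /=.
have -> : pr @^-1` `]a, b]%classic = [set t | a < pr t] `&` ~` [set t | b < pr t].
  apply/seteqP; split=> t /=; rewrite in_itv /=; first by move=> /andP[u0 u1]; split=> //; apply/negP; rewrite -leNgt.
  by move=> [u0 /negP]; rewrite -leNgt u0 => ->.
by apply: SM_I; [exact: SM_ray | apply: SM_C; exact: SM_ray].
Qed.
End Coordinates.

(** * Surjectivity when [Q0] has no root on the circle *)

Section Generic.
Context {R : realType}.
Local Notation C := R[i].
Local Notation array := (nat -> nat -> C).
Local Notation poly2 := {poly {poly C}}.
Context (n : nat) (n0 : (0 < n)%N) (p : poly2) (hp : deg_le_n1 n p)
  (hz : forall z : C * C, in_D2 z -> eval2 p z != 0)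
  (hdeg : deg_eq_n1 n (ptilde n p)) (hno : no_common_factor p (ptilde n p))
  (alpha : C) (ha : cabs alpha = 1)
  (sg : {measure set (R * R)%type -> \bar R}) (hsg : is_clark_measure n p alpha sg)
  (J : array -> R * R -> C) (hJ : is_J n p alpha sg J).
Local Notation pt := (ptilde n p).
Local Notation phi := (Defs.phi n p).
Local Notation Q := (level n p alpha).
Context (hroot : forall tau, cabs tau = 1 -> (Q`_0).[tau] != 0).
Local Notation mult := (mult sg).

Lemma sig_mass_le : (sg setT <= (sig_mass sg)%:E)%E.
Proof using hp hz hdeg hno ha hsg. by rewrite (sig_massE hp hz hdeg hno ha hsg). Qed.
Let hm := sig_mass_le.

Let Z1 (t : R * R) : C := expi t.1.
Let Z2 (t : R * R) : C := expi t.2.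

(* On the support of the Clark measure [Q0(z1) + Q1(z1) z2 = 0], which expresses the conjugates of the
   coordinates through multipliers. *)
Lemma mult_conj : mult (fun t => cconj (Z2 t)) /\ mult (fun t => cconj (Z1 t)).
Proof using n0 hp hz hdeg hno ha hsg hroot.
have [s [ss s1 e0 e1]] := level_factor hp hz hdeg hno ha.
set c := (Q`_0).[0] in e0 e1.
have c0 : c != 0 by apply: level0_neq0 => //; rewrite cabs0.
(* A unimodular [b] would make [conj b] a root of [Q0] on the circle. *)
have slt b : b \in s -> cabs b < 1.
  move=> hb; have := s1 b hb; rewrite le_eqVlt => /predU1P[hb1|//].
  have hb' : cabs (cconj b) = 1 by rewrite cabs_conj.
  have := hroot hb'; rewrite e0 (big_rem b hb) /= mul_conj hb1 expr1n.
  by rewrite subrr mul0r mulr0 eqxx.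
have u1 t : cabs (Z1 t) = 1 by exact: cabs_expi.
have u2 t : cabs (Z2 t) = 1 by exact: cabs_expi.
have m1 : mult Z1 by exact: mult_z1 hm.
have m2 : mult Z2 by exact: mult_z2 hm.
have u1' t : cabs (Z1 t) <= 1 by rewrite u1.
have mb b : b \in s -> mult (fun t => (1 - b * Z1 t)^-1).
  by move=> hb; apply: (mult_geo hm) => //; exact: slt.
have mi : mult (fun t => (Q`_0).[Z1 t]^-1).
  apply: (@mult_ext _ _ (fun t => c^-1 * \prod_(b <- s) (1 - b * Z1 t)^-1)).
    by move=> t; rewrite e0 invfM prodfV.
  by apply: multM; [exact: mult_cst | apply: mult_prod => b hb; exact: mb].
have mlin b : mult (fun t => Z1 t - b) := multB m1 (mult_cst _ b).
have mq1 : mult (fun t => (Q`_1).[Z1 t]).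
  apply: (@mult_ext _ _ (fun t => (- alpha * cconj c) * \prod_(b <- s) (Z1 t - cconj b))).
    by move=> t; rewrite e1.
  by apply: multM; [exact: mult_cst | apply: mult_prod => b _; exact: mlin].
have q0 t : (Q`_0).[Z1 t] != 0 by exact: hroot (u1 t).
have q1 t : (Q`_1).[Z1 t] != 0 by rewrite -cabs_eq0 (level_T hp ha (u1 t)) cabs_eq0.
have z20 t : Z2 t != 0 by exact: unim_neq0 (u2 t).
have nl := null_level hp hz hdeg hno ha hsg.
have onQ t : eval2 Q (zeta t) = 0 -> (Q`_1).[Z1 t] = - (Q`_0).[Z1 t] / Z2 t.
  move=> hQ; have := level_lin hp alpha (zeta t); rewrite hQ /= -/(Z1 t) -/(Z2 t) => /esym/eqP.
  by rewrite addrC addr_eq0 => /eqP h; apply: (mulIf (z20 t)); rewrite h divfK.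
have bz1 : bfun (fun t => cconj (Z1 t)).
  split; first by apply: cmeas_conj; exact: cmeas_z1.
  by exists 1 => t; rewrite cabs_conj u1.
have bz2 : bfun (fun t => cconj (Z2 t)).
  split; first by apply: cmeas_conj; exact: cmeas_z2.
  by exists 1 => t; rewrite cabs_conj u2.
have mc2 : mult (fun t => cconj (Z2 t)).
  apply: (@mult_ae _ _ _ (fun t => (-1) * ((Q`_1).[Z1 t] * (Q`_0).[Z1 t]^-1)) _ bz2).
    exact: multM (mult_cst _ _) (multM mq1 mi).
  apply: negligibleS nl => t /= h; apply/negP => /eqP hQ; apply: h.
  change (cconj (Z2 t) = -1 * ((Q`_1).[Z1 t] * (Q`_0).[Z1 t]^-1)).
  by rewrite (onQ t hQ) (conj_unim (u2 t)); field; rewrite q0 z20.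
split; first exact: mc2.
case: s ss s1 e0 e1 slt mb {mlin} => [|b s] ss s1 e0 e1 slt mb; first by exfalso; move: n0; rewrite -ss.
have hb : cabs b < 1 by apply: slt; rewrite mem_head.
have nb t : Z1 t - cconj b != 0.
  by rewrite subr_eq0; apply/eqP => e; have := u1 t; rewrite e cabs_conj => e2; rewrite e2 ltxx in hb.
have mlin b' : mult (fun t => Z1 t - b') := multB m1 (mult_cst _ b').
(* On [Q = 0] the factorisation of [Q1 = - Q0 / Z2] is solved for the reciprocal of one factor,
   which exists because [n] is positive. *)
have mv : mult (fun t => (Z1 t - cconj b)^-1).
  apply: (@mult_ae _ _ _ (fun t => (\prod_(b' <- s) (Z1 t - cconj b')) * ((alpha * cconj c) * (Z2 t * (Q`_0).[Z1 t]^-1)))).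
  - apply: multM; first by apply: mult_prod => b' _; exact: mlin.
    by apply: multM; [exact: mult_cst | exact: multM].
  - split; first by apply: cmeasV => //; apply: cmeasB; [exact: cmeas_z1 | exact: cmeas_cst].
    exists (1 - cabs b)^-1 => t; rewrite cabsV lef_pV2 ?posrE ?cabs_gt0 ?subr_gt0 //.
    by have := cabs_subr (Z1 t) (cconj b); rewrite u1 cabs_conj.
  apply: negligibleS nl => t /= h; apply/negP => /eqP hQ; apply: h.
  have h3 := onQ t hQ; have := e1 (Z1 t); rewrite h3 big_cons => h4.
  set P := \prod_(b' <- s) _ in h4 *.
  have e5 : alpha * cconj c * P * (Z1 t - cconj b) = (Q`_0).[Z1 t] / Z2 t.
    by rewrite -[RHS]opprK -mulNr h4; ring.
  have e6 : P * (alpha * cconj c * (Z2 t / (Q`_0).[Z1 t])) * (Z1 t - cconj b) = 1.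
    have -> : P * (alpha * cconj c * (Z2 t / (Q`_0).[Z1 t])) * (Z1 t - cconj b) =
      (alpha * cconj c * P * (Z1 t - cconj b)) * (Z2 t / (Q`_0).[Z1 t]) by ring.
    by rewrite e5; field; rewrite q0 z20.
  by apply: (mulIf (nb t)); rewrite mulVf // e6.
(* On the circle [om] is the conjugate of a Blaschke factor, and
   [conj Z1 = (om + b) / (1 + conj b om)], where the reciprocal expands in a geometric series. *)
pose om t := (1 - b * Z1 t) * (Z1 t - cconj b)^-1.
have mom : mult om.
  exact: multM (multB (mult_cst _ 1) (multM (mult_cst _ b) m1)) mv.
have om1 t : cabs (om t) = 1.
  rewrite /om cabsM cabsV.
  have -> : cabs (1 - b * Z1 t) = cabs (Z1 t - cconj b).
    rewrite -(cabs_conj (Z1 t - cconj b)) cconjB cconjK (conj_unim (u1 t)).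
    have z10 := unim_neq0 (u1 t).
    have -> : 1 - b * Z1 t = ((Z1 t)^-1 - b) * Z1 t by rewrite mulrBl mulVf.
    by rewrite cabsM u1 mulr1.
  by rewrite divff // cabs_eq0.
have hnb : cabs (- cconj b) < 1 by rewrite cabsN cabs_conj.
apply: (@mult_ext _ _ (fun t => (om t + b) * (1 - (- cconj b) * om t)^-1)); last first.
  apply: multM; first exact: multD mom (mult_cst _ b).
  by apply: (mult_geo hm) => // t; rewrite om1.
move=> t; have z10 := unim_neq0 (u1 t); rewrite (conj_unim (u1 t)).
have d0 : 1 - (- cconj b) * om t != 0 by apply: one_sub_neq0; rewrite cabsM om1 mulr1.
apply: (mulIf d0); rewrite mulfVK //; rewrite /om.
apply: (mulIf z10); apply: (mulIf (nb t)); move: (nb t) => nbt.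
by field; rewrite nbt z10.
Qed.

Lemma all_SM A : measurable A -> SM sg A.
Proof using n0 hp hz hdeg hno ha hsg hroot.
have [mc2 mc1] := mult_conj.
have hbox : sg.-negligible (~` [set t : R * R | 0 <= t.1 < 2 * pi /\ 0 <= t.2 < 2 * pi]).
  apply/negligibleP; last by have := hsg.1.
  apply: measurableC.
  have -> : [set t : R * R | 0 <= t.1 < 2 * pi /\ 0 <= t.2 < 2 * pi] = `[0, 2 * pi[%classic `*` `[0, 2 * pi[%classic.
    by apply/seteqP; split=> t /=; rewrite !in_itv.
  by apply: measurableX; exact: measurable_itv.
have b1 : sg.-negligible (~` [set t : R * R | 0 <= t.1 < 2 * pi]).
  by apply: negligibleS hbox => t /= h [h1 _]; exact: h.
have b2 : sg.-negligible (~` [set t : R * R | 0 <= t.2 < 2 * pi]).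
  by apply: negligibleS hbox => t /= h [_ h1]; exact: h.
rewrite measurable_prod_measurableType.
move: A; suff h : <<s [set A1 `*` A2 | A1 in @measurable _ R & A2 in @measurable _ R] >> `<=` [set A | SM sg A] by exact: h.
apply: smallest_sub.
  split.
  - rewrite /= -[set0]setCK setC0; apply: SM_C; exact: SM_T.
  - by move=> B hB; rewrite /= setTD; exact: SM_C.
  - by move=> F hF; exact: (SM_bigcup hm).
move=> _ [A1 m1 [A2 m2 <-]] /=.
have -> : A1 `*` A2 = (fst @^-1` A1) `&` (snd @^-1` A2) by [].
apply: SM_I.
  exact: (SM_pre hm measurable_fst b1 (mult_z1 hm) mc1 m1).
exact: (SM_pre hm measurable_snd b2 (mult_z2 hm) mc2 m2).
Qed.

(** [J] maps kernel combinations onto Szego combinations, which are dense; the preimages of an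
    approximating sequence are Cauchy by isometry, and the model space is complete. *)
Lemma generic_surjective g : in_L2 sg g -> exists2 a, in_K n p a & sg.-negligible [set t | J a t <> g t].
Proof using n0 hp hz hdeg hno ha hsg hroot hJ.
move=> [g1 [g2 g3]]; have mg : cmeas g by [].
have [kap hk] := kernel_family hp hz.
have dense e : 0 < e -> exists2 a, in_K n p a & (N2 sg (fun t => (J a t - g t)%R) <= e%:E)%E.
  move=> e0; have [L hL hd] := L2_dense hm all_SM mg g3 e0.
  (* [J] sends the kernel at [w] to the Szego kernel times [1 - alpha conj (phi w)], nonzero since
     [|phi| < 1]; the coefficients are divided by it in advance. *)
  pose L' := [seq (x.1 / (1 - alpha * cconj (phi x.2)), x.2) | x <- L].
  have hL' : in_disc L' by move=> x /mapP[y /hL hy ->].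
  exists (kcomb kap L'); first exact: kcomb_in_K.
  have mJ := J_meas hJ (kcomb_in_K hp hz hk hL').
  rewrite (@N2_ae _ _ _ (fun t => scomb L t - g t)) //.
  - exact: cmeasB.
  - by apply: cmeasB => //; exact: (bfun_scomb hL).1.
  apply: negligibleS (J_kcomb hp hz hJ hk hL') => t /= h1 h2; apply: h1; rewrite h2; congr (_ - _).
  rewrite /Jcomb /scomb /L' big_map /= !big_seq; apply: eq_bigr => x hx.
  rewrite mulrA; congr (_ * _); rewrite divfK //.
  apply: one_sub_neq0; rewrite cabsM ha mul1r cabs_conj; apply: phi_lt1 => //; exact: hL.
have q4 m : 0 < (4 ^+ m)^-1 :> R by rewrite invr_gt0 exprn_gt0.
have /choice[f hf] : forall m, exists a, in_K n p a /\ (N2 sg (fun t => (J a t - g t)%R) <= ((4 ^+ m)^-1)%:E)%E.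
  by move=> m; have [a h1 h2] := dense _ (q4 m); exists a.
have fK m : in_K n p (f m) by have [] := hf m.
have mf m : cmeas (J (f m)) by have := J_meas hJ (fK m). 
have hcN k l : (N2 sg (fun t => (J (f k) t - J (f l) t)%R) <= (2 * (4 ^+ k)^-1 + 2 * (4 ^+ l)^-1)%:E)%E.
  apply: (le_trans (N2_sub sg (mf k) mg (mf l))).
  rewrite (EFinD (2 * (4 ^+ k)^-1)) (EFinM 2 (4 ^+ k)^-1) (EFinM 2 (4 ^+ l)^-1).
  apply: leeD; apply: lee_wpmul2l; rewrite ?lee_fin //; first by have [] := hf k.
  have [_ h] := hf l; apply: le_trans h; rewrite le_eqVlt; apply/orP; left; apply/eqP.
  by apply: eq_integral => t _; rewrite cabsBC.
have small (e : R) : 0 < e -> exists N : nat, forall k, (N <= k)%N -> (4 ^+ k)^-1 < e.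
  move=> e0; have h14 : 0 <= (4^-1 : R) < 1 by rewrite invr_ge0 invf_lt1 //; apply/andP; split; lra.
  by have [N hN] := geo0 h14 e0; exists N => k hk0; rewrite -exprVn; exact: hN.
have [a hca] : exists a, forall e : R, 0 < e -> exists N, forall k, (N <= k)%N -> bnd e (fun i j => f k i j - a i j).
  apply: l2_complete => e e0; have e4 : 0 < e ^+ 2 / 4 by rewrite divr_gt0 // exprn_gt0.
  have [N hN] := small _ e4; exists N => k l hk' hl'; split=> // N'.
  rewrite -lee_fin; apply: (le_trans (J_diff_ge hJ N' (fK k) (fK l))); apply: (le_trans (hcN k l)).
  by rewrite lee_fin; have := hN k hk'; have := hN l hl'; lra.
have aK : in_K n p a by exact: (in_K_closed hp hz fK hca).
exists a => //.
have ma := J_meas hJ aK.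
have N20 : (N2 sg (fun t => (J a t - g t)%R) <= 0)%E.
  apply/lee_addgt0Pr => e e0; rewrite add0e.
  have e4 : 0 < e / 4 by rewrite divr_gt0.
  have e5 : 0 < Num.min 1 (e / 4) by rewrite lt_min ltr01 e4.
  have [N1 h1] := small _ e4; have [N2' h2] := hca _ e5.
  set k := maxn N1 N2'; have k1 := h1 k (leq_maxl _ _); have k2 := h2 k (leq_maxr _ _).
  apply: (le_trans (N2_sub sg ma (mf k) mg)).
  apply: (@le_trans _ _ (2%:E * (e / 4)%:E + 2%:E * (e / 4)%:E)%E); last first.
    by rewrite -!EFinM -EFinD lee_fin; lra.
  apply: leeD; apply: lee_wpmul2l; rewrite ?lee_fin //; last first.
    by have [_ h] := hf k; apply: (le_trans h); rewrite lee_fin ltW.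
  have k3 : bnd (Num.min 1 (e / 4)) (fun i j => a i j - f k i j).
    by split=> // N; rewrite nN_sub0; exact: k2.2.
  apply: (le_trans (J_diff_le hJ aK (fK k) k3)); rewrite lee_fin.
  have d1 : Num.min 1 (e / 4) <= 1 by rewrite ge_min lexx.
  have d2 : Num.min 1 (e / 4) <= e / 4 by rewrite ge_min lexx orbT.
  move: (Num.min 1 (e / 4)) e5 d1 d2 => d *; nra.
pose G (k : nat) := [set t | k.+1%:R^-1 <= cabs (J a t - g t)].
have md : cmeas (fun t => J a t - g t) by exact: cmeasB.
apply: (@negligibleS _ _ _ _ (\bigcup_k G k)).
  move=> t /= /eqP; rewrite -subr_eq0 -cabs_gt0; set q := cabs _ => q0.
  have [k hk'] : exists k : nat, q^-1 < k%:R by exists (Num.truncn q^-1).+1; exact: truncnS_gt.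
  exists k => //; rewrite /G /= -/q invf_ple ?posrE //; apply: ltW; apply: (lt_trans hk').
  by rewrite ltr_nat.
apply: negligible_bigcup => k; have k0 : 0 < k.+1%:R^-1 :> R by rewrite invr_gt0.
apply/negligibleP; first by apply: meas_ge; exact: cmeas_cabs.
apply/eqP; rewrite eq_le measure_ge0 andbT.
have := @chebyshev2 _ _ _ sg (fun t => cabs (J a t - g t)) _ 0 (cmeas_cabs md) k0 N20.
by rewrite mul0r.
Qed.
End Generic.

(** * Failure of surjectivity at exceptional values *)

Section Moments.
Context {R : realType}.
Local Notation C := R[i].
Implicit Types (f g : R * R -> C).
Context (sg : {measure set (R * R)%type -> \bar R}) (mass : R) (hmass : (sg setT <= mass%:E)%E).
Context (A : set (R * R)) (mA : measurable A) (rho : R)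
  (hpois : forall z2, cabs z2 < 1 -> (\int[sg]_(t in A) (poisson2 (0, z2) (zeta t))%:E = rho%:E)%E).

Let Z2 (t : R * R) : C := expi t.2.
(** Only real parts are integrated; a free complex coefficient in front of the integrand recovers
    the rest. *)
Definition reint f : R := Rintegral sg A (fun t => complex.Re (f t)).

Lemma bfun_integrable f : bfun f -> sg.-integrable A (EFin \o (fun t => complex.Re (f t))).
Proof using hmass mA.
move=> [mf [K hK]]; have sA : (sg A < +oo)%E.
  apply: (@le_lt_trans _ _ (sg setT)); first by apply: le_measure => //; exact: mem_set.
  by apply: (le_lt_trans hmass); exact: ltry.
apply: measurable_bounded_integrable => //; first exact: (measurable_funTS mf.1).
exists K; split; first exact: num_real.
by move=> x hx t _; apply: (le_trans (cabs_Re _)); apply: (le_trans (hK t)); exact: ltW.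
Qed.

Lemma integral_reint f : bfun f -> (\int[sg]_(t in A) (complex.Re (f t))%:E = (reint f)%:E)%E.
Proof using hmass mA.
by move=> hf; rewrite /reint /Rintegral fineK //; apply: integrable_fin_num => //; exact: bfun_integrable.
Qed.

Lemma reintD f g : bfun f -> bfun g -> reint (fun t => f t + g t) = reint f + reint g.
Proof using hmass mA.
move=> hf hg; rewrite /reint -RintegralD //; try exact: bfun_integrable.
by apply: eq_Rintegral => t _; rewrite cReD.
Qed.

Lemma reintZ (r : R) f : bfun f -> reint (fun t => (r%:C)%C * f t) = r * reint f.
Proof using hmass mA.
move=> hf; rewrite /reint -RintegralZl //; last exact: bfun_integrable.
by apply: eq_Rintegral => t _; rewrite cReM /= mul0r subr0.
Qed.

Lemma reintB f g : bfun f -> bfun g -> reint (fun t => f t - g t) = reint f - reint g.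
Proof using hmass mA.
move=> hf hg; rewrite /reint -RintegralB //; try exact: bfun_integrable.
by apply: eq_Rintegral => t _; rewrite cReB.
Qed.

Lemma reint_ext f g : (forall t, A t -> complex.Re (f t) = complex.Re (g t)) -> reint f = reint g.
Proof. by move=> h; apply: eq_Rintegral => t /set_mem; exact: h. Qed.

Lemma bfun_sum (I : eqType) (r : seq I) (F : I -> R * R -> C) :
  (forall i, i \in r -> bfun (F i)) -> bfun (fun t => \sum_(i <- r) F i t).
Proof.
elim: r => [|i r IH] hF.
  by under eq_fun do rewrite big_nil; exact: bfun_cst.
under eq_fun do rewrite big_cons; apply: bfunD; first by apply: hF; rewrite mem_head.
by apply: IH => j hj; apply: hF; rewrite in_cons hj orbT.
Qed.

Lemma reint_sum (I : eqType) (r : seq I) (F : I -> R * R -> C) :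
  (forall i, i \in r -> bfun (F i)) -> reint (fun t => \sum_(i <- r) F i t) = \sum_(i <- r) reint (F i).
Proof using hmass mA.
elim: r => [|i r IH] hF.
  rewrite big_nil; have := reintB (bfun_cst 0) (bfun_cst 0); rewrite (subrr (reint _)) => h; rewrite -[RHS]h.
  by apply: reint_ext => t _; rewrite big_nil subrr.
have hF' j : j \in r -> bfun (F j) by move=> hj; apply: hF; rewrite in_cons hj orbT.
rewrite big_cons -IH // -reintD; [|by apply: hF; rewrite mem_head | exact: bfun_sum].
by apply: reint_ext => t _; rewrite big_cons.
Qed.

Lemma mass_line : sg A = rho%:E.
Proof using mA hpois.
have h0 : cabs (0 : C) < 1 by rewrite cabs0.
rewrite -(hpois h0) -[LHS]mul1e -integral_cst //; apply: eq_integral => t _.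
by rewrite poisson2_snd cabs0 subr0 cabs_expi expr1n expr0n subr0 divr1.
Qed.

Lemma rho_ge0 : 0 <= rho.
Proof using mA hpois. by rewrite -lee_fin -mass_line. Qed.

Lemma reint_cst (r : R) : reint (fun=> (r%:C)%C) = r * rho.
Proof using mA hpois. by rewrite /reint Rintegral_cst //= mass_line. Qed.

Lemma reint_bound f (K : R) : bfun f -> (forall t, cabs (f t) <= K) -> `|reint f| <= K * rho.
Proof using hmass mA hpois.
move=> hf hK; apply: (le_trans (le_normr_Rintegral mA (bfun_integrable hf))).
rewrite -reint_cst; apply: le_Rintegral => //.
- have hb := bfun_integrable hf; exact: (integrable_norm hb).
- exact: (bfun_integrable (bfun_cst (K%:C)%C)).
by move=> t _ /=; apply: (le_trans (cabs_Re _)).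
Qed.

Lemma bfun_z2 : bfun Z2.
Proof. by split; [exact: cmeas_z2 | exists 1 => t; rewrite cabs_expi]. Qed.

Lemma bfunX f k : bfun f -> bfun (fun t => f t ^+ k).
Proof.
move=> hf; elim: k => [|k IH]; first exact: bfun_cst.
by under eq_fun do rewrite exprS; exact: bfunM.
Qed.

Lemma bfun_moment (u : C) k : bfun (fun t => u * Z2 t ^+ k).
Proof. by apply: bfunM; [exact: bfun_cst | apply: bfunX; exact: bfun_z2]. Qed.

(* All Poisson integrals being equal, the Fourier coefficients of [sigma] on the line vanish one after the other. *)
Lemma moment0 (u : C) k : reint (fun t => u * Z2 t ^+ k.+1) = 0.
Proof using hmass mA hpois.
have [k' hk'] : exists k', (k < k')%N by exists k.+1.
elim: k' => // k' IH in k hk' u *.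
have IHk j v : (j < k)%N -> reint (fun t => v * Z2 t ^+ j.+1) = 0.
  by move=> hj; apply: IH; exact: leq_trans hj hk'.
(* Up to an error of order [r^(k+2)] the Poisson kernel at a point of radius [r] is a trigonometric
   sum of order [k + 1]. Its integral is [rho] and the lower moments vanish, so the moment of order
   [k + 1], which enters with weight [r^(k+1)], is [O(r)]. *)
have unim s : reint (fun t => expi s * Z2 t ^+ k.+1) = 0.
  set M := reint _; apply/eqP; rewrite -normr_eq0; apply/eqP; apply: le_anti; rewrite normr_ge0 andbT.
  apply/ler_addgt0Pr => e e0; rewrite add0r.
  have r0 := rho_ge0.
  pose r : R := Num.min (1 / 2) (e / (2 * rho + 1)).
  have e1 : 0 < e / (2 * rho + 1) by rewrite divr_gt0 //; lra.
  have rp : 0 < r by rewrite lt_min e1 andbT; lra.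
  have r2 : r <= 1 / 2 by rewrite ge_min lexx.
  have re : r * (2 * rho + 1) <= e.
    by rewrite -ler_pdivlMr ?ge_min ?lexx ?orbT //; lra.
  (* The argument is chosen so that [conj z^(k+1) = r^(k+1) e^(is)]. *)
  pose z : C := (r%:C)%C * expi (- s / k.+1%:R).
  have cz : cabs z = r by rewrite /z cabsM cabs_real cabs_expi mulr1 gtr0_norm.
  have z1 : cabs z < 1 by rewrite cz; lra.
  have zk : cconj z ^+ k.+1 = ((r ^+ k.+1)%:C)%C * expi s.
    rewrite /z cconjM exprMn real_complexX; congr (_ * _); first by congr (_ ^+ _); apply: complex_ext; rewrite ?Re_conj ?Im_conj /= ?oppr0.
    rewrite -expiN mulNr opprK -expiMn; congr expi.
    by rewrite mulrC divfK // pnatr_eq0.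
  have bp : bfun (fun t => ((pois z t.2)%:C)%C).
    split.
      apply: cmeas_real; have := @meas_poisson2 R (0, z) (in_D2_0l z1).
      by under eq_fun do rewrite poisson2_snd.
    exists ((1 - cabs z ^+ 2) / (1 - r) ^+ 2) => t; rewrite cabs_real ger0_norm; last exact: pois_ge0.
    rewrite /pois; apply: ler_wpM2l; first by rewrite cz; nra.
    rewrite lef_pV2 ?posrE ?exprn_gt0 ?cabs_gt0 ?expi_sub_neq0 //; last by lra.
    by apply: sqr_le; [lra | have := cabs_subr (expi t.2) z; rewrite cabs_expi cz].
  have ip : reint (fun t => ((pois z t.2)%:C)%C) = rho.
    have := integral_reint bp; rewrite -[X in _ = X -> _]/((reint _)%:E) => h.
    apply: EFin_inj; rewrite -h -(hpois z1); apply: eq_integral => t _.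
    by rewrite poisson2_snd.
  pose F (j : nat) t := (2 * cconj z ^+ j.+1) * Z2 t ^+ j.+1.
  have bF j : bfun (F j) by exact: bfun_moment.
  have bS : bfun (fun t => \sum_(j <- iota 0 k.+1) F j t) by exact: bfun_sum.
  have iS : reint (fun t => \sum_(j <- iota 0 k.+1) F j t) = 2 * r ^+ k.+1 * M.
    rewrite reint_sum // -[k.+1]addn1 iotaD big_cat /= big_seq1 add0n addn1 big1_seq ?add0r.
      rewrite -reintZ; last exact: bfun_moment.
      by apply: reint_ext => t _; rewrite /F zk real_complexM (_ : ((2%:R : R)%:C)%C = 2) ?(rmorph_nat (real_complex R) 2) // -!mulrA.
    by move=> j /andP[_]; rewrite mem_iota add0n => hj; exact: IHk.
  have b1S : bfun (fun t => 1 + \sum_(j <- iota 0 k.+1) F j t) by apply: bfunD => //; exact: bfun_cst.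
  have i1S : reint (fun t => 1 + \sum_(j <- iota 0 k.+1) F j t) = rho + 2 * r ^+ k.+1 * M.
    by rewrite (reintD (bfun_cst 1)) // iS; congr (_ + _); rewrite -[RHS]mul1r -reint_cst.
  have [mD _] := bfunB bp b1S.
  pose D t : C := ((complex.Re (((pois z t.2)%:C)%C - (1 + \sum_(j <- iota 0 k.+1) F j t)))%:C)%C.
  have hD t : cabs (D t) <= 2 * r ^+ k.+2 / (1 - r).
    have eF : \sum_(j <- iota 0 k.+1) F j t = \sum_(j < k.+1) F j t.
      by rewrite -[X in iota 0 X]subn0 -/(index_iota 0 k.+1) big_mkord.
    have := pois_part_err k.+1 t.2 z1; rewrite cz /D cabs_real eF; congr (`|_| <= _).
    rewrite cReB cReD Re_sum; congr (_ - (_ + _)); apply: eq_bigr => j _.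
    have e2 (y : C) : 2 * complex.Re y = complex.Re (2 * y) by rewrite (mulr_natl y) mulr2n cReD; ring.
    by rewrite e2 mulrA.
  have bD : bfun D.
    by split; [apply: cmeas_real; exact: mD.1 | exists (2 * r ^+ k.+2 / (1 - r))].
  have iD : reint D = - (2 * r ^+ k.+1 * M).
    transitivity (reint (fun t => ((pois z t.2)%:C)%C - (1 + \sum_(j <- iota 0 k.+1) F j t))).
      by apply: reint_ext.
    by rewrite reintB // ip i1S; ring.
  have := reint_bound bD hD; rewrite iD normrN normrM gtr0_norm; last by rewrite mulr_gt0 // exprn_gt0.
  have rk : 0 < r ^+ k.+1 by rewrite exprn_gt0.
  have -> : 2 * r ^+ k.+2 / (1 - r) * rho = 2 * r ^+ k.+1 * (r / (1 - r) * rho).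
    by rewrite exprS; field; lra.
  rewrite ler_pM2l; last by rewrite mulr_gt0.
  move=> h; apply: (le_trans h); apply: le_trans re.
  rewrite mulrAC ler_pdivrMr; last by lra.
  by rewrite -mulrA ler_pM2l //; clearbody r; nra.
have [->|u0] := eqVneq u 0.
  have := reint_cst 0; rewrite mul0r => e; rewrite -[RHS]e; apply: reint_ext => t _.
  by rewrite mul0r.
have cu : cabs u != 0 by rewrite cabs_eq0.
have [s _ es] : exists2 s : R, 0 <= s < 2 * pi & u / ((cabs u)%:C)%C = expi s.
  by apply: expi_surj; rewrite cabsM cabsV cabs_real ger0_norm ?cabs_ge0 // divff.
rewrite -[RHS](mulr0 (cabs u)) -(unim s) -reintZ; last exact: bfun_moment.
apply: reint_ext => t _; congr complex.Re; rewrite mulrA -es mulrCA divff ?mulr1 //.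
by rewrite -cabs_eq0 cabs_real normr_eq0.
Qed.

(** The geometric series expands the function into positive powers of [Z2], whose moments vanish;
    the remainder is [conj w^N Z2^N] times the function itself. *)
Lemma szego_moment (d w : C) : cabs w < 1 ->
  bfun (fun t => d * (Z2 t / (1 - Z2 t * cconj w))) /\
  reint (fun t => d * (Z2 t / (1 - Z2 t * cconj w))) = 0.
Proof using hmass mA hpois.
move=> hw; have hw' : cabs (cconj w) < 1 by rewrite cabs_conj.
have n0 t : 1 - Z2 t * cconj w != 0 by apply: one_sub_neq0; rewrite cabsM cabs_expi mul1r.
have bi : bfun (fun t => (1 - Z2 t * cconj w)^-1).
  split; last first.
    exists (1 - cabs w)^-1 => t; rewrite cabsV lef_pV2 ?posrE ?cabs_gt0 ?subr_gt0 //.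
    by have := cabs_subr 1 (Z2 t * cconj w); rewrite cabs1 cabsM cabs_expi mul1r cabs_conj.
  apply: cmeasV => //; apply: cmeasB; first exact: cmeas_cst.
  by apply: cmeasM; [exact: cmeas_z2 | exact: cmeas_cst].
have bX : bfun (fun t => d * (Z2 t / (1 - Z2 t * cconj w))).
  by apply: bfunM; [exact: bfun_cst | apply: bfunM => //; exact: bfun_z2].
split=> //; set X := (fun t => d * _) in bX *.
apply/eqP; rewrite -normr_eq0; apply/eqP; apply: le_anti; rewrite normr_ge0 andbT.
apply/ler_addgt0Pr => e e0; rewrite add0r.
have [K [K0 hK]] : exists K, 0 < K /\ forall t, cabs (X t) <= K.
  have [_ [K hK]] := bX; exists (`|K| + 1); split; first by have := normr_ge0 K; lra.
  by move=> t; apply: (le_trans (hK t)); have := ler_norm K; lra.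
have r0 := rho_ge0.
have e1 : 0 < e / (K * rho + 1) by rewrite divr_gt0 //; have := mulr_ge0 (ltW K0) r0; lra.
have h01 : 0 <= cabs w < 1 by rewrite cabs_ge0.
have [N hN] := geo0 h01 e1.
pose F (j : nat) t := (d * cconj w ^+ j) * Z2 t ^+ j.+1.
have bF j : bfun (F j) by exact: bfun_moment.
have bS : bfun (fun t => \sum_(j <- iota 0 N) F j t) by exact: bfun_sum.
have iS : reint (fun t => \sum_(j <- iota 0 N) F j t) = 0.
  by rewrite reint_sum //; apply: big1 => j _; exact: moment0.
have eD t : X t - \sum_(j <- iota 0 N) F j t = cconj w ^+ N * Z2 t ^+ N * X t.
  have -> : \sum_(j <- iota 0 N) F j t = d * Z2 t * \sum_(j < N) (Z2 t * cconj w) ^+ j.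
    rewrite -[N in LHS]subn0 -/(index_iota 0 N) big_mkord mulr_sumr; apply: eq_bigr => j _.
    by rewrite /F exprMn exprS; ring.
  apply: (mulIf (n0 t)); rewrite mulrBl /X -!mulrA mulVf // mulr1.
  have := subrX1 (Z2 t * cconj w) N; set S := \sum_(j < N) _ => h.
  have -> : S * (1 - Z2 t * cconj w) = 1 - (Z2 t * cconj w) ^+ N by rewrite -[RHS]opprB h; ring.
  by rewrite exprMn; ring.
have iX : reint X = reint (fun t => cconj w ^+ N * Z2 t ^+ N * X t).
  by rewrite -[LHS]subr0 -iS -reintB //; apply: reint_ext => t _; rewrite eD.
rewrite iX; apply: (@le_trans _ _ (cabs w ^+ N * K * rho)).
  apply: reint_bound; first by apply: bfunM => //; exact: bfun_moment.
  move=> t; rewrite cabsM [in leLHS](cabsM (_ ^+ _)) !cabsX cabs_conj cabs_expi expr1n mulr1.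
  by apply: ler_wpM2l; [apply: exprn_ge0; exact: cabs_ge0 | exact: hK].
have := hN N (leqnn N); rewrite ltr_pdivlMr; last by have := mulr_ge0 (ltW K0) r0; lra.
have := exprn_ge0 N (cabs_ge0 w); set q := cabs w ^+ N => q0 h.
by rewrite -mulrA; lra.
Qed.
End Moments.

Section Exceptional.
Context {R : realType}.
Local Notation C := R[i].
Local Notation array := (nat -> nat -> C).
Local Notation poly2 := {poly {poly C}}.
Context (n : nat) (p : poly2) (hp : deg_le_n1 n p)
  (hz : forall z : C * C, in_D2 z -> eval2 p z != 0)
  (hdeg : deg_eq_n1 n (ptilde n p)) (hno : no_common_factor p (ptilde n p))
  (alpha : C) (ha : cabs alpha = 1)
  (sg : {measure set (R * R)%type -> \bar R}) (hsg : is_clark_measure n p alpha sg)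
  (J : array -> R * R -> C) (hJ : is_J n p alpha sg J).

Local Notation hmass := (sig_mass_le hp hz hdeg hno ha hsg).

(* On a line of positive mass the closed span of the Szego kernels behaves like [H^2], to which [conj z2]
   is orthogonal. *)
Lemma exceptional_not_surjective : exceptional n p alpha ->
  exists2 g, in_L2 sg g & forall a, in_K n p a -> ~ sg.-negligible [set t | J a t <> g t].
Proof using hp hz hdeg hno ha hsg hJ.
move=> /(exceptional_root hp hz hdeg hno ha)[tau ht hroot].
have [rho rho0 hrho] := line_mass hp hz hdeg hno ha hsg ht hroot.
have mA : measurable (line tau) by exact: meas_line.
pose g t := ind (line tau) t * cconj (expi t.2).
have bg : bfun g.
  apply: bfunM; first exact: bfun_ind.
  split; first by apply: cmeas_conj; exact: cmeas_z2.
  by exists 1 => t; rewrite cabs_conj cabs_expi.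
exists g.
  split; first exact: bg.1.1.
  split; first exact: bg.1.2.
  have [_ [K hK]] := bg; apply: (le_lt_trans (N2_le hmass bg.1 hK)); exact: ltry.
move=> a haK hneg.
have [kap hk] := kernel_family hp hz.
have e0 : 0 < Num.min 1 (rho / 2) by rewrite lt_min ltr01 divr_gt0.
set e := Num.min 1 (rho / 2) in e0.
have e1 : e <= 1 by rewrite ge_min lexx.
have e2 : e <= rho / 2 by rewrite ge_min lexx orbT.
have [L hL hd] := kernel_dense hp hz hk haK e0.
pose X := Jcomb n p alpha L.
(* On the line [z1 = tau] the first factor of each kernel is constant and joins the coefficient. *)
pose d (x : C * (C * C)) := x.1 * (1 - alpha * cconj (Defs.phi n p x.2)) / (1 - tau * cconj x.2.1).
have bX : bfun X.
  apply: bfun_sum => x /hL hx; apply: bfunM; first exact: bfun_cst.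
  by apply: bfunM; [exact: bfun_cst | exact: bfun_ker].
have N2X : (N2 sg (fun t => (X t - g t)%R) <= (e ^+ 2)%:E)%E.
  have mJ := J_meas hJ (kcomb_in_K hp hz hk hL); have ma := J_meas hJ haK.
  apply: le_trans (J_diff_le hJ haK (kcomb_in_K hp hz hk hL) hd).
  rewrite le_eqVlt; apply/orP; left; apply/eqP.
  transitivity (N2 sg (fun t => J a t - J (kcomb kap L) t)); last by [].
  transitivity (N2 sg (fun t => g t - X t)).
    by apply: eq_integral => t _; rewrite cabsBC.
  apply: N2_ae; [by apply: cmeasB; [exact: bg.1 | exact: bX.1] | exact: cmeasB |].
  apply: negligibleS (negligibleU hneg (J_kcomb hp hz hJ hk hL)) => t /= h.
  have [h1|h1] := pselect (J a t = g t); last by left.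
  by right => h2; apply: h; rewrite h1 h2.
(* With [y = z2 X], on the line [|X - conj z2|^2 = |y - 1|^2 >= 1 - 2 Re y], and the right-hand side
   has integral [rho] because that of [Re y] vanishes. *)
have b2 : bfun (fun t => 1 - (2%:C)%C * (expi t.2 * X t)).
  apply: bfunB; first exact: bfun_cst.
  by apply: bfunM; [exact: bfun_cst | apply: bfunM => //; exact: bfun_z2].
have bz : bfun (fun t => expi t.2 * X t) by apply: bfunM => //; exact: bfun_z2.
have i0 : reint sg (line tau) (fun t => expi t.2 * X t) = 0.
  pose F (x : C * (C * C)) (t : R * R) := d x * (expi t.2 / (1 - expi t.2 * cconj x.2.2)).
  have hF x : x \in L -> bfun (F x) /\ reint sg (line tau) (F x) = 0.
    by move=> /hL[_ hx]; exact: (szego_moment hmass mA hrho).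
  transitivity (reint sg (line tau) (fun t => \sum_(x <- L) F x t)).
    apply: reint_ext => t ht'; congr complex.Re; rewrite /X /Jcomb mulr_sumr !big_seq; apply: eq_bigr => x hx.
    have [h1 h2] := hL x hx; rewrite /F /d.
    have -> : Cker x.2 (zeta t) = ((1 - tau * cconj x.2.1) * (1 - expi t.2 * cconj x.2.2))^-1.
      by rewrite -ht'.
    by rewrite invfM; ring.
  rewrite (reint_sum hmass mA); last by move=> x /hF[].
  by rewrite big_seq; apply: big1 => x /hF[].
have i2 : reint sg (line tau) (fun t => 1 - (2%:C)%C * (expi t.2 * X t)) = rho.
  rewrite (reintB hmass mA (bfun_cst 1)); last by apply: bfunM => //; exact: bfun_cst.
  rewrite (reintZ hmass mA) // i0 mulr0 subr0.
  by have := reint_cst mA hrho 1; rewrite mul1r.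
(* [e <= 1] and [e <= rho / 2] give [e^2 <= rho / 2 < rho]. *)
suff : rho <= e ^+ 2 by nra.
rewrite -lee_fin; apply: le_trans N2X; rewrite -{1}i2 -(integral_reint hmass mA b2).
have bd := bfunB bX bg.
apply: (@le_trans _ _ (\int[sg]_(t in line tau) (cabs (X t - g t) ^+ 2)%:E)%E); last first.
  apply: ge0_subset_integral => //; first by apply: N2_meas; exact: bd.1.
  by move=> t _; rewrite lee_fin sqr_ge0.
have bs : bfun (fun t => (X t - g t) * cconj (X t - g t)).
  by apply: bfunM => //; split; [apply: cmeas_conj; exact: bd.1 | have [_ [K hK]] := bd; exists K => t; rewrite cabs_conj].
have es t : complex.Re ((X t - g t) * cconj (X t - g t)) = cabs (X t - g t) ^+ 2 by rewrite mul_conj.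
rewrite -(@eq_integral _ _ _ sg (line tau) _ _ (fun t _ => congr1 EFin (es t))).
apply: le_integral => //; try exact: (bfun_integrable hmass mA).
move=> t /set_mem ht'; rewrite lee_fin es /g (ind_in ht') mul1r.
have -> : cabs (X t - cconj (expi t.2)) = cabs (expi t.2 * X t - 1).
  have h1 : cabs (expi t.2 : C) = 1 by exact: cabs_expi.
  rewrite -[LHS]mul1r -h1 -cabsM mulrBr (conj_unim h1) divff //; exact: unim_neq0.
have := cabs_sqr (expi t.2 * X t - 1); move: (expi t.2 * X t) => y ->.
by rewrite cReB cReM cReB cImB /=; nra.
Qed.
End Exceptional.

(** [is_J] contains the isometry, so that unitarity amounts to surjectivity up to [sigma]-null
    sets. *)
Theorem theorem1p2 (R : realType) (n : nat) (p : {poly {poly R[i]}}) (alpha : R[i]) :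
  (0 < n)%N ->
  deg_le_n1 n p ->
  (forall z : R[i] * R[i], in_D2 z -> eval2 p z != 0) ->
  deg_eq_n1 n (ptilde n p) ->
  no_common_factor p (ptilde n p) ->
  cabs alpha = 1 ->
  forall sigma : {measure set (R * R)%type -> \bar R},
  is_clark_measure n p alpha sigma ->
  forall J : (nat -> nat -> R[i]) -> R * R -> R[i],
  is_J n p alpha sigma J ->
  (forall (a : nat -> nat -> R[i]) (F : R[i] * R[i] -> R[i]),
     in_K n p a -> represents a F ->
     {ae sigma, forall t, nt_lim F (zeta t) (J a t)}) /\
  ((forall g : R * R -> R[i], in_L2 sigma g ->
      exists2 a, in_K n p a & {ae sigma, forall t, J a t = g t})
   <-> ~ exceptional n p alpha).
Proof.
move=> n0 hp hz hdeg hno ha sg hsg J hJ; split.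
  move=> a F haK hF; have [kap hk] := kernel_family hp hz.
  apply: negligibleS (boundary_value hp hz hdeg hno ha hsg hJ hk haK) => t /= h h1; apply: h.
  move=> c c1 e e0; have [d d0 hd] := h1 c c1 e e0; exists d => // z hzD *.
  by rewrite (represents_ev hF hzD); exact: hd.
split=> [hsurj hexc|hne g hg].
  have [g hg hn] := exceptional_not_surjective hp hz hdeg hno ha hsg hJ hexc.
  by have [a haK hag] := hsurj g hg; exact: (hn a haK).
have hroot tau : cabs tau = 1 -> ((level n p alpha)`_0).[tau] != 0.
  move=> ht; apply/negP => /eqP h0; apply: hne.
  exact: (root_exceptional hp hz hdeg hno ha hsg ht h0).
exact: (generic_surjective n0 hp hz hdeg hno ha hsg hJ hroot hg).
Qed.
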